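(* There is a constant $c>0$ such that the following holds for all $\mu,\lambda>0$ and all $u=S(t)u_0$, $v=S(t)v_0$ with $u_0,v_0\in L^2(\mathbb R^3)$. First, $$\|u_{<\mu}v_{>\lambda}\|_{L^2(\mathbb R^4)}\le c\,\mu\,\|u_0\|_{L^2}\|v_0\|_{L^2}.$$ Second, if $\mu\le\lambda$, if $\Gamma\subset\mathbb R^2$ is measurable, and if either (a) $\mu\le\lambda/8$, or (b) $\lambda/8<\mu\le\lambda$, $\Gamma\subset B_\lambda(0)$, and the support of the (space-time) Fourier transform of $v_\lambda$ is disjoint from $\mathbb R\times\mathbb R\times B_{10\lambda^2}(0)$, then $$\left\|\int_{\mathbb R\times\mathbb R^2}\Big(\lambda+\Big|\frac{\eta_1}{\xi_1}-\frac{\eta-\eta_1}{\xi-\xi_1}\Big|\Big)\hat u_{\mu,\Gamma}(t,\xi_1,\eta_1)\,\hat v_\lambda(t,\xi-\xi_1,\eta-\eta_1)\,d\xi_1\,d\eta_1\right\|_{L^2}\le c\,\mu\,|\Gamma|^{\frac12}\,\|u_{0,\mu,\Gamma}\|_{L^2}\|v_{0,\lambda}\|_{L^2},$$ where the $L^2$ norm on the left is over $(t,\xi,\eta)\in\mathbb R\times\mathbb R\times\mathbb R^2$ and $|\Gamma|$ is the Lebesgue measure of $\Gamma$.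
   Context: Fourier variables: $\tau,\xi\in\mathbb R$, $\eta\in\mathbb R^2$ are dual to $t$, $x$, $y$ ($y\in\mathbb R^2$). The group $S(t)$ is defined by $\widehat{S(t)u_0}(\xi,\eta)=e^{it(\xi^3-|\eta|^2/\xi)}\hat u_0(\xi,\eta)$. $u_{<\mu}$ is the Fourier projection to $|\xi|<\mu$; $v_{>\lambda}$ is the Fourier projection to $|\xi|>\lambda$; $v_\lambda$ is the Fourier projection to $\lambda\le|\xi|<2\lambda$; $u_{\mu,\Gamma}$ is the Fourier projection to $\{(\xi,\eta):\mu<|\xi|\le2\mu,\ \eta/\xi\in\Gamma\}$. $u_{0,\mu,\Gamma}$ and $v_{0,\lambda}$ denote the corresponding Fourier projections of the initial data. $\hat u_{\mu,\Gamma}(t,\cdot)$, $\hat v_\lambda(t,\cdot)$ are spatial Fourier transforms at time $t$. $B_r(0)$ is the ball of radius $r$ around $0$ in $\mathbb R^2$. *)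

(* Defs.v *)
From HB Require Import structures.
From mathcomp Require Import all_boot all_order all_algebra.
From mathcomp Require Import all_classical all_reals all_analysis.
From mathcomp Require Import measurable_realfun.
From mathcomp Require Export complex.

Set Implicit Arguments.
Unset Strict Implicit.
Unset Printing Implicit Defensive.

Import Order.TTheory GRing.Theory Num.Theory.
Import numFieldNormedType.Exports.

Local Open Scope classical_set_scope.
Local Open Scope ring_scope.
Local Open Scope complex_scope.

(* Points: eta = (eta_1, eta_2) in R2; (x, y) or (xi, eta) in R3;
   (t, (x, y)), (t, (xi, eta)) or (tau, (xi, eta)) in R4. *)
Notation R2 R := (measurableTypeR R * measurableTypeR R)%type.
Notation R3 R := (measurableTypeR R * R2 R)%type.
Notation R4 R := (measurableTypeR R * R3 R)%type.

Section lebesgue_measures.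
Variable R : realType.

(* The library proves this for its product measure, but the corresponding
   instance is not found by unification. *)
Lemma product_sigma_finite d1 d2 (T1 : measurableType d1)
    (T2 : measurableType d2) (m1 : {sigma_finite_measure set T1 -> \bar R})
    (m2 : {sigma_finite_measure set T2 -> \bar R}) :
  sigma_finite setT (m1 \x m2)%E.
Proof.
have /sigma_finiteP[F [TF ndF Foo]] := sigma_finiteT m1.
have /sigma_finiteP[G [TG ndG Goo]] := sigma_finiteT m2.
exists (fun n => F n `*` G n).
  rewrite -setXTT TF TG predeqE => -[x y]; split.
    move=> [/= [n _ Fnx] [k _ Gky]]; exists (maxn n k) => //; split.
    - by move: x Fnx; exact/subsetPset/ndF/leq_maxl.
    - by move: y Gky; exact/subsetPset/ndG/leq_maxr.
  by move=> [n _ []/= ? ?]; split; exists n.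
move=> k; have [? ?] := Foo k; have [? ?] := Goo k.
split; first exact: measurableX.
by rewrite product_measure1E// lte_mul_pinfty// ge0_fin_numE.
Qed.

Definition leb2 : set (R2 R) -> \bar R :=
  (@lebesgue_measure R \x @lebesgue_measure R)%E.
HB.instance Definition _ := Measure.on leb2.
HB.instance Definition _ := Measure_isSigmaFinite.Build _ _ _ leb2
  (product_sigma_finite (@lebesgue_measure R) (@lebesgue_measure R)).

Definition leb3 : set (R3 R) -> \bar R := (@lebesgue_measure R \x leb2)%E.
HB.instance Definition _ := Measure.on leb3.
HB.instance Definition _ := Measure_isSigmaFinite.Build _ _ _ leb3
  (product_sigma_finite (@lebesgue_measure R) leb2).

Definition leb4 : set (R4 R) -> \bar R := (@lebesgue_measure R \x leb3)%E.
HB.instance Definition _ := Measure.on leb4.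
HB.instance Definition _ := Measure_isSigmaFinite.Build _ _ _ leb4
  (product_sigma_finite (@lebesgue_measure R) leb3).

(* The sigma-algebra on R2 is the Borel one; its completion is the family of
   Lebesgue measurable sets. leb2 itself is meaningless on non-Borel sets,
   so |G| is taken to be the outer measure. *)
Definition lebesgue_measurable2 (G : set (R2 R)) := completed_algebra_gen leb2 G.

Definition vol2 (G : set (R2 R)) : \bar R :=
  ereal_inf [set leb2 B | B in [set B | measurable B /\ G `<=` B]].

End lebesgue_measures.
Arguments leb2 {R}.
Arguments leb3 {R}.
Arguments leb4 {R}.

Section complex_functions.
Context d (T : measurableType d) (R : realType).
Variable m : {measure set T -> \bar R}.
Implicit Types f : T -> R[i].

Definition cmeasurable f :=
  measurable_fun setT (fun x => complex.Re (f x)) /\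
  measurable_fun setT (fun x => complex.Im (f x)).

Definition cintegrable (D : set T) f :=
  m.-integrable D (fun x => (complex.Re (f x))%:E) /\
  m.-integrable D (fun x => (complex.Im (f x))%:E).

(* As for the Bochner integral, 0 when f is not absolutely integrable. *)
Definition cintegral (D : set T) f : R[i] :=
  if `[< cintegrable D f >] then
    (\int[m]_(x in D) complex.Re (f x))%R +i* (\int[m]_(x in D) complex.Im (f x))%R
  else 0.

Definition L2norm f : \bar R := Lnorm m 2%:E (fun x => (Normc.normc (f x))%:E).

Definition L2 f := cmeasurable f /\ (L2norm f < +oo)%E.

End complex_functions.

Section fourier.
Variable R : realType.
Local Notation C := (R[i]).

Definition expi (x : R) : C := cos x +i* sin x.

Definition norm2 (e : R2 R) : R := Num.sqrt (e.1 ^+ 2 + e.2 ^+ 2).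

Definition dot2 (e e' : R2 R) : R := e.1 * e'.1 + e.2 * e'.2.

(* Unitary normalization. *)
Definition fourier3 (f : R3 R -> C) (k : R3 R) : C :=
  ((2 * pi) `^ (- (3 / 2)))%:C *
  cintegral leb3 setT (fun x => expi (- (x.1 * k.1 + dot2 x.2 k.2)) * f x).

Definition fourier4 (f : R4 R -> C) (k : R4 R) : C :=
  ((2 * pi) ^- 2)%:C *
  cintegral leb4 setT
    (fun x => expi (- (x.1 * k.1 + x.2.1 * k.2.1 + dot2 x.2.2 k.2.2)) * f x).

(* g represents the L2 Fourier transform of f, i.e. the continuous extension
   to L2 of the Fourier integral on the intersection of L1 and L2. *)
Definition is_fourier (f g : R3 R -> C) :=
  [/\ L2 leb3 f, L2 leb3 g &
    exists2 f_ : nat -> R3 R -> C,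
      forall n, cintegrable leb3 setT (f_ n) /\ L2 leb3 (f_ n) &
      (fun n => L2norm leb3 (fun x => f_ n x - f x)) @ \oo --> 0%E /\
      (fun n => L2norm leb3 (fun k => fourier3 (f_ n) k - g k)) @ \oo --> 0%E].

(* h represents the Fourier multiplier with symbol s applied to f. *)
Definition is_multiplier (s : R3 R -> C) (f h : R3 R -> C) :=
  exists fh hh : R3 R -> C, [/\ is_fourier f fh, is_fourier h hh &
    \forall k \ae leb3, hh k = s k * fh k].

Definition is_projection (A : set (R3 R)) (f h : R3 R -> C) :=
  is_multiplier (fun k => (\1_A k : R)%:C) f h.

Definition symbolS (t : R) (k : R3 R) : C :=
  expi (t * (k.1 ^+ 3 - norm2 k.2 ^+ 2 / k.1)).

(* u = S(.) u0: u is a jointly measurable function such that u(t, .)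
   represents the element S(t) u0 of L2 for every t. *)
Definition is_evolution (u0 : R3 R -> C) (u : R4 R -> C) :=
  cmeasurable u /\
  forall t : R, is_multiplier (symbolS t) u0 (fun x => u (t, x)).

Definition is_projection_at_all_times (A : set (R3 R)) (u w : R4 R -> C) :=
  cmeasurable w /\
  forall t : R, is_projection A (fun x => u (t, x)) (fun x => w (t, x)).

Definition is_spatial_fourier (w wh : R4 R -> C) :=
  forall t : R, is_fourier (fun x => w (t, x)) (fun k => wh (t, k)).

(* eta / xi *)
Definition slope (k : R3 R) : R2 R := (k.2.1 / k.1, k.2.2 / k.1).

Definition below (mu : R) : set (R3 R) := [set k | `|k.1| < mu].
Definition above (lambda : R) : set (R3 R) := [set k | lambda < `|k.1|].
Definition dyadic (lambda : R) : set (R3 R) :=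
  [set k | lambda <= `|k.1| < 2 * lambda].
Definition sector (mu : R) (G : set (R2 R)) : set (R3 R) :=
  [set k | mu < `|k.1| <= 2 * mu /\ G (slope k)].

Definition disc (r : R) : set (R2 R) := [set e | norm2 e < r].

(* C^k through iterated directional derivatives in all directions. *)
Fixpoint Ck (V : normedModType R) (n : nat) (f : V -> R) : Prop :=
  continuous f /\
  if n is n'.+1 then
    forall v, (forall x, derivable f x v) /\ Ck n' (fun x => 'D_v f x)
  else True.

Definition smooth (f : R4 R -> C) :=
  forall n, Ck n (fun x : R * (R * (R * R)) => complex.Re (f x)) /\
            Ck n (fun x : R * (R * (R * R)) => complex.Im (f x)).

Definition tsupport (f : R4 R -> C) : set (R * (R * (R * R))) :=
  closure [set x | f x != 0].

Definition test_function (f : R4 R -> C) := smooth f /\ compact (tsupport f).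

(* The Fourier transform of w as a tempered distribution. *)
Definition fourier_distr (w : R4 R -> C) (f : R4 R -> C) : C :=
  cintegral leb4 setT (fun x => w x * fourier4 f x).

Definition distr_support (F : (R4 R -> C) -> C) : set (R * (R * (R * R))) :=
  ~` [set p | exists2 V : set (R * (R * (R * R))), open V /\ V p &
      forall f, test_function f -> tsupport f `<=` V -> F f = 0].

(* The integral restricted to (xi_1, eta_1) in D. *)
Definition weighted_conv (D : set (R3 R)) (lambda : R) (U V : R4 R -> C)
    (p : R4 R) : C :=
  cintegral leb3 D (fun q =>
    (lambda + norm2 (slope q - slope (p.2 - q)))%:C *
    U (p.1, q) * V (p.1, p.2 - q)).

(* Since the weight is unbounded, the weighted convolution of two L2 functions
   need not converge absolutely; in general it has to be read as the L2(R4)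
   limit of the integrals over |eta_1| < n. The two readings agree almost
   everywhere on the set where the integral converges absolutely. *)
Definition is_weighted_conv (lambda : R) (U V F : R4 R -> C) :=
  L2 leb4 F /\
  (fun n : nat => L2norm leb4 (fun p =>
     weighted_conv [set q | norm2 q.2 < n%:R] lambda U V p - F p))
    @ \oo --> 0%E.

End fourier.

(* Main.v *)
From HB Require Import structures.
Require Import Defs.
From mathcomp Require Import all_boot all_order all_algebra.
From mathcomp Require Import all_classical all_reals all_analysis.
From mathcomp Require Import complex.
From mathcomp Require Import measurable_realfun ring lra.

Set Implicit Arguments.
Unset Strict Implicit.
Unset Printing Implicit Defensive.

Import Order.TTheory GRing.Theory Num.Theory.
Import numFieldNormedType.Exports.

Local Open Scope classical_set_scope.
Local Open Scope ring_scope.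
Local Open Scope complex_scope.

(** Both estimates bound the space-time energy of a bilinear expression in two
    free waves. On the Fourier side a free wave is [evolved a], its transform
    [a] at time 0 times expi (t * phase k), and a product becomes a
    convolution: at total frequency [p] one has to bound the L2 norm in [t] of

      T t = cintegral over q of w (q, p - q) a q b (p - q) expi (t * h q),
      h q = phase q + phase (p - q).

    Plancherel's theorem in [t] sorts this integral by the level sets of [h].
    If the integral of w^2 over the level sets [h = tau], restricted to the
    frequencies that interact, is at most [B] with respect to the measure that
    disintegrates the Lebesgue measure, then by Cauchy--Schwarz the energy of
    [T] is at most a multiple of [B] times the integral of
    |a q b (p - q)|^2 in [q]; integrating in [p] gives B |a|^2 |b|^2. The level
    sets are thickened by the Poisson kernel [cauchy e], the transform of
    [decay e]; this makes every exchange of integrals absolutely convergent,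
    and the bounds are uniform in [e] ([Schur_test], [time_Schur],
    [bilinear_energy]). What remains are two bounds for level sets, both of
    size mu^2 or mu^2 |G|.

    In the first estimate w = 1. Conjugation reduces to waves of positive
    frequencies [x] and [xi - x]. At fixed [x], completing the square turns [h]
    into a constant minus A |z|^2 with A = xi / (x (xi - x)) >= 1 / x, whose
    level sets in the plane have measure at most pi / A <= pi x; integrating
    over x < mu gives mu^2 ([same_sign_level_sets]). The product is formed with
    absolutely convergent waves; the general case follows by Fatou's lemma.

    In the second estimate w = lambda + |s - s'|, where [s] and [s'] are the
    slopes of the two frequencies. Along a line of fixed slope [s], that is in
    the coordinates (x, x s), the function [h] satisfies

      - h' x = 3 (xi - x)^2 - 3 x^2 + |s - s'|^2.

    This dominates w^2 when mu <= lambda / 8, because then the first term beats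
    the second, and also when |s - s'| >= 4 lambda ([weight_le]). The latter
    follows from the support condition in the second case: |xi s - eta| is
    constant on the line, equal to |xi - x| |s - s'|, and at least 8 lambda^2
    if |s| < lambda and the transversal component of the second frequency has
    length at least 10 lambda^2 ([transversal_case]). Hence the integral over the line is bounded by a
    constant, the Jacobian contributes x^2 <= 4 mu^2, and integrating over the
    slopes in [G] yields mu^2 |G| ([sector_level_sets]). The same bound,
    applied to differences, makes the truncated weighted convolutions a Cauchy
    sequence ([truncated_limit]).

    The support condition itself concerns the Fourier transform of the wave as
    a distribution. Tested against a product of bumps in time frequency and in
    space frequency, it equals an integral of [a] over a neighbourhood of a
    point of the characteristic surface tau = phase k, with a weight that has
    positive real part ([fourier_distr_test_bump], [time_dual_gt0]). So off
    the support the transform of the data vanishes locally, hence almost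
    everywhere ([frequency_support]).

    The L2 theory of the Fourier transform underneath (Bessel's inequality,
    uniqueness, the multiplication formula, inversion) uses the same pair of
    kernels, [decay3] and [cauchy3], as a regularisation. *)

(** * Complex-valued functions and their integrals *)

Section complex_numbers.
Variable R : realType.
Implicit Types (z w : R[i]) (x y : R).
Local Notation Re := complex.Re.
Local Notation Im := complex.Im.
Local Notation normc := Normc.normc.

Definition sqn z : R := Re z ^+ 2 + Im z ^+ 2.

Lemma sqn_ge0 z : 0 <= sqn z.
Proof. by rewrite addr_ge0 ?sqr_ge0. Qed.

Lemma normc_ge0 z : 0 <= normc z.
Proof. by case: z => a b; exact: sqrtr_ge0. Qed.

Lemma normc2 z : normc z ^+ 2 = sqn z.
Proof. by case: z => a b /=; rewrite sqr_sqrtr// addr_ge0 ?sqr_ge0. Qed.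

Lemma normcE z : normc z = Num.sqrt (sqn z).
Proof. by case: z. Qed.

Lemma cReM z w : Re (z * w) = Re z * Re w - Im z * Im w.
Proof. by case: z; case: w. Qed.

Lemma cImM z w : Im (z * w) = Re z * Im w + Im z * Re w.
Proof. by case: z => a b; case: w. Qed.

Lemma cReD z w : Re (z + w) = Re z + Re w. Proof. by case: z; case: w. Qed.
Lemma cImD z w : Im (z + w) = Im z + Im w. Proof. by case: z; case: w. Qed.
Lemma cReN z : Re (- z) = - Re z. Proof. by case: z. Qed.
Lemma cImN z : Im (- z) = - Im z. Proof. by case: z. Qed.
Lemma cReJ z : Re (z^*)%C = Re z. Proof. by case: z. Qed.
Lemma cImJ z : Im (z^*)%C = - Im z. Proof. by case: z. Qed.
Lemma cReC x : Re (x%:C) = x. Proof. by []. Qed.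
Lemma cImC x : Im (x%:C) = 0. Proof. by []. Qed.
Lemma complex_ext z w : Re z = Re w -> Im z = Im w -> z = w.
Proof. by case: z; case: w => a b c d /= -> ->. Qed.

Lemma sqnM z w : sqn (z * w) = sqn z * sqn w.
Proof. by rewrite /sqn cReM cImM; ring. Qed.

Lemma sqnD z w : sqn (z + w) <= 2 * sqn z + 2 * sqn w.
Proof.
rewrite /sqn cReD cImD.
have h1 := sqr_ge0 (Re z - Re w); have h2 := sqr_ge0 (Im z - Im w).
move: h1 h2; rewrite !expr2; lra.
Qed.

Lemma sqnN z : sqn (- z) = sqn z.
Proof. by rewrite /sqn cReN cImN !sqrrN. Qed.

Lemma sqnJ z : sqn (z^*)%C = sqn z.
Proof. by rewrite /sqn cReJ cImJ sqrrN. Qed.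

Lemma sqnC x : sqn (x%:C) = x ^+ 2.
Proof. by rewrite /sqn cReC cImC expr0n addr0. Qed.

Lemma sqn0 : sqn 0 = 0.
Proof. by rewrite -[0]/((0 : R)%:C) sqnC expr0n. Qed.

Lemma sqn_eq0 z : sqn z = 0 -> z = 0.
Proof.
move=> /eqP; rewrite /sqn paddr_eq0 ?sqr_ge0// !sqrf_eq0 => /andP[/eqP h1 /eqP h2].
exact: complex_ext.
Qed.

Lemma mulcJ z : (z * z^*)%C = (sqn z)%:C.
Proof. by apply: complex_ext; rewrite ?cReM ?cImM cReJ cImJ ?cReC ?cImC /sqn; ring. Qed.

Lemma normcMr z w : normc (z * w) = normc z * normc w.
Proof. by rewrite Normc.normcM. Qed.

Lemma normcJ z : normc (z^*)%C = normc z.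
Proof. by rewrite !normcE sqnJ. Qed.

Lemma normcC x : normc (x%:C) = `|x|.
Proof. by rewrite normcE sqnC sqrtr_sqr. Qed.

Lemma normc_0 : normc (0 : R[i]) = 0.
Proof. by rewrite normcE sqn0 sqrtr0. Qed.

Lemma normc_le_sqn z w : sqn z <= sqn w -> normc z <= normc w.
Proof. by move=> h; rewrite !normcE ler_wsqrtr. Qed.

Lemma Re_le_normc z : `|Re z| <= normc z.
Proof.
by rewrite -sqrtr_sqr normcE ler_wsqrtr// lerDl sqr_ge0.
Qed.

Lemma Im_le_normc z : `|Im z| <= normc z.
Proof.
by rewrite -sqrtr_sqr normcE ler_wsqrtr// lerDr sqr_ge0.
Qed.

Lemma normc_le_ReIm z : normc z <= `|Re z| + `|Im z|.
Proof.
rewrite normcE -[leRHS]ger0_norm ?addr_ge0// -sqrtr_sqr ler_wsqrtr//.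
rewrite /sqn sqrrD !real_normK ?num_real//.
by rewrite -addrA lerD2l lerDr mulrn_wge0// mulr_ge0.
Qed.

Lemma expiD x y : expi (x + y) = expi x * expi y.
Proof. by apply: complex_ext; rewrite ?cReM ?cImM /= ?cosD ?sinD; ring. Qed.

Lemma expiN x : expi (- x) = ((expi x)^*)%C.
Proof. by apply: complex_ext => /=; rewrite ?cosN ?sinN. Qed.

Lemma expi0 : expi (0 : R) = 1.
Proof. by apply: complex_ext; rewrite /= ?cos0 ?sin0. Qed.

Lemma sqn_expi x : sqn (expi x) = 1.
Proof. by rewrite /sqn /= cos2Dsin2. Qed.

Lemma normc_expi x : normc (expi x) = 1.
Proof. by rewrite normcE sqn_expi sqrtr1. Qed.

End complex_numbers.

Section cmeasurable.
Context d (T : measurableType d) (R : realType).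
Implicit Types f g : T -> R[i].
Local Notation Re := complex.Re.
Local Notation Im := complex.Im.
Local Notation normc := Normc.normc.

Lemma cmeasurable_cst z : cmeasurable (fun _ : T => z : R[i]).
Proof. by split; exact: measurable_cst. Qed.

Lemma cmeasurable_real (f : T -> R) : measurable_fun setT f ->
  cmeasurable (fun x => (f x)%:C).
Proof. by move=> mf; split => //; exact: measurable_cst. Qed.

Lemma cmeasurableD f g : cmeasurable f -> cmeasurable g ->
  cmeasurable (fun x => f x + g x).
Proof.
move=> [f1 f2] [g1 g2]; split.
- by under eq_fun do rewrite cReD; exact: measurable_funD.
- by under eq_fun do rewrite cImD; exact: measurable_funD.
Qed.

Lemma cmeasurableN f : cmeasurable f -> cmeasurable (fun x => - f x).
Proof.
move=> [f1 f2]; split.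
- by under eq_fun do rewrite cReN; exact: measurableT_comp.
- by under eq_fun do rewrite cImN; exact: measurableT_comp.
Qed.

Lemma cmeasurableB f g : cmeasurable f -> cmeasurable g ->
  cmeasurable (fun x => f x - g x).
Proof. by move=> mf mg; apply: cmeasurableD => //; exact: cmeasurableN. Qed.

Lemma cmeasurableM f g : cmeasurable f -> cmeasurable g ->
  cmeasurable (fun x => f x * g x).
Proof.
move=> [f1 f2] [g1 g2]; split.
- under eq_fun do rewrite cReM.
  by apply: measurable_funB; exact: measurable_funM.
- under eq_fun do rewrite cImM.
  by apply: measurable_funD; exact: measurable_funM.
Qed.

Lemma cmeasurableJ f : cmeasurable f -> cmeasurable (fun x => (f x)^*%C).
Proof.
move=> [f1 f2]; split.
- by under eq_fun do rewrite cReJ.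
- by under eq_fun do rewrite cImJ; exact: measurableT_comp.
Qed.

Lemma cmeasurable_expi (f : T -> R) : measurable_fun setT f ->
  cmeasurable (fun x => expi (f x)).
Proof.
move=> mf; split => /=.
- by apply: measurableT_comp => //; apply: continuous_measurable_fun; exact: continuous_cos.
- by apply: measurableT_comp => //; apply: continuous_measurable_fun; exact: continuous_sin.
Qed.

Lemma measurable_sqn f : cmeasurable f -> measurable_fun setT (fun x => sqn (f x)).
Proof. by move=> [f1 f2]; apply: measurable_funD; exact: measurable_funX. Qed.

Lemma measurable_normc f : cmeasurable f -> measurable_fun setT (fun x => normc (f x)).
Proof.
move=> mf; under eq_fun do rewrite normcE.
apply: measurableT_comp; last exact: measurable_sqn.
by apply: continuous_measurable_fun; exact: sqrt_continuous.
Qed.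

Lemma cmeasurable_indic (A : set T) : measurable A ->
  cmeasurable (fun x => (\1_A x : R)%:C).
Proof. by move=> mA; apply: cmeasurable_real; exact: measurable_indic. Qed.

End cmeasurable.

Lemma cmeasurable_comp d d' (T : measurableType d) (T' : measurableType d')
    (R : realType) (f : T -> R[i]) (h : T' -> T) :
  cmeasurable f -> measurable_fun setT h -> cmeasurable (fun x => f (h x)).
Proof. by move=> [f1 f2] mh; split; [exact: (measurableT_comp f1 mh)|exact: (measurableT_comp f2 mh)]. Qed.

Section cintegral.
Context d (T : measurableType d) (R : realType).
Variable m : {measure set T -> \bar R}.
Implicit Types f g : T -> R[i].
Local Notation Re := complex.Re.
Local Notation Im := complex.Im.
Local Notation normc := Normc.normc.

Definition absint f : \bar R := (\int[m]_x (normc (f x))%:E)%E.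

Definition energy f : \bar R := (\int[m]_x (sqn (f x))%:E)%E.

Lemma absint_ge0 f : (0 <= absint f)%E.
Proof. by apply: integral_ge0 => x _; rewrite lee_fin normc_ge0. Qed.

Lemma energy_ge0 f : (0 <= energy f)%E.
Proof. by apply: integral_ge0 => x _; rewrite lee_fin sqn_ge0. Qed.

Lemma cintegrableP f :
  cintegrable m setT f <-> cmeasurable f /\ (absint f < +oo)%E.
Proof.
split.
- move=> [i1 i2].
  have mf : cmeasurable f.
    by split; apply/measurable_EFinP; [exact: (measurable_int m i1)|exact: (measurable_int m i2)].
  split=> //.
  apply: (@le_lt_trans _ _ (\int[m]_x (`|(Re (f x))%:E| + `|(Im (f x))%:E|))%E).
    apply: ge0_le_integral => //.
    + by move=> x _; rewrite lee_fin normc_ge0.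
    + by apply/measurable_EFinP; exact: measurable_normc.
    + by case: mf => m1 m2; apply: emeasurable_funD; apply: measurableT_comp => //;
        apply/measurable_EFinP.
    + by move=> x _; rewrite -EFinD lee_fin normc_le_ReIm.
  case: mf => m1 m2.
  rewrite ge0_integralD//; try by apply: measurableT_comp => //; apply/measurable_EFinP.
  by apply: lte_add_pinfty; [case/integrableP: i1|case/integrableP: i2].
- move=> [[m1 m2] fi]; split; apply/integrableP; split; try exact/measurable_EFinP.
  + apply: le_lt_trans fi; apply: ge0_le_integral => //.
    * by apply: measurableT_comp => //; apply/measurable_EFinP.
    * by apply/measurable_EFinP; exact: measurable_normc.
    * by move=> x _; rewrite lee_fin Re_le_normc.
  + apply: le_lt_trans fi; apply: ge0_le_integral => //.
    * by apply: measurableT_comp => //; apply/measurable_EFinP.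
    * by apply/measurable_EFinP; exact: measurable_normc.
    * by move=> x _; rewrite lee_fin Im_le_normc.
Qed.

Lemma cintegrable_meas f : cintegrable m setT f -> cmeasurable f.
Proof. by case/cintegrableP. Qed.

Lemma le_absint f g : cmeasurable f -> cmeasurable g ->
  (forall x, normc (f x) <= normc (g x)) -> (absint f <= absint g)%E.
Proof.
move=> mf mg fg; apply: ge0_le_integral => //.
- by move=> x _; rewrite lee_fin normc_ge0.
- by apply/measurable_EFinP; exact: measurable_normc.
- by apply/measurable_EFinP; exact: measurable_normc.
- by move=> x _; rewrite lee_fin.
Qed.

Lemma le_energy f g : cmeasurable f -> cmeasurable g ->
  (forall x, sqn (f x) <= sqn (g x)) -> (energy f <= energy g)%E.
Proof.
move=> mf mg fg; apply: ge0_le_integral => //.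
- by move=> x _; rewrite lee_fin sqn_ge0.
- by apply/measurable_EFinP; exact: measurable_sqn.
- by apply/measurable_EFinP; exact: measurable_sqn.
- by move=> x _; rewrite lee_fin.
Qed.

Lemma le_cintegrable f g : cmeasurable f -> cintegrable m setT g ->
  (forall x, normc (f x) <= normc (g x)) -> cintegrable m setT f.
Proof.
move=> mf /cintegrableP[mg gi] fg; apply/cintegrableP; split=> //.
by apply: le_lt_trans gi; exact: le_absint.
Qed.

Lemma cintegralE f : cintegrable m setT f -> cintegral m setT f =
  (\int[m]_x Re (f x))%R +i* (\int[m]_x Im (f x))%R.
Proof. by move=> fi; rewrite /cintegral asboolT. Qed.

Lemma cintegral_notint f : ~ cintegrable m setT f -> cintegral m setT f = 0.
Proof. by move=> fi; rewrite /cintegral asboolF. Qed.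

Lemma eq_cintegral f g : f =1 g -> cintegral m setT f = cintegral m setT g.
Proof. by move=> /funext ->. Qed.

Lemma cintegrable0 : cintegrable m setT (fun=> 0).
Proof. by split; exact: integrable0. Qed.

Lemma cintegral0 : cintegral m setT (fun=> 0) = 0.
Proof.
rewrite cintegralE//; last exact: cintegrable0.
by rewrite /= /Rintegral integral0.
Qed.

Lemma cintegrableD f g : cintegrable m setT f -> cintegrable m setT g ->
  cintegrable m setT (fun x => f x + g x).
Proof.
move=> [f1 f2] [g1 g2]; split.
- by under eq_fun do rewrite cReD EFinD; exact: integrableD.
- by under eq_fun do rewrite cImD EFinD; exact: integrableD.
Qed.

Lemma cintegralD f g : cintegrable m setT f -> cintegrable m setT g ->
  cintegral m setT (fun x => f x + g x) = cintegral m setT f + cintegral m setT g.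
Proof.
move=> fi gi; rewrite !cintegralE//; last exact: cintegrableD.
case: fi gi => [f1 f2] [g1 g2].
apply: complex_ext => /=.
- by rewrite -RintegralD//; apply: eq_Rintegral => x _; rewrite cReD.
- by rewrite -RintegralD//; apply: eq_Rintegral => x _; rewrite cImD.
Qed.

Lemma cintegrableZ z f : cintegrable m setT f -> cintegrable m setT (fun x => z * f x).
Proof.
move=> [f1 f2]; split.
- under eq_fun do rewrite cReM EFinB !EFinM.
  by apply: integrableB => //; exact: integrableZl.
- under eq_fun do rewrite cImM EFinD !EFinM.
  by apply: integrableD => //; exact: integrableZl.
Qed.

Lemma cintegralZ z f : cintegrable m setT f ->
  cintegral m setT (fun x => z * f x) = z * cintegral m setT f.
Proof.
move=> fi; rewrite !cintegralE//; last exact: cintegrableZ.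
case: fi => f1 f2.
have z1 (c : R) (h : T -> R) : m.-integrable setT (fun x => (h x)%:E) ->
    m.-integrable setT (fun x => (c * h x)%:E).
  by move=> ih; under eq_fun do rewrite EFinM; exact: integrableZl.
apply: complex_ext.
- rewrite cReM /= -!RintegralZl// -RintegralB//; try exact: z1.
  by apply: eq_Rintegral => x _; rewrite cReM.
- rewrite cImM /= -!RintegralZl// -RintegralD//; try exact: z1.
  by apply: eq_Rintegral => x _; rewrite cImM.
Qed.

Lemma cintegrableN f : cintegrable m setT f -> cintegrable m setT (fun x => - f x).
Proof. by move=> fi; under eq_fun do rewrite -mulN1r; exact: cintegrableZ. Qed.

Lemma cintegrableB f g : cintegrable m setT f -> cintegrable m setT g ->
  cintegrable m setT (fun x => f x - g x).
Proof. by move=> fi gi; apply: cintegrableD => //; exact: cintegrableN. Qed.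

Lemma cintegralN f : cintegrable m setT f ->
  cintegral m setT (fun x => - f x) = - cintegral m setT f.
Proof.
by move=> fi; under eq_cintegral do rewrite -mulN1r; rewrite cintegralZ// mulN1r.
Qed.

Lemma cintegralB f g : cintegrable m setT f -> cintegrable m setT g ->
  cintegral m setT (fun x => f x - g x) = cintegral m setT f - cintegral m setT g.
Proof.
by move=> fi gi; rewrite cintegralD ?cintegralN//; exact: cintegrableN.
Qed.

Lemma cintegrableJ f : cintegrable m setT f ->
  cintegrable m setT (fun x => ((f x)^*)%C).
Proof.
move=> [f1 f2]; split.
- by under eq_fun do rewrite cReJ.
- under eq_fun do rewrite cImJ EFinN; exact: integrableN.
Qed.

Lemma cintegralJ f : cintegral m setT (fun x => ((f x)^*)%C) = ((cintegral m setT f)^*)%C.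
Proof.
have [fi|fi] := pselect (cintegrable m setT f); last first.
  rewrite [in RHS]cintegral_notint// cintegral_notint ?conjc0// => /cintegrableJ.
  by under eq_fun do rewrite conjcK.
rewrite !cintegralE//; last exact: cintegrableJ.
apply: complex_ext; rewrite /=.
- by apply: eq_Rintegral => x _; rewrite cReJ.
- rewrite -mulN1r -RintegralZl//; last by case: fi.
  by apply: eq_Rintegral => x _; rewrite cImJ mulN1r.
Qed.

Lemma cintegral_real (f : T -> R) : m.-integrable setT (EFin \o f) ->
  cintegral m setT (fun x => (f x)%:C) = (\int[m]_x f x)%:C.
Proof.
move=> fi; rewrite cintegralE; last by split => //=; exact: integrable0.
by apply: complex_ext => //=; rewrite /Rintegral integral0.
Qed.

(** Multiplying by a unit complex number moves the integral to the positive
    axis, where it is the integral of a real part. *)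
Lemma normc_cintegral f : ((normc (cintegral m setT f))%:E <= absint f)%E.
Proof.
have [fi|fi] := pselect (cintegrable m setT f); last first.
  by rewrite cintegral_notint// normc_0 absint_ge0.
set z := cintegral m setT f.
have [z0|z0] := eqVneq z 0; first by rewrite z0 normc_0 absint_ge0.
have nz : 0 < normc z.
  rewrite lt_neqAle normc_ge0 andbT eq_sym; apply: contra_neq z0.
  exact: Normc.eq0_normc.
pose u := (z^*)%C * ((normc z)^-1)%:C.
have nu : normc u = 1.
  by rewrite normcMr normcJ normcC ger0_norm ?invr_ge0 ?normc_ge0// divff// gt_eqF.
have uz : u * z = (normc z)%:C.
  rewrite /u mulrAC (mulrC (z^*)%C) mulcJ -normc2 -rmorphM/= expr2 -mulrA.
  by rewrite divff ?mulr1// gt_eqF.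
have -> : normc z = \int[m]_x Re (u * f x).
  have /(congr1 (@complex.Re _)) := cintegralZ u fi.
  by rewrite -/z uz cReC cintegralE//; exact: cintegrableZ.
have [iu _] := cintegrableZ u fi.
rewrite /Rintegral fineK; last exact: integrable_fin_num.
have mf := cintegrable_meas fi.
apply: le_trans (lee_abs _) _; apply: le_trans (le_abse_integral m _ _) _ => //.
  exact: (measurable_int m iu).
apply: ge0_le_integral => //.
- by apply: measurableT_comp => //; exact: (measurable_int m iu).
- by apply/measurable_EFinP; exact: measurable_normc.
- by move=> x _; rewrite lee_fin (le_trans (Re_le_normc _))// normcMr nu mul1r.
Qed.

Lemma eq_cintegrable_ae f g : cmeasurable f -> cmeasurable g ->
  (\forall x \ae m, f x = g x) -> cintegrable m setT f -> cintegrable m setT g.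
Proof.
move=> mf mg fg /cintegrableP[_ fi]; apply/cintegrableP; split => //.
suff <- : absint f = absint g by [].
apply: ge0_ae_eq_integral => //.
- by apply/measurable_EFinP; exact: measurable_normc.
- by apply/measurable_EFinP; exact: measurable_normc.
- by move=> x _; rewrite lee_fin normc_ge0.
- by move=> x _; rewrite lee_fin normc_ge0.
- by apply: filterS fg => x -> _.
Qed.

Lemma ae_eq_cintegral f g : cmeasurable f -> cmeasurable g ->
  (\forall x \ae m, f x = g x) -> cintegral m setT f = cintegral m setT g.
Proof.
move=> mf mg fg.
have gf : \forall x \ae m, g x = f x by apply: filterS fg.
have [fi|fi] := pselect (cintegrable m setT f); last first.
  rewrite !cintegral_notint// => gi; apply: fi.
  exact: eq_cintegrable_ae gi.
have gi : cintegrable m setT g by exact: eq_cintegrable_ae fi.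
rewrite !cintegralE//; apply: complex_ext => /=; rewrite /Rintegral; congr fine.
- apply: ae_eq_integral => //.
  + by case: fi => /(measurable_int m).
  + by case: gi => /(measurable_int m).
  + by apply: filterS fg => x -> _.
- apply: ae_eq_integral => //.
  + by case: fi => _ /(measurable_int m).
  + by case: gi => _ /(measurable_int m).
  + by apply: filterS fg => x -> _.
Qed.

Lemma ae_eq_energy f g : cmeasurable f -> cmeasurable g ->
  (\forall x \ae m, f x = g x) -> energy f = energy g.
Proof.
move=> mf mg fg; apply: ge0_ae_eq_integral => //.
- by apply/measurable_EFinP; exact: measurable_sqn.
- by apply/measurable_EFinP; exact: measurable_sqn.
- by move=> x _; rewrite lee_fin sqn_ge0.
- by move=> x _; rewrite lee_fin sqn_ge0.
- by apply: filterS fg => x -> _.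
Qed.

End cintegral.

Section energy.
Context d (T : measurableType d) (R : realType).
Variable m : {measure set T -> \bar R}.
Implicit Types f g : T -> R[i].
Local Notation normc := Normc.normc.
Local Notation en := (energy m).

Lemma L2normE f : L2norm m f = (en f `^ 2^-1)%E.
Proof.
rewrite /L2norm unlock; congr (_ `^ _)%E; apply: eq_integral => x _ /=.
by rewrite powR_mulrn// ger0_norm ?normc_ge0// normc2.
Qed.

Lemma L2norm_lty f : (L2norm m f < +oo)%E <-> (en f < +oo)%E.
Proof.
rewrite L2normE; split; last exact: poweR_lty.
by apply: lty_poweRy; rewrite invr_eq0.
Qed.

Lemma L2P f : L2 m f <-> cmeasurable f /\ (en f < +oo)%E.
Proof. by rewrite /L2; split=> -[mf /L2norm_lty]. Qed.

Lemma sqrte_le (x y : \bar R) : (0 <= x -> x <= y -> x `^ 2^-1 <= y `^ 2^-1)%E.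
Proof.
move=> x0 xy; apply: gt0_ler_poweR => //; rewrite in_itv/= ?x0 ?leey//=.
by rewrite (le_trans x0 xy).
Qed.

Lemma energy_sqr f : (en f = L2norm m f `^ 2)%E.
Proof. by rewrite L2normE -poweRrM mulVf// poweRe1// energy_ge0. Qed.

Lemma energyD f g : cmeasurable f -> cmeasurable g ->
  (en (fun x => f x + g x)%R <= 2%:E * en f + 2%:E * en g)%E.
Proof.
move=> mf mg; rewrite /energy.
have msf := measurable_sqn mf; have msg := measurable_sqn mg.
rewrite -!ge0_integralZl//; try (by apply/measurable_EFinP);
  try (by move=> x _; rewrite lee_fin sqn_ge0).
rewrite -ge0_integralD//=.
- apply: ge0_le_integral => //.
  + by move=> x _; rewrite lee_fin sqn_ge0.
  + by apply/measurable_EFinP/measurable_sqn/cmeasurableD.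
  + by apply/measurable_EFinP; apply: measurable_funD; apply: measurable_funM.
  + by move=> x _; rewrite -!EFinM -EFinD lee_fin sqnD.
- by move=> x _; rewrite mule_ge0// lee_fin sqn_ge0.
- by apply/measurable_EFinP; apply: measurable_funM.
- by move=> x _; rewrite mule_ge0// lee_fin sqn_ge0.
- by apply/measurable_EFinP; apply: measurable_funM.
Qed.

Lemma energyN f : en (fun x => - f x)%R = en f.
Proof. by apply: eq_integral => x _; rewrite sqnN. Qed.

Lemma energyB f g : cmeasurable f -> cmeasurable g ->
  (en (fun x => f x - g x)%R <= 2%:E * en f + 2%:E * en g)%E.
Proof.
by move=> mf mg; rewrite -(energyN g); apply: energyD => //; exact: cmeasurableN.
Qed.

Lemma energyBC f g : en (fun x => f x - g x)%R = en (fun x => g x - f x)%R.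
Proof. by apply: eq_integral => x _; rewrite -sqnN opprB. Qed.

Lemma energy_triangle f g h : cmeasurable f -> cmeasurable g -> cmeasurable h ->
  (en (fun x => f x - h x)%R <= 2%:E * en (fun x => f x - g x)%R
     + 2%:E * en (fun x => g x - h x)%R)%E.
Proof.
move=> mf mg mh.
rewrite (_ : (fun x => f x - h x)%R = (fun x => (f x - g x) + (g x - h x))%R).
  by apply: energyD; exact: cmeasurableB.
by apply/funext => x; rewrite addrA subrK.
Qed.

Lemma energyZ z f : cmeasurable f -> en (fun x => z * f x)%R = ((sqn z)%:E * en f)%E.
Proof.
move=> mf; rewrite /energy -ge0_integralZl//.
- by apply: eq_integral => x _; rewrite sqnM.
- by apply/measurable_EFinP/measurable_sqn.
- by move=> x _; rewrite lee_fin sqn_ge0.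
- by rewrite lee_fin sqn_ge0.
Qed.

Lemma energyJ f : en (fun x => (f x)^*)%C = en f.
Proof. by apply: eq_integral => x _; rewrite sqnJ. Qed.

Lemma energy_eq0_ae f : cmeasurable f -> en f = 0%E -> \forall x \ae m, f x = 0.
Proof.
move=> mf f0; have ms : measurable_fun setT (fun x => (sqn (f x))%:E).
  by apply/measurable_EFinP/measurable_sqn.
have /(ae_eq_integral_abs m measurableT ms) : (\int[m]_x `|(sqn (f x))%:E| = 0)%E.
  by rewrite -f0; apply: eq_integral => x _; rewrite gee0_abs// lee_fin sqn_ge0.
by apply: filterS => x /(_ I) /= [] /sqn_eq0.
Qed.

(** Cauchy--Schwarz, squared so that no root of an infinite quantity occurs. *)
Lemma absintM f g : cmeasurable f -> cmeasurable g ->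
  (absint m (fun x => f x * g x)%R `^ 2 <= en f * en g)%E.
Proof.
move=> mf mg; rewrite !energy_sqr -poweRM ?Lnorm_ge0//.
apply: gt0_ler_poweR => //; rewrite ?in_itv/= ?leey ?andbT.
- exact: absint_ge0.
- by rewrite mule_ge0 ?Lnorm_ge0.
have h2 : (2^-1 + 2^-1 = 1 :> R)%R by rewrite [RHS]splitr !div1r.
have := hoelder m (measurable_normc mf) (measurable_normc mg) (ltr0Sn _ 1) (ltr0Sn _ 1) h2.
rewrite Lnorm1; apply: le_trans; rewrite le_eqVlt; apply/orP; left; apply/eqP.
apply: eq_integral => x _ /=.
by rewrite normcMr ger0_norm// mulr_ge0 ?normc_ge0.
Qed.

Lemma L2M_cintegrable f g : L2 m f -> L2 m g -> cintegrable m setT (fun x => f x * g x).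
Proof.
move=> /L2P[mf fi] /L2P[mg gi]; apply/cintegrableP; split; first exact: cmeasurableM.
apply: (@lty_poweRy _ _ 2) => //; apply: le_lt_trans (absintM mf mg) _.
by rewrite lte_mul_pinfty ?energy_ge0// ge0_fin_numE// energy_ge0.
Qed.

Lemma sqn_cintegralM f g : cmeasurable f -> cmeasurable g ->
  ((sqn (cintegral m setT (fun x => f x * g x)%R))%:E <= en f * en g)%E.
Proof.
move=> mf mg; apply: le_trans (absintM mf mg).
rewrite -normc2 -powR_mulrn ?normc_ge0// -poweR_EFin.
apply: gt0_ler_poweR => //; rewrite ?in_itv/= ?leey ?andbT.
- by rewrite lee_fin normc_ge0.
- exact: absint_ge0.
- exact: normc_cintegral.
Qed.

Lemma L2D f g : L2 m f -> L2 m g -> L2 m (fun x => f x + g x).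
Proof.
move=> /L2P[mf fi] /L2P[mg gi]; apply/L2P; split; first exact: cmeasurableD.
by apply: le_lt_trans (energyD mf mg) _; rewrite lte_add_pinfty// lte_mul_pinfty.
Qed.

Lemma L2N f : L2 m f -> L2 m (fun x => - f x).
Proof.
by move=> /L2P[mf fi]; apply/L2P; rewrite energyN; split=> //; exact: cmeasurableN.
Qed.

Lemma L2B f g : L2 m f -> L2 m g -> L2 m (fun x => f x - g x).
Proof. by move=> fi gi; apply: L2D => //; exact: L2N. Qed.

Lemma L2Z z f : L2 m f -> L2 m (fun x => z * f x).
Proof.
move=> /L2P[mf fi]; apply/L2P; split.
  by apply: cmeasurableM => //; exact: cmeasurable_cst.
by rewrite energyZ// lte_mul_pinfty// lee_fin sqn_ge0.
Qed.

Lemma le_L2 f g : cmeasurable f -> L2 m g -> (forall x, sqn (f x) <= sqn (g x)) -> L2 m f.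
Proof.
move=> mf /L2P[mg gi] fg; apply/L2P; split=> //.
by apply: le_lt_trans gi; exact: le_energy.
Qed.

Lemma fatou_cvg (f : nat -> T -> R) (g : T -> R) (B : \bar R) :
  (forall n, measurable_fun setT (f n)) -> measurable_fun setT g ->
  (forall n x, 0 <= f n x) -> (forall x, 0 <= g x) ->
  (\forall x \ae m, f ^~ x @ \oo --> g x) ->
  (forall n, \int[m]_x (f n x)%:E <= B)%E ->
  (\int[m]_x (g x)%:E <= B)%E.
Proof.
move=> mf mg f0 g0 fg fB.
have E : (\int[m]_x (g x)%:E = \int[m]_x limn_einf (fun n => (f n x)%:E))%E.
  apply: ge0_ae_eq_integral => //.
  - exact/measurable_EFinP.
  - rewrite [X in measurable_fun _ X](_ : _ = (fun x =>
        - limn_esup (-%E \o (fun n => (f n x)%:E)))%E).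
      apply: measurableT_comp => //; apply: measurable_fun_limn_esup => n /=.
      by apply/(@measurable_EFinP _ _ _ _ (fun x => - f n x)); exact: measurableT_comp.
    by apply/funext => x; rewrite limn_esupN oppeK.
  - by move=> x _; rewrite lee_fin.
  - move=> x _; rewrite limn_einf_lim; apply: lime_ge.
      apply: ereal_nondecreasing_is_cvgn => a b ab.
      by apply: ereal_inf_le_tmp => _ [n /= bn <-]; exists n => //=; rewrite (leq_trans ab).
    by apply: nearW => n; apply: le_ereal_inf_tmp => _ [k /= _ <-]; rewrite lee_fin.
  - apply: filterS fg => x fgx _ /=.
    have h : (f n x)%:E @[n --> \oo] --> (g x)%:E by apply: cvg_EFin => //; exact: nearW.
    by rewrite is_cvg_limn_einfE; [apply/esym/cvg_lim|apply/cvg_ex; exists (g x)%:E].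
rewrite E; apply: le_trans (fatou _ _ _ _) _ => //.
- by move=> n; exact/measurable_EFinP.
- by move=> n x _; rewrite lee_fin.
rewrite limn_einf_lim; apply: lime_le.
  apply: ereal_nondecreasing_is_cvgn => a b ab.
  by apply: ereal_inf_le_tmp => _ [n /= bn <-]; exists n => //=; rewrite (leq_trans ab).
by apply: nearW => n; apply: le_trans (fB n); apply: ereal_inf_lbound; exists n => /=.
Qed.

Lemma energy_dominated (f : nat -> T -> R[i]) g :
  (forall n, cmeasurable (f n)) -> L2 m g ->
  (forall n x, sqn (f n x) <= sqn (g x)) ->
  (forall x, (fun n => sqn (f n x)) @ \oo --> (0 : R)) ->
  en (f n) @[n --> \oo] --> 0%E.
Proof.
move=> mf /L2P[mg gi] fg f0.
have [] := @dominated_convergence _ T R m setT measurableT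
  (fun n x => (sqn (f n x))%:E) (cst 0%E) (fun x => (sqn (g x))%:E).
- by move=> n; apply/measurable_EFinP/measurable_sqn.
- exact: measurable_cst.
- by apply: nearW => x _; apply: cvg_EFin; [exact: nearW|exact: f0].
- apply/integrableP; split; first by apply/measurable_EFinP/measurable_sqn.
  rewrite (_ : (\int[m]_x _)%E = en g)//.
  by apply: eq_integral => x _; rewrite gee0_abs// lee_fin sqn_ge0.
- by apply: nearW => x n _; rewrite gee0_abs ?lee_fin ?sqn_ge0.
- by move=> _ _; rewrite integral0.
Qed.

End energy.

Section complex_Fubini.
Context d1 d2 (X : measurableType d1) (Y : measurableType d2) (R : realType).
Variable m1 : {sigma_finite_measure set X -> \bar R}.
Variable m2 : {sigma_finite_measure set Y -> \bar R}.
Implicit Type f : X * Y -> R[i].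
Local Notation Re := complex.Re.
Local Notation Im := complex.Im.
Local Notation normc := Normc.normc.

Lemma cmeasurable_pair1 f x : cmeasurable f -> cmeasurable (fun y => f (x, y)).
Proof. by move=> mf; apply: (cmeasurable_comp mf); exact: measurable_pair1. Qed.

Lemma cmeasurable_pair2 f y : cmeasurable f -> cmeasurable (fun x => f (x, y)).
Proof. by move=> mf; apply: (cmeasurable_comp mf); exact: measurable_pair2. Qed.

Lemma measurable_absint f : cmeasurable f ->
  measurable_fun setT (fun x => absint m2 (fun y => f (x, y))).
Proof.
move=> mf; apply: (@measurable_fun_fubini_tonelli_F _ _ X Y R m2
   (fun z => (normc (f z))%:E)).
- by apply/measurable_EFinP/measurable_normc.
- by move=> z; rewrite lee_fin normc_ge0.
Qed.

Lemma measurable_Rintegral (g : X * Y -> R) : measurable_fun setT g ->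
  measurable_fun setT (fun x => \int[m2]_y g (x, y))%R.
Proof.
move=> mg; apply: measurableT_comp; first exact: fine_measurable.
rewrite [X in measurable_fun _ X](_ : _ = (fun x =>
  \int[m2]_y ((EFin \o g)^\+ (x, y)) - \int[m2]_y ((EFin \o g)^\- (x, y)))%E).
  apply: emeasurable_funB.
  - apply: (@measurable_fun_fubini_tonelli_F _ _ X Y R m2 (EFin \o g)^\+%E) => //.
    by apply: measurable_funepos; exact/measurable_EFinP.
  - apply: (@measurable_fun_fubini_tonelli_F _ _ X Y R m2 (EFin \o g)^\-%E) => //.
    by apply: measurable_funeneg; exact/measurable_EFinP.
apply/funext => x; rewrite integralE; congr (_ - _)%E; apply: eq_integral => y _.
- by rewrite !funeposE.
- by rewrite !funenegE.
Qed.

Lemma cmeasurable_cintegral f : cmeasurable f ->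
  cmeasurable (fun x => cintegral m2 setT (fun y => f (x, y))).
Proof.
move=> mf; pose A := [set x | absint m2 (fun y => f (x, y)) < +oo]%E.
have mA : measurable A.
  rewrite /A -[X in measurable X]setTI.
  by apply: emeasurable_fun_infty_o => //; exact: measurable_absint.
rewrite (_ : (fun x => _) = (fun x => (\1_A x : R)%:C *
   ((\int[m2]_y Re (f (x, y)))%R +i* (\int[m2]_y Im (f (x, y)))%R))).
  apply: cmeasurableM; first exact: cmeasurable_indic.
  by case: mf => mf1 mf2; split => /=; [exact: (measurable_Rintegral mf1)|exact: (measurable_Rintegral mf2)].
apply/funext => x; rewrite indicE.
have [xA|xA] := boolP (x \in A).
  rewrite mul1r cintegralE//; apply/cintegrableP; split; last exact: set_mem xA.
  exact: cmeasurable_pair1.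
rewrite mul0r cintegral_notint// => /cintegrableP[_ h].
by move/negP: xA; apply; exact/mem_set.
Qed.

Lemma cintegrable_prod f : cmeasurable f ->
  (\int[m1]_x absint m2 (fun y => f (x, y)) < +oo)%E ->
  cintegrable (m1 \x m2)%E setT f.
Proof.
move=> mf fi; apply/cintegrableP; split=> //.
rewrite /absint fubini_tonelli1//.
- by apply/measurable_EFinP/measurable_normc.
- by move=> z; rewrite lee_fin normc_ge0.
Qed.

Lemma absint_swap f : cmeasurable f ->
  (\int[m1]_x absint m2 (fun y => f (x, y))
   = \int[m2]_y absint m1 (fun x => f (x, y)))%E.
Proof.
move=> mf; apply: (@fubini_tonelli _ _ X Y R m1 m2 (fun z => (normc (f z))%:E)).
- by apply/measurable_EFinP/measurable_normc.
- by move=> z; rewrite lee_fin normc_ge0.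
Qed.

Lemma ae_cintegrable f : cmeasurable f ->
  (\int[m1]_x absint m2 (fun y => f (x, y)) < +oo)%E ->
  \forall x \ae m1, cintegrable m2 setT (fun y => f (x, y)).
Proof.
move=> mf fi.
have : m1.-integrable setT (fun x => absint m2 (fun y => f (x, y))).
  apply/integrableP; split; first exact: measurable_absint.
  by under eq_integral do rewrite gee0_abs ?absint_ge0//.
move=> /(integrable_ae measurableT); apply: filterS => x /(_ I) h.
apply/cintegrableP; split; first exact: cmeasurable_pair1.
by rewrite -ge0_fin_numE// absint_ge0.
Qed.

Lemma cintegral_iter1 f : cmeasurable f ->
  (\int[m1]_x absint m2 (fun y => f (x, y)) < +oo)%E ->
  cintegral m1 setT (fun x => cintegral m2 setT (fun y => f (x, y)))
  = (\int[(m1 \x m2)%E]_z Re (f z))%R +i* (\int[(m1 \x m2)%E]_z Im (f z))%R.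
Proof.
move=> mf fi; have [i1 i2] := cintegrable_prod mf fi.
pose F (g : X * Y -> R) x := (\int[m2]_y (g (x, y))%:E)%E.
have mFf g : (m1 \x m2)%E.-integrable setT (EFin \o g) -> m1.-integrable setT (F g).
  by move=> gi; exact: (integrable_fubini_F gi).
pose H x := (fine (F (fun z => Re (f z)) x)) +i* (fine (F (fun z => Im (f z)) x)).
have mH : cmeasurable H.
  by case: mf => mf1 mf2; split; [exact: (measurable_Rintegral mf1)|exact: (measurable_Rintegral mf2)].
have ae1 : \forall x \ae m1, cintegral m2 setT (fun y => f (x, y)) = H x.
  apply: filterS (ae_cintegrable mf fi) => x xi.
  by rewrite cintegralE.
rewrite (ae_eq_cintegral _ _ ae1)//; last exact: cmeasurable_cintegral.
have fin g : (m1 \x m2)%E.-integrable setT (EFin \o g) ->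
    (\forall x \ae m1, (fine (F g x))%:E = F g x).
  move=> gi; move: (integrable_ae measurableT (mFf _ gi)).
  by apply: filterS => x /(_ I) h; rewrite fineK.
have Ffin g : (m1 \x m2)%E.-integrable setT (EFin \o g) ->
    m1.-integrable setT (fun x => (fine (F g x))%:E).
  move=> gi; have mF := mFf _ gi.
  have mfine : measurable_fun setT (fun x => (fine (F g x))%:E).
    apply/measurable_EFinP; apply: measurableT_comp; first exact: fine_measurable.
    by move: mF => /(measurable_int m1).
  apply/integrableP; split => //.
  move/integrableP: mF => [mF]; apply: le_lt_trans.
  rewrite le_eqVlt; apply/orP; left; apply/eqP.
  apply: ge0_ae_eq_integral => //; try exact: measurableT_comp.
  by apply: filterS (fin _ gi) => x -> _.
rewrite cintegralE; last by split; apply: Ffin.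
have key g : (m1 \x m2)%E.-integrable setT (EFin \o g) ->
    (\int[m1]_x fine (F g x))%R = (\int[(m1 \x m2)%E]_z g z)%R.
  move=> gi; rewrite /Rintegral; congr fine.
  rewrite -(integral12_prod_meas1 gi); apply: ae_eq_integral => //.
  - by move: (Ffin _ gi) => /(measurable_int m1).
  - by move: (mFf _ gi) => /(measurable_int m1).
  - by apply: filterS (fin _ gi) => x -> _.
by rewrite /H /= !key.
Qed.

End complex_Fubini.

Section complex_Fubini_swap.
Context d1 d2 (X : measurableType d1) (Y : measurableType d2) (R : realType).
Variable m1 : {sigma_finite_measure set X -> \bar R}.
Variable m2 : {sigma_finite_measure set Y -> \bar R}.
Implicit Type f : X * Y -> R[i].
Local Notation Re := complex.Re.
Local Notation Im := complex.Im.

Lemma cintegral_iter2 f : cmeasurable f ->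
  (\int[m1]_x absint m2 (fun y => f (x, y)) < +oo)%E ->
  cintegral m2 setT (fun y => cintegral m1 setT (fun x => f (x, y)))
  = (\int[(m1 \x m2)%E]_z Re (f z))%R +i* (\int[(m1 \x m2)%E]_z Im (f z))%R.
Proof.
move=> mf fi; have [i1 i2] := cintegrable_prod mf fi.
pose f' (z : Y * X) := f (z.2, z.1).
have mf' : cmeasurable f' by apply: cmeasurable_comp => //; exact: measurable_swap.
have fi' : (\int[m2]_y absint m1 (fun x => f' (y, x)) < +oo)%E by rewrite -absint_swap.
have := cintegral_iter1 mf' fi'; rewrite /f' /= => ->.
have key g : (m1 \x m2)%E.-integrable setT (EFin \o g) ->
   (m2 \x m1)%E.-integrable setT (EFin \o (g \o (fun z : Y * X => (z.2, z.1)))) ->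
    (\int[(m2 \x m1)%E]_z g (z.2, z.1))%R = (\int[(m1 \x m2)%E]_z g z)%R.
  move=> gi gi'; rewrite /Rintegral; congr fine.
  by rewrite -(integral12_prod_meas1 gi') -(integral21_prod_meas1 gi).
have [j1 j2] := cintegrable_prod mf' fi'.
by rewrite (key (fun z => Re (f z))) ?(key (fun z => Im (f z))).
Qed.

Lemma cFubini f : cmeasurable f ->
  (\int[m1]_x absint m2 (fun y => f (x, y)) < +oo)%E ->
  cintegral m1 setT (fun x => cintegral m2 setT (fun y => f (x, y))) =
  cintegral m2 setT (fun y => cintegral m1 setT (fun x => f (x, y))).
Proof. by move=> mf fi; rewrite cintegral_iter1// cintegral_iter2. Qed.

Lemma cintegral_prod f : cmeasurable f ->
  (\int[m1]_x absint m2 (fun y => f (x, y)) < +oo)%E ->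
  cintegral (m1 \x m2)%E setT f =
  cintegral m1 setT (fun x => cintegral m2 setT (fun y => f (x, y))).
Proof.
by move=> mf fi; rewrite cintegral_iter1// cintegralE//; exact: cintegrable_prod.
Qed.

End complex_Fubini_swap.

(** * One-dimensional calculus: affine substitutions and the Poisson kernel *)

Section is_derive_lambda.
Variable R : realType.
Implicit Types (f g : R -> R) (x : R).

Lemma isd_cst (c : R) x : is_derive x 1 (fun _ : R => c) 0.
Proof. exact: is_derive_cst. Qed.

Lemma isd_id x : is_derive x 1 (fun y : R => y) 1.
Proof. exact: is_derive_id. Qed.

Lemma isdD f g x df dg : is_derive x 1 f df -> is_derive x 1 g dg ->
  is_derive x 1 (fun y => f y + g y) (df + dg).
Proof. by move=> *; exact: is_deriveD. Qed.

Lemma isdN f x df : is_derive x 1 f df -> is_derive x 1 (fun y => - f y) (- df).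
Proof. by move=> *; exact: is_deriveN. Qed.

Lemma isdM f g x df dg : is_derive x 1 f df -> is_derive x 1 g dg ->
  is_derive x 1 (fun y => f y * g y) (f x * dg + g x * df).
Proof. by move=> *; exact: is_deriveM. Qed.

Lemma isdX f n x df : is_derive x 1 f df ->
  is_derive x 1 (fun y => f y ^+ n) (n%:R * f x ^+ n.-1 * df).
Proof.
move=> h; have := @is_deriveX R R f n x 1 df h.
by rewrite (_ : f ^+ n = fun y => f y ^+ n)//; apply/funext => y; rewrite exprfctE.
Qed.

Lemma isdV f x df : f x != 0 -> is_derive x 1 f df ->
  is_derive x 1 (fun y => (f y)^-1) (- (f x) ^- 2 * df).
Proof.
move=> f0 [fd <-]; apply: DeriveDef; first exact: derivableV.
by rewrite deriveV.
Qed.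

Lemma isd_comp f g x a b : is_derive (g x) 1 f a -> is_derive x 1 g b ->
  is_derive x 1 (fun y => f (g y)) (a * b).
Proof. by move=> *; exact: is_derive1_comp. Qed.

Lemma isd_continuous f x df : is_derive x 1 f df -> {for x, continuous f}.
Proof.
by move=> [fd _]; apply/differentiable_continuous/derivable1_diffP.
Qed.

End is_derive_lambda.

Definition pushforward_measure d d' (T : measurableType d) (T' : measurableType d')
    (R : realType) (m : {measure set T -> \bar R}) (f : T -> T')
    (mf : measurable_fun setT f) : {measure set T' -> \bar R} :=
  measure_function_pushforward__canonical__measure_function_Measure m mf.

Lemma measurable_patch d (T : measurableType d) (R : realType) (D : set T)
    (f : T -> \bar R) : measurable D -> measurable_fun setT f ->
  measurable_fun setT (f \_ D).
Proof. by move=> mD mf; apply/(measurable_restrictT f mD); exact: measurable_funTS. Qed.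

Lemma measurable_inv (R : realType) : measurable_fun setT (fun x : R => x^-1).
Proof.
rewrite (_ : (fun x : R => x^-1) = (fun x : R => x * (x ^+ 2) `^ (-1))).
  by apply: measurable_funM => //; apply: (@measurableT_comp _ _ _ _ _ _ (fun x : R => x `^ (-1)) _ (fun x : R => x ^+ 2)); [exact: measurable_powR|exact: measurable_funX].
apply/funext => x; rewrite powR_inv1 ?sqr_ge0// expr2 invfM mulrA.
by have [->|x0] := eqVneq x 0; [rewrite invr0 mulr0|rewrite divff// mul1r].
Qed.

Lemma measurable_funV d (T : measurableType d) (R : realType) (f : T -> R) :
  measurable_fun setT f -> measurable_fun setT (fun x => (f x)^-1).
Proof. by move=> mf; exact: (measurableT_comp (@measurable_inv R) mf). Qed.

Section one_dimension.
Variable R : realType.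
Local Notation leb := (@lebesgue_measure R).

Lemma FTC_is_derive (F f : R -> R) (a b : R) : a <= b ->
  (forall x, a <= x <= b -> is_derive x 1 F (f x)) ->
  (forall x, a <= x <= b -> {for x, continuous f}) ->
  (\int[leb]_(x in `[a, b]) (f x)%:E = (F b - F a)%:E)%E.
Proof.
rewrite le_eqVlt => /predU1P[<- _ _|ab dF cf].
  by rewrite set_itv1 integral_set1 subrr.
have cF x : a <= x <= b -> {for x, continuous F}.
  by move=> /dF; exact: isd_continuous.
rewrite (@continuous_FTC2 R f F a b) -?EFinB//.
- apply: continuous_in_subspaceT => x; rewrite inE/= in_itv/=; exact: cf.
- split.
  + by move=> x; rewrite in_itv/= => /andP[/ltW ax /ltW xb]; case: (dF x) => //; rewrite ax.
  + by apply: cvg_at_right_filter; apply: cF; rewrite lexx ltW.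
  + by apply: cvg_at_left_filter; apply: cF; rewrite lexx ltW.
- move=> x; rewrite in_itv/= => /andP[/ltW ax /ltW xb].
  by rewrite derive1E; case: (dF x); rewrite ?ax.
Qed.

Lemma measurable_affine (a b : R) :
  measurable_fun setT (fun x : measurableTypeR R => (a * x + b)%R : measurableTypeR R).
Proof. by apply: measurable_funD => //; exact: measurable_funM. Qed.

Lemma lebesgue_affine (a b : R) (A : set R) : a != 0 -> measurable A ->
  mscale (NngNum (normr_ge0 a)) (pushforward_measure leb (measurable_affine a b)) A
  = leb A.
Proof.
move=> a0 mA; apply/esym/lebesgue_measure_unique => // _ [[u v]] _ <- /=.
rewrite /mscale /= /pushforward.
have [a_gt0|a_le0] := ltP 0 a.
- have -> : (fun x => a * x + b) @^-1` [set` `]u, v]] = [set` `]((u - b) / a), ((v - b) / a)]].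
    apply/seteqP; split => x /=; rewrite !in_itv/= ltr_pdivrMr// ler_pdivlMr// (mulrC x);
      by rewrite ltrBlDr lerBrDr.
  rewrite !lebesgue_measure_itv/= !lte_fin ltr_pM2r ?invr_gt0// ltrD2r.
  case: ifP => uv; rewrite ?mule0// -!EFinB -EFinM; congr EFin.
  by rewrite gtr0_norm//; field; rewrite gt_eqF.
- have {a_le0}an : a < 0 by rewrite lt_neqAle a0.
  have -> : (fun x => a * x + b) @^-1` [set` `]u, v]] = [set` `[((v - b) / a), ((u - b) / a)[].
    apply/seteqP; split => x /=; rewrite !in_itv/= ler_ndivrMr// ltr_ndivlMr// (mulrC x);
      by rewrite ltrBlDr lerBrDr andbC.
  rewrite !lebesgue_measure_itv/= !lte_fin ltr_nM2r ?invr_lt0// ltrD2r.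
  case: ifP => uv; rewrite ?mule0// -!EFinB -EFinM; congr EFin.
  by rewrite ltr0_norm//; field; rewrite lt_eqF.
Qed.

Lemma integral_affine (a b : R) (f : R -> \bar R) : a != 0 ->
  measurable_fun setT f -> (forall x, 0 <= f x)%E ->
  (`|a|%:E * \int[leb]_x f (a * x + b)%R = \int[leb]_x f x)%E.
Proof.
move=> a0 mf f0.
have := @ge0_integral_pushforward _ _ _ _ R _ (measurable_affine a b) leb setT f measurableT mf.
rewrite preimage_setT /comp /= => <-; last by move=> y _.
rewrite -(@ge0_integral_mscale _ _ R (pushforward_measure leb (measurable_affine a b))
  setT measurableT (NngNum (normr_ge0 a)) f)//.
by apply: eq_measure_integral => A mA _; exact: lebesgue_affine.
Qed.

Lemma integral_R_le (f : R -> R) (B : \bar R) : measurable_fun setT f ->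
  (forall x, 0 <= f x) ->
  (forall n : nat, \int[leb]_(x in `[(- n%:R)%R, n%:R]) (f x)%:E <= B)%E ->
  (\int[leb]_x (f x)%:E <= B)%E.
Proof.
move=> mf f0 fB.
have mI (n : nat) : measurable [set` `[(- n%:R : R), n%:R]] by exact: measurable_itv.
apply: (@fatou_cvg _ _ R leb (fun n => f \* \1_[set` `[(- n%:R : R), n%:R]])) => //.
- by move=> n; apply: measurable_funM => //; exact: measurable_indic.
- by move=> n x /=; rewrite mulr_ge0// indicE.
- apply: nearW => x; apply: cvg_near_cst; near=> n.
  rewrite /= indicE mem_set ?mulr1//= in_itv/= -ler_norml.
  by near: n; exact: nbhs_infty_ger.
- move=> n; rewrite (le_trans _ (fB n))// [leRHS]integral_mkcond.
  apply: ge0_le_integral => //.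
  + by move=> x _; rewrite lee_fin mulr_ge0// indicE.
  + by apply/measurable_EFinP; apply: measurable_funM => //; exact: measurable_indic.
  + by apply: measurable_patch => //; exact/measurable_EFinP.
  + move=> x _; rewrite /= patchE indicE.
    by case: ifPn => _; rewrite ?mulr1 ?mulr0.
Unshelve. all: by end_near. Qed.

(** The Fourier transform of [decay e]; its antiderivative is an arctangent,
    which makes every substitution below an instance of the fundamental theorem
    of calculus. *)
Definition cauchy (e s : R) : R := 2 * e / (e ^+ 2 + s ^+ 2).

Definition decay (e t : R) : R := expR (- (e * `|t|)).

Lemma cauchy_den (e s : R) : 0 < e -> 0 < e ^+ 2 + s ^+ 2.
Proof. by move=> e0; rewrite ltr_wpDr ?sqr_ge0// exprn_gt0. Qed.

Lemma cauchy_ge0 e s : 0 < e -> 0 <= cauchy e s.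
Proof. by move=> e0; rewrite divr_ge0 ?mulr_ge0 ?ltW// cauchy_den. Qed.

Lemma cauchyN e s : cauchy e (- s) = cauchy e s.
Proof. by rewrite /cauchy sqrrN. Qed.

Lemma cauchyB e s t : cauchy e (s - t) = cauchy e (t - s).
Proof. by rewrite -cauchyN opprB. Qed.

Lemma continuous_cauchy e : 0 < e -> continuous (cauchy e).
Proof.
move=> e0 s; have d0 : e ^+ 2 + s ^+ 2 != 0 by rewrite gt_eqF// cauchy_den.
have := (isd_continuous (isdM (isd_cst (2 * e) s)
  (@isdV _ (fun y => e ^+ 2 + y ^+ 2) s _ d0 (isdD (isd_cst (e ^+ 2) s) (isdX 2 (isd_id s)))))).
by rewrite /prop_for.
Qed.

Lemma measurable_cauchy e : measurable_fun setT (cauchy e).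
Proof.
rewrite /cauchy; apply: measurable_funM => //; apply: measurable_funV.
by apply: measurable_funD => //; exact: measurable_funX.
Qed.

Lemma is_derive_atan_scaled (H : R -> R) (H' tau e x : R) : 0 < e ->
  is_derive x 1 H H' ->
  is_derive x 1 (fun y => 2 * atan ((H y - tau) / e)) (H' * cauchy e (tau - H x)).
Proof.
move=> e0 dH.
have dE : is_derive x 1 (fun y => (H y - tau) / e) ((H x - tau) * 0 + e^-1 * (H' + 0)).
  exact: (isdM (isdD dH (isd_cst (- tau) x)) (isd_cst e^-1 x)).
apply: (is_derive_eq (isdM (isd_cst 2 x) (isd_comp (is_derive1_atan _) dE))).
rewrite cauchyB /cauchy; field.
by rewrite !gt_eqF ?cauchy_den// exprn_gt0.
Qed.

Lemma cauchy_subst (H H' : R -> R) (lo hi tau e : R) : 0 < e -> lo <= hi ->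
  (forall x, lo <= x <= hi -> is_derive x 1 H (H' x)) ->
  (forall x, lo <= x <= hi -> {for x, continuous H'}) ->
  (\int[leb]_(x in `[lo, hi]) (H' x * cauchy e (tau - H x))%:E
    = (2 * atan ((H hi - tau) / e) - 2 * atan ((H lo - tau) / e))%:E)%E.
Proof.
move=> e0 lh dH cH'.
apply: (@FTC_is_derive (fun y => 2 * atan ((H y - tau) / e))
   (fun x => H' x * cauchy e (tau - H x)) lo hi lh).
- by move=> x xI; apply: is_derive_atan_scaled => //; exact: dH.
- move=> x xI; apply: (@continuousM _ _ H' (fun x => cauchy e (tau - H x))).
    exact: cH'.
  apply: (@continuous_comp _ _ _ (fun x => tau - H x) (cauchy e)).
    apply: (@continuousB _ _ _ (fun=> tau) H); first exact: cst_continuous.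
    exact: isd_continuous (dH _ xI).
  exact: continuous_cauchy.
Qed.

Lemma cauchy_subst_le (H H' : R -> R) (lo hi tau e : R) : 0 < e -> lo <= hi ->
  (forall x, lo <= x <= hi -> is_derive x 1 H (H' x)) ->
  (forall x, lo <= x <= hi -> {for x, continuous H'}) ->
  (\int[leb]_(x in `[lo, hi]) (H' x * cauchy e (tau - H x))%:E <= (2 * pi)%:E)%E.
Proof.
move=> e0 lh dH cH'; rewrite (cauchy_subst tau e0 lh dH cH') lee_fin.
have h1 := atan_ltpi2 ((H hi - tau) / e).
have h2 := atan_gtNpi2 ((H lo - tau) / e).
lra.
Qed.

Lemma integral_cauchy_le (e tau : R) : 0 < e ->
  (\int[leb]_x (cauchy e (tau - x))%:E <= (2 * pi)%:E)%E.
Proof.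
move=> e0; apply: integral_R_le.
- apply: (measurableT_comp (measurable_cauchy e)).
  exact: measurable_funB.
- by move=> x; exact: cauchy_ge0.
- move=> n.
  have := @cauchy_subst_le id (fun=> 1) (- n%:R) n%:R tau e e0.
  under eq_integral do rewrite mul1r; apply.
  + by rewrite (@le_trans _ _ 0)// oppr_le0.
  + by move=> x _; exact: cst_continuous.
Qed.

Lemma integral_cauchy_sqr_le (B tau e : R) : 0 < B -> 0 < e ->
  (\int[leb]_z (`|z| * cauchy e (tau - B * z ^+ 2))%:E <= (2 * pi / B)%:E)%E.
Proof.
move=> B0 e0.
have mf : measurable_fun setT (fun z : R => `|z| * cauchy e (tau - B * z ^+ 2)).
  apply: measurable_funM; first exact: normr_measurable.
  apply: (measurableT_comp (measurable_cauchy e)); apply: measurable_funB => //.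
  by apply: measurable_funM => //; exact: measurable_funX.
have dH (x : R) : is_derive x 1 (fun z : R => B * z ^+ 2) (2 * B * x).
  apply: (is_derive_eq (isdM (isd_cst B x) (isdX 2 (isd_id x)))).
  by rewrite /= expr1; ring.
have cH (x : R) : {for x, continuous (fun z : R => 2 * B * z)}.
  exact: (isd_continuous (isdM (isd_cst (2 * B) x) (isd_id x))).
apply: integral_R_le => //.
  by move=> x; rewrite mulr_ge0// cauchy_ge0.
move=> n.
have half : (\int[leb]_(z in `[0%R, n%:R]) (`|z| * cauchy e (tau - B * z ^+ 2))%:E
    <= (pi / B)%:E)%E.
  have := @cauchy_subst_le _ _ 0 n%:R tau e e0 (ler0n _ n) (fun x _ => dH x) (fun x _ => cH x).
  have -> : (\int[leb]_(z in `[0%R, n%:R]) (2 * B * z * cauchy e (tau - B * z ^+ 2))%:E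
     = \int[leb]_(z in `[0%R, n%:R]) ((2 * B)%:E * (`|z| * cauchy e (tau - B * z ^+ 2))%:E))%E.
    apply: eq_integral => z; rewrite inE/= in_itv/= => /andP[z0 _].
    by rewrite -EFinM ger0_norm// !mulrA.
  rewrite ge0_integralZl//; last 3 first.
  - by apply: measurable_funTS; exact/measurable_EFinP.
  - by move=> z _; rewrite lee_fin mulr_ge0// cauchy_ge0.
  - by rewrite lee_fin mulr_ge0// ltW.
  rewrite -lee_pdivlMl ?mulr_gt0// -EFinM => /le_trans; apply.
  by rewrite lee_fin le_eqVlt; apply/orP; left; apply/eqP; field; rewrite gt_eqF.
have half' : (\int[leb]_(z in `[(- n%:R)%R, 0%R]) (`|z| * cauchy e (tau - B * z ^+ 2))%:E
    <= (pi / B)%:E)%E.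
  apply: le_trans half; rewrite le_eqVlt; apply/orP; left; apply/eqP.
  pose h z := (`|z| * cauchy e (tau - B * z ^+ 2))%:E.
  have mh : measurable_fun setT (h \_ `[0%R, (n%:R : R)]).
    by apply: measurable_patch => //; exact/measurable_EFinP.
  have h0 x : (0 <= (h \_ `[0%R, (n%:R : R)]) x)%E.
    by apply: erestrict_ge0 => z _; rewrite lee_fin mulr_ge0// cauchy_ge0.
  have N10 : -1 != 0 :> R by rewrite oppr_eq0 oner_neq0.
  have := integral_affine 0 N10 mh h0.
  rewrite normrN1 mul1e => hE; rewrite [LHS]integral_mkcond [RHS]integral_mkcond.
  apply: etrans hE; apply: eq_integral => x _; rewrite !patchE.
  rewrite mulN1r addr0 /h normrN sqrrN; congr (if _ then _ else _).
  by apply/idP/idP; rewrite !inE/= !in_itv/= oppr_ge0 lerNl andbC.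
have -> : [set` `[(- n%:R)%R, (n%:R : R)]] = [set` `[(- n%:R)%R, 0%R]] `|` [set` `[(0%R : R), n%:R]].
  apply/seteqP; split => x /=; rewrite !in_itv/=.
    by move=> /andP[-> ->]; rewrite andbT; exact/orP/le_total.
  move=> [/andP[-> x0]|/andP[x0 ->]]; rewrite ?andbT /=; first exact: le_trans x0 _.
  by apply: le_trans x0; rewrite oppr_le0.
apply: le_trans (_ : ((pi / B)%:E + (pi / B)%:E <= _)%E); last first.
  by rewrite -EFinD lee_fin le_eqVlt; apply/orP; left; apply/eqP; field; rewrite gt_eqF.
apply: le_trans (leeD half' half).
rewrite [leLHS]integral_mkcond [X in (_ <= X + _)%E]integral_mkcond.
rewrite [X in (_ <= _ + X)%E]integral_mkcond.
rewrite -ge0_integralD//; last 4 first.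
- by move=> x _; apply: erestrict_ge0 => z _; rewrite lee_fin mulr_ge0// cauchy_ge0.
- by apply: measurable_patch => //; exact/measurable_EFinP.
- by move=> x _; apply: erestrict_ge0 => z _; rewrite lee_fin mulr_ge0// cauchy_ge0.
- by apply: measurable_patch => //; exact/measurable_EFinP.
apply: ge0_le_integral => //.
- by move=> x _; apply: erestrict_ge0 => z _; rewrite lee_fin mulr_ge0// cauchy_ge0.
- by apply: measurable_patch; [exact: measurableU|exact/measurable_EFinP].
- by apply: emeasurable_funD; apply: measurable_patch => //; exact/measurable_EFinP.
- move=> x _; have h0 : (0 <= (`|x| * cauchy e (tau - B * x ^+ 2))%:E)%E.
    by rewrite lee_fin mulr_ge0// cauchy_ge0.
  rewrite !patchE in_setU; case: (x \in _); case: (x \in _) => //=;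
    rewrite ?adde0 ?add0e//.
  by rewrite leeDl.
Qed.

End one_dimension.

(** * The kernel [decay e] and Schur's test *)

Section fourier_decay.
Variable R : realType.
Local Notation leb := (@lebesgue_measure R).
Implicit Types (e s t : R).

Lemma decay_ge0 e t : 0 <= decay e t. Proof. exact: expR_ge0. Qed.

Lemma decay_le1 e t : 0 <= e -> decay e t <= 1.
Proof. by move=> e0; rewrite -[leRHS]expR0 ler_expR oppr_le0 mulr_ge0. Qed.

Lemma continuous_decay e : continuous (decay e).
Proof.
move=> t; apply: (@continuous_comp _ _ _ (fun t => - (e * `|t|)) expR); last first.
  exact: continuous_expR.
apply: (@continuousN _ _ _ (fun t => e * `|t|)).
apply: (@continuousM _ _ (fun=> e) (fun t => `|t|)); first exact: cst_continuous.
exact: norm_continuous.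
Qed.

Lemma measurable_decay e : measurable_fun setT (decay e).
Proof. by apply: continuous_measurable_fun; exact: continuous_decay. Qed.

Lemma decayN e t : decay e (- t) = decay e t.
Proof. by rewrite /decay normrN. Qed.

Lemma cosD1_ge0 t : 0 <= 1 + cos t :> R.
Proof. by rewrite -lerBlDl sub0r cos_geN1. Qed.

Lemma sinD1_ge0 t : 0 <= 1 + sin t :> R.
Proof. by rewrite -lerBlDl sub0r sin_geN1. Qed.

Lemma is_derive_cosM s t : is_derive t 1 (fun t => cos (s * t)) (- sin (s * t) * s).
Proof.
apply: (is_derive_eq (isd_comp (is_derive_cos _) (isdM (isd_cst s t) (isd_id t)))).
by rewrite mulr1 mulr0 addr0.
Qed.

Lemma is_derive_sinM s t : is_derive t 1 (fun t => sin (s * t)) (cos (s * t) * s).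
Proof.
apply: (is_derive_eq (isd_comp (is_derive_sin _) (isdM (isd_cst s t) (isd_id t)))).
by rewrite mulr1 mulr0 addr0.
Qed.

Lemma is_derive_expRM e t :
  is_derive t 1 (fun t => expR (- (e * t))) (- e * expR (- (e * t))).
Proof.
apply: (is_derive_eq (isd_comp (is_derive_expR _) (isdN (isdM (isd_cst e t) (isd_id t))))).
by rewrite mulr1 mulr0 addr0 mulrC.
Qed.

Lemma continuous_osc e s : continuous (fun t => decay e t * (1 + cos (s * t))).
Proof.
move=> t; apply: cvgM; first exact: continuous_decay.
by apply: cvgD; [exact: cvg_cst|exact: (isd_continuous (is_derive_cosM s t))].
Qed.

Lemma expR_cvg0 e : 0 < e -> expR (- (e * t)) @[t --> +oo%R] --> (0 : R).
Proof.
move=> e0; apply: (@cvg_comp _ _ _ (fun t => e * t) (fun y => expR (- y)) _ +oo%R).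
  exact: gt0_cvgMry.
exact: cvgr_expR.
Qed.

Lemma integral_decay_cos1 e s : 0 < e ->
  (\int[leb]_t (decay e t * (1 + cos (s * t)))%:E = (2 / e + cauchy e s)%:E)%E.
Proof.
move=> e0; have d0 := cauchy_den s e0.
rewrite (ge0_symfun_integralT (f := fun t => decay e t * (1 + cos (s * t)))); last 3 first.
- by move=> t; rewrite mulr_ge0 ?decay_ge0 ?cosD1_ge0.
- exact: continuous_osc.
- by move=> t; rewrite /= decayN mulrN cosN.
rewrite -set_itvcy.
pose f t := expR (- (e * t)) * (1 + cos (s * t)).
pose F t := expR (- (e * t)) *
   (- e^-1 + (s * sin (s * t) - e * cos (s * t)) * (e ^+ 2 + s ^+ 2)^-1).
have dF (t : R) : is_derive t 1 F (f t).
  apply: (is_derive_eq (isdM (is_derive_expRM e t) (isdD (isd_cst (- e^-1) t)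
    (isdM (isdD (isdM (isd_cst s t) (is_derive_sinM s t))
             (isdN (isdM (isd_cst e t) (is_derive_cosM s t))))
      (isd_cst (e ^+ 2 + s ^+ 2)^-1 t))))).
  rewrite /f; move: (expR _) (sin _) (cos _) => E S C; field.
  by rewrite !gt_eqF.
have -> : (\int[leb]_(x in `[0%R, +oo[) (decay e x * (1 + cos (s * x)))%:E = \int[leb]_(x in `[0%R, +oo[) (f x)%:E)%E.
  apply: eq_integral => t; rewrite inE/= in_itv/= andbT => t0.
  by rewrite /decay ger0_norm.
have cf (t : R) : {for t, continuous f}.
  exact: (isd_continuous (isdM (is_derive_expRM e t) (isdD (isd_cst 1 t) (is_derive_cosM s t)))).
rewrite (@ge0_continuous_FTC2y R f F 0 0).
- rewrite sub0e /F !mulr0 oppr0 expR0 cos0 sin0 -EFinN -EFinM; congr EFin.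
  by rewrite /cauchy; field; rewrite !gt_eqF.
- by move=> t t0; rewrite mulr_ge0 ?expR_ge0 ?cosD1_ge0.
- by apply: continuous_subspaceT => t; exact: cf.
- pose C := e^-1 + (`|s| + e) / (e ^+ 2 + s ^+ 2).
  have h0 : (fun t => C * expR (- (e * t))) @ +oo%R --> (0 : R).
    by rewrite -[X in _ --> X](mulr0 C); apply: cvgMr; exact: expR_cvg0.
  have h1 : (fun t => - (C * expR (- (e * t)))) @ +oo%R --> (0 : R).
    by rewrite -[X in _ --> X]oppr0; exact: cvgN.
  apply: (squeeze_cvgr _ h1 h0); near=> t.
  rewrite -ler_norml /F normrM ger0_norm ?expR_ge0// mulrC ler_wpM2r ?expR_ge0//.
  apply: (le_trans (ler_normD _ _)); rewrite normrN gtr0_norm ?invr_gt0// /C lerD2l.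
  have i0 : 0 < (e ^+ 2 + s ^+ 2)^-1 by rewrite invr_gt0.
  rewrite normrM (gtr0_norm i0) ler_pM2r//.
  rewrite (le_trans (ler_normB _ _))// lerD// normrM.
    by rewrite ler_piMr// ler_norml sin_geN1 sin_le1.
  by rewrite gtr0_norm// ler_piMr ?(ltW e0)// ler_norml cos_geN1 cos_le1.
- by move=> t _; case: (dF t).
- by apply: cvg_at_right_filter; exact: (isd_continuous (dF 0)).
- by move=> t _; rewrite derive1E; case: (dF t).
Unshelve. all: by end_near. Qed.

Lemma integral_decay e : 0 < e -> (\int[leb]_t (decay e t)%:E = (2 / e)%:E)%E.
Proof.
move=> e0; have := integral_decay_cos1 0 e0.
rewrite (_ : (\int[leb]_t _)%E = (2%:E * \int[leb]_t (decay e t)%:E)%E); last first.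
  rewrite -ge0_integralZl//.
  - by apply: eq_integral => t _; rewrite mul0r cos0 -EFinM mulrC.
  - by apply/measurable_EFinP; exact: measurable_decay.
  - by move=> t _; rewrite lee_fin decay_ge0.
move=> h; have -> : (2 / e)%:E = (2^-1%:E * (2 / e + cauchy e 0)%:E)%E.
  by rewrite -EFinM; congr EFin; rewrite /cauchy; field; rewrite gt_eqF.
by rewrite -h muleA -EFinM mulVf// mul1e.
Qed.

Lemma integrable_decay e : 0 < e -> leb.-integrable setT (EFin \o decay e).
Proof.
move=> e0; apply/integrableP; split; first by apply/measurable_EFinP; exact: measurable_decay.
rewrite (_ : (\int[leb]_t _)%E = (2 / e)%:E) ?ltry//.
rewrite -integral_decay//; apply: eq_integral => t _ /=.
by rewrite ger0_norm// decay_ge0.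
Qed.

Lemma cintegrable_decay e (p : R -> R) : 0 < e -> measurable_fun setT p ->
  cintegrable leb setT (fun t => (decay e t)%:C * expi (p t)).
Proof.
move=> e0 mp; apply/cintegrableP; split.
  apply: cmeasurableM; last exact: cmeasurable_expi.
  by apply: cmeasurable_real; exact: measurable_decay.
rewrite /absint (_ : (\int[leb]_x _)%E = (2 / e)%:E) ?ltry//.
rewrite -integral_decay//; apply: eq_integral => t _.
by rewrite normcMr normcC normc_expi mulr1 ger0_norm// decay_ge0.
Qed.

Lemma fourier_decay e s : 0 < e ->
  cintegral leb setT (fun t => (decay e t)%:C * expi (s * t)) = (cauchy e s)%:C.
Proof.
move=> e0.
have ms : measurable_fun setT (fun t : R => s * t) by exact: measurable_funM.
have ci := cintegrable_decay e0 ms.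
have [ic is_] := ci.
have {}ic : leb.-integrable setT (fun t => (decay e t * cos (s * t))%:E).
  rewrite (_ : (fun t => _) = (fun t => (complex.Re ((decay e t)%:C * expi (s * t)))%:E))//.
  by apply/funext => t; rewrite cReM /= mul0r subr0.
have {}is_ : leb.-integrable setT (fun t => (decay e t * sin (s * t))%:E).
  rewrite (_ : (fun t => _) = (fun t => (complex.Im ((decay e t)%:C * expi (s * t)))%:E))//.
  by apply/funext => t; rewrite cImM /= mul0r addr0.
have id := integrable_decay e0.
rewrite cintegralE//; apply: complex_ext => /=.
- under eq_Rintegral do rewrite mul0r subr0.
  have : (\int[leb]_t (decay e t + decay e t * cos (s * t)) = 2 / e + cauchy e s)%R.
    rewrite /Rintegral; under eq_integral do rewrite -{1}[decay e _]mulr1 -mulrDr.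
    by rewrite integral_decay_cos1.
  rewrite RintegralD//= => /eqP; rewrite {1}/Rintegral integral_decay//=.
  by rewrite (inj_eq (addrI _)) => /eqP.
- under eq_Rintegral do rewrite mul0r addr0.
  set J := Rintegral _ _ _.
  pose h t := (decay e t + decay e t * sin (s * t))%:E.
  have h0 t : (0 <= h t)%E.
    by rewrite lee_fin -{1}[decay e _]mulr1 -mulrDr mulr_ge0 ?decay_ge0 ?sinD1_ge0.
  have mh : measurable_fun setT h.
    apply/measurable_EFinP; apply: measurable_funD; first exact: measurable_decay.
    by move: is_ => /(measurable_int leb) /measurable_EFinP.
  have N10 : -1 != 0 :> R by rewrite oppr_eq0 oner_neq0.
  have := integral_affine 0 N10 mh h0; rewrite normrN1 mul1e => /(congr1 fine).
  rewrite -[RHS]/(\int[leb]_t (decay e t + decay e t * sin (s * t)))%R RintegralD//.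
  rewrite -/J.
  have -> : fine (\int[leb]_x h (-1 * x + 0)%R)%E =
      (\int[leb]_t (decay e t - decay e t * sin (s * t)))%R.
    rewrite /Rintegral; congr fine; apply: eq_integral => t _.
    by rewrite /h mulN1r addr0 decayN mulrN sinN mulrN.
  rewrite RintegralB// -/J => /eqP; rewrite (inj_eq (addrI _)) eq_sym -subr_eq0 opprK.
  by rewrite -mulr2n mulrn_eq0 /= => /eqP.
Qed.

End fourier_decay.

Lemma cmeasurable_tensor d1 d2 (X : measurableType d1) (Y : measurableType d2)
    (R : realType) (f : X -> R[i]) (g : Y -> R[i]) : cmeasurable f -> cmeasurable g ->
  cmeasurable (fun z : X * Y => f z.1 * g z.2).
Proof.
by move=> mf mg; apply: cmeasurableM;
  [exact: (cmeasurable_comp mf measurable_fst)|exact: (cmeasurable_comp mg measurable_snd)].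
Qed.

Section tensor.
Context d1 d2 (X : measurableType d1) (Y : measurableType d2) (R : realType).
Variable m1 : {sigma_finite_measure set X -> \bar R}.
Variable m2 : {sigma_finite_measure set Y -> \bar R}.
Implicit Types (f : X -> R[i]) (g : Y -> R[i]).

Lemma absint_tensor f g : cmeasurable f -> cmeasurable g ->
  (\int[m1]_x absint m2 (fun y => f x * g y)%R = absint m1 f * absint m2 g)%E.
Proof.
move=> mf mg.
have mnf : measurable_fun setT (fun x => (Normc.normc (f x))%:E).
  exact/measurable_EFinP/measurable_normc.
have mng : measurable_fun setT (fun x => (Normc.normc (g x))%:E).
  exact/measurable_EFinP/measurable_normc.
rewrite /absint muleC -ge0_integralZl ?absint_ge0//; last first.
  by move=> x _; rewrite lee_fin normc_ge0.
apply: eq_integral => x _; under eq_integral do rewrite normcMr EFinM.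
rewrite ge0_integralZl// ?lee_fin ?normc_ge0// 1?muleC//.
by move=> y _; rewrite lee_fin normc_ge0.
Qed.

Lemma cintegrable_tensor f g : cintegrable m1 setT f -> cintegrable m2 setT g ->
  cintegrable (m1 \x m2)%E setT (fun z => f z.1 * g z.2).
Proof.
move=> /cintegrableP[mf fi] /cintegrableP[mg gi].
apply: cintegrable_prod; first exact: cmeasurable_tensor.
rewrite /=.
by rewrite absint_tensor// lte_mul_pinfty ?absint_ge0// ge0_fin_numE// absint_ge0.
Qed.

Lemma cintegral_tensor f g : cintegrable m1 setT f -> cintegrable m2 setT g ->
  cintegral (m1 \x m2)%E setT (fun z => f z.1 * g z.2)
  = cintegral m1 setT f * cintegral m2 setT g.
Proof.
move=> fi gi; have /cintegrableP[mf fi'] := fi; have /cintegrableP[mg gi'] := gi.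
rewrite cintegral_prod /=; last 2 first.
- exact: cmeasurable_tensor.
- by rewrite absint_tensor// lte_mul_pinfty ?absint_ge0// ge0_fin_numE// absint_ge0.
under eq_cintegral do rewrite cintegralZ// mulrC.
by rewrite cintegralZ// mulrC.
Qed.

End tensor.

Lemma measurable_integral2 d1 d2 (X : measurableType d1) (Y : measurableType d2)
    (R : realType) (m : {sigma_finite_measure set Y -> \bar R}) (f : X * Y -> \bar R) :
  measurable_fun setT f -> (forall z, 0 <= f z)%E ->
  measurable_fun setT (fun x => \int[m]_y f (x, y))%E.
Proof.
by move=> mf f0; apply: (@measurable_fun_fubini_tonelli_F _ _ X Y R m f).
Qed.

Lemma tonelli_swap d1 d2 (X : measurableType d1) (Y : measurableType d2)
    (R : realType) (m : {sigma_finite_measure set X -> \bar R})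
    (n : {sigma_finite_measure set Y -> \bar R}) (f : X * Y -> \bar R) :
  measurable_fun setT f -> (forall z, 0 <= f z)%E ->
  (\int[m]_x \int[n]_y f (x, y) = \int[n]_y \int[m]_x f (x, y))%E.
Proof. by move=> mf f0; exact: (@fubini_tonelli _ _ X Y R m n f). Qed.

Section Schur.
Context d1 d2 (X : measurableType d1) (Y : measurableType d2) (R : realType).
Variable m : {sigma_finite_measure set X -> \bar R}.
Variable n : {sigma_finite_measure set Y -> \bar R}.
Local Notation normc := Normc.normc.
Variables (K : Y -> R) (phase : Y -> X -> R) (k : X -> X -> R).
Hypothesis mK : measurable_fun setT K.
Hypothesis K0 : forall y, 0 <= K y.
Hypothesis iK : n.-integrable setT (EFin \o K).
Hypothesis mphase : measurable_fun setT (fun z : Y * X => phase z.1 z.2).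
Hypothesis mk : measurable_fun setT (fun z : X * X => k z.1 z.2).
Hypothesis k0 : forall q q', 0 <= k q q'.
Hypothesis kC : forall q q', k q q' = k q' q.
Hypothesis kE : forall q q', cintegral n setT (fun y =>
  (K y)%:C * expi (phase y q - phase y q')) = (k q q')%:C.

(** Expanding the square of the transform and integrating first in [y] replaces
    the oscillating phases by the kernel [k], which is nonnegative; all that is
    left is the weighted Schur test for [k]. *)
Lemma Schur_test (F : X -> R[i]) (rho f2 : X -> R) (B : R) :
  cintegrable m setT F -> measurable_fun setT rho -> measurable_fun setT f2 ->
  (forall q, 0 <= rho q) -> (forall q, 0 <= f2 q) ->
  (forall q, sqn (F q) <= rho q * f2 q) ->
  (forall q, \int[m]_q' (rho q' * k q q')%:E <= B%:E)%E ->
  (\int[n]_y (K y * sqn (cintegral m setT (fun q => F q * expi (phase y q))))%:E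
   <= B%:E * \int[m]_q (f2 q)%:E)%E.
Proof.
move=> Fi mrho mf2 rho0 f20 Fle kB.
have /cintegrableP[mF aF] := Fi.
have aFfin : absint m F \is a fin_num by rewrite ge0_fin_numE ?absint_ge0.
have aK : absint n (fun y => (K y)%:C) \is a fin_num.
  rewrite ge0_fin_numE ?absint_ge0//.
  have /integrableP[_] := iK; apply: le_lt_trans; rewrite le_eqVlt; apply/orP; left.
  by apply/eqP; apply: eq_integral => y _; rewrite normcC.
have mE : cmeasurable (fun z : Y * X => expi (phase z.1 z.2)) by exact: cmeasurable_expi.
have mEq q : cmeasurable (fun y : Y => expi (phase y q)).
  exact: (cmeasurable_pair2 q mE).
have mEy y : cmeasurable (fun q : X => expi (phase y q)).
  exact: (cmeasurable_pair1 y mE).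
pose FE y q := F q * expi (phase y q).
have FEi y : cintegrable m setT (FE y).
  apply: (le_cintegrable _ Fi); first exact: cmeasurableM.
  by move=> q; rewrite normcMr normc_expi mulr1.
pose T y := cintegral m setT (FE y).
have mFE : cmeasurable (fun z : Y * X => FE z.1 z.2).
  by apply: cmeasurableM => //; apply: (cmeasurable_comp mF); exact: measurable_snd.
have mT : cmeasurable T by exact: (cmeasurable_cintegral m mFE).
have TA y : ((normc (T y))%:E <= absint m F)%E.
  apply: le_trans (normc_cintegral _ _) _; apply: le_absint => //.
    exact: cintegrable_meas (FEi y).
  by move=> q; rewrite normcMr normc_expi mulr1.
pose A := fine (absint m F).
have TA' y : normc (T y) <= A by rewrite -lee_fin fineK.
have A0 : 0 <= A by rewrite fine_ge0// absint_ge0.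
have mKc : cmeasurable (fun y => (K y)%:C) by exact: cmeasurable_real.
have KTi : n.-integrable setT (fun y => (K y * sqn (T y))%:E).
  apply: (@le_integrable _ _ _ n setT measurableT _ (fun y => ((A ^+ 2)%:E * (K y)%:E)%E)).
  - apply/measurable_EFinP; apply: measurable_funM => //; exact: measurable_sqn.
  - move=> y _; rewrite lee_fin !ger0_norm ?mulr_ge0 ?sqn_ge0 ?sqr_ge0// mulrC.
    by rewrite ler_wpM2r// -normc2 ler_sqr ?nnegrE ?normc_ge0.
  - exact: integrableZl.
(* every integrand exchanged below is dominated by a multiple of [K y |F q|] *)
have dom (A1 : R) (L : Y * X -> R[i]) : 0 <= A1 -> cmeasurable L ->
    (forall y q, normc (L (y, q)) <= A1 * K y * normc (F q)) ->
    (\int[n]_y absint m (fun q => L (y, q)) < +oo)%E.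
  move=> A10 mL LA; have mAK : cmeasurable (fun y => A1%:C * (K y)%:C).
    by apply: cmeasurableM => //; exact: cmeasurable_cst.
  apply: (@le_lt_trans _ _ (\int[n]_y absint m (fun q => ((A1%:C * (K y)%:C) * F q)%R))%E).
    apply: ge0_le_integral => //.
    - by move=> y _; exact: absint_ge0.
    - exact: (measurable_absint m mL).
    - have mG := cmeasurable_tensor mAK mF.
      exact: (measurable_absint m mG).
    - move=> y _; apply: le_absint.
      + exact: (cmeasurable_pair1 y mL).
      + by apply: cmeasurableM => //; exact: cmeasurable_cst.
      + by move=> q; rewrite !normcMr !normcC (ger0_norm A10) (ger0_norm (K0 y)).
  rewrite absint_tensor//.
  have /cintegrableP[_ h] : cintegrable n setT (fun y => A1%:C * (K y)%:C).
    by apply: cintegrableZ; apply/cintegrableP; split => //; rewrite -ge0_fin_numE// absint_ge0.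
  by rewrite lte_mul_pinfty// ?absint_ge0// ge0_fin_numE// absint_ge0.
have iKb (h : Y -> R[i]) : cmeasurable h -> (forall y, normc (h y) <= A + 1) ->
    cintegrable n setT (fun y => (K y)%:C * h y).
  move=> mh hA.
  have hi : cintegrable n setT (fun y => (A + 1)%:C * (K y)%:C).
    by apply: cintegrableZ; apply/cintegrableP; split => //; rewrite -ge0_fin_numE// absint_ge0.
  apply: (le_cintegrable _ hi); first exact: cmeasurableM.
  move=> y; rewrite !normcMr !normcC mulrC ler_wpM2r//.
  by rewrite ger0_norm// addr_ge0.
(* The energy of the transform [T] is the integral of [F] against [G], the
   conjugate of [T] transformed back with the kernel [K]; exchanging once more,
   [G] becomes the conjugate of [F] smoothed by [k]. *)
pose H (z : Y * X) := (K z.1)%:C * ((T z.1)^*)%C * FE z.1 z.2.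
have mKT : cmeasurable (fun y => (K y)%:C * ((T y)^*)%C).
  by apply: cmeasurableM => //; exact: cmeasurableJ.
have mH : cmeasurable H.
  by apply: cmeasurableM => //; apply: (cmeasurable_comp mKT); exact: measurable_fst.
have HI : (\int[n]_y absint m (fun q => H (y, q)) < +oo)%E.
  apply: (dom A) => // y q; rewrite /H /FE !normcMr !normcC normc_expi mulr1 normcJ.
  by rewrite ler_wpM2r ?normc_ge0// mulrC (ger0_norm (K0 y)) ler_wpM2r.
pose G q := cintegral n setT (fun y => (K y)%:C * (((T y)^*)%C * expi (phase y q))).
have S1 : (\int[n]_y (K y * sqn (T y)))%:C = cintegral m setT (fun q => F q * G q).
  rewrite -cintegral_real//.
  rewrite (eq_cintegral n (g := fun y => cintegral m setT (fun q => H (y, q)))); last first.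
    move=> y; rewrite /H /= cintegralZ// -/(T y) -mulrA (mulrC (_^*)%C) mulcJ.
    by rewrite rmorphM.
  rewrite (cFubini mH HI); apply: eq_cintegral => q.
  rewrite /H /FE /G /= -cintegralZ; last first.
    apply: iKb; first by apply: cmeasurableM => //; exact: cmeasurableJ.
    by move=> y; rewrite normcMr normcJ normc_expi mulr1 (le_trans (TA' y))// lerDl.
  by apply: eq_cintegral => y; rewrite /= -mulrA (mulrCA _ (F q)) [RHS]mulrCA.
have GE q : G q = cintegral m setT (fun q' => ((F q')^*)%C * (k q q')%:C).
  pose L (z : Y * X) := (K z.1)%:C * expi (phase z.1 q) * ((FE z.1 z.2)^*)%C.
  have mKe : cmeasurable (fun y => (K y)%:C * expi (phase y q)) by exact: cmeasurableM.
  have mL : cmeasurable L.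
    apply: cmeasurableM; last exact: cmeasurableJ.
    by apply: (cmeasurable_comp mKe); exact: measurable_fst.
  have LI : (\int[n]_y absint m (fun q => L (y, q)) < +oo)%E.
    apply: (dom 1) => // y q'; rewrite /L /FE !normcMr normcJ normcMr !normcC !normc_expi !mulr1.
    by rewrite mul1r (ger0_norm (K0 y)).
  transitivity (cintegral n setT (fun y => cintegral m setT (fun q' => L (y, q')))).
    apply: eq_cintegral => y; rewrite /L /= cintegralZ; last exact: cintegrableJ.
    by rewrite cintegralJ -/(T y) -mulrA [in RHS](mulrC (expi _)).
  rewrite (cFubini mL LI); apply: eq_cintegral => q'.
  rewrite -kE -cintegralZ; last first.
    apply: iKb.
      under eq_fun do rewrite expiD expiN.
      by apply: cmeasurableM => //; exact: cmeasurableJ.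
    by move=> y; rewrite normc_expi lerDr.
  apply: eq_cintegral => y; rewrite /L /FE /= expiD expiN rmorphM.
  by rewrite mulrCA !mulrA.
have mG : cmeasurable G.
  have mGG : cmeasurable (fun z : X * Y => (K z.2)%:C * (((T z.2)^*)%C * expi (phase z.2 z.1))).
    apply: cmeasurableM; first by apply: (cmeasurable_comp mKc); exact: measurable_snd.
    apply: cmeasurableM; first by apply: (cmeasurable_comp (cmeasurableJ mT)); exact: measurable_snd.
    apply: (cmeasurable_comp (h := fun z : X * Y => (z.2, z.1)) mE).
    exact: measurable_swap.
  exact: (cmeasurable_cintegral n mGG).
have V0 : (0 <= \int[n]_y (K y * sqn (T y))%:E)%E.
  by apply: integral_ge0 => y _; rewrite lee_fin mulr_ge0 ?sqn_ge0.
have -> : (\int[n]_y (K y * sqn (T y))%:E = (normc (cintegral m setT (fun q => F q * G q)%R))%:E)%E.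
  rewrite -S1 normcC ger0_norm; last by rewrite fine_ge0.
  by rewrite /Rintegral fineK//; exact: integrable_fin_num.
apply: le_trans (normc_cintegral _ _) _.
pose P (z : X * X) := (f2 z.1 * (rho z.2 * k z.1 z.2))%:E.
pose Q (z : X * X) := (f2 z.2 * (rho z.1 * k z.1 z.2))%:E.
have m1 (h : X -> R) : measurable_fun setT h -> measurable_fun setT (fun z : X * X => h z.1).
  by move=> mh; apply: (measurableT_comp mh); exact: measurable_fst.
have m2 (h : X -> R) : measurable_fun setT h -> measurable_fun setT (fun z : X * X => h z.2).
  by move=> mh; apply: (measurableT_comp mh); exact: measurable_snd.
have mP : measurable_fun setT P.
  by apply/measurable_EFinP; apply: measurable_funM; [exact: m1|apply: measurable_funM => //; exact: m2].
have mQ : measurable_fun setT Q.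
  by apply/measurable_EFinP; apply: measurable_funM; [exact: m2|apply: measurable_funM => //; exact: m1].
have P0 z : (0 <= P z)%E by rewrite lee_fin !mulr_ge0.
have Q0 z : (0 <= Q z)%E by rewrite lee_fin !mulr_ge0.
have PB : (\int[m]_q \int[m]_q' P (q, q') <= B%:E * \int[m]_q (f2 q)%:E)%E.
  rewrite -ge0_integralZl//; last 3 first.
  - exact/measurable_EFinP.
  - by move=> q _; rewrite lee_fin.
  - apply: (@le_trans _ _ (\int[m]_q' (rho q' * k point q')%:E)%E) => //.
    by apply: integral_ge0 => q _; rewrite lee_fin mulr_ge0.
  apply: ge0_le_integral => //.
  - by move=> q _; apply: integral_ge0.
  - exact: (measurable_integral2 m mP P0).
  - by apply: measurable_funeM; exact/measurable_EFinP.
  - move=> q _; rewrite /P /=; under eq_integral do rewrite EFinM.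
    rewrite ge0_integralZl//.
    + by rewrite muleC lee_wpmul2r// lee_fin.
    + apply/measurable_EFinP; apply: measurable_funM => //.
      exact: (measurableT_comp mk (measurable_pair1 q)).
    + by move=> q' _; rewrite lee_fin mulr_ge0.
    + by rewrite lee_fin.
have QB : (\int[m]_q \int[m]_q' Q (q, q') <= B%:E * \int[m]_q (f2 q)%:E)%E.
  rewrite (tonelli_swap m m mQ Q0); apply: le_trans PB; rewrite le_eqVlt; apply/orP; left.
  apply/eqP; apply: eq_integral => q _; apply: eq_integral => q' _.
  by rewrite /P /Q /= kC.
have FF q q' : normc (F q) * normc (F q') * k q q' <=
    2^-1 * (f2 q * (rho q' * k q q') + f2 q' * (rho q * k q q')).
  suff h : normc (F q) * normc (F q') <= 2^-1 * (f2 q * rho q' + f2 q' * rho q).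
    have := ler_wpM2r (k0 q q') h; rewrite -!mulrA mulrDl !mulrA; exact.
  rewrite -(@ler_sqr R) ?nnegrE ?mulr_ge0 ?addr_ge0 ?mulr_ge0 ?normc_ge0 ?invr_ge0//.
  rewrite exprMn !normc2.
  apply: (@le_trans _ _ ((rho q * f2 q) * (rho q' * f2 q'))).
    by rewrite ler_pM ?sqn_ge0.
  have := sqr_ge0 (f2 q * rho q' - f2 q' * rho q).
  move: (f2 q) (f2 q') (rho q) (rho q') => a b c d; rewrite !expr2; lra.
apply: (@le_trans _ _ (2^-1%:E * \int[m]_q \int[m]_q' (P (q, q') + Q (q, q')))%E); last first.
  have -> : (\int[m]_q \int[m]_q' (P (q, q') + Q (q, q')) =
     \int[m]_q \int[m]_q' P (q, q') + \int[m]_q \int[m]_q' Q (q, q'))%E.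
    rewrite -ge0_integralD//; last 4 first.
    - by move=> q _; apply: integral_ge0.
    - exact: (measurable_integral2 m mP P0).
    - by move=> q _; apply: integral_ge0.
    - exact: (measurable_integral2 m mQ Q0).
    apply: eq_integral => q _; rewrite ge0_integralD//.
    - exact: (measurableT_comp mP (measurable_pair1 q)).
    - exact: (measurableT_comp mQ (measurable_pair1 q)).
  rewrite -[leRHS]mul1e (_ : 1%E = (2^-1%:E * 2%:E)%E :> \bar R); last first.
    by rewrite -EFinM mulVf.
  rewrite -muleA; apply: lee_wpmul2l; first by rewrite lee_fin.
  move: PB QB; move: (\int[m]_q \int[m]_q' P (q, q'))%E (\int[m]_q \int[m]_q' Q (q, q'))%E.
  move: (B%:E * _)%E => a b c ba ca; rewrite mule_natl mule2n; exact: leeD.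
have mPQ : measurable_fun setT (fun z => P z + Q z)%E by exact: emeasurable_funD.
have PQ0 z : (0 <= P z + Q z)%E by rewrite adde_ge0.
rewrite -ge0_integralZl//; last 2 first.
- exact: (measurable_integral2 m mPQ PQ0).
- by move=> q _; apply: integral_ge0.
apply: ge0_le_integral => //.
- by move=> q _; rewrite lee_fin normc_ge0.
- by apply/measurable_EFinP/measurable_normc; exact: cmeasurableM.
- by apply: measurable_funeM; exact: (measurable_integral2 m mPQ PQ0).
move=> q _; rewrite normcMr EFinM.
have mkq : measurable_fun setT (k q) by exact: (measurableT_comp mk (measurable_pair1 q)).
apply: (@le_trans _ _ ((normc (F q))%:E * absint m (fun q' => ((F q')^*)%C * (k q q')%:C)%R)%E).
  by rewrite lee_wpmul2l ?lee_fin ?normc_ge0// GE; exact: normc_cintegral.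
have mFk : cmeasurable (fun q' => ((F q')^*)%C * (k q q')%:C).
  by apply: cmeasurableM; [exact: cmeasurableJ|exact: cmeasurable_real].
rewrite /absint -!ge0_integralZl//; last 4 first.
- exact: (measurableT_comp mPQ (measurable_pair1 q)).
- by apply/measurable_EFinP/measurable_normc.
- by move=> q' _; rewrite lee_fin normc_ge0.
- by rewrite lee_fin normc_ge0.
apply: ge0_le_integral => //.
- by move=> q' _; rewrite mule_ge0// lee_fin normc_ge0.
- by apply: measurable_funeM; apply/measurable_EFinP/measurable_normc.
- by apply: measurable_funeM; exact: (measurableT_comp mPQ (measurable_pair1 q)).
- move=> q' _; rewrite /P /Q /= -EFinD -!EFinM lee_fin normcMr normcJ normcC.
  by apply: le_trans (FF q q'); rewrite (ger0_norm (k0 q q')) mulrA.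
Qed.

End Schur.

(** * Bessel's inequality *)

Section Bessel.
Variable R : realType.
Local Notation leb := (@lebesgue_measure R).
Local Notation leb3 := (@leb3 R).
Local Notation leb2 := (@leb2 R).
Implicit Types (e : R) (x k q p : R3 R).

Definition dot3 x k : R := x.1 * k.1 + dot2 x.2 k.2.

Definition decay3 e x : R := decay e x.1 * (decay e x.2.1 * decay e x.2.2).

Definition cauchy3 e x : R := cauchy e x.1 * (cauchy e x.2.1 * cauchy e x.2.2).

Lemma measurable_proj1 : measurable_fun setT (fun x : R3 R => x.1).
Proof. exact: measurable_fst. Qed.

Lemma measurable_proj2 : measurable_fun setT (fun x : R3 R => x.2.1).
Proof. exact: (measurableT_comp (measurable_fst) (measurable_snd)). Qed.

Lemma measurable_proj3 : measurable_fun setT (fun x : R3 R => x.2.2).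
Proof. exact: (measurableT_comp (measurable_snd) (measurable_snd)). Qed.

Lemma measurable_tensor3 (f g h : R -> R) : measurable_fun setT f ->
  measurable_fun setT g -> measurable_fun setT h ->
  measurable_fun setT (fun x : R3 R => f x.1 * (g x.2.1 * h x.2.2)).
Proof.
move=> mf mg mh; apply: measurable_funM; first exact: (measurableT_comp mf measurable_proj1).
by apply: measurable_funM; [exact: (measurableT_comp mg measurable_proj2)
                           |exact: (measurableT_comp mh measurable_proj3)].
Qed.

Lemma measurable_decay3 e : measurable_fun setT (decay3 e).
Proof. by apply: measurable_tensor3; exact: measurable_decay. Qed.

Lemma measurable_cauchy3 e : measurable_fun setT (cauchy3 e).
Proof. by apply: measurable_tensor3; exact: measurable_cauchy. Qed.

Lemma decay3_ge0 e x : 0 <= decay3 e x.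
Proof. by rewrite /decay3 !mulr_ge0// decay_ge0. Qed.

Lemma decay3_le1 e x : 0 <= e -> decay3 e x <= 1.
Proof.
move=> e0; rewrite /decay3 mulr_ile1 ?mulr_ge0 ?decay_ge0 ?decay_le1//.
by rewrite mulr_ile1 ?decay_ge0 ?decay_le1.
Qed.

Lemma cauchy3_ge0 e x : 0 < e -> 0 <= cauchy3 e x.
Proof. by move=> e0; apply: mulr_ge0; [|apply: mulr_ge0]; exact: cauchy_ge0. Qed.

Lemma cauchy3B e x k : cauchy3 e (x - k) = cauchy3 e (k - x).
Proof. by rewrite /cauchy3 /= cauchyB [cauchy e (x.2.1 - _)]cauchyB [cauchy e (x.2.2 - _)]cauchyB. Qed.

Lemma measurable_dot3 x : measurable_fun setT (dot3 x).
Proof.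
apply: measurable_funD; first by apply: measurable_funM => //; exact: measurable_proj1.
by apply: measurable_funD; apply: measurable_funM => //; [exact: measurable_proj2|exact: measurable_proj3].
Qed.

Lemma measurable_dot3_2 : measurable_fun setT (fun z : R3 R * R3 R => dot3 z.1 z.2).
Proof.
have m1 (f : R3 R -> R) : measurable_fun setT f -> measurable_fun setT (fun z : R3 R * R3 R => f z.1).
  by move=> mf; exact: (measurableT_comp mf measurable_fst).
have m2 (f : R3 R -> R) : measurable_fun setT f -> measurable_fun setT (fun z : R3 R * R3 R => f z.2).
  by move=> mf; exact: (measurableT_comp mf measurable_snd).
apply: measurable_funD.
  by apply: measurable_funM; [exact: m1 measurable_proj1|exact: m2 measurable_proj1].
apply: measurable_funD.
  by apply: measurable_funM; [exact: m1 measurable_proj2|exact: m2 measurable_proj2].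
by apply: measurable_funM; [exact: m1 measurable_proj3|exact: m2 measurable_proj3].
Qed.

Lemma dot3C x k : dot3 x k = dot3 k x.
Proof. by rewrite /dot3 /dot2; ring. Qed.

Lemma dot3Dl x k p : dot3 (x + k) p = dot3 x p + dot3 k p.
Proof. by rewrite /dot3 /dot2 /=; ring. Qed.

Lemma dot3Nl x p : dot3 (- x) p = - dot3 x p.
Proof. by rewrite /dot3 /dot2 /=; ring. Qed.

Lemma dot3Bl x k p : dot3 (x - k) p = dot3 x p - dot3 k p.
Proof. by rewrite dot3Dl dot3Nl. Qed.

Lemma dot30 p : dot3 0 p = 0.
Proof. by rewrite -(subrr p) dot3Bl subrr. Qed.

Lemma decay3_split e s x : (decay3 e x)%:C * expi (dot3 s x) =
  ((decay e x.1)%:C * expi (s.1 * x.1)) *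
  (((decay e x.2.1)%:C * expi (s.2.1 * x.2.1)) * ((decay e x.2.2)%:C * expi (s.2.2 * x.2.2))).
Proof.
rewrite /decay3 /dot3 /dot2 !expiD !rmorphM /=.
by move: (expi _) (expi _) (expi _) => a b c; ring.
Qed.

Lemma cintegrable_decay3 e s : 0 < e ->
  cintegrable leb3 setT (fun x => (decay3 e x)%:C * expi (dot3 s x)).
Proof.
move=> e0; have ci (r : R) : cintegrable leb setT (fun t => (decay e t)%:C * expi (r * t)).
  by apply: cintegrable_decay => //; exact: measurable_funM.
under eq_fun do rewrite decay3_split.
have ci2 : cintegrable leb2 setT (fun y : R2 R => ((decay e y.1)%:C * expi (s.2.1 * y.1)) *
    ((decay e y.2)%:C * expi (s.2.2 * y.2))).
  exact: (cintegrable_tensor (ci s.2.1) (ci s.2.2)).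
exact: (cintegrable_tensor (ci s.1) ci2).
Qed.

Lemma fourier_decay3 e s : 0 < e ->
  cintegral leb3 setT (fun x => (decay3 e x)%:C * expi (dot3 s x)) = (cauchy3 e s)%:C.
Proof.
move=> e0; have ci (r : R) : cintegrable leb setT (fun t => (decay e t)%:C * expi (r * t)).
  by apply: cintegrable_decay => //; exact: measurable_funM.
under eq_cintegral do rewrite decay3_split.
have ci2 : cintegrable leb2 setT (fun y : R2 R => ((decay e y.1)%:C * expi (s.2.1 * y.1)) *
    ((decay e y.2)%:C * expi (s.2.2 * y.2))).
  exact: (cintegrable_tensor (ci s.2.1) (ci s.2.2)).
have -> := cintegral_tensor (ci s.1) ci2.
have -> := cintegral_tensor (ci s.2.1) (ci s.2.2).
rewrite !fourier_decay//.
by rewrite /cauchy3 !rmorphM.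
Qed.

Lemma integrable_decay3 e : 0 < e -> leb3.-integrable setT (EFin \o decay3 e).
Proof.
move=> e0; have [+ _] := cintegrable_decay3 0 e0.
rewrite (_ : (fun x => _) = EFin \o decay3 e)//; apply/funext => x /=.
by rewrite dot30 cos0 mulr1 mul0r subr0.
Qed.

Lemma ge0_integral_tensor d1 d2 (X : measurableType d1) (Y : measurableType d2)
    (m1 : {sigma_finite_measure set X -> \bar R})
    (m2 : {sigma_finite_measure set Y -> \bar R}) (f : X -> R) (g : Y -> R) :
  measurable_fun setT f -> measurable_fun setT g ->
  (forall x : X, 0 <= f x) -> (forall y : Y, 0 <= g y) ->
  (\int[(m1 \x m2)%E]_z (f z.1 * g z.2)%:E =
   (\int[m1]_x0 (f x0)%:E) * (\int[m2]_y (g y)%:E))%E.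
Proof.
move=> mf mg f0 g0; rewrite fubini_tonelli1/=; last 2 first.
- apply/measurable_EFinP; apply: measurable_funM.
    exact: (measurableT_comp mf measurable_fst).
  exact: (measurableT_comp mg measurable_snd).
- by move=> z; rewrite lee_fin mulr_ge0.
rewrite /fubini_F muleC -ge0_integralZl//; last 3 first.
- exact/measurable_EFinP.
- by move=> x _; rewrite lee_fin.
- by apply: integral_ge0 => y _; rewrite lee_fin.
apply: eq_integral => x _; under eq_integral do rewrite EFinM /=.
rewrite ge0_integralZl// ?lee_fin// 1?muleC//; first exact/measurable_EFinP.
by move=> y _; rewrite lee_fin.
Qed.

Lemma integral_cauchy3_le e x : 0 < e ->
  (\int[leb3]_k (cauchy3 e (x - k))%:E <= ((2 * pi) ^+ 3)%:E)%E.
Proof.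
move=> e0.
have mc (r : R) : measurable_fun setT (fun s : R => cauchy e (r - s)).
  by apply: (measurableT_comp (measurable_cauchy e)); exact: measurable_funB.
have c0 (r s : R) : 0 <= cauchy e (r - s) by exact: cauchy_ge0.
have cI (r : R) : (0 <= \int[leb]_s (cauchy e (r - s))%:E)%E.
  by apply: integral_ge0 => s _; rewrite lee_fin.
have pi20 : 0 <= 2 * pi :> R by rewrite mulr_ge0// pi_ge0.
have -> : (\int[leb3]_k (cauchy3 e (x - k))%:E = (\int[leb]_s (cauchy e (x.1 - s))%:E) *
   ((\int[leb]_s (cauchy e (x.2.1 - s))%:E) * (\int[leb]_s (cauchy e (x.2.2 - s))%:E)))%E.
  have m2 : measurable_fun setT (fun y : R2 R => cauchy e (x.2.1 - y.1) * cauchy e (x.2.2 - y.2)).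
    apply: measurable_funM; [exact: (measurableT_comp (mc x.2.1) measurable_fst)
                            |exact: (measurableT_comp (mc x.2.2) measurable_snd)].
  have m20 (y : R2 R) : 0 <= cauchy e (x.2.1 - y.1) * cauchy e (x.2.2 - y.2) by exact: mulr_ge0.
  have <- := ge0_integral_tensor leb leb (mc x.2.1) (mc x.2.2) (c0 x.2.1) (c0 x.2.2).
  by have <- := ge0_integral_tensor leb leb2 (mc x.1) m2 (c0 x.1) m20.
rewrite exprS expr2 !EFinM; apply: lee_pmul => //; rewrite ?mule_ge0//.
  exact: integral_cauchy_le.
by apply: lee_pmul => //; exact: integral_cauchy_le.
Qed.

Lemma cvg_decay1 (t : R) : decay n.+1%:R^-1 t @[n --> \oo] --> (1 : R).
Proof.
rewrite -[X in _ --> X]expR0; apply: continuous_cvg; first exact: continuous_expR.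
rewrite -oppr0 -[X in - X](mul0r `|t|); apply: cvgN; apply: cvgMl.
exact: cvg_harmonic.
Qed.

Lemma cvg_decay3 x : decay3 n.+1%:R^-1 x @[n --> \oo] --> (1 : R).
Proof.
suff : decay3 n.+1%:R^-1 x @[n --> \oo] --> (1 * (1 * 1) : R) by rewrite !mulr1.
by apply: cvgM; [exact: cvg_decay1|apply: cvgM; exact: cvg_decay1].
Qed.

(** Fatou's lemma; serves to pass from the measures with density [decay e] or
    [decay3 e] to the Lebesgue measure. *)
Lemma unregularise d (Y : measurableType d) (n : {measure set Y -> \bar R})
    (K : nat -> Y -> R) (g : Y -> R) (B : \bar R) :
  (forall i, measurable_fun setT (K i)) -> (forall i y, 0 <= K i y) ->
  (forall y, K ^~ y @ \oo --> (1 : R)) ->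
  measurable_fun setT g -> (forall y, 0 <= g y) ->
  (forall i, \int[n]_y (K i y * g y)%:E <= B)%E -> (\int[n]_y (g y)%:E <= B)%E.
Proof.
move=> mK K0 K1 mg g0 KB; apply: (fatou_cvg (f := fun i y => K i y * g y)) => //.
- by move=> i; exact: measurable_funM.
- by move=> i y; rewrite mulr_ge0.
- apply: nearW => y; rewrite -[X in _ --> X](mul1r (g y)).
  by apply: cvgMl; exact: K1.
Qed.

(** [Schur_test] with the kernel [decay3], whose transform [cauchy3] has
    integral at most (2 pi)^3 whatever its width. *)
Lemma Bessel (s : R) (F : R3 R -> R[i]) : s ^+ 2 = 1 -> cintegrable leb3 setT F ->
  (energy leb3 (fun k => cintegral leb3 setT (fun x => F x * expi (s * dot3 x k))%R)
   <= ((2 * pi) ^+ 3)%:E * energy leb3 F)%E.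
Proof.
move=> s1 Fi; have mF := cintegrable_meas Fi.
have mph : measurable_fun setT (fun z : R3 R * R3 R => s * dot3 z.2 z.1).
  apply: measurable_funM => //.
  by under eq_fun do rewrite dot3C; exact: measurable_dot3_2.
have mT : cmeasurable (fun k => cintegral leb3 setT (fun x => F x * expi (s * dot3 x k))).
  have h : cmeasurable (fun z : R3 R * R3 R => F z.2 * expi (s * dot3 z.2 z.1)).
    apply: cmeasurableM; last exact: cmeasurable_expi.
    exact: (cmeasurable_comp mF measurable_snd).
  exact: (cmeasurable_cintegral leb3 h).
apply: (unregularise (K := fun i => decay3 i.+1%:R^-1)).
- by move=> i; exact: measurable_decay3.
- by move=> i y; exact: decay3_ge0.
- exact: cvg_decay3.
- exact: measurable_sqn.
- by move=> y; exact: sqn_ge0.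
move=> i; set e := _^-1; have e0 : 0 < e by rewrite invr_gt0.
apply: (@Schur_test _ _ (R3 R) (R3 R) R leb3 leb3 (decay3 e) (fun y q => s * dot3 q y)
  (fun q q' => cauchy3 e (q - q')) _ _ _ _ _ _ _ _ F (fun=> 1) (fun q => sqn (F q))) => //.
- exact: measurable_decay3.
- exact: decay3_ge0.
- exact: integrable_decay3.
- apply: (measurableT_comp (measurable_cauchy3 e)).
  have mB (f : R3 R -> R) : measurable_fun setT f ->
      measurable_fun setT (fun z : R3 R * R3 R => f z.1 - f z.2).
    move=> mf; apply: measurable_funB; [exact: (measurableT_comp mf measurable_fst)
                                       |exact: (measurableT_comp mf measurable_snd)].
  apply: measurable_fun_pair; first exact: (mB _ measurable_proj1).
  by apply: measurable_fun_pair; [exact: (mB _ measurable_proj2)|exact: (mB _ measurable_proj3)].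
- by move=> q q'; exact: cauchy3_ge0.
- by move=> q q'; exact: cauchy3B.
- move=> q q'.
  pose sq : R3 R := (s * (q.1 - q'.1), (s * (q.2.1 - q'.2.1), s * (q.2.2 - q'.2.2))).
  have -> : cauchy3 e (q - q') = cauchy3 e sq.
    have : (s == 1) || (s == -1) by rewrite -eqf_sqr s1 expr1n.
    by rewrite /sq /cauchy3 => /orP[] /eqP ->; rewrite ?mul1r// !mulN1r !cauchyN.
  rewrite -fourier_decay3//; apply: eq_cintegral => y; congr (_ * expi _).
  by rewrite /sq /dot3 /dot2 /=; ring.
- exact: measurable_sqn.
- by move=> q; exact: sqn_ge0.
- by move=> q; rewrite mul1r.
- move=> q; under eq_integral do rewrite mul1r; exact: integral_cauchy3_le.
Qed.

(** The hypothesis on [B] bounds the weighted measure of the level sets of the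
    time frequency [h], smoothed by a Poisson kernel of any width. *)
Lemma time_Schur d (X : measurableType d) (m : {sigma_finite_measure set X -> \bar R})
    (h : X -> R) (F : X -> R[i]) (rho f2 : X -> R) (B : R) :
  measurable_fun setT h -> cintegrable m setT F ->
  measurable_fun setT rho -> measurable_fun setT f2 ->
  (forall q : X, 0 <= rho q) -> (forall q : X, 0 <= f2 q) ->
  (forall q : X, sqn (F q) <= rho q * f2 q) ->
  (forall e tau : R, 0 < e -> (\int[m]_x0 (rho x0 * cauchy e (tau - h x0))%:E <= B%:E)%E) ->
  (energy leb (fun t => cintegral m setT (fun q : X => F q * expi (t * h q))%R)
   <= B%:E * \int[m]_x0 (f2 x0)%:E)%E.
Proof.
move=> mh Fi mrho mf2 rho0 f20 Fle kB; have mF := cintegrable_meas Fi.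
have mph : measurable_fun setT (fun z : R * X => z.1 * h z.2).
  by apply: measurable_funM => //; exact: (measurableT_comp mh measurable_snd).
have mT : cmeasurable (fun t : R => cintegral m setT (fun q : X => F q * expi (t * h q))).
  have mm : cmeasurable (fun z : R * X => F z.2 * expi (z.1 * h z.2)).
    apply: cmeasurableM; last exact: cmeasurable_expi.
    exact: (cmeasurable_comp mF measurable_snd).
  exact: (cmeasurable_cintegral m mm).
apply: (@unregularise _ (measurableTypeR R) leb (fun i => decay i.+1%:R^-1)).
- by move=> i; exact: measurable_decay.
- by move=> i y; exact: decay_ge0.
- exact: cvg_decay1.
- exact: measurable_sqn.
- by move=> y; exact: sqn_ge0.
move=> i; set e := _^-1; have e0 : 0 < e by rewrite invr_gt0.
apply: (@Schur_test _ _ X (measurableTypeR R) R m leb (decay e) (fun (y : R) (q : X) => y * h q)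
  (fun q q' : X => cauchy e (h q - h q')) _ _ _ _ _ _ _ _ F rho f2) => //.
- exact: measurable_decay.
- exact: decay_ge0.
- exact: integrable_decay.
- apply: (measurableT_comp (measurable_cauchy e)); apply: measurable_funB.
    exact: (measurableT_comp mh measurable_fst).
  exact: (measurableT_comp mh measurable_snd).
- by move=> q q' /=; exact: cauchy_ge0.
- by move=> q q' /=; exact: cauchyB.
- move=> q q' /=; rewrite -fourier_decay//; apply: eq_cintegral => y; congr (_ * expi _).
  by rewrite -mulrBr mulrC.
- by move=> q; exact: kB.
Qed.

End Bessel.

(** * Affine substitutions, determining families and completeness *)

Section affine_substitutions.
Variable R : realType.
Local Notation leb := (@lebesgue_measure R).
Local Notation leb2 := (@leb2 R).
Local Notation leb3 := (@leb3 R).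

Lemma tonelli2 (f : R2 R -> \bar R) : measurable_fun setT f -> (forall y, 0 <= f y)%E ->
  (\int[leb2]_z f z = \int[leb]_x \int[leb]_y f (x, y))%E.
Proof. by move=> mf f0; exact: (@fubini_tonelli1 _ _ _ _ R leb leb f mf f0). Qed.

Lemma tonelli3 (f : R3 R -> \bar R) : measurable_fun setT f -> (forall y, 0 <= f y)%E ->
  (\int[leb3]_z f z = \int[leb]_x \int[leb2]_y f (x, y))%E.
Proof. by move=> mf f0; exact: (@fubini_tonelli1 _ _ _ _ R leb leb2 f mf f0). Qed.

Lemma integral2_affine (a b c : R) (f : R2 R -> \bar R) : a != 0 ->
  measurable_fun setT f -> (forall y, 0 <= f y)%E ->
  ((a ^+ 2)%:E * \int[leb2]_y f (a * y.1 + b, a * y.2 + c)%R = \int[leb2]_y f y)%E.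
Proof.
move=> a0 mf f0.
have mA (b' : R) : measurable_fun setT (fun x : R => a * x + b') by exact: measurable_affine.
have mg : measurable_fun setT (fun y : R2 R => f (a * y.1 + b, a * y.2 + c)%R).
  apply: (measurableT_comp mf); apply: measurable_fun_pair.
    exact: (measurableT_comp (mA b) measurable_fst).
  exact: (measurableT_comp (mA c) measurable_snd).
have h1 (x : R) : (`|a|%:E * \int[leb]_y f (x, a * y + c)%R = \int[leb]_y f (x, y))%E.
  apply: (integral_affine c a0 (f := fun y => f (x, y))) => //.
  exact: (measurableT_comp mf (measurable_pair1 x)).
have mF : measurable_fun setT (fun x : R => \int[leb]_y f (x, y))%E.
  exact: (measurable_integral2 leb mf).
have F0 (x : R) : (0 <= \int[leb]_y f (x, y))%E by exact: integral_ge0.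
rewrite (tonelli2 mf f0) (tonelli2 mg (fun y => f0 _)).
apply: etrans (integral_affine b a0 mF F0).
have -> : (a ^+ 2)%:E = (`|a|%:E * `|a|%:E)%E by rewrite -EFinM -expr2 real_normK ?num_real.
rewrite -muleA -(ge0_integralZl _ measurableT (measurable_integral2 leb mg (fun z => f0 _))
  (fun x _ => integral_ge0 _ (fun y _ => f0 _))); last by rewrite lee_fin.
by congr (_ * _)%E; apply: eq_integral => x _; rewrite -h1.
Qed.

Lemma integral3_affine (s : R) (p : R3 R) (f : R3 R -> \bar R) : s ^+ 2 = 1 ->
  measurable_fun setT f -> (forall y, 0 <= f y)%E ->
  (\int[leb3]_q f (s * q.1 + p.1, (s * q.2.1 + p.2.1, s * q.2.2 + p.2.2))%R
   = \int[leb3]_q f q)%E.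
Proof.
move=> s1 mf f0.
have s0 : s != 0 by apply/eqP => s0; move: s1; rewrite s0 expr0n/= => /eqP; rewrite eq_sym oner_eq0.
have ns : `|s| = 1 by apply/eqP; rewrite -sqrp_eq1// real_normK ?num_real// s1.
have mA (b : R) : measurable_fun setT (fun x : R => s * x + b) by exact: measurable_affine.
have mg : measurable_fun setT (fun q : R3 R => f (s * q.1 + p.1, (s * q.2.1 + p.2.1, s * q.2.2 + p.2.2))%R).
  apply: (measurableT_comp mf); apply: measurable_fun_pair.
    exact: (measurableT_comp (mA _) (@measurable_proj1 R)).
  apply: measurable_fun_pair.
    exact: (measurableT_comp (mA _) (@measurable_proj2 R)).
  exact: (measurableT_comp (mA _) (@measurable_proj3 R)).
have h1 (x : R) : (\int[leb2]_y f (x, (s * y.1 + p.2.1, s * y.2 + p.2.2))%R = \int[leb2]_y f (x, y))%E.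
  rewrite -(integral2_affine p.2.1 p.2.2 s0 (f := fun y => f (x, y))) ?s1 ?mul1e//.
  exact: (measurableT_comp mf (measurable_pair1 x)).
have mF : measurable_fun setT (fun x : R => \int[leb2]_y f (x, y))%E.
  exact: (measurable_integral2 leb2 mf).
have F0 (x : R) : (0 <= \int[leb2]_y f (x, y))%E by exact: integral_ge0.
rewrite (tonelli3 mf f0) (tonelli3 mg (fun y => f0 _)).
rewrite -[RHS](integral_affine p.1 s0 mF F0) ns mul1e.
by apply: eq_integral => x _; rewrite -h1.
Qed.

Lemma integral3_shift (p : R3 R) (f : R3 R -> \bar R) :
  measurable_fun setT f -> (forall y, 0 <= f y)%E ->
  (\int[leb3]_q f (q + p)%R = \int[leb3]_q f q)%E.
Proof.
move=> mf f0; rewrite -(integral3_affine p (expr1n _ 2) mf f0).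
by apply: eq_integral => q _; rewrite !mul1r.
Qed.

Lemma integral3_reflect (p : R3 R) (f : R3 R -> \bar R) :
  measurable_fun setT f -> (forall y, 0 <= f y)%E ->
  (\int[leb3]_q f (p - q)%R = \int[leb3]_q f q)%E.
Proof.
have N1 : (-1) ^+ 2 = 1 :> R by rewrite sqrrN expr1n.
move=> mf f0; rewrite -(integral3_affine p N1 mf f0).
by apply: eq_integral => q _; rewrite !mulN1r ![- _ + _]addrC.
Qed.

Lemma measurable_R3D (p : R3 R) : measurable_fun setT (fun q : R3 R => q + p).
Proof.
apply: measurable_fun_pair; first exact: (measurable_funD (@measurable_proj1 R) (measurable_cst _)).
apply: measurable_fun_pair.
  exact: (measurable_funD (@measurable_proj2 R) (measurable_cst _)).
exact: (measurable_funD (@measurable_proj3 R) (measurable_cst _)).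
Qed.

Lemma measurable_R3B : measurable_fun setT (fun z : R3 R * R3 R => z.1 - z.2).
Proof.
have mB (f : R3 R -> R) : measurable_fun setT f ->
    measurable_fun setT (fun z : R3 R * R3 R => f z.1 - f z.2).
  move=> mf; apply: measurable_funB; [exact: (measurableT_comp mf measurable_fst)
                                     |exact: (measurableT_comp mf measurable_snd)].
apply: measurable_fun_pair; first exact: (mB _ (@measurable_proj1 R)).
by apply: measurable_fun_pair; [exact: (mB _ (@measurable_proj2 R))|exact: (mB _ (@measurable_proj3 R))].
Qed.

Lemma measurable_R3reflect (p : R3 R) : measurable_fun setT (fun q : R3 R => p - q).
Proof. exact: (measurableT_comp measurable_R3B (measurable_pair1 p)). Qed.

Lemma measurable_R3N : measurable_fun setT (fun q : R3 R => - q).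
Proof. by under eq_fun do rewrite -sub0r; exact: measurable_R3reflect. Qed.

Lemma energy_reflect (p : R3 R) (f : R3 R -> R[i]) : cmeasurable f ->
  energy leb3 (fun q => f (p - q)) = energy leb3 f.
Proof.
move=> mf; apply: (integral3_reflect p (f := fun q => (sqn (f q))%:E)).
  by apply/measurable_EFinP; exact: measurable_sqn.
by move=> q; rewrite lee_fin sqn_ge0.
Qed.

Lemma energyNr (f : R3 R -> R[i]) : cmeasurable f ->
  energy leb3 (fun q => f (- q)) = energy leb3 f.
Proof.
by move=> mf; rewrite -(energy_reflect 0 mf); apply: eq_integral => q _; rewrite sub0r.
Qed.

End affine_substitutions.

Section determining.
Variable R : realType.

(** Uniqueness of measures in this form passes to products one factor at a
    time ([determining_prod]). *)
Definition determining d (X : measurableType d) (G : set (set X)) :=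
  G `<=` measurable /\
  forall mu nu : {measure set X -> \bar R}, (mu setT < +oo)%E ->
    (forall A, G A -> mu A = nu A) -> forall A, measurable A -> mu A = nu A.

Lemma determining_ocitv : determining (X := measurableTypeR R) (@ocitv R).
Proof.
split=> [_ [[a b]] _ <-|mu nu muT E A mA]; first exact: measurable_itv.
apply: (@measure_unique _ R (measurableTypeR R) (@ocitv R)
  (fun n : nat => [set` `](- n%:R)%R, n%:R]])) => //.
- exact: ocitvI.
- by move=> n; exact: is_ocitv.
- apply/seteqP; split => // x _; exists (Num.Def.archi_bound x) => //=.
  have := archi_boundP (normr_ge0 x); rewrite /Num.Def.archi_bound normr_id => /ltW h.
  have := archi_boundP (normr_ge0 x); rewrite /Num.Def.archi_bound normr_id ltr_norml.
  by rewrite in_itv/= => /andP[-> /ltW ->].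
- move=> n; apply: le_lt_trans muT; apply: le_measure; rewrite ?inE//.
Qed.

Lemma determining_prod d1 d2 (X : measurableType d1) (Y : measurableType d2)
    (GX : set (set X)) (GY : set (set Y)) : determining GX -> determining GY ->
  determining [set A `*` B | A in GX & B in GY].
Proof.
move=> [mX dX] [mY dY]; split=> [_ [A GA] [B GB] <-|mu nu muT E].
  by apply: measurableX; [exact: mX|exact: mY].
have fin A : measurable A -> (mu A < +oo)%E.
  by move=> mA; apply: le_lt_trans muT; apply: le_measure; rewrite ?inE.
have E1 A B : measurable A -> GY B -> mu (A `*` B) = nu (A `*` B).
  move=> mA GB; have mB : measurable (setT `*` B : set (X * Y)).
    by apply: measurableX => //; exact: mY.
  pose mu' := pushforward_measure (mrestr mu mB : {measure set _ -> \bar R}) measurable_fst.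
  pose nu' := pushforward_measure (mrestr nu mB : {measure set _ -> \bar R}) measurable_fst.
  have HS (C : set X) : fst @^-1` C `&` (setT `*` B) = C `*` B.
    by apply/seteqP; split => -[x y] /= [] // ? [].
  have h : forall C, measurable C -> mu' C = nu' C.
    apply: dX.
      rewrite /mu' /= /pushforward /mrestr; apply: fin; apply: measurableI => //.
      by rewrite preimage_setT.
    by move=> C GC; rewrite /mu' /nu' /= /pushforward /mrestr HS; apply: E; exists C => //; exists B.
  by have := h A mA; rewrite /mu' /nu' /= /pushforward /mrestr HS.
have E2 A B : measurable A -> measurable B -> mu (A `*` B) = nu (A `*` B).
  move=> mA mB; have mA' : measurable (A `*` setT : set (X * Y)) by exact: measurableX.
  pose mu' := pushforward_measure (mrestr mu mA' : {measure set _ -> \bar R}) measurable_snd.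
  pose nu' := pushforward_measure (mrestr nu mA' : {measure set _ -> \bar R}) measurable_snd.
  have HS (C : set Y) : snd @^-1` C `&` (A `*` setT) = A `*` C.
    by apply/seteqP; split => -[x y] /= [] // ? [].
  have h : forall C, measurable C -> mu' C = nu' C.
    apply: dY.
      rewrite /mu' /= /pushforward /mrestr; apply: fin; apply: measurableI => //.
      by rewrite preimage_setT.
    by move=> C GC; rewrite /mu' /nu' /= /pushforward /mrestr HS; exact: E1.
  by have := h B mB; rewrite /mu' /nu' /= /pushforward /mrestr HS.
move=> C mC; apply: (measure_unique [set A `*` B | A in measurable & B in measurable]
   (fun=> setT)) => //.
- by rewrite -measurable_prod_measurableType.
- move=> _ _ [A mA [B mB <-]] [A' mA' [B' mB' <-]]; rewrite -setXI.
  by exists (A `&` A'); [exact: measurableI|exists (B `&` B') => //; exact: measurableI].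
- by move=> n; exists setT => //; exists setT => //; rewrite setXTT.
- by rewrite bigcup_const.
- by move=> _ [A mA [B mB <-]]; exact: E2.
Qed.

Section density.
Context d (X : measurableType d) (m : {measure set X -> \bar R}).
Variable f : X -> \bar R.
Hypothesis mf : measurable_fun setT f.
Hypothesis f0 : forall x, (0 <= f x)%E.

Definition density (A : set X) : \bar R := (\int[m]_(x in A) f x)%E.

Lemma density0 : density set0 = 0%E. Proof. exact: integral_set0. Qed.
Lemma density_ge0 A : (0 <= density A)%E. Proof. exact: integral_ge0. Qed.
Lemma density_sigma_additive : semi_sigma_additive density.
Proof. exact: semi_sigma_additive_nng_induced. Qed.

Definition density_measure : {measure set X -> \bar R} :=
  HB.pack density (isMeasure.Build _ _ _ density density0 density_ge0 density_sigma_additive).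

End density.

Lemma determining_ae0 d (X : measurableType d) (m : {measure set X -> \bar R})
    (G : set (set X)) (h : X -> R) : determining G -> m.-integrable setT (EFin \o h) ->
  (forall A, G A -> \int[m]_(x in A) (h x)%:E = 0)%E ->
  \forall x \ae m, h x = 0.
Proof.
move=> [mG dG] ih h0.
have mh : measurable_fun setT (EFin \o h) by exact: (measurable_int m ih).
have mp := measurable_funepos mh; have mn := measurable_funeneg mh.
pose P := density_measure m mp (funepos_ge0 _).
pose N := density_measure m mn (funeneg_ge0 _).
have Pf : (P setT < +oo)%E.
  by have /integrableP[_] := integrable_funepos measurableT ih;
    under eq_integral do rewrite gee0_abs ?funepos_ge0//.
have hI A : measurable A -> (\int[m]_(x in A) (h x)%:E = P A - N A)%E.
  by move=> mA; rewrite integralE.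
have finA A : measurable A -> (P A \is a fin_num) && (N A \is a fin_num).
  move=> mA; have iA : m.-integrable A (EFin \o h) by exact: integrableS ih.
  by rewrite /P /N /=; apply/andP; split; [exact: integrable_pos_fin_num|exact: integrable_neg_fin_num].
have PN A : measurable A -> P A = N A.
  move: A; apply: dG => // A GA; have := h0 _ GA; rewrite hI; last exact: mG.
  have /andP[fP fN] := finA _ (mG _ GA).
  by rewrite -(fineK fP) -(fineK fN) -EFinB => -[] /eqP; rewrite subr_eq0 => /eqP ->.
have [] := integral_ae_eq measurableT ih (measurable_cst 0%E).
  move=> E _ mE; rewrite hI// PN// integral0.
  by have /andP[fP fN] := finA _ mE; rewrite subee.
move=> U [mU U0 sU]; exists U; split => // x /= hx; apply: sU => /= /(_ I) [].
exact: hx.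
Qed.

End determining.

Section Riesz_Fischer.
Context d (T : measurableType d) (R : realType) (m : {measure set T -> \bar R}).
Implicit Types h : nat -> T -> R[i].
Local Notation Re := complex.Re.
Local Notation Im := complex.Im.

Lemma geometric_increments_cvg (u : nat -> R) (M : R) :
  (forall k, `|u k.+1 - u k| <= M * 2^-1 ^+ k) -> cvgn u.
Proof.
move=> uM; rewrite (funext (eq_sum_telescope u)); apply: is_cvgD; first exact: is_cvg_cst.
apply: normed_cvg.
apply: (series_le_cvg (v_ := geometric M 2^-1)) => //=.
- by move=> n; apply: le_trans (uM n).
- by apply: is_cvg_geometric_series; rewrite gtr0_norm// invf_lt1// ltr1n.
Qed.

(** The majorant is the sum of the 4^k sqn (D k x), whose integral is at most
    the sum of the 2^-k. *)
Lemma geometric_majorant (D : nat -> T -> R[i]) : (forall k, cmeasurable (D k)) ->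
  (forall k, energy m (D k) <= (8^-1 ^+ k)%:E)%E ->
  exists S : T -> \bar R, [/\ measurable_fun setT S, forall x, (0 <= S x)%E,
    \forall x \ae m, (S x < +oo)%E &
    forall x k, (S x < +oo)%E -> sqn (D k x) <= fine (S x) * 4^-1 ^+ k].
Proof.
move=> mD hD; pose g k x := (4 ^+ k * sqn (D k x))%:E.
have mg k : measurable_fun setT (g k).
  by apply/measurable_EFinP; apply: measurable_funM => //; exact: measurable_sqn (mD k).
have g0 k x : (0 <= g k x)%E by rewrite lee_fin mulr_ge0 ?sqn_ge0// exprn_ge0.
pose S x := (\sum_(0 <= k <oo) g k x)%E.
have mS : measurable_fun setT S by apply: ge0_emeasurable_sum => // k x _ _.
have S0 x : (0 <= S x)%E by apply: nneseries_ge0.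
have Sfin : (\int[m]_x S x < +oo)%E.
  rewrite integral_nneseries//.
  apply: (@le_lt_trans _ _ (\sum_(0 <= k <oo) (geometric 1 (2^-1 : R) k)%:E)%E).
    apply: lee_nneseries => [k _ _|k _]; first exact: integral_ge0.
    rewrite /g; under eq_integral do rewrite EFinM.
    rewrite ge0_integralZl//; last 2 first.
    - by apply/measurable_EFinP; exact: measurable_sqn (mD k).
    - by move=> x _; rewrite lee_fin sqn_ge0.
    rewrite /= mul1r (_ : 2^-1 = 4 * 8^-1 :> R); last by field.
    by rewrite exprMn EFinM lee_wpmul2l ?lee_fin ?exprn_ge0//; exact: hD.
  have c : cvgn (series (geometric 1 (2^-1 : R))).
    by apply: is_cvg_geometric_series; rewrite gtr0_norm// invf_lt1// ltr1n.
  rewrite (_ : (fun n => _) = EFin \o series (geometric 1 (2^-1 : R))).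
    by rewrite EFin_lim// ltry.
  by apply/funext => n /=; rewrite /series /= sumEFin.
exists S; split => //.
  have iS : m.-integrable setT S.
    by apply/integrableP; split => //; under eq_integral do rewrite gee0_abs//.
  apply: filterS (integrable_ae measurableT iS) => x /(_ I).
  by rewrite ge0_fin_numE.
move=> x k Ax; have Sf : S x \is a fin_num by rewrite ge0_fin_numE.
rewrite exprVn ler_pdivlMr ?exprn_gt0// -lee_fin fineK// mulrC.
have := nneseries_lim_ge k.+1 (fun i _ _ => g0 i x) (m := 0%N) (P := xpredT).
apply: le_trans; rewrite big_nat_recr//= leeDr//; exact: sume_ge0.
Qed.

Lemma fast_cvg_ae (h : nat -> T -> R[i]) f : (forall k, cmeasurable (h k)) -> cmeasurable f ->
  (forall k, energy m (fun x => h k x - f x)%R <= (8^-1 ^+ k)%:E)%E ->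
  \forall x \ae m, (fun k => sqn (h k x - f x)) @ \oo --> (0 : R).
Proof.
move=> mh mf hk.
have [S [mS S0 Sae hS]] := geometric_majorant (fun k => cmeasurableB (mh k) mf) hk.
apply: filterS Sae => x Sx.
apply: (@squeeze_cvgr _ _ _ _ (fun=> 0) (fun k => fine (S x) * 4^-1 ^+ k)).
- by apply: nearW => k; rewrite sqn_ge0; exact: hS.
- exact: cvg_cst.
- rewrite -(mulr0 (fine (S x))); apply: cvgM; first exact: cvg_cst.
  by apply: cvg_expr; rewrite gtr0_norm// invf_lt1// ltr1n.
Qed.

(** Along a sufficiently fast subsequence the increments have an integrable
    majorant, so that it converges almost everywhere; Fatou's lemma then turns
    the Cauchy property into convergence in energy. *)
Lemma Riesz_Fischer h : (forall n, L2 m (h n)) ->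
  (forall e : R, 0 < e -> exists N, forall n k, (N <= n)%N -> (N <= k)%N ->
     (energy m (fun x => h n x - h k x)%R <= e%:E)%E) ->
  exists2 f, L2 m f & forall e : R, 0 < e -> exists N, forall n, (N <= n)%N ->
     (energy m (fun x => h n x - f x)%R <= e%:E)%E.
Proof.
move=> Lh Ch; have mh n : cmeasurable (h n) by have /L2P[] := Lh n.
have /choice[N0 N0P] : forall k, exists N, forall n j, (N <= n)%N -> (N <= j)%N ->
    (energy m (fun x => h n x - h j x)%R <= (8^-1 ^+ k)%:E)%E.
  by move=> k; apply: Ch; rewrite exprn_gt0.
pose phi k := (k + \sum_(i < k.+1) N0 i)%N.
have phi_ge k : (k <= phi k)%N by exact: leq_addr.
have phi_N0 k j : (k <= j)%N -> (N0 k <= phi j)%N.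
  move=> kj; have kj' : (k < j.+1)%N by [].
  rewrite /phi (bigD1 (Ordinal kj'))//= addnA addnAC.
  exact: leq_addl.
pose f k := h (phi k).
have mfk k : cmeasurable (fun x => f k.+1 x - f k x) by apply: cmeasurableB; exact: mh.
have [S [mS S0 Sae inc]] := geometric_majorant mfk
  (fun k => N0P k _ _ (phi_N0 k k.+1 (leqnSn k)) (phi_N0 k k (leqnn k))).
pose A := [set x | S x < +oo]%E.
have mA : measurable A.
  by rewrite /A -[X in measurable X]setTI; apply: emeasurable_fun_infty_o.
have incs x (p : R[i] -> R) : A x -> (forall z w, p (z - w) = p z - p w) ->
    (forall z, p z ^+ 2 <= sqn z) -> cvgn (fun k => p (f k x)).
  move=> Ax pB p2; apply: (@geometric_increments_cvg _ (Num.sqrt (fine (S x)))) => k.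
  rewrite -pB -(@ler_sqr R) ?nnegrE ?mulr_ge0 ?sqrtr_ge0 ?exprn_ge0//.
  rewrite real_normK ?num_real// (le_trans (p2 _))// (le_trans (inc x k Ax))//.
  rewrite exprMn sqr_sqrtr ?fine_ge0// -exprM mulnC exprM.
  by rewrite (_ : 2^-1 ^+ 2 = 4^-1 :> R)//; rewrite expr2; field.
have cRe x : A x -> cvgn (fun k => Re (f k x)).
  move=> Ax; apply: incs => // [z w|z]; first by rewrite cReD cReN.
  by rewrite lerDl sqr_ge0.
have cIm x : A x -> cvgn (fun k => Im (f k x)).
  move=> Ax; apply: incs => // [z w|z]; first by rewrite cImD cImN.
  by rewrite lerDr sqr_ge0.
pose F x := if x \in A then (limn (fun k => Re (f k x))) +i* (limn (fun k => Im (f k x))) else 0.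
have mF : cmeasurable F.
  split.
  - apply: (measurable_fun_cvg (h := fun k x => \1_A x * Re (f k x))).
      by move=> k; apply: measurable_funM; [exact: measurable_indic|case: (mh (phi k))].
    move=> x _; rewrite /F indicE; case: ifPn => xA /=.
      by under eq_fun do rewrite mul1r; exact: cRe (set_mem xA).
    by under eq_fun do rewrite mul0r; exact: cvg_cst.
  - apply: (measurable_fun_cvg (h := fun k x => \1_A x * Im (f k x))).
      by move=> k; apply: measurable_funM; [exact: measurable_indic|case: (mh (phi k))].
    move=> x _; rewrite /F indicE; case: ifPn => xA /=.
      by under eq_fun do rewrite mul1r; exact: cIm (set_mem xA).
    by under eq_fun do rewrite mul0r; exact: cvg_cst.
have key e : 0 < e -> exists N, forall n, (N <= n)%N ->
     (energy m (fun x => h n x - F x)%R <= e%:E)%E.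
  move=> /Ch[N NP]; exists N => n Nn.
  apply: (fatou_cvg (f := fun k x => sqn (h n x - f (k + N)%N x))).
  - by move=> k; apply: measurable_sqn; apply: cmeasurableB => //; exact: mh.
  - by apply: measurable_sqn; apply: cmeasurableB => //; exact: mh.
  - by move=> k x; exact: sqn_ge0.
  - by move=> x; exact: sqn_ge0.
  - apply: filterS Sae => x Ax; rewrite /F mem_set// /sqn.
    have hc (p : R[i] -> R) l : (forall z w, p (z - w) = p z - p w) ->
        (fun k => p (f k x)) @ \oo --> l ->
        (fun k => p (h n x - f (k + N)%N x) ^+ 2) @ \oo --> (p (h n x) - l) ^+ 2.
      move=> pB c; under eq_fun do rewrite pB; rewrite expr2; under eq_fun do rewrite expr2.
      have c' : (fun k => p (h n x) - p (f (k + N)%N x)) @ \oo --> p (h n x) - l.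
        by apply: cvgB; [exact: cvg_cst|rewrite (cvg_shiftn N (fun k => p (f k x)))].
      exact: cvgM.
    rewrite cReD cReN cImD cImN /=; apply: cvgD.
      apply: hc; [by move=> z w; rewrite cReD cReN|exact: cRe].
    apply: hc; [by move=> z w; rewrite cImD cImN|exact: cIm].
  - by move=> k; apply: NP => //; apply: leq_trans (phi_ge _); exact: leq_addl.
exists F => //; apply/L2P; split=> //.
have [N /(_ N (leqnn N)) hN] := key 1 ltr01.
have := energy_triangle m mF (mh N) (@cmeasurable_cst _ T R 0).
rewrite (_ : (fun x => F x - 0) = F); last by apply/funext => x; rewrite subr0.
move=> /le_lt_trans; apply; apply: lte_add_pinfty; apply: lte_mul_pinfty => //.
  by rewrite energyBC; apply: le_lt_trans hN _; exact: ltry.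
rewrite (_ : (fun x => h N x - 0) = h N); first by have /L2P[] := Lh N.
by apply/funext => x; rewrite subr0.
Qed.

End Riesz_Fischer.

(** * The Fourier transform on square integrable functions *)

Section convergence_in_energy.
Context d (T : measurableType d) (R : realType) (m : {measure set T -> \bar R}).
Implicit Types (h : nat -> T -> R[i]) (f g : T -> R[i]).

Definition cvg_energy h f := forall e : R, 0 < e -> exists N, forall n, (N <= n)%N ->
  (energy m (fun x => h n x - f x)%R <= e%:E)%E.

Lemma cvg_energyP h f :
  cvg_energy h f <-> (fun n => L2norm m (fun x => h n x - f x)) @ \oo --> 0%E.
Proof.
split=> [hf|hf e e0].
- apply/fine_cvgP; split.
    have [N hN] := hf 1 ltr01; near=> n.
    have nN : (N <= n)%N by near: n; exact: nbhs_infty_ge.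
    rewrite ge0_fin_numE ?Lnorm_ge0//; apply/L2norm_lty.
    by apply: le_lt_trans (hN n nN) _; exact: ltry.
  apply/cvgrPdist_le => e e0.
  have [N hN] := hf (e ^+ 2) (exprn_gt0 2 e0); near=> n.
  have nN : (N <= n)%N by near: n; exact: nbhs_infty_ge.
  have := sqrte_le (energy_ge0 m _) (hN n nN).
  rewrite -L2normE [leRHS]poweR12_sqrt /= ?lee_fin ?sqr_ge0// sqrtr_sqr gtr0_norm// => hle.
  rewrite sub0r normrN ger0_norm ?fine_ge0 ?Lnorm_ge0// -lee_fin fineK//.
  by rewrite ge0_fin_numE ?Lnorm_ge0//; apply: le_lt_trans hle _; exact: ltry.
- move/fine_cvgP: hf => [hfin /cvgrPdist_le /(_ (Num.sqrt e))].
  rewrite sqrtr_gt0 => /(_ e0) hle.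
  have [N _ hN] : \forall n \near \oo, (energy m (fun x => h n x - f x)%R <= e%:E)%E.
    near=> n.
    have fn : L2norm m (fun x => h n x - f x) \is a fin_num by near: n.
    have : `|0 - fine (L2norm m (fun x => h n x - f x))| <= Num.sqrt e by near: n.
    rewrite sub0r normrN ger0_norm ?fine_ge0 ?Lnorm_ge0// energy_sqr -(fineK fn) => hh.
    rewrite poweR_EFin lee_fin powR_mulrn ?fine_ge0 ?Lnorm_ge0//.
    by rewrite -(sqr_sqrtr (ltW e0)) ler_sqr ?nnegrE ?fine_ge0 ?Lnorm_ge0 ?sqrtr_ge0.
  by exists N.
Unshelve. all: by end_near. Qed.

Lemma cvg_energy_dominated h f g : (forall n, cmeasurable (h n)) -> cmeasurable f -> L2 m g ->
  (forall n x, sqn (h n x - f x) <= sqn (g x)) ->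
  (forall x, (fun n => sqn (h n x - f x)) @ \oo --> (0 : R)) -> cvg_energy h f.
Proof.
move=> mh mf Lg hg hc e e0.
have := energy_dominated (fun n => cmeasurableB (mh n) mf) Lg hg hc.
move/fine_cvgP => [hfin /cvgrPdist_le /(_ e e0) he].
have [N _ HN] : \forall n \near \oo, (energy m (fun x => h n x - f x)%R <= e%:E)%E.
  near=> n.
  have fn : energy m (fun x => h n x - f x) \is a fin_num by near: n.
  have : `|0 - fine (energy m (fun x => h n x - f x))| <= e by near: n.
  rewrite sub0r normrN ger0_norm ?fine_ge0 ?energy_ge0// => hh.
  by rewrite -(fineK fn) lee_fin.
by exists N.
Unshelve. all: by end_near. Qed.

Lemma energy_small f : (forall e : R, 0 < e -> (energy m f <= e%:E)%E) -> energy m f = 0%E.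
Proof.
move=> h; apply/eqP; rewrite eq_le energy_ge0 andbT; apply/lee_addgt0Pr => e e0.
by rewrite add0e; exact: h.
Qed.

Lemma small_real (x C : R) : 0 <= x -> 0 <= C -> (forall e, 0 < e -> x <= C * e) -> x = 0.
Proof.
move=> x0 C0 h; apply/eqP; rewrite eq_le x0 andbT leNgt; apply/negP => xp.
have C1 : 0 < C + 1 by rewrite ltr_wpDl.
have := h (x / (C + 1)) (divr_gt0 xp C1).
rewrite mulrCA; apply/negP; rewrite -ltNge gtr_pMr// ltr_pdivrMr// mul1r.
by rewrite ltrDl.
Qed.

Lemma cvg_energy_uniq h f g : (forall n, cmeasurable (h n)) -> cmeasurable f -> cmeasurable g ->
  cvg_energy h f -> cvg_energy h g -> \forall x \ae m, f x = g x.
Proof.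
move=> mh mf mg hf hg.
have : energy m (fun x => f x - g x) = 0%E.
  apply: energy_small => e e0; have e4 : 0 < e / 4 by rewrite divr_gt0.
  have [N hN] := hf _ e4; have [M hM] := hg _ e4.
  apply: le_trans (energy_triangle m mf (mh (maxn N M)) mg) _.
  rewrite energyBC (_ : e%:E = (2%:E * (e / 4)%:E + 2%:E * (e / 4)%:E)%E).
    by apply: leeD; rewrite lee_wpmul2l ?lee_fin//; [apply: hN|apply: hM];
      rewrite ?leq_maxl ?leq_maxr.
  by rewrite -!EFinM -EFinD; congr EFin; field.
move=> /(energy_eq0_ae (cmeasurableB mf mg)); apply: filterS => x /eqP.
by rewrite subr_eq0 => /eqP.
Qed.

Lemma cvg_energy_cintegral h f g (z : R[i]) :
  (forall n, L2 m (h n)) -> L2 m f -> L2 m g -> cvg_energy h f ->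
  (forall e : R, 0 < e -> exists N, forall n, (N <= n)%N ->
    sqn (cintegral m setT (fun x => h n x * g x) - z) <= e) ->
  cintegral m setT (fun x => f x * g x) = z.
Proof.
move=> Lh Lf Lg hf hz; apply/eqP; rewrite -subr_eq0; apply/eqP; apply: sqn_eq0.
have [mf _] := (L2P m f).1 Lf; have [mg gfin] := (L2P m g).1 Lg.
have gf : energy m g \is a fin_num by rewrite ge0_fin_numE// energy_ge0.
pose C := 2 * fine (energy m g) + 2.
apply: (@small_real _ C); rewrite ?sqn_ge0 ?addr_ge0 ?mulr_ge0 ?fine_ge0 ?energy_ge0//.
move=> e e0; have [N hN] := hf _ e0; have [M hM] := hz _ e0.
set n := maxn N M; have [mh _] := (L2P m (h n)).1 (Lh n).
set a := cintegral _ _ _; set b := cintegral m setT (fun x => h n x * g x).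
rewrite (_ : a - z = (a - b) + (b - z)); last by rewrite addrA subrK.
have -> : C * e = 2 * (fine (energy m g) * e) + 2 * e by rewrite /C; ring.
apply: le_trans (sqnD _ _) _; apply: lerD; last first.
  by rewrite ler_wpM2l//; apply: hM; rewrite leq_maxr.
rewrite ler_wpM2l//.
have -> : a - b = cintegral m setT (fun x => (f x - h n x) * g x).
  rewrite /a /b -cintegralB; [|exact: L2M_cintegrable|exact: L2M_cintegrable].
  by apply: eq_cintegral => x; rewrite mulrBl.
rewrite -lee_fin EFinM fineK// muleC.
apply: le_trans (sqn_cintegralM m (cmeasurableB mf mh) mg) _.
rewrite lee_wpmul2r ?energy_ge0// energyBC; apply: hN; exact: leq_maxl.
Qed.

End convergence_in_energy.

Section Fourier_L2.
Variable R : realType.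
Local Notation leb := (@lebesgue_measure R).
Local Notation leb2 := (@leb2 R).
Local Notation leb3 := (@leb3 R).
Local Notation C := (R[i]).
Implicit Types (f g psi : R3 R -> C) (e s : R) (x k q p : R3 R).
Local Notation en := (energy leb3).

Definition c3 : R := (2 * pi) `^ (- (3 / 2)).

Lemma pi2_gt0 : 0 < 2 * pi :> R. Proof. by rewrite mulr_gt0// pi_gt0. Qed.

Lemma c3_gt0 : 0 < c3. Proof. by rewrite powR_gt0// pi2_gt0. Qed.

Lemma c3_sqr : c3 ^+ 2 = ((2 * pi) ^+ 3)^-1.
Proof.
rewrite -powR_mulrn ?powR_ge0// -powRrM (_ : - (3 / 2) * 2 = - 3%:R); last by field.
by rewrite powRN powR_mulrn// ltW// pi2_gt0.
Qed.

(** The forward transform for s = -1, the inverse one for s = 1. *)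
Definition fint s f k : C :=
  c3%:C * cintegral leb3 setT (fun x => f x * expi (s * dot3 x k)).

Lemma fourier3E f k : fourier3 f k = fint (-1) f k.
Proof.
congr (_ * _); apply: eq_cintegral => x; rewrite mulrC mulN1r; congr (_ * expi (- _)).
Qed.

Lemma cmeasurable_fint s f : cmeasurable f -> cmeasurable (fint s f).
Proof.
move=> mf; apply: cmeasurableM; first exact: cmeasurable_cst.
have h : cmeasurable (fun z : R3 R * R3 R => f z.2 * expi (s * dot3 z.2 z.1)).
  apply: cmeasurableM; first exact: (cmeasurable_comp mf measurable_snd).
  apply: cmeasurable_expi; apply: measurable_funM => //.
  by under eq_fun do rewrite dot3C; exact: measurable_dot3_2.
exact: (cmeasurable_cintegral leb3 h).
Qed.

Lemma cintegrable_fint s f k : cintegrable leb3 setT f ->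
  cintegrable leb3 setT (fun x => f x * expi (s * dot3 x k)).
Proof.
move=> fi; apply: (le_cintegrable _ fi).
  apply: cmeasurableM; first exact: cintegrable_meas fi.
  apply: cmeasurable_expi; apply: measurable_funM => //.
  by under eq_fun do rewrite dot3C; exact: measurable_dot3.
by move=> x; rewrite normcMr normc_expi mulr1.
Qed.

Lemma energy_fint s f : s ^+ 2 = 1 -> cintegrable leb3 setT f -> (en (fint s f) <= en f)%E.
Proof.
move=> s1 fi; have mf := cintegrable_meas fi.
have mT : cmeasurable (fun k => cintegral leb3 setT (fun x => f x * expi (s * dot3 x k))).
  have h : cmeasurable (fun z : R3 R * R3 R => f z.2 * expi (s * dot3 z.2 z.1)).
    apply: cmeasurableM; first exact: (cmeasurable_comp mf measurable_snd).
    apply: cmeasurable_expi; apply: measurable_funM => //.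
    by under eq_fun do rewrite dot3C; exact: measurable_dot3_2.
  exact: (cmeasurable_cintegral leb3 h).
rewrite /fint energyZ// sqnC c3_sqr.
have h3 : 0 < (2 * pi) ^+ 3 :> R by rewrite exprn_gt0// pi2_gt0.
by rewrite lee_pdivrMl//; exact: Bessel.
Qed.

Lemma fintB s f g k : cintegrable leb3 setT f -> cintegrable leb3 setT g ->
  fint s (fun x => f x - g x) k = fint s f k - fint s g k.
Proof.
move=> fi gi; rewrite /fint -mulrBr -cintegralB; last 2 first.
- exact: cintegrable_fint.
- exact: cintegrable_fint.
by congr (_ * _); apply: eq_cintegral => x; rewrite mulrBl.
Qed.

Lemma N1sqr : (-1) ^+ 2 = 1 :> R. Proof. by rewrite sqrrN expr1n. Qed.

Lemma L2_fint s f : s ^+ 2 = 1 -> cintegrable leb3 setT f -> L2 leb3 f -> L2 leb3 (fint s f).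
Proof.
move=> s1 fi /L2P[mf ff]; apply/L2P; split; first exact: cmeasurable_fint.
by apply: le_lt_trans ff; exact: energy_fint.
Qed.

Lemma is_fourierP f g : is_fourier f g -> [/\ L2 leb3 f, L2 leb3 g &
  exists f_ : nat -> R3 R -> C, [/\ forall n, cintegrable leb3 setT (f_ n),
    forall n, L2 leb3 (f_ n), cvg_energy leb3 f_ f &
    cvg_energy leb3 (fun n => fint (-1) (f_ n)) g]].
Proof.
move=> [Lf Lg [f_ fP [f1 f2]]]; split => //; exists f_; split.
- by move=> n; have [] := fP n.
- by move=> n; have [] := fP n.
- exact/cvg_energyP.
- apply/cvg_energyP; under eq_fun do under eq_fun do rewrite -fourier3E.
  exact: f2.
Qed.

Lemma L2_cmeas f : L2 leb3 f -> cmeasurable f. Proof. by case. Qed.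

(** By Bessel's inequality, approximating sequences of the same function have
    nearby transforms. *)
Lemma is_fourier_uniq f g g' : is_fourier f g -> is_fourier f g' ->
  \forall k \ae leb3, g k = g' k.
Proof.
move=> /is_fourierP[Lf Lg [f_ [fi fL f1 f2]]] /is_fourierP[_ Lg' [h [hi hL h1 h2]]].
have mF n : cmeasurable (fint (-1) (f_ n)) by apply: cmeasurable_fint; exact: L2_cmeas.
have mH n : cmeasurable (fint (-1) (h n)) by apply: cmeasurable_fint; exact: L2_cmeas.
apply: (cvg_energy_uniq mF (L2_cmeas Lg) (L2_cmeas Lg') f2).
move=> e e0; have e1 : 0 < e / 4 by rewrite divr_gt0.
have e2 : 0 < e / 16 by rewrite divr_gt0.
have [N1 H1] := f1 _ e2; have [N2 H2] := h1 _ e2; have [N3 H3] := h2 _ e1.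
exists (maxn N1 (maxn N2 N3)) => n; rewrite !geq_max => /and3P[n1 n2 n3].
apply: le_trans (energy_triangle leb3 (mF n) (mH n) (L2_cmeas Lg')) _.
have E1 : e%:E = (2%:E * (e / 4)%:E + 2%:E * (e / 4)%:E)%E.
  by rewrite -!EFinM -EFinD; congr EFin; field.
rewrite [leRHS]E1; apply: leeD; rewrite lee_wpmul2l ?lee_fin//; last exact: H3.
have -> : (fun x => fint (-1) (f_ n) x - fint (-1) (h n) x) = fint (-1) (fun x => f_ n x - h n x).
  by apply/funext => k; rewrite fintB.
apply: le_trans (energy_fint N1sqr _) _; first exact: cintegrableB.
apply: le_trans (energy_triangle leb3 (L2_cmeas (fL n)) (L2_cmeas Lf) (L2_cmeas (hL n))) _.
have E2 : (e / 4)%:E = (2%:E * (e / 16)%:E + 2%:E * (e / 16)%:E)%E.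
  by rewrite -!EFinM -EFinD; congr EFin; field.
rewrite E2; apply: leeD; rewrite lee_wpmul2l ?lee_fin//; first exact: H1.
by rewrite energyBC; exact: H2.
Qed.

(** Bessel's inequality for the approximating sequence; the two passages to
    the limit each cost a factor 2, by the inequality
    |z + w|^2 <= 2 |z|^2 + 2 |w|^2. *)
Lemma is_fourier_energy f g : is_fourier f g -> (en g <= 4%:E * en f)%E.
Proof.
move=> /is_fourierP[Lf Lg [f_ [fi fL f1 f2]]].
have mF n : cmeasurable (fint (-1) (f_ n)) by apply: cmeasurable_fint; exact: L2_cmeas.
apply/lee_addgt0Pr => e e0; have e6 : 0 < e / 6 by rewrite divr_gt0.
have [N1 H1] := f1 _ e6; have [N2 H2] := f2 _ e6.
set n := maxn N1 N2.
have mg := L2_cmeas Lg; have mf := L2_cmeas Lf.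
have h1 : (en g <= 2%:E * (e / 6)%:E + 2%:E * en (fint (-1) (f_ n)))%E.
  have := energyD leb3 (cmeasurableB mg (mF n)) (mF n).
  rewrite (_ : (fun x => g x - fint (-1) (f_ n) x + fint (-1) (f_ n) x) = g); last first.
    by apply/funext => x; rewrite subrK.
  move/le_trans; apply; rewrite leeD2r// lee_wpmul2l ?lee_fin// energyBC.
  by apply: H2; exact: leq_maxr.
have h2 : (en (f_ n) <= 2%:E * (e / 6)%:E + 2%:E * en f)%E.
  have := energyD leb3 (cmeasurableB (L2_cmeas (fL n)) mf) mf.
  rewrite (_ : (fun x => f_ n x - f x + f x) = f_ n); last first.
    by apply/funext => x; rewrite subrK.
  move/le_trans; apply; rewrite leeD2r// lee_wpmul2l ?lee_fin//.
  by apply: H1; exact: leq_maxl.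
apply: le_trans h1 _.
have h3 : (2%:E * en (fint (-1) (f_ n)) <= 2%:E * (2%:E * (e / 6)%:E + 2%:E * en f))%E.
  by rewrite lee_wpmul2l ?lee_fin//; apply: le_trans h2; exact: (energy_fint N1sqr (fi n)).
apply: le_trans (leeD2l _ h3) _.
have ef : en f \is a fin_num by have /L2P[_] := Lf; rewrite ge0_fin_numE ?energy_ge0.
rewrite -(fineK ef) -!(EFinM, EFinD) lee_fin.
by move: (fine _) => a; lra.
Qed.

Lemma fint_swap s f psi : cintegrable leb3 setT f -> cintegrable leb3 setT psi ->
  cintegral leb3 setT (fun k => fint s f k * psi k) =
  cintegral leb3 setT (fun x => f x * fint s psi x).
Proof.
move=> fi pi; have mf := cintegrable_meas fi; have mp := cintegrable_meas pi.
pose H (z : R3 R * R3 R) := c3%:C * (psi z.1 * (f z.2 * expi (s * dot3 z.2 z.1))).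
have mH : cmeasurable H.
  apply: cmeasurableM; first exact: cmeasurable_cst.
  apply: cmeasurableM; first exact: (cmeasurable_comp mp measurable_fst).
  apply: cmeasurableM; first exact: (cmeasurable_comp mf measurable_snd).
  apply: cmeasurable_expi; apply: measurable_funM => //.
  by under eq_fun do rewrite dot3C; exact: measurable_dot3_2.
have HI : (\int[leb3]_k absint leb3 (fun x => H (k, x)) < +oo)%E.
  have hz := cintegrableZ (c3%:C) pi.
  have := absint_tensor leb3 leb3 (cintegrable_meas hz) mf.
  have /cintegrableP[_ a1] := hz; have /cintegrableP[_ a2] := fi.
  move=> E; apply: (@le_lt_trans _ _ (\int[leb3]_x absint leb3 (fun y => (c3%:C * psi x * f y)%R))%E).
    rewrite le_eqVlt; apply/orP; left; apply/eqP; apply: eq_integral => k _.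
    apply: eq_integral => x _; rewrite /H !normcMr normc_expi mulr1.
    by rewrite mulrA.
  by rewrite E lte_mul_pinfty ?absint_ge0// ge0_fin_numE// absint_ge0.
transitivity (cintegral leb3 setT (fun k => cintegral leb3 setT (fun x => H (k, x)))).
  apply: eq_cintegral => k; rewrite /H /= cintegralZ; last first.
    by apply: cintegrableZ; exact: cintegrable_fint.
  by rewrite cintegralZ; [rewrite mulrCA mulrC mulrA|exact: cintegrable_fint].
rewrite (cFubini mH HI); apply: eq_cintegral => x.
transitivity (cintegral leb3 setT (fun k => c3%:C * (f x * (psi k * expi (s * dot3 k x))))).
  by apply: eq_cintegral => k; rewrite /H /= (dot3C k x) [psi k * _]mulrCA.
rewrite cintegralZ; last by apply: cintegrableZ; exact: cintegrable_fint.
by rewrite cintegralZ; [rewrite /fint mulrCA|exact: cintegrable_fint].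
Qed.

(** The multiplication formula extends from integrable functions by density. *)
Lemma is_fourier_swap f g psi : is_fourier f g -> cintegrable leb3 setT psi -> L2 leb3 psi ->
  cintegral leb3 setT (fun k => g k * psi k) =
  cintegral leb3 setT (fun x => f x * fint (-1) psi x).
Proof.
move=> /is_fourierP[Lf Lg [f_ [fi fL f1 f2]]] pi Lp.
have LF n : L2 leb3 (fint (-1) (f_ n)) by apply: L2_fint => //; exact: N1sqr.
have Lpp := L2_fint N1sqr pi Lp.
apply: (cvg_energy_cintegral LF Lg Lp f2) => e e0.
have [/L2P[mpp] ppf] := (Lpp, Lpp).
have pf : en (fint (-1) psi) \is a fin_num by rewrite ge0_fin_numE ?energy_ge0//; have /L2P[] := ppf.
move=> _; pose D := fine (en (fint (-1) psi)) + 1.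
have D0 : 0 < D by rewrite ltr_wpDl ?fine_ge0 ?energy_ge0.
have [N HN] := f1 (e / D) (divr_gt0 e0 D0); exists N => n Nn.
rewrite fint_swap// -cintegralB; [|exact: L2M_cintegrable|exact: L2M_cintegrable].
under eq_cintegral do rewrite -mulrBl.
rewrite -lee_fin; apply: le_trans (sqn_cintegralM leb3 (cmeasurableB (L2_cmeas (fL n)) (L2_cmeas Lf)) mpp) _.
apply: (@le_trans _ _ ((e / D)%:E * (fine (en (fint (-1) psi)))%:E)%E).
  by rewrite fineK// lee_wpmul2r ?energy_ge0//; exact: HN.
rewrite -EFinM lee_fin mulrAC ler_pdivrMr// ler_wpM2l ?(ltW e0)//.
by rewrite lerDl.
Qed.

End Fourier_L2.

(** * Inversion of the Fourier transform *)

Section boxes.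
Variable R : realType.
Local Notation leb := (@lebesgue_measure R).
Local Notation leb2 := (@leb2 R).
Local Notation leb3 := (@leb3 R).
Local Notation C := (R[i]).
Implicit Types (I J K : set R) (x k q p : R3 R).

Definition box I J K x : R := \1_I x.1 * (\1_J x.2.1 * \1_K x.2.2).

Lemma ocitv_measurable I : ocitv I -> measurable I.
Proof. by move=> [[a b]] _ <-; exact: measurable_itv. Qed.

Lemma measurable_box I J K : measurable I -> measurable J -> measurable K ->
  measurable_fun setT (box I J K).
Proof. by move=> mI mJ mK; apply: measurable_tensor3; exact: measurable_indic. Qed.

Lemma boxE I J K x : box I J K x = \1_(I `*` (J `*` K)) x.
Proof.
rewrite /box !indicE !in_setX; case: (_ \in I); rewrite ?mul0r ?mul1r//=.
by case: (_ \in J); rewrite ?mul0r ?mul1r.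
Qed.

Lemma box_ge0 I J K x : 0 <= box I J K x. Proof. by rewrite boxE. Qed.
Lemma box_le1 I J K x : box I J K x <= 1.
Proof. by rewrite boxE indicE; case: (_ \in _). Qed.

Lemma boxM I J K I' J' K' x :
  box I J K x * box I' J' K' x = box (I `&` I') (J `&` J') (K `&` K') x.
Proof. by rewrite /box !indicI /=; ring. Qed.

Lemma ocitv_finite I : ocitv I -> (leb I < +oo)%E.
Proof.
by move=> [[a b]] _ <-; rewrite lebesgue_measure_itv/=; case: ifP => // _; rewrite -EFinB ltry.
Qed.

Lemma L2_real (f : R3 R -> R) : measurable_fun setT f -> (forall x : R3 R, 0 <= f x <= 1) ->
  (\int[leb3]_x (f x)%:E < +oo)%E -> L2 leb3 (fun x => (f x)%:C) /\
  cintegrable leb3 setT (fun x => (f x)%:C).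
Proof.
move=> mf f01 fi; have mc := cmeasurable_real mf.
have sq : measurable_fun setT (fun x : R3 R => (sqn (f x)%:C)%:E) by exact/measurable_EFinP/measurable_sqn.
split.
  apply/L2P; split => //; apply: le_lt_trans fi; apply: ge0_le_integral => //.
  - by move=> x _; rewrite lee_fin sqn_ge0.
  - exact/measurable_EFinP.
  - by move=> x _; rewrite lee_fin sqnC expr2; have /andP[a0 a1] := f01 x; rewrite ler_piMr.
apply/cintegrableP; split => //; rewrite /absint.
under eq_integral do rewrite normcC ger0_norm ?(andP (f01 _)).1//.
exact: fi.
Qed.

Lemma box_fin I J K : ocitv I -> ocitv J -> ocitv K -> (\int[leb3]_x (box I J K x)%:E < +oo)%E.
Proof.
move=> oI oJ oK.
have [mI [mJ mK]] := (ocitv_measurable oI, (ocitv_measurable oJ, ocitv_measurable oK)).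
have ci A : ocitv A -> measurable A -> (\int[leb]_x (\1_A x)%:E \is a fin_num)%E.
  by move=> oA mA; rewrite integral_indic// setIT ge0_fin_numE ?measure_ge0//; exact: ocitv_finite.
have m2 : measurable_fun setT (fun y : R2 R => (\1_J y.1 : R) * \1_K y.2).
  apply: measurable_funM.
    by apply: (measurableT_comp (f := (\1_J : R -> R)) (measurable_indic mJ)); exact: measurable_fst.
  by apply: (measurableT_comp (f := (\1_K : R -> R)) (measurable_indic mK)); exact: measurable_snd.
have e1 := @ge0_integral_tensor R _ _ _ _ leb leb2 (\1_I) _ (measurable_indic mI) m2.
have e2 := @ge0_integral_tensor R _ _ _ _ leb leb (\1_J) _ (measurable_indic mJ) (measurable_indic mK).
have -> : (\int[leb3]_x (box I J K x)%:E)%E =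
  ((\int[leb]_x (\1_I x)%:E) * ((\int[leb]_x (\1_J x)%:E) * (\int[leb]_x (\1_K x)%:E)))%E.
  by rewrite -e2// -e1// => y; rewrite mulr_ge0.
by rewrite ltey_eq !fin_numM//; exact: ci.
Qed.

Lemma box01 I J K x : 0 <= box I J K x <= 1. Proof. by rewrite box_ge0 box_le1. Qed.

Lemma L2_box I J K : ocitv I -> ocitv J -> ocitv K -> L2 leb3 (fun x => (box I J K x)%:C).
Proof.
move=> oI oJ oK; apply: (L2_real _ (box01 I J K) (box_fin oI oJ oK)).1.
by apply: measurable_box; exact: ocitv_measurable.
Qed.

Lemma cintegrable_box I J K : ocitv I -> ocitv J -> ocitv K ->
  cintegrable leb3 setT (fun x => (box I J K x)%:C).
Proof.
move=> oI oJ oK; apply: (L2_real _ (box01 I J K) (box_fin oI oJ oK)).2.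
by apply: measurable_box; exact: ocitv_measurable.
Qed.

(** Boxes determine finite measures, hence square integrable functions, the
    latter after cutting off to bounded sets. *)
Lemma ae0_boxes (D : R3 R -> C) : L2 leb3 D ->
  (forall I J K, ocitv I -> ocitv J -> ocitv K ->
    cintegral leb3 setT (fun x => (box I J K x)%:C * D x) = 0) ->
  \forall x \ae leb3, D x = 0.
Proof.
move=> LD hD; pose I (n : nat) : set R := [set` `](- n%:R), n%:R]].
have oI n : ocitv (I n) by exact: is_ocitv.
pose Dn n x := (box (I n) (I n) (I n) x)%:C * D x.
have iDn n : cintegrable leb3 setT (Dn n) by apply: L2M_cintegrable => //; exact: L2_box.
have det := determining_prod (determining_ocitv R)
  (determining_prod (determining_ocitv R) (determining_ocitv R)).
have h n (A J K : set R) : ocitv A -> ocitv J -> ocitv K ->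
    cintegral leb3 setT (fun x => (box A J K x)%:C * Dn n x) = 0.
  move=> oA oJ oK; rewrite -[RHS](hD (A `&` I n) (J `&` I n) (K `&` I n)); do ?exact: ocitvI.
  by apply: eq_cintegral => x; rewrite /Dn mulrA -boxM -rmorphM.
have ae n : \forall x \ae leb3, Dn n x = 0.
  have bound (A J K : set R) : ocitv A -> ocitv J -> ocitv K ->
      cintegrable leb3 setT (fun x => (box A J K x)%:C * Dn n x).
    move=> oA oJ oK; apply: (le_cintegrable _ (iDn n)).
      apply: cmeasurableM; last exact: cintegrable_meas (iDn n).
      by apply: cmeasurable_real; apply: measurable_box; exact: ocitv_measurable.
    move=> x; rewrite normcMr normcC ger0_norm ?box_ge0// ler_piMl ?normc_ge0//.
    exact: box_le1.
  have reim (p : C -> R) : (forall (r : R) z, p (r%:C * z) = r * p z) ->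
      leb3.-integrable setT (fun x => (p (Dn n x))%:E) ->
      (forall A J K : set R, ocitv A -> ocitv J -> ocitv K ->
        leb3.-integrable setT (fun x => (p ((box A J K x)%:C * Dn n x))%:E) /\
        (\int[leb3]_x p ((box A J K x)%:C * Dn n x) = 0)%R) ->
      \forall x \ae leb3, p (Dn n x) = 0.
    move=> pM ip hp; apply: (determining_ae0 det ip) => _ [A oA [_ [J oJ [K oK <-]] <-]].
    have [hi h0] := hp A J K oA oJ oK.
    transitivity (\int[leb3]_x (p ((box A J K x)%:C * Dn n x))%:E)%E.
      rewrite integral_mkcond; apply: eq_integral => x _; rewrite pM boxE indicE /patch.
      by case: ifP => _; rewrite ?mul1r ?mul0r.
    by have := integrable_fin_num measurableT hi; move/fineK => <-; rewrite -/(Rintegral _ _ _) h0.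
  have r1 : \forall x \ae leb3, complex.Re (Dn n x) = 0.
    apply: reim (iDn n).1 _ => [r z|A J K oA oJ oK]; first by rewrite cReM cReC cImC mul0r subr0.
    split; first exact: (bound A J K oA oJ oK).1.
    by have := h n A J K oA oJ oK; rewrite (cintegralE (bound A J K oA oJ oK)) => -[].
  have r2 : \forall x \ae leb3, complex.Im (Dn n x) = 0.
    apply: reim (iDn n).2 _ => [r z|A J K oA oJ oK]; first by rewrite cImM cReC cImC mul0r addr0.
    split; first exact: (bound A J K oA oJ oK).2.
    by have := h n A J K oA oJ oK; rewrite (cintegralE (bound A J K oA oJ oK)) => -[].
  by apply: filterS2 r1 r2 => x a b; exact: complex_ext.
have := ae_foralln ae; apply: filterS => x /= hx.
pose n := (Num.bound `|x.1| + (Num.bound `|x.2.1| + Num.bound `|x.2.2|))%N.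
have inI (y : R) (k l : nat) : y \in I (k + (Num.bound `|y| + l))%N.
  rewrite inE /I /= in_itv /=; have yb := archi_boundP (normr_ge0 y).
  have := ler_norm y; have := ler_norm (- y); rewrite normrN => h1 h2.
  have : (Num.bound `|y|)%:R <= ((k + (Num.bound `|y| + l))%N)%:R :> R
    by rewrite ler_nat (leq_trans (leq_addr _ _) (leq_addl _ _)).
  move: yb; set B := _%:R; set E := _%:R => yb BE.
  by apply/andP; split; lra.
have := hx n; rewrite /Dn /box !indicE (inI _ 0%N).
have -> : x.2.1 \in I n by rewrite /n; apply: inI.
have -> : x.2.2 \in I n.
  by have := inI x.2.2 (Num.bound `|x.1| + Num.bound `|x.2.1|)%N 0%N; rewrite addn0 /n addnA.
by rewrite !mulr1 mul1r.
Qed.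

End boxes.

Section almost_everywhere_products.
Context d1 d2 (X : measurableType d1) (Y : measurableType d2) (R : realType).
Variable m1 : {sigma_finite_measure set X -> \bar R}.
Variable m2 : {sigma_finite_measure set Y -> \bar R}.

Lemma ae_fst (P : X -> Prop) : (\forall x \ae m1, P x) -> \forall z \ae (m1 \x m2)%E, P z.1.
Proof.
move=> [A [mA A0 PA]]; exists (A `*` setT); split; first exact: measurableX.
  by transitivity (m1 A * m2 setT)%E; [exact: product_measure1E|rewrite A0 mul0e].
by move=> z /= hz; split => //; apply: PA.
Qed.

Lemma ae_snd (P : Y -> Prop) : (\forall x \ae m2, P x) -> \forall z \ae (m1 \x m2)%E, P z.2.
Proof.
move=> [A [mA A0 PA]]; exists (setT `*` A); split; first exact: measurableX.
  by transitivity (m1 setT * m2 A)%E; [exact: product_measure1E|rewrite A0 mule0].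
by move=> z /= hz; split => //; apply: PA.
Qed.

End almost_everywhere_products.

Lemma ae_conj d (T : measurableType d) (R : realType) (m : {measure set T -> \bar R})
    (P Q : T -> Prop) : (\forall x \ae m, P x) -> (\forall x \ae m, Q x) ->
  \forall x \ae m, P x /\ Q x.
Proof. by apply: filterS2. Qed.

Lemma ae_imp d (T : measurableType d) (R : realType) (m : {measure set T -> \bar R})
    (P Q : T -> Prop) : (\forall x \ae m, P x) -> (forall x, P x -> Q x) ->
  \forall x \ae m, Q x.
Proof. by move=> hP PQ; apply: filterS hP. Qed.

Section inversion.
Variable R : realType.
Local Notation leb := (@lebesgue_measure R).
Local Notation leb2 := (@leb2 R).
Local Notation leb3 := (@leb3 R).
Local Notation C := (R[i]).
Implicit Types (f g : R3 R -> C) (I J K : set R) (e : R).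
Local Notation en := (energy leb3).
Local Notation eps := (fun n : nat => (n.+1%:R^-1 : R)).

Lemma ae_neq (a : R) : \forall x \ae leb, x != a.
Proof.
exists [set a]; split; [exact: measurable_set1|exact: lebesgue_measure_set1|].
by move=> x /= /negP; rewrite negbK => /eqP.
Qed.

Lemma ae3_neq (a b c : R) : \forall x \ae leb3, [/\ x.1 != a, x.2.1 != b & x.2.2 != c].
Proof.
have h1 : \forall x \ae leb3, x.1 != a by exact: (ae_fst leb2 (ae_neq a)).
have h2' : \forall y \ae leb2, y.1 != b by exact: (ae_fst leb (ae_neq b)).
have h3' : \forall y \ae leb2, y.2 != c by exact: (ae_snd leb (ae_neq c)).
have h2 : \forall x \ae leb3, x.2.1 != b by exact: (@ae_snd _ _ _ _ R leb leb2 _ h2').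
have h3 : \forall x \ae leb3, x.2.2 != c by exact: (@ae_snd _ _ _ _ R leb leb2 _ h3').
by apply: filterS (ae_conj h1 (ae_conj h2 h3)) => x [a1 [b1 c1]]; split.
Qed.

Lemma cvg_atan_scaled (s : R) : s != 0 ->
  (fun n : nat => atan (s / eps n)) @ \oo --> (if 0 < s then pi / 2 else - (pi / 2) : R).
Proof.
have pos (r : R) : 0 < r -> (fun n : nat => atan (r / eps n)) @ \oo --> (pi / 2 : R).
  move=> r0; apply: (cvg_comp _ _ _ (@cvgy_atan R)).
  apply/cvgryPge => A; exists (Num.bound (A / r)) => // n /= hn.
  rewrite invrK -ler_pdivrMl// mulrC.
  apply: le_trans (ler_norm _) (le_trans (ltW (archi_boundP (normr_ge0 _))) _).
  rewrite ler_nat; apply: leq_trans (leqnSn _).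
  apply: leq_trans hn; rewrite /Num.bound.
  by rewrite normr_id.
move=> s0; case: ifPn => [|]; first exact: pos.
rewrite -leNgt le_eqVlt (negPf s0)/= => sn.
have -> : (fun n : nat => atan (s / eps n)) = (fun n : nat => - atan (- s / eps n)).
  by apply/funext => n; rewrite mulNr atanN opprK.
by apply: cvgN; apply: pos; rewrite oppr_gt0.
Qed.

Lemma integral_cauchy_itv (a b x e : R) : 0 < e -> a <= b ->
  (\int[leb]_y (\1_(`]a, b]%classic) y * cauchy e (y - x)))%R =
  2 * atan ((b - x) / e) - 2 * atan ((a - x) / e).
Proof.
move=> e0 ab; rewrite /Rintegral.
have -> : (\int[leb]_y (\1_(`]a, b]%classic) y * cauchy e (y - x))%:E =
    \int[leb]_(y in `]a, b]%classic) (1 * cauchy e (x - y))%:E)%E.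
  rewrite [RHS]integral_mkcond; apply: eq_integral => y _; rewrite indicE /patch.
  by case: ifP => _; rewrite ?mul0r// cauchyB.
have h := @cauchy_subst R (fun y => y) (fun=> 1) a b x e e0 ab.
rewrite integral_itv_obnd_cbnd; last first.
  by apply: measurable_funTS; apply/measurable_EFinP/measurable_funM => //;
    apply: (measurableT_comp (measurable_cauchy e)); apply: measurable_funB.
by rewrite h// => y _; exact: cvg_cst.
Qed.

Lemma cvg_cauchy_itv I : ocitv I -> exists a b : R, forall x : R, x != a -> x != b ->
  (fun n => \int[leb]_y (\1_I y * cauchy (eps n) (y - x)))%R @ \oo --> 2 * pi * \1_I x.
Proof.
move=> [[a b]] _ <- /=; exists a, b => x xa xb.
have [ba|ab] := ltP b a.
  have -> : `]a, b]%classic = set0 :> set R by rewrite set_itv_ge// bnd_simp -leNgt ltW.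
  have z : \1_(set0 : set R) = (fun=> 0) :> (R -> R) by rewrite indic0.
  rewrite z mulr0 (_ : (fun n => _) = (fun=> 0)); first exact: cvg_cst.
  apply/funext => n; under eq_Rintegral do rewrite mul0r.
  by rewrite /Rintegral integral0.
under eq_fun => n do rewrite integral_cauchy_itv ?invr_gt0//.
have xa' : a - x != 0 by rewrite subr_eq0 eq_sym.
have xb' : b - x != 0 by rewrite subr_eq0 eq_sym.
have -> : 2 * pi * \1_(`]a, b]%classic) x = 2 * (if 0 < b - x then pi / 2 else - (pi / 2)) -
    2 * (if 0 < a - x then pi / 2 else - (pi / 2)) :> R.
  rewrite !subr_gt0 indicE mem_setE /= in_itv /=.
  rewrite (le_eqVlt x b) (negPf xb)/= [x < a]ltNge le_eqVlt eq_sym (negPf xa) /=.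
  case: ltP => h1; case: ltP => h2 /=; try by field.
  have xlta : x < a by rewrite lt_neqAle xa.
  by have := lt_le_trans xlta (le_trans ab h2); rewrite ltxx.
by apply: cvgB; (apply: cvgM; [exact: cvg_cst|exact: cvg_atan_scaled]).
Qed.

Lemma cintegrable_cauchy_itv I (e x : R) : 0 < e -> ocitv I ->
  leb.-integrable setT (EFin \o (fun y : R => \1_I y * cauchy e (y - x))).
Proof.
move=> e0 /ocitv_measurable mI.
have mc : measurable_fun setT (fun y : R => cauchy e (y - x)).
  by apply: (measurableT_comp (measurable_cauchy e)); apply: measurable_funB.
have mf : measurable_fun setT (fun y : R => \1_I y * cauchy e (y - x)) by exact: measurable_funM.
apply/integrableP; split; first exact/measurable_EFinP.
apply: le_lt_trans (ltry (2 * pi)); apply: le_trans (integral_cauchy_le x e0).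
apply: ge0_le_integral => //.
- by apply/measurable_EFinP; apply: measurableT_comp.
- by apply/measurable_EFinP; under eq_fun do rewrite cauchyB.
- move=> y _; rewrite /= lee_fin (cauchyB _ x); have c0 := cauchy_ge0 (y - x) e0.
  rewrite indicE; case: (_ \in _); rewrite ?mul1r ?mul0r ?normr0//.
  by rewrite ger0_norm.
Qed.

Lemma L2_decay3 e : 0 < e -> L2 leb3 (fun k => (decay3 e k)%:C).
Proof.
move=> e0; apply: (L2_real (@measurable_decay3 R e) _ _).1.
  by move=> x; rewrite decay3_ge0 decay3_le1// ltW.
have /integrableP[_] := integrable_decay3 e0; apply: le_lt_trans.
rewrite le_eqVlt; apply/orP; left; apply/eqP; apply: eq_integral => x _ /=.
by rewrite ger0_norm ?decay3_ge0.
Qed.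

(** Abel regularisation, dictated by the fact that the Fourier transform of
    [decay3] is explicit. *)
Definition regular e g (k : R3 R) : C := (decay3 e k)%:C * g k.

Lemma cmeasurable_regular e g : cmeasurable g -> cmeasurable (regular e g).
Proof. by apply: cmeasurableM; apply: cmeasurable_real; exact: measurable_decay3. Qed.

Lemma sqn_regular e g k : 0 < e -> sqn (regular e g k) <= sqn (g k).
Proof.
move=> e0; rewrite sqnM sqnC ler_piMl ?sqn_ge0//.
by rewrite expr_le1// ?decay3_ge0// decay3_le1// ltW.
Qed.

Lemma L2_regular e g : 0 < e -> L2 leb3 g -> L2 leb3 (regular e g).
Proof.
move=> e0 Lg; apply: (le_L2 _ Lg); first by apply: cmeasurable_regular; exact: L2_cmeas Lg.
by move=> k; exact: sqn_regular.
Qed.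

Lemma cintegrable_regular e g : 0 < e -> L2 leb3 g -> cintegrable leb3 setT (regular e g).
Proof. by move=> e0 Lg; apply: L2M_cintegrable => //; exact: L2_decay3. Qed.

Lemma regularised_fourier e f x : 0 < e -> cintegrable leb3 setT f ->
  fint (-1) (regular e (fint 1 f)) x =
  (c3 R ^+ 2)%:C * cintegral leb3 setT (fun y => f y * (cauchy3 e (y - x))%:C).
Proof.
move=> e0 fi; have mf := cintegrable_meas fi.
pose H (z : R3 R * R3 R) := f z.2 * ((decay3 e z.1)%:C * expi (dot3 z.2 z.1 - dot3 x z.1)).
have mH : cmeasurable H.
  apply: cmeasurableM; first exact: (cmeasurable_comp mf measurable_snd).
  apply: cmeasurableM.
    by apply: cmeasurable_real; apply: (measurableT_comp (@measurable_decay3 R e) measurable_fst).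
  apply: cmeasurable_expi; apply: measurable_funB.
    by under eq_fun do rewrite dot3C; exact: measurable_dot3_2.
  exact: (measurableT_comp (measurable_dot3 x) measurable_fst).
have idec := (L2_real (@measurable_decay3 R e) _ _).2.
have id0 : cintegrable leb3 setT (fun k => (decay3 e k)%:C).
  have := cintegrable_decay3 0 e0; congr (cintegrable _ _ _); apply/funext => k.
  by rewrite dot30 expi0 mulr1.
have HI : (\int[leb3]_k absint leb3 (fun y => H (k, y)) < +oo)%E.
  have /cintegrableP[m1 a1] := id0; have /cintegrableP[_ a2] := fi.
  have E := absint_tensor leb3 leb3 m1 mf.
  apply: (@le_lt_trans _ _ (\int[leb3]_x absint leb3 (fun y => ((decay3 e x)%:C * f y)%R))%E).
    rewrite le_eqVlt; apply/orP; left; apply/eqP; apply: eq_integral => k _.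
    apply: eq_integral => y _; rewrite /H !normcMr normc_expi mulr1.
    by rewrite mulrC.
  by rewrite E lte_mul_pinfty ?absint_ge0// ge0_fin_numE// absint_ge0.
transitivity ((c3 R)%:C * ((c3 R)%:C * cintegral leb3 setT (fun k => cintegral leb3 setT (fun y => H (k, y))))).
  rewrite {1}/fint -[X in _ = _ * X]cintegralZ.
    congr (_ * _); apply: eq_cintegral => k; rewrite /H /regular /fint /=.
    rewrite (_ : cintegral leb3 setT (fun y => f y * ((decay3 e k)%:C * expi (dot3 y k - dot3 x k))) =
        (decay3 e k)%:C * expi (- dot3 x k) * cintegral leb3 setT (fun y => f y * expi (1 * dot3 y k))).
      by rewrite mulN1r (dot3C k x); ring.
    rewrite -cintegralZ; last exact: cintegrable_fint.
    by apply: eq_cintegral => y; rewrite expiD mul1r; ring.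
  apply/cintegrableP; split; first exact: (cmeasurable_cintegral leb3 mH).
  apply: le_lt_trans HI; apply: ge0_le_integral; first exact: measurableT.
  - by move=> k _; rewrite lee_fin normc_ge0.
  - exact/measurable_EFinP/measurable_normc/(cmeasurable_cintegral leb3 mH).
  - exact: (measurable_absint leb3 mH).
  - by move=> k _; exact: normc_cintegral.
rewrite (cFubini mH HI) mulrA -rmorphM -expr2; congr (_ * _); apply: eq_cintegral => y.
rewrite /H /= -(fourier_decay3 _ e0) -cintegralZ; last exact: cintegrable_decay3.
by apply: eq_cintegral => k; rewrite dot3Bl.
Qed.

Lemma regularised_box I J K e x : 0 < e -> ocitv I -> ocitv J -> ocitv K ->
  fint (-1) (regular e (fint 1 (fun y => (box I J K y)%:C))) x =
  (c3 R ^+ 2 * ((\int[leb]_y (\1_I y * cauchy e (y - x.1))) *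
   ((\int[leb]_y (\1_J y * cauchy e (y - x.2.1))) *
    (\int[leb]_y (\1_K y * cauchy e (y - x.2.2))))))%R%:C.
Proof.
move=> e0 oI oJ oK; rewrite regularised_fourier//; last exact: cintegrable_box.
have ci A (z : R) : ocitv A -> cintegrable leb setT (fun y => (\1_A y * cauchy e (y - z))%:C).
  move=> oA; split; first exact: cintegrable_cauchy_itv.
  exact: integrable0.
have iJK := cintegrable_tensor (ci J x.2.1 oJ) (ci K x.2.2 oK).
have E := @cintegral_tensor _ _ _ _ R leb leb2 _ _ (ci I x.1 oI) iJK.
have E2 := cintegral_tensor (ci J x.2.1 oJ) (ci K x.2.2 oK).
set A := (\int[leb]_y (\1_I y * _))%R; set A' := (\int[leb]_y (\1_J y * _))%R.
set A'' := (\int[leb]_y (\1_K y * _))%R.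
have -> : (c3 R ^+ 2 * (A * (A' * A'')))%:C = (c3 R ^+ 2)%:C * (A%:C * (A'%:C * A''%:C)).
  by rewrite -!(rmorphM (real_complex R)).
congr (_ * _); transitivity (cintegral (leb \x leb2)%E setT (fun y : R3 R =>
  (\1_I y.1 * cauchy e (y.1 - x.1))%:C * ((\1_J y.2.1 * cauchy e (y.2.1 - x.2.1))%:C *
  (\1_K y.2.2 * cauchy e (y.2.2 - x.2.2))%:C))).
  by apply: eq_cintegral => y; rewrite /box /cauchy3 -!rmorphM; congr (_%:C); rewrite /=; ring.
by rewrite E E2 !cintegral_real//; exact: cintegrable_cauchy_itv.
Qed.

Lemma cvg_regular g : L2 leb3 g -> cvg_energy leb3 (fun n => regular (eps n) g) g.
Proof.
move=> Lg; have mg := L2_cmeas Lg.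
apply: (cvg_energy_dominated _ mg Lg) => [n|n k|k]; first exact: cmeasurable_regular.
  rewrite /regular -[X in _ - X]mul1r -mulrBl sqnM ler_piMl ?sqn_ge0//.
  rewrite -(rmorphB (real_complex R)) sqnC -sqrrN opprB expr_le1// ?subr_ge0 ?gerBl ?decay3_ge0//.
  by rewrite decay3_le1.
have := cvg_decay3 k.
rewrite (_ : (fun n => sqn (regular (eps n) g k - g k)) =
  (fun n => ((decay3 (eps n) k - 1) * (decay3 (eps n) k - 1)) * sqn (g k))); last first.
  apply/funext => n; rewrite /regular -[X in _ - X]mul1r -mulrBl sqnM.
  by rewrite -(rmorphB (real_complex R)) sqnC expr2.
move=> h; have h1 : decay3 (eps n) k - 1 @[n --> \oo] --> (0 : R).
  by rewrite -(subrr 1); apply: cvgB => //; exact: cvg_cst.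
rewrite -(mul0r (sqn (g k))) -(mul0r (0 : R)).
by apply: cvgM; [exact: cvgM|exact: cvg_cst].
Qed.

Lemma cvg_energy_cauchy (h : nat -> R3 R -> C) f : (forall n, cmeasurable (h n)) ->
  cmeasurable f -> cvg_energy leb3 h f ->
  forall e, 0 < e -> exists N, forall n k, (N <= n)%N -> (N <= k)%N ->
     (en (fun x => h n x - h k x)%R <= e%:E)%E.
Proof.
move=> mh mf hf e e0; have e4 : 0 < e / 4 by rewrite divr_gt0.
have [N hN] := hf _ e4; exists N => n k Nn Nk.
apply: le_trans (energy_triangle leb3 (mh n) mf (mh k)) _.
rewrite (_ : e%:E = (2%:E * (e / 4)%:E + 2%:E * (e / 4)%:E)%E).
  by rewrite [in leLHS](energyBC leb3 f); apply: leeD; rewrite lee_wpmul2l ?lee_fin//; apply: hN.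
by rewrite -!EFinM -EFinD; congr EFin; field.
Qed.

Lemma fint_cauchy (s : R) (g_ : nat -> R3 R -> C) : s ^+ 2 = 1 ->
  (forall n, cintegrable leb3 setT (g_ n)) ->
  (forall e, 0 < e -> exists N, forall n k, (N <= n)%N -> (N <= k)%N ->
     (en (fun x => g_ n x - g_ k x)%R <= e%:E)%E) ->
  forall e, 0 < e -> exists N, forall n k, (N <= n)%N -> (N <= k)%N ->
     (en (fun x => fint s (g_ n) x - fint s (g_ k) x)%R <= e%:E)%E.
Proof.
move=> s1 gi hg e e0; have [N hN] := hg e e0; exists N => n k Nn Nk.
apply: le_trans (hN n k Nn Nk).
have -> : (fun x => fint s (g_ n) x - fint s (g_ k) x) = fint s (fun x => g_ n x - g_ k x).
  by apply/funext => x; rewrite fintB.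
by apply: energy_fint => //; exact: cintegrableB.
Qed.

Lemma sqr11 : 1 ^+ 2 = 1 :> R. Proof. by rewrite expr1n. Qed.

(** Fourier inversion for the indicator of a box, whose regularised inversion
    integrals are products of differences of arctangents. *)
Lemma box_inversion I J K : ocitv I -> ocitv J -> ocitv K ->
  cvg_energy leb3 (fun n => fint (-1) (regular (eps n) (fint 1 (fun y => (box I J K y)%:C))))
    (fun x => (box I J K x)%:C).
Proof.
move=> oI oJ oK; set B := fun y => (box I J K y)%:C; set G := fint 1 B.
have iB : cintegrable leb3 setT B by exact: cintegrable_box.
have LB : L2 leb3 B by exact: L2_box.
have LG : L2 leb3 G by apply: L2_fint => //; exact: sqr11.
have e0 n : 0 < eps n by rewrite invr_gt0.
have ir n : cintegrable leb3 setT (regular (eps n) G) by exact: cintegrable_regular.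
set h := fun n => fint (-1) (regular (eps n) G).
have mh n : cmeasurable (h n) by apply: cmeasurable_fint; exact: cintegrable_meas (ir n).
have Ch := fint_cauchy (N1sqr R) ir (cvg_energy_cauchy
  (fun n => cintegrable_meas (ir n)) (L2_cmeas LG) (cvg_regular LG)).
move=> e ep; have [N hN] := Ch e ep; exists N => n Nn.
have [a1 [b1 c1]] := cvg_cauchy_itv oI; have [a2 [b2 c2]] := cvg_cauchy_itv oJ.
have [a3 [b3 c3']] := cvg_cauchy_itv oK.
rewrite /energy; apply: (fatou_cvg (f := fun k x => sqn (h n x - h (k + N)%N x))).
- by move=> k; apply: measurable_sqn; apply: cmeasurableB => //; exact: mh.
- by apply: measurable_sqn; apply: cmeasurableB; [exact: mh|exact: L2_cmeas LB].
- by move=> k x; exact: sqn_ge0.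
- by move=> x; exact: sqn_ge0.
- apply: filterS (ae_conj (ae3_neq a1 a2 a3) (ae3_neq b1 b2 b3)) => x [[x1 x2 x3] [y1 y2 y3]].
  have hx : (fun k => (c3 R ^+ 2 * ((\int[leb]_y (\1_I y * cauchy (eps k) (y - x.1))) *
     ((\int[leb]_y (\1_J y * cauchy (eps k) (y - x.2.1))) *
      (\int[leb]_y (\1_K y * cauchy (eps k) (y - x.2.2)))))))%R @ \oo --> box I J K x.
    have -> : box I J K x = c3 R ^+ 2 *
        ((2 * pi * \1_I x.1) * ((2 * pi * \1_J x.2.1) * (2 * pi * \1_K x.2.2))).
      rewrite c3_sqr /box; have := lt0r_neq0 (pi2_gt0 R); set P := 2 * pi => P0.
      by field.
    apply: cvgM; first exact: cvg_cst.
    by apply: cvgM; [exact: c1|apply: cvgM; [exact: c2|exact: c3']].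
  under eq_fun => k do rewrite {2}/h regularised_box// {1}/sqn cReD cReN cReC cImD cImN cImC subr0.
  rewrite /sqn /B cReD cReN cReC cImD cImN cImC subr0.
  apply: cvgD; last exact: cvg_cst.
  rewrite expr2; under eq_fun do rewrite expr2.
  by apply: cvgM; (apply: cvgB; [exact: cvg_cst|]);
    rewrite (cvg_shiftn N (fun k : nat => c3 R ^+ 2 * ((\int[leb]_y (\1_I y * cauchy (eps k) (y - x.1))) *
     ((\int[leb]_y (\1_J y * cauchy (eps k) (y - x.2.1))) *
      (\int[leb]_y (\1_K y * cauchy (eps k) (y - x.2.2))))))%R); exact: hx.
- by move=> k; apply: hN => //; exact: leq_addl.
Qed.

(** The regularised inversion integrals form a Cauchy sequence. Its limit is
    [f] because both have the same integral against every box, by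
    [is_fourier_swap] and [box_inversion]. *)
Lemma inversion f g : is_fourier f g ->
  cvg_energy leb3 (fun n => fint 1 (regular (eps n) g)) f.
Proof.
move=> Ffg; have [Lf Lg _] := is_fourierP Ffg; have mf := L2_cmeas Lf.
have e0 n : 0 < eps n by rewrite invr_gt0.
have ir n : cintegrable leb3 setT (regular (eps n) g) by exact: cintegrable_regular.
set h := fun n => fint 1 (regular (eps n) g).
have Lh n : L2 leb3 (h n) by apply: L2_fint => //; [exact: sqr11|exact: L2_regular].
have Ch := fint_cauchy sqr11 ir (cvg_energy_cauchy
  (fun n => cintegrable_meas (ir n)) (L2_cmeas Lg) (cvg_regular Lg)).
have [F LF hF] := Riesz_Fischer Lh Ch.
have FE : \forall x \ae leb3, F x - f x = 0.
  apply: ae0_boxes; first exact: L2B.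
  move=> I J K oI oJ oK; set B := fun y => (box I J K y)%:C.
  have LB : L2 leb3 B by exact: L2_box.
  have iB : cintegrable leb3 setT B by exact: cintegrable_box.
  have LG : L2 leb3 (fint 1 B) by apply: L2_fint => //; exact: sqr11.
  have E : cintegral leb3 setT (fun x => F x * B x) = cintegral leb3 setT (fun x => f x * B x).
    apply: (cvg_energy_cintegral Lh LF LB hF) => e ep.
    have [_ /L2P[_ ff]] := (LB, Lf).
    pose D := fine (en f) + 1.
    have D0 : 0 < D by rewrite ltr_wpDl ?fine_ge0 ?energy_ge0.
    have [N HN] := box_inversion oI oJ oK (divr_gt0 ep D0); exists N => n Nn.
    rewrite /h fint_swap//.
    have -> : cintegral leb3 setT (fun x => regular (eps n) g x * fint 1 B x) =
              cintegral leb3 setT (fun x => f x * fint (-1) (regular (eps n) (fint 1 B)) x).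
      have := is_fourier_swap Ffg (cintegrable_regular (e0 n) LG) (L2_regular (e0 n) LG).
      by move=> <-; apply: eq_cintegral => x; rewrite /regular; ring.
    have Lq : L2 leb3 (fint (-1) (regular (eps n) (fint 1 B))).
      by apply: L2_fint; [exact: N1sqr|exact: cintegrable_regular|exact: L2_regular].
    rewrite -cintegralB; [|exact: L2M_cintegrable|exact: L2M_cintegrable].
    under eq_cintegral do rewrite -mulrBr.
    have mB := cmeasurableB (L2_cmeas Lq) (L2_cmeas LB).
    rewrite -lee_fin; apply: le_trans (sqn_cintegralM leb3 mf mB) _.
    apply: (@le_trans _ _ ((fine (en f))%:E * (e / D)%:E)%E).
      rewrite fineK ?ge0_fin_numE ?energy_ge0// lee_wpmul2l ?energy_ge0//; exact: HN.
    rewrite -EFinM lee_fin mulrA ler_pdivrMr// mulrC ler_wpM2l ?(ltW ep)//.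
    by rewrite lerDl.
  transitivity (cintegral leb3 setT (fun x => F x * B x - f x * B x)).
    by apply: eq_cintegral => x; rewrite mulrBr mulrC (mulrC _ (f x)).
  by rewrite cintegralB ?E ?subrr//; exact: L2M_cintegrable.
move=> e ep; have [N HN] := hF e ep; exists N => n Nn; apply: le_trans (HN n Nn).
rewrite le_eqVlt; apply/orP; left; apply/eqP; apply: ae_eq_energy.
- by apply: cmeasurableB; [exact: L2_cmeas (Lh n)|].
- by apply: cmeasurableB; [exact: L2_cmeas (Lh n)|exact: L2_cmeas LF].
- by apply: filterS FE => x /eqP; rewrite subr_eq0 => /eqP ->.
Qed.

(** The speed of convergence is controlled by the modulus of the Fourier
    transform alone, hence uniformly along an evolution. *)
Lemma inversion_rate f g n : is_fourier f g ->
  (en (fun x => fint 1 (regular (eps n) g) x - f x)%R <=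
   2%:E * en (fun k => regular (eps n) g k - g k)%R)%E.
Proof.
move=> Ffg; have [Lf Lg _] := is_fourierP Ffg; have mf := L2_cmeas Lf.
have e0 k : 0 < eps k by rewrite invr_gt0.
have ir k : cintegrable leb3 setT (regular (eps k) g) by exact: cintegrable_regular.
have mr k := cintegrable_meas (ir k).
apply/lee_addgt0Pr => e ep; have ep2 : 0 < e / 2 by rewrite divr_gt0.
have [N HN] := inversion Ffg ep2; set k := maxn n N.
have kn : eps k <= eps n by rewrite lef_pV2 ?posrE// ler_nat ltnS leq_maxl.
apply: le_trans (energy_triangle leb3 (cmeasurable_fint 1 (mr n)) (cmeasurable_fint 1 (mr k)) mf) _.
apply: leeD; last first.
  rewrite (_ : e%:E = (2%:E * (e / 2)%:E)%E); last by rewrite -EFinM; congr EFin; field.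
  by rewrite lee_wpmul2l ?lee_fin//; apply: HN; exact: leq_maxr.
rewrite lee_wpmul2l ?lee_fin//.
have -> : (fun x => fint 1 (regular (eps n) g) x - fint 1 (regular (eps k) g) x) =
    fint 1 (fun x => regular (eps n) g x - regular (eps k) g x).
  by apply/funext => x; rewrite fintB.
apply: le_trans (energy_fint sqr11 _) _; first exact: cintegrableB.
apply: le_energy.
- exact: cmeasurableB.
- by apply: cmeasurableB => //; exact: L2_cmeas Lg.
- move=> x; rewrite /regular -mulrBl -[X in _ <= sqn (_ - X)]mul1r -mulrBl !sqnM ler_wpM2r ?sqn_ge0//.
  rewrite -2!(rmorphB (real_complex R)) !sqnC -[leLHS]sqrrN -[leRHS]sqrrN !opprB.
  have d1 (y : R) : decay (eps n) y <= decay (eps k) y.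
    by rewrite /decay ler_expR lerN2 ler_wpM2r.
  have dd : decay3 (eps n) x <= decay3 (eps k) x.
    rewrite /decay3; apply: ler_pM; rewrite ?mulr_ge0 ?decay_ge0//.
    by apply: ler_pM; rewrite ?decay_ge0.
  have := decay3_le1 x (ltW (e0 k)).
  by move: dd; set u := decay3 _ _; set v := decay3 _ _ => uv v1; rewrite ler_sqr ?nnegrE; lra.
Qed.

End inversion.

(** * Bilinear estimates on the Fourier side *)

Section bilinear.
Variable R : realType.
Local Notation leb := (@lebesgue_measure R).
Local Notation leb2 := (@leb2 R).
Local Notation leb3 := (@leb3 R).
Local Notation leb4 := (@leb4 R).
Local Notation C := (R[i]).
Implicit Types (a b : R3 R -> C).
Local Notation en := (energy leb3).

Definition phase (k : R3 R) : R := k.1 ^+ 3 - norm2 k.2 ^+ 2 / k.1.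

Lemma norm2_sqr (y : R2 R) : norm2 y ^+ 2 = y.1 ^+ 2 + y.2 ^+ 2.
Proof. by rewrite sqr_sqrtr// addr_ge0 ?sqr_ge0. Qed.

Lemma measurable_phase : measurable_fun setT phase.
Proof.
have m1 := @measurable_proj1 R; have m2 := @measurable_proj2 R; have m3 := @measurable_proj3 R.
apply: measurable_funB; first exact: measurable_funX.
apply: measurable_funM; last exact: measurable_funV.
by under eq_fun do rewrite norm2_sqr; apply: measurable_funD; exact: measurable_funX.
Qed.

Lemma symbolSE (t : R) (k : R3 R) : symbolS t k = expi (t * phase k).
Proof. by []. Qed.

Definition evolved a (z : R4 R) : C := expi (z.1 * phase z.2) * a z.2.

Lemma sqn_evolved a z : sqn (evolved a z) = sqn (a z.2).
Proof. by rewrite sqnM sqn_expi mul1r. Qed.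

Lemma cmeasurable_evolved a : cmeasurable a -> cmeasurable (evolved a).
Proof.
move=> ma; apply: cmeasurableM; last exact: (cmeasurable_comp ma measurable_snd).
apply: cmeasurable_expi; apply: measurable_funM; first exact: measurable_fst.
exact: (measurableT_comp measurable_phase measurable_snd).
Qed.

Definition bilinear (w : R3 R * R3 R -> R) a b (z : R4 R) : C :=
  cintegral leb3 setT (fun q : R3 R =>
    (w (q, z.2 - q))%:C * evolved a (z.1, q) * evolved b (z.1, z.2 - q)).

Lemma measurable_R3pair : measurable_fun setT (fun z : R3 R * R3 R => (z.2, z.1 - z.2)).
Proof. by apply/measurable_fun_pairP; split; [exact: measurable_snd|exact: measurable_R3B]. Qed.

Lemma cmeasurable_bilinear (w : R3 R * R3 R -> R) a b : measurable_fun setT w ->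
  cmeasurable a -> cmeasurable b -> cmeasurable (bilinear w a b).
Proof.
move=> mw ma mb.
pose H (z : R4 R * R3 R) := (w (z.2, z.1.2 - z.2))%:C * evolved a (z.1.1, z.2) *
  evolved b (z.1.1, z.1.2 - z.2).
suff mH : cmeasurable H by exact: (cmeasurable_cintegral leb3 mH).
have m11 : measurable_fun setT (fun z : R4 R * R3 R => z.1.1).
  exact: (measurableT_comp measurable_fst measurable_fst).
have mp : measurable_fun setT (fun z : R4 R * R3 R => (z.2, z.1.2 - z.2)).
  apply: (measurableT_comp measurable_R3pair (g := fun z : R4 R * R3 R => (z.1.2, z.2))).
  apply/measurable_fun_pairP; split; last exact: measurable_snd.
  exact: (measurableT_comp measurable_snd measurable_fst).
apply: cmeasurableM; first apply: cmeasurableM.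
- by apply: cmeasurable_real; exact: (measurableT_comp mw mp).
- apply: (cmeasurable_comp (cmeasurable_evolved ma)
    (h := fun z : R4 R * R3 R => (z.1.1, z.2))).
  by apply/measurable_fun_pairP; split => //; exact: measurable_snd.
- apply: (cmeasurable_comp (cmeasurable_evolved mb)
    (h := fun z : R4 R * R3 R => (z.1.1, z.1.2 - z.2))).
  apply/measurable_fun_pairP; split => //.
  exact: (measurableT_comp measurable_snd mp).
Qed.

Lemma energy4E (f : R4 R -> C) : cmeasurable f ->
  (energy leb4 f = \int[leb]_t en (fun x => f (t, x)))%E.
Proof.
move=> mf.
apply: (@fubini_tonelli1 _ _ _ _ R leb leb3 (fun z => (sqn (f z))%:E)).
  exact/measurable_EFinP/measurable_sqn.
by move=> z; rewrite lee_fin sqn_ge0.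
Qed.

Lemma energy4E_swap (f : R4 R -> C) : cmeasurable f ->
  (energy leb4 f = \int[leb3]_x energy leb (fun t => f (t, x)))%E.
Proof.
move=> mf; rewrite energy4E//.
apply: (@tonelli_swap _ _ _ _ R leb leb3 (fun z => (sqn (f z))%:E)).
  exact/measurable_EFinP/measurable_sqn.
by move=> z; rewrite lee_fin sqn_ge0.
Qed.

(** By [time_Schur] at fixed total frequency, the space-time norm of the
    bilinear expression is controlled by the size of the level sets of the
    resonance function. *)
Lemma bilinear_energy (w rho : R3 R * R3 R -> R) a b (B : R) :
  measurable_fun setT w -> measurable_fun setT rho -> cmeasurable a -> cmeasurable b ->
  (forall z : R3 R * R3 R, 0 <= rho z) ->
  (forall q r : R3 R, sqn ((w (q, r))%:C * a q * b r) <= rho (q, r) * (sqn (a q) * sqn (b r))) ->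
  (forall (e tau : R) (p : R3 R), 0 < e ->
    (\int[leb3]_q (rho (q, p - q) * cauchy e (tau - (phase q + phase (p - q))))%:E <= B%:E)%E) ->
  (energy leb4 (bilinear w a b) <= B%:E * (en a * en b))%E.
Proof.
move=> mw mrho ma mb rho0 hw hB.
have pairp (p : R3 R) : measurable_fun setT (fun q : R3 R => (q, p - q)).
  by apply/measurable_fun_pairP; split; [exact: measurable_id|exact: measurable_R3reflect].
have mbp (p : R3 R) : cmeasurable (fun q : R3 R => b (p - q)).
  exact: (cmeasurable_comp mb (measurable_R3reflect p)).
have mf2 : measurable_fun setT (fun z : R3 R * R3 R => sqn (a z.2) * sqn (b (z.1 - z.2))).
  apply: measurable_funM; apply: measurable_sqn.
    exact: (cmeasurable_comp ma measurable_snd).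
  exact: (cmeasurable_comp mb (h := fun z : R3 R * R3 R => z.1 - z.2) (@measurable_R3B R)).
have key (p : R3 R) : (energy leb (fun t => bilinear w a b (t, p)) <=
    B%:E * \int[leb3]_q (sqn (a q) * sqn (b (p - q)))%:E)%E.
  pose F q := (w (q, p - q))%:C * a q * b (p - q).
  pose h q := phase q + phase (p - q).
  have mh : measurable_fun setT h.
    apply: measurable_funD; first exact: measurable_phase.
    exact: (measurableT_comp measurable_phase (measurable_R3reflect p)).
  have E t : bilinear w a b (t, p) = cintegral leb3 setT (fun q : R3 R => F q * expi (t * h q)).
    have r (c x a' y b' : C) : c * (x * a') * (y * b') = c * a' * b' * (x * y) by ring.
    by apply: eq_cintegral => q; rewrite /h mulrDr expiD; exact: r.
  have mF : cmeasurable F.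
    have mwp : cmeasurable (fun q : R3 R => (w (q, p - q))%:C).
      by apply: cmeasurable_real; exact: (measurableT_comp mw (pairp p)).
    exact: (cmeasurableM (cmeasurableM mwp ma) (mbp p)).
  have B0 : 0 <= B.
    rewrite -lee_fin; apply: le_trans (hB 1 0 p ltr01); apply: integral_ge0 => q _.
    by rewrite lee_fin mulr_ge0// cauchy_ge0.
  have [Fi|nFi] := pselect (cintegrable leb3 setT F); last first.
    have -> : (fun t => bilinear w a b (t, p)) = (fun=> 0).
      apply/funext => t; rewrite E cintegral_notint// => /cintegrableP[_ fi].
      apply: nFi; apply/cintegrableP; split => //; apply: le_lt_trans fi.
      by rewrite /absint; under [leRHS]eq_integral do rewrite normcMr normc_expi mulr1.
    rewrite /energy; under eq_integral do rewrite sqn0.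
    rewrite integral0 mule_ge0 ?lee_fin//; apply: integral_ge0 => q _.
    by rewrite lee_fin mulr_ge0 ?sqn_ge0.
  under eq_fun do rewrite E.
  apply: (time_Schur (h := h) (F := F) (rho := fun q : R3 R => rho (q, p - q))
    (f2 := fun q : R3 R => sqn (a q) * sqn (b (p - q)))) => //.
  - exact: (measurableT_comp mrho (pairp p)).
  - by apply: measurable_funM; apply: measurable_sqn.
  - by move=> q; rewrite mulr_ge0 ?sqn_ge0.
  - by move=> q; exact: hw.
  - by move=> e tau e0; exact: hB.
have B0 : 0 <= B.
  rewrite -lee_fin; apply: le_trans (hB 1 0 0 ltr01); apply: integral_ge0 => q _.
  by rewrite lee_fin mulr_ge0// cauchy_ge0.
have mG : measurable_fun setT (fun z : R3 R * R3 R => (sqn (a z.2) * sqn (b (z.1 - z.2)))%:E).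
  exact/measurable_EFinP.
have G0 (z : R3 R * R3 R) : (0 <= (sqn (a z.2) * sqn (b (z.1 - z.2)))%:E)%E.
  by rewrite lee_fin mulr_ge0 ?sqn_ge0.
have mT := cmeasurable_bilinear mw ma mb.
rewrite energy4E_swap//.
apply: (@le_trans _ _ (\int[leb3]_p (B%:E * \int[leb3]_q (sqn (a q) * sqn (b (p - q)))%:E))%E).
  apply: ge0_le_integral; first exact: measurableT.
  - by move=> p _; exact: energy_ge0.
  - have mT2 : measurable_fun setT (fun z : R3 R * R => (sqn (bilinear w a b (z.2, z.1)))%:E).
      apply/measurable_EFinP/measurable_sqn.
      apply: (cmeasurable_comp mT (h := fun z : R3 R * R => (z.2, z.1))).
      by apply/measurable_fun_pairP; split; [exact: measurable_snd|exact: measurable_fst].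
    apply: (@measurable_integral2 _ _ _ _ R leb _ mT2).
    by move=> z; rewrite lee_fin sqn_ge0.
  - apply: measurable_funeM.
    exact: (@measurable_integral2 _ _ _ _ R leb3 _ mG G0).
  - by move=> p _; exact: key.
have B0' : (0 <= B%:E)%E by rewrite lee_fin.
rewrite (ge0_integralZl _ measurableT (@measurable_integral2 _ _ _ _ R leb3 _ mG G0)
  (fun p _ => integral_ge0 _ (fun q _ => G0 (p, q))) B0').
rewrite lee_wpmul2l ?lee_fin// (@tonelli_swap _ _ _ _ R leb3 leb3 _ mG G0).
have eb q : (\int[leb3]_p (sqn (a q) * sqn (b (p - q)))%:E = (sqn (a q))%:E * en b)%E.
  under eq_integral do rewrite EFinM.
  have mbs : measurable_fun setT (fun p : R3 R => (sqn (b p))%:E).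
    exact/measurable_EFinP/measurable_sqn.
  rewrite ge0_integralZl//; last 3 first.
  - by apply/measurable_EFinP/measurable_sqn; exact: (cmeasurable_comp mb (measurable_R3D (- q))).
  - by move=> p _; rewrite lee_fin sqn_ge0.
  - by rewrite lee_fin sqn_ge0.
  congr (_ * _)%E; apply: (integral3_shift (- q) mbs).
  by move=> y; rewrite lee_fin sqn_ge0.
under eq_integral do rewrite /= eb.
rewrite ge0_integralZr ?energy_ge0//.
  exact/measurable_EFinP/measurable_sqn.
by move=> q _; rewrite lee_fin sqn_ge0.
Qed.

End bilinear.

(** * Level sets of the resonance function *)

Section resonance.
Variable R : realType.
Local Notation leb := (@lebesgue_measure R).
Local Notation leb2 := (@leb2 R).
Local Notation leb3 := (@leb3 R).

Lemma integral_arctan_density : (\int[leb]_s ((1 + s ^+ 2)^-1)%:E <= pi%:E :> \bar R)%E.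
Proof.
have := @integral_cauchy_le R 1 0 ltr01.
have -> : (\int[leb]_x (cauchy 1 (0 - x))%:E = 2%:E * \int[leb]_s ((1 + s ^+ 2)^-1)%:E)%E.
  rewrite -ge0_integralZl//.
  - by apply: eq_integral => s _; rewrite sub0r cauchyN /cauchy expr1n mulr1 EFinM.
  - apply/measurable_EFinP/measurable_funV; apply: measurable_funD => //.
  - by move=> s _; rewrite lee_fin invr_ge0 addr_ge0 ?sqr_ge0.
by rewrite EFinM lee_pmul2l// lte_fin.
Qed.

(** Polar coordinates without angles: the substitution z = (z1, z1 s). *)
Lemma integral2_cauchy_sqr (A tau e : R) : 0 < A -> 0 < e ->
  (\int[leb2]_z (cauchy e (tau - A * (z.1 ^+ 2 + z.2 ^+ 2)))%:E <= (2 * pi ^+ 2 / A)%:E)%E.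
Proof.
move=> A0 e0.
have mc (d : measure_display) (T : measurableType d) (f : T -> R) : measurable_fun setT f ->
    measurable_fun setT (fun z : T => cauchy e (tau - f z)).
  by move=> mf; apply: (measurableT_comp (measurable_cauchy e)); exact: measurable_funB.
have mfst : measurable_fun setT (fun z : R2 R => z.1 : R) by exact: measurable_fst.
have msnd : measurable_fun setT (fun z : R2 R => z.2 : R) by exact: measurable_snd.
have mf : measurable_fun setT (fun z : R2 R => (cauchy e (tau - A * (z.1 ^+ 2 + z.2 ^+ 2)))%:E).
  apply/measurable_EFinP/mc; apply: measurable_funM => //.
  by apply: measurable_funD; exact: measurable_funX.
rewrite tonelli2//; last by move=> z; rewrite lee_fin cauchy_ge0.
pose G (z : R2 R) : \bar R := (`|z.1| * cauchy e (tau - A * (1 + z.2 ^+ 2) * z.1 ^+ 2))%:E.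
have mG : measurable_fun setT G.
  apply/measurable_EFinP; apply: measurable_funM; first exact: measurableT_comp.
  apply: mc; apply: measurable_funM; last exact: measurable_funX.
  by apply: measurable_funM => //; apply: measurable_funD => //; exact: measurable_funX.
have G0 z : (0 <= G z)%E by rewrite lee_fin mulr_ge0// cauchy_ge0.
have -> : (\int[leb]_x \int[leb]_y (cauchy e (tau - A * (x ^+ 2 + y ^+ 2)))%:E =
           \int[leb]_x \int[leb]_s G (x, s))%E.
  apply: ae_eq_integral => //.
  - apply: (@measurable_integral2 _ _ _ _ R leb _ mf).
    by move=> z; rewrite lee_fin cauchy_ge0.
  - exact: (@measurable_integral2 _ _ _ _ R leb _ mG G0).
  - apply: (ae_imp (ae_neq (0 : R))) => x x0 _ /=.
    have mg : measurable_fun setT (fun y : R => (cauchy e (tau - A * (x ^+ 2 + y ^+ 2)))%:E).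
      apply/measurable_EFinP/mc; apply: measurable_funM => //.
      by apply: measurable_funD => //; exact: measurable_funX.
    rewrite -(integral_affine 0 x0 mg); last by move=> y; rewrite lee_fin cauchy_ge0.
    rewrite -ge0_integralZl//.
    + apply: eq_integral => s _; rewrite /G /= addr0 EFinM; congr (_ * (cauchy e (tau - _))%:E)%E.
      by rewrite exprMn; ring.
    + by apply: (measurableT_comp mg); exact: measurable_affine.
    + by move=> s _; rewrite lee_fin cauchy_ge0.
rewrite (@tonelli_swap _ _ _ _ R leb leb _ mG G0).
apply: (@le_trans _ _ (\int[leb]_s ((2 * pi / A)%:E * ((1 + s ^+ 2)^-1)%:E))%E).
  apply: ge0_le_integral => //.
  - by move=> s _; apply: integral_ge0 => x _; exact: (G0 (x, s)).
  - have mG' : measurable_fun setT (fun z : R2 R => G (z.2, z.1)).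
      apply: (measurableT_comp mG).
      by apply/measurable_fun_pairP; split; [exact: measurable_snd|exact: measurable_fst].
    by apply: (@measurable_integral2 _ _ _ _ R leb _ mG') => z; exact: G0.
  - apply: measurable_funeM; apply/measurable_EFinP/measurable_funV.
    by apply: measurable_funD => //; exact: measurable_funX.
  - move=> s _; have s0 : 0 < A * (1 + s ^+ 2) by rewrite mulr_gt0// ltr_pwDl// sqr_ge0.
    apply: le_trans (integral_cauchy_sqr_le tau s0 e0) _.
    by rewrite -EFinM lee_fin invfM mulrA.
rewrite ge0_integralZl//.
- rewrite (_ : 2 * pi ^+ 2 / A = 2 * pi / A * pi); last by ring.
  rewrite [leRHS]EFinM; apply: lee_wpmul2l; last exact: integral_arctan_density.
  by rewrite lee_fin divr_ge0 ?mulr_ge0 ?pi_ge0// ltW.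
- apply/measurable_EFinP/measurable_funV.
  by apply: measurable_funD => //; exact: measurable_funX.
- by move=> s _; rewrite lee_fin invr_ge0 addr_ge0 ?sqr_ge0.
- by rewrite lee_fin divr_ge0 ?mulr_ge0 ?pi_ge0 ?ltW.
Qed.

(** For frequencies of the same sign the phase is a definite quadratic form
    in the transversal frequency; completing the square reduces to the
    previous lemma. *)
Lemma same_sign_level_sets (mu e tau : R) (p : R3 R) : 0 < mu -> 0 < e ->
  (\int[leb3]_q (((0 < q.1 < mu) && (0 < (p - q).1))%:R *
     cauchy e (tau - (phase q + phase (p - q))))%:E <= (2 * pi ^+ 2 * mu ^+ 2)%:E)%E.
Proof.
move=> mu0 e0.
pose f (q : R3 R) := ((0 < q.1 < mu) && (0 < (p - q).1))%:R *
  cauchy e (tau - (phase q + phase (p - q))).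
have m1 : measurable_fun setT (fun q : R3 R => q.1) by exact: measurable_proj1.
have mb : measurable_fun setT (fun q : R3 R => ((0 < q.1 < mu) && (0 < (p - q).1) : bool)).
  apply: measurable_and; first apply: measurable_and.
  - exact: measurable_fun_ltr.
  - exact: measurable_fun_ltr.
  - apply: measurable_fun_ltr => //; apply: measurable_funB => //.
have mf : measurable_fun setT (fun q => (f q)%:E).
  apply/measurable_EFinP; apply: measurable_funM.
    exact: (measurableT_comp (f := fun b : bool => b%:R : R)).
  apply: (measurableT_comp (measurable_cauchy e)); apply: measurable_funB => //.
  apply: measurable_funD; first exact: measurable_phase.
  exact: (measurableT_comp (@measurable_phase R) (measurable_R3reflect p)).
have f0 q : (0 <= (f q)%:E)%E by rewrite lee_fin mulr_ge0 ?cauchy_ge0.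
rewrite (_ : (\int[leb3]_q _)%E = (\int[leb3]_q (f q)%:E)%E)// tonelli3//.
have inner x : (\int[leb2]_y (f (x, y))%:E <= (2 * pi ^+ 2 * mu)%:E * (\1_(`]0, mu[%classic) x)%:E)%E.
  have [/andP[/andP[x0 xmu] y0]|nx] := boolP ((0 < x < mu) && (0 < p.1 - x)); last first.
    rewrite (_ : (\int[leb2]_y _)%E = 0%E).
      by rewrite -EFinM lee_fin !mulr_ge0// ?pi_ge0// ltW.
    apply: integral0_eq => y _; rewrite /f (_ : (_ && _) = false) ?mul0r//; exact: negbTE.
  rewrite indicE mem_setE /= in_itv /= x0 xmu /= mule1.
  set Y := p.1 - x in y0 *; set A := x^-1 + Y^-1.
  have A0 : 0 < A by rewrite addr_gt0 ?invr_gt0.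
  have Amu : ((2 * pi ^+ 2 / A)%:E <= (2 * pi ^+ 2 * mu)%:E)%E.
    rewrite lee_fin; apply: ler_wpM2l; first by rewrite mulr_ge0 ?sqr_ge0.
    rewrite -(invrK mu) lef_pV2 ?posrE ?invr_gt0//.
    by apply: (@le_trans _ _ x^-1); [rewrite lef_pV2 ?posrE// ltW|rewrite lerDl invr_ge0 ltW].
  apply: le_trans Amu.
  pose t' := - (tau - x ^+ 3 - Y ^+ 3 + (p.2.1 ^+ 2 + p.2.2 ^+ 2) / (x + Y)).
  apply: le_trans (integral2_cauchy_sqr t' A0 e0).
  have mfx : measurable_fun setT (fun y : R2 R => (f (x, y))%:E).
    apply: (measurableT_comp mf (g := fun y : R2 R => (x, y))).
    by apply/measurable_fun_pairP; split; [exact: measurable_cst|exact: measurable_id].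
  have := integral2_affine (p.2.1 * x / (x + Y)) (p.2.2 * x / (x + Y)) (oner_neq0 R) mfx
    (fun y => f0 (x, y)).
  rewrite expr1n mul1e => <-; rewrite le_eqVlt; apply/orP; left; apply/eqP.
  apply: eq_integral => y _; congr EFin; rewrite /f /phase /= x0 xmu -/Y y0 /= mul1r !norm2_sqr /=.
  rewrite -(cauchyN e (t' - _)); congr (cauchy e _); rewrite /t' /A !mul1r.
  have xn : x != 0 by rewrite gt_eqF.
  have yn : Y != 0 by rewrite gt_eqF.
  have xyn : x + Y != 0 by rewrite gt_eqF// addr_gt0.
  move: (Y) xn yn xyn => y' xn yn xyn; move: (p.2.1) (p.2.2) => P1 P2; field.
  by rewrite xn yn xyn.
apply: (@le_trans _ _ (\int[leb]_x ((2 * pi ^+ 2 * mu)%:E * (\1_(`]0, mu[%classic) x)%:E))%E).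
  apply: ge0_le_integral => //.
  - by move=> x _; apply: integral_ge0 => y _.
  - by apply: (@measurable_integral2 _ _ _ _ R leb2 _ mf) => z; exact: f0.
  - by apply: measurable_funeM; apply/measurable_EFinP; exact: measurable_indic.
have c0 : 0 <= 2 * pi ^+ 2 * mu := mulr_ge0 (mulr_ge0 (ler0n _ 2) (sqr_ge0 pi)) (ltW mu0).
rewrite ge0_integralZl; [|exact: measurableT|by apply/measurable_EFinP; exact: measurable_indic
  |by move=> x _; rewrite lee_fin|by rewrite lee_fin].
have -> : (\int[leb]_x (\1_(`]0%R, mu[%classic) x)%:E = mu%:E :> \bar R)%E.
  transitivity (leb `]0, mu[%classic); first by rewrite integral_indic// setIT.
  by rewrite lebesgue_measure_itv/= lte_fin mu0 -EFinB subr0.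
by rewrite -EFinM lee_fin [mu ^+ 2]expr2 !mulrA.
Qed.

Section fixed_slope.
Variables (lam xi s1 s2 eta1 eta2 : R).

(** The resonance function along the line of first frequencies (x, x s), the
    total frequency (xi, eta) being fixed. *)
Definition resonance (x : R) : R :=
  - x ^+ 3 - (xi - x) ^+ 3 + x * (s1 ^+ 2 + s2 ^+ 2) +
  ((eta1 - x * s1) ^+ 2 + (eta2 - x * s2) ^+ 2) * (xi - x)^-1.

Definition transversality : R := (xi * s1 - eta1) ^+ 2 + (xi * s2 - eta2) ^+ 2.

Definition resonance' (x : R) : R :=
  3 * (xi - x) ^+ 2 - 3 * x ^+ 2 + transversality * ((xi - x) ^+ 2)^-1.

Lemma is_derive_resonance x : xi - x != 0 -> is_derive x 1 resonance (resonance' x).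
Proof.
move=> y0.
have dx := isd_id x; have dy := isdD (isd_cst xi x) (isdN dx).
have dN (et s : R) := isdX 2 (isdD (isd_cst et x) (isdN (isdM dx (isd_cst s x)))).
have dy3 := isdX 3 dy; have dx3 := isdX 3 dx; have dyV := @isdV R (fun y => xi - y) x _ y0 dy.
have d1 := isdD (@isdN R (fun y => y ^+ 3) x _ dx3) (@isdN R (fun y => (xi - y) ^+ 3) x _ dy3).
have d2 := isdD d1 (isdM dx (isd_cst (s1 ^+ 2 + s2 ^+ 2) x)).
have d3 := isdM (isdD (dN eta1 s1) (dN eta2 s2)) dyV.
have := isdD d2 d3.
move/is_derive_eq; apply; rewrite /resonance' /transversality /=.
field; exact: y0.
Qed.

Lemma continuous_resonance' x : xi - x != 0 -> {for x, continuous resonance'}.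
Proof.
move=> y0; have dx := isd_id x; have dy := isdX 2 (isdD (isd_cst xi x) (isdN dx)).
have y2 : (xi - x) ^+ 2 != 0 by rewrite sqrf_eq0.
have d1 := isdM (isd_cst 3 x) dy; have d2 := isdM (isd_cst 3 x) (isdX 2 dx).
have d3 := isdM (isd_cst transversality x) (@isdV R (fun y => (xi - y) ^+ 2) x _ y2 dy).
exact: (isd_continuous (isdD (isdD d1 (@isdN R (fun y => 3 * y ^+ 2) x _ d2)) d3)).
Qed.

Definition weight x : R := lam + Num.sqrt (transversality / (xi - x) ^+ 2).

Lemma transversality_ge0 : 0 <= transversality.
Proof. by rewrite addr_ge0 ?sqr_ge0. Qed.

(** Both under strong separation of the first frequencies and under
    transversality of the two waves, the weight is dominated by the
    group velocity difference. *)
Lemma weight_le (mu x : R) : 0 < mu -> 0 < lam ->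
  (mu <= lam / 8) || ((mu <= lam) && (64 * lam ^+ 4 <= transversality)) ->
  mu <= `|x| <= 2 * mu -> lam <= `|xi - x| <= 2 * lam ->
  weight x ^+ 2 <= 5 * resonance' x.
Proof.
move=> mu0 lam0 hc /andP[_ xu] /andP[yl yu]; rewrite /weight /resonance'.
have x2 : x ^+ 2 <= 4 * mu ^+ 2.
  rewrite -real_normK ?num_real// (_ : 4 * mu ^+ 2 = (2 * mu) ^+ 2); last by ring.
  by rewrite ler_sqr ?nnegrE ?mulr_ge0// ltW.
have y2l : lam ^+ 2 <= (xi - x) ^+ 2.
  by rewrite -[leRHS]real_normK ?num_real// ler_sqr ?nnegrE// ltW.
have y2u : (xi - x) ^+ 2 <= 4 * lam ^+ 2.
  rewrite -[leLHS]real_normK ?num_real// (_ : 4 * lam ^+ 2 = (2 * lam) ^+ 2); last by ring.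
  by rewrite ler_sqr ?nnegrE ?mulr_ge0// ltW.
have y2 : 0 < (xi - x) ^+ 2 by apply: lt_le_trans y2l; rewrite exprn_gt0.
have dsq : Num.sqrt (transversality / (xi - x) ^+ 2) ^+ 2 = transversality * ((xi - x) ^+ 2)^-1.
  by rewrite sqr_sqrtr// divr_ge0 ?transversality_ge0// ltW.
have d0 := sqrtr_ge0 (transversality / (xi - x) ^+ 2).
move: dsq d0; set dd := Num.sqrt _ => dsq d0; rewrite -dsq.
case/orP: hc => [m8|/andP[ml tr]].
  have m2 : mu ^+ 2 <= lam ^+ 2 / 64.
    rewrite (_ : lam ^+ 2 / 64 = (lam / 8) ^+ 2); last by field.
    by rewrite ler_sqr ?nnegrE ?divr_ge0// ltW.
  by have := sqr_ge0 (lam - dd); move: (x ^+ 2) ((xi - x) ^+ 2) x2 y2l y2u => X Y; nra.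
have m2 : mu ^+ 2 <= lam ^+ 2 by rewrite ler_sqr ?nnegrE// ltW.
have d2 : (4 * lam) ^+ 2 <= dd ^+ 2.
  rewrite dsq ler_pdivlMr//; apply: le_trans tr.
  rewrite (_ : 64 * lam ^+ 4 = (4 * lam) ^+ 2 * (4 * lam ^+ 2)); last by ring.
  by rewrite ler_wpM2l ?sqr_ge0.
have d4 : 4 * lam <= dd by move: d2; rewrite ler_sqr ?nnegrE ?mulr_ge0// ltW.
by move: (x ^+ 2) ((xi - x) ^+ 2) x2 y2l y2u => X Y; nra.
Qed.

Lemma measurable_weighted_cauchy (e tau : R) :
  measurable_fun setT (fun x => weight x ^+ 2 * cauchy e (tau + resonance x)).
Proof.
have mx : measurable_fun setT (fun x : R => xi - x) by exact: measurable_funB.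
have ma (u v : R) : measurable_fun setT (fun x : R => (u - x * v) ^+ 2).
  by apply: measurable_funX; apply: measurable_funB => //; exact: measurable_funM.
have mr : measurable_fun setT resonance.
  apply: measurable_funD; last first.
    by apply: measurable_funM; [exact: measurable_funD|exact: measurable_funV].
  apply: measurable_funD; last exact: measurable_funM.
  apply: measurable_funB; last exact: measurable_funX.
  by apply: measurableT_comp => //; exact: measurable_funX.
apply: measurable_funM.
  apply: measurable_funX; apply: measurable_funD => //.
  apply: (measurableT_comp (f := @Num.sqrt R)).
    by apply: continuous_measurable_fun; exact: sqrt_continuous.
  apply: measurable_funM => //.
  by apply: measurable_funV; exact: measurable_funX.
by apply: (measurableT_comp (measurable_cauchy e)); exact: measurable_funD.
Qed.

Lemma integral_piece (lo hi e tau : R) : 0 < e ->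
  (forall x, lo <= x <= hi -> xi - x != 0) ->
  (forall x, lo <= x <= hi -> weight x ^+ 2 <= 5 * resonance' x) ->
  (\int[leb]_x ((lo <= x <= hi)%R%:R * (weight x ^+ 2 * cauchy e (tau + resonance x)))%:E
    <= (10 * pi)%:E)%E.
Proof.
move=> e0 y0 hw; have [lh|hl] := leP lo hi; last first.
  rewrite (_ : (\int[leb]_x _)%E = 0%E) ?lee_fin ?mulr_ge0 ?pi_ge0//.
  apply: integral0_eq => x _; rewrite (_ : (lo <= x <= hi) = false) ?mul0r//.
  apply/negbTE/negP => /andP[a b]; have := lt_le_trans hl (le_trans a b).
  by rewrite ltxx.
have h := cauchy_subst_le (- tau) e0 lh (fun x hx => is_derive_resonance (y0 x hx))
  (fun x hx => continuous_resonance' (y0 x hx)).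
have -> : (\int[leb]_x ((lo <= x <= hi)%R%:R * (weight x ^+ 2 * cauchy e (tau + resonance x)))%:E =
   \int[leb]_(x in `[lo, hi]) (weight x ^+ 2 * cauchy e (tau + resonance x))%:E)%E.
  rewrite [RHS]integral_mkcond; apply: eq_integral => x _.
  by rewrite /patch mem_setE /= in_itv /=; case: ifP => _; rewrite ?mul1r ?mul0r.
have ce x : cauchy e (tau + resonance x) = cauchy e (- tau - resonance x).
  by rewrite -opprD cauchyN.
have mres : measurable_fun `[lo, hi] (fun x => (resonance' x * cauchy e (- tau - resonance x))%:E).
  apply/measurable_EFinP; apply: subspace_continuous_measurable_fun => //.
  apply: continuous_in_subspaceT => x; rewrite inE /= in_itv /= => hx.
  apply: cvgM; first exact: continuous_resonance' (y0 x hx).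
  have hc : {for x, continuous (cauchy e \o (fun x => - tau - resonance x))}.
    apply: continuous_comp; last exact: continuous_cauchy.
    by apply: cvgB; [exact: cvg_cst|exact: isd_continuous (is_derive_resonance (y0 x hx))].
  exact: hc.
apply: (@le_trans _ _ (\int[leb]_(x in `[lo, hi]) (5%:E * (resonance' x * cauchy e (- tau - resonance x))%:E))%E).
  apply: ge0_le_integral => //.
  - by move=> x _; rewrite lee_fin mulr_ge0 ?sqr_ge0 ?cauchy_ge0.
  - by apply: measurable_funTS; apply/measurable_EFinP; exact: measurable_weighted_cauchy.
  - exact: measurable_funeM.
  - move=> x /=; rewrite in_itv /= => hx; rewrite ce -EFinM lee_fin (mulrA 5).
    by rewrite ler_wpM2r ?cauchy_ge0//; exact: hw.
rewrite ge0_integralZl//; last first.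
  move=> x /=; rewrite in_itv /= => hx; rewrite lee_fin mulr_ge0 ?cauchy_ge0//.
  by rewrite -(pmulr_rge0 _ (_ : 0 < 5 :> R))//; apply: le_trans (hw x hx); exact: sqr_ge0.
rewrite (_ : (10 * pi)%:E = (5%:E * (2 * pi)%:E)%E); last by rewrite -EFinM; congr EFin; ring.
by apply: lee_wpmul2l => //; rewrite lee_fin.
Qed.

(** The two annuli meet in at most four intervals. On each of them [weight_le]
    and the substitution [tau + resonance x] give at most 5 * 2 pi. *)
Lemma integral_level_sets (mu e tau : R) : 0 < mu -> 0 < lam -> 0 < e ->
  (mu <= lam / 8) || ((mu <= lam) && (64 * lam ^+ 4 <= transversality)) ->
  (\int[leb]_x (((mu < `|x| <= 2 * mu) && (lam <= `|xi - x| < 2 * lam))%:R *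
     (weight x ^+ 2 * cauchy e (tau + resonance x)))%:E <= (40 * pi)%:E)%E.
Proof.
move=> mu0 lam0 e0 hc.
pose G x := weight x ^+ 2 * cauchy e (tau + resonance x).
have mG : measurable_fun setT G by exact: measurable_weighted_cauchy.
have G0 x : 0 <= G x by rewrite mulr_ge0 ?sqr_ge0 ?cauchy_ge0.
pose P (a b c d : R) x := (Num.max a c <= x <= Num.min b d)%R%:R * G x.
have PE a b c d x : P a b c d x = ((a <= x <= b) && (c <= x <= d))%:R * G x.
  by rewrite /P ge_max le_min; congr (_%:R * _); congr nat_of_bool;
    case: (a <= x); case: (c <= x); case: (x <= b); case: (x <= d).
have mP a b c d : measurable_fun setT (P a b c d).
  apply: measurable_funM => //; apply: (measurableT_comp (f := fun b : bool => b%:R : R)) => //.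
  by apply: measurable_and; exact: measurable_fun_ler.
have P0 a b c d x : 0 <= P a b c d x by rewrite mulr_ge0.
have bound a b c d : (forall x, a <= x <= b -> mu <= `|x| <= 2 * mu) ->
    (forall x, c <= x <= d -> lam <= `|xi - x| <= 2 * lam) ->
    (\int[leb]_x (P a b c d x)%:E <= (10 * pi)%:E)%E.
  move=> h1 h2; have hh x : Num.max a c <= x <= Num.min b d -> a <= x <= b /\ c <= x <= d.
    by rewrite ge_max le_min => /andP[/andP[-> ->] /andP[-> ->]].
  apply: integral_piece => // x /hh[/h1 hx /h2 hy]; last exact: weight_le hx hy.
  by rewrite -normr_gt0; apply: lt_le_trans lam0 _; case/andP: hy.
have xpos x : mu <= x <= 2 * mu -> mu <= `|x| <= 2 * mu.
  by move=> /andP[a b]; rewrite ger0_norm ?a//; apply: le_trans a; exact: ltW.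
have xneg x : - (2 * mu) <= x <= - mu -> mu <= `|x| <= 2 * mu.
  move=> h; rewrite -normrN; apply: xpos.
  by move: h => /andP[a b]; rewrite lerNr b lerNl a.
have ypos x : xi - 2 * lam <= x <= xi - lam -> lam <= `|xi - x| <= 2 * lam.
  move=> /andP[a b]; rewrite ger0_norm; last by apply: le_trans (ltW lam0) _; rewrite lerBrDr addrC -lerBrDr.
  by apply/andP; split; lra.
have yneg x : xi + lam <= x <= xi + 2 * lam -> lam <= `|xi - x| <= 2 * lam.
  move=> /andP[a b]; rewrite distrC ger0_norm; last by rewrite subr_ge0; apply: le_trans a; rewrite lerDl ltW.
  by apply/andP; split; lra.
have b1 := bound _ _ _ _ xpos ypos; have b2 := bound _ _ _ _ xpos yneg.
have b3 := bound _ _ _ _ xneg ypos; have b4 := bound _ _ _ _ xneg yneg.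
have E : (40 * pi)%:E = ((10 * pi)%:E + (10 * pi)%:E + ((10 * pi)%:E + (10 * pi)%:E))%E :> \bar R.
  by rewrite -!EFinD; congr EFin; ring.
rewrite E; apply: le_trans (leeD (leeD b1 b2) (leeD b3 b4)).
have D (g h : R -> R) (mg : measurable_fun setT g) (mh : measurable_fun setT h)
    (g0 : forall x, 0 <= g x) (h0 : forall x, 0 <= h x) :
    (\int[leb]_x (g x)%:E + \int[leb]_x (h x)%:E = \int[leb]_x (g x + h x)%:E)%E.
  have mgE := (measurable_EFinP _ _).2 mg; have mhE := (measurable_EFinP _ _).2 mh.
  by rewrite -ge0_integralD// => x _; rewrite lee_fin.
rewrite !D//; do ?[exact: measurable_funD|by move=> x; rewrite addr_ge0].
have bl (a b c d : bool) : a || b -> c || d ->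
    1 <= (a && c)%:R + (a && d)%:R + ((b && c)%:R + (b && d)%:R) :> R.
  by rewrite -!natrD (ler_nat R 1); case: a; case: b; case: c; case: d.
have mreg : measurable_fun setT (fun x : R => ((mu < `|x| <= 2 * mu) && (lam <= `|xi - x| < 2 * lam) : bool)).
  have n1 : measurable_fun setT (fun x : R => `|x|) by exact: measurableT_comp.
  have n2 : measurable_fun setT (fun x : R => `|xi - x|).
    by apply: measurableT_comp => //; exact: measurable_funB.
  by apply: measurable_and; apply: measurable_and; do ?[exact: measurable_fun_ltr|exact: measurable_fun_ler].
apply: ge0_le_integral => //.
- by move=> x _; rewrite lee_fin mulr_ge0 ?G0.
- apply/measurable_EFinP; apply: measurable_funM => //.
  exact: (measurableT_comp (f := fun b : bool => b%:R : R)).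
- apply/measurable_EFinP.
  exact: (measurable_funD (measurable_funD (mP _ _ _ _) (mP _ _ _ _)) (measurable_funD (mP _ _ _ _) (mP _ _ _ _))).
- move=> x _; rewrite lee_fin !PE -!mulrDl ler_wpM2r ?(G0 x)//.
  case: (boolP ((mu < `|x| <= 2 * mu) && _)) => [/andP[/andP[x1 x2] /andP[y1 y2]]|_]; last first.
    by rewrite !addr_ge0.
  have hx : (mu <= x <= 2 * mu) || (- (2 * mu) <= x <= - mu).
    have [x0|x0] := leP 0 x; move: x1 x2; [rewrite ger0_norm//|rewrite ltr0_norm//] => x1 x2.
      by rewrite (ltW x1) x2.
    by apply/orP; right; apply/andP; split; clear - x0 x1 x2; lra.
  have hy : (xi - 2 * lam <= x <= xi - lam) || (xi + lam <= x <= xi + 2 * lam).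
    have [y0|y0] := leP 0 (xi - x); move: y1 y2; [rewrite ger0_norm//|rewrite ltr0_norm//] => y1 y2.
      by apply/orP; left; apply/andP; split; clear - y0 y1 y2; lra.
    by apply/orP; right; apply/andP; split; clear - y0 y1 y2; lra.
  exact: bl hx hy.
Qed.

End fixed_slope.

(** The change of variables eta = x s has Jacobian x^2. *)
Lemma integral3_slope (f : R3 R -> \bar R) : measurable_fun setT f -> (forall q, 0 <= f q)%E ->
  (forall y, f (0, y) = 0%E) ->
  (\int[leb3]_q f q =
   \int[leb2]_s \int[leb]_x ((x ^+ 2)%:E * f (x, (x * s.1, x * s.2)%R)))%E.
Proof.
move=> mf f0 fz; rewrite tonelli3//.
pose G (z : R * R2 R) : \bar R := ((z.1 ^+ 2)%:E * f (z.1, (z.1 * z.2.1, z.1 * z.2.2)%R))%E.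
have m1 : measurable_fun setT (fun z : R * R2 R => z.1) by exact: measurable_fst.
have m2 : measurable_fun setT (fun z : R * R2 R => (z.1, (z.1 * z.2.1, z.1 * z.2.2))).
  apply/measurable_fun_pairP; split => //; apply/measurable_fun_pairP; split.
    by apply: measurable_funM => //; exact: measurable_proj2.
  by apply: measurable_funM => //; exact: measurable_proj3.
have mG : measurable_fun setT G.
  apply: emeasurable_funM; last exact: (measurableT_comp mf m2).
  by apply/measurable_EFinP; exact: measurable_funX.
have G0 z : (0 <= G z)%E by rewrite mule_ge0 ?lee_fin ?sqr_ge0.
transitivity (\int[leb]_x \int[leb2]_s G (x, s))%E; last first.
  exact: (@tonelli_swap _ _ _ _ R leb leb2 _ mG G0).
apply: eq_integral => x _; have [->|x0] := eqVneq x 0.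
  transitivity (0%E : \bar R); first by apply: integral0_eq => y _; exact: fz.
  by apply/esym/integral0_eq => y _; rewrite /G /= expr0n mul0e.
have mfx : measurable_fun setT (fun y : R2 R => f (x, y)).
  apply: (measurableT_comp mf (g := fun y : R2 R => (x, y))).
  by apply/measurable_fun_pairP; split; [exact: measurable_cst|exact: measurable_id].
rewrite -(integral2_affine 0 0 x0 mfx) //.
rewrite -ge0_integralZl//.
- by apply: eq_integral => s _; rewrite /G /= !addr0.
- apply: (measurableT_comp mfx (g := fun y : R2 R => (x * y.1 + 0, x * y.2 + 0))).
  apply/measurable_fun_pairP; split; apply: measurable_funD => //; apply: measurable_funM => //.
- by rewrite lee_fin sqr_ge0.
Qed.

Lemma measurable_slope : measurable_fun setT (@slope R).
Proof.
have mV : measurable_fun setT (fun k : R3 R => k.1^-1).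
  by apply: measurable_funV; exact: measurable_proj1.
apply/measurable_fun_pairP; split; apply: measurable_funM => //.
  exact: measurable_proj2.
exact: measurable_proj3.
Qed.

Definition sector_weight (lam : R) (z : R3 R * R3 R) : R := lam + norm2 (slope z.1 - slope z.2).

Definition sector_transversality (z : R3 R * R3 R) : R :=
  transversality (z.1.1 + z.2.1) (slope z.1).1 (slope z.1).2
    (z.1.2.1 + z.2.2.1) (z.1.2.2 + z.2.2.2).

Definition sector_region (lam mu : R) (z : R3 R * R3 R) : bool :=
  ((mu < `|z.1.1| <= 2 * mu) && (lam <= `|z.2.1| < 2 * lam)) &&
  ((mu <= lam / 8) || ((mu <= lam) && (64 * lam ^+ 4 <= sector_transversality z))).

Definition sector_density lam mu (B : set (R2 R)) (z : R3 R * R3 R) : R :=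
  (sector_region lam mu z)%:R * (\1_B (slope z.1) * sector_weight lam z ^+ 2).

Lemma sector_density_ge0 lam mu B z : 0 <= sector_density lam mu B z.
Proof. by apply: mulr_ge0; [exact: ler0n|apply: mulr_ge0; [exact: ler0n|exact: sqr_ge0]]. Qed.

Lemma measurable_sector_weight lam : measurable_fun setT (sector_weight lam).
Proof.
have ms1 : measurable_fun setT (fun z : R3 R * R3 R => slope z.1).
  exact: (measurableT_comp measurable_slope measurable_fst).
have ms2 : measurable_fun setT (fun z : R3 R * R3 R => slope z.2).
  exact: (measurableT_comp measurable_slope measurable_snd).
apply: measurable_funD => //; apply: (measurableT_comp (f := @Num.sqrt R)).
  by apply: continuous_measurable_fun; exact: sqrt_continuous.
by apply: measurable_funD; apply: measurable_funX; apply: measurable_funB;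
  do ?[exact: (measurableT_comp measurable_fst ms1)|exact: (measurableT_comp measurable_fst ms2)
    |exact: (measurableT_comp measurable_snd ms1)|exact: (measurableT_comp measurable_snd ms2)].
Qed.

Lemma measurable_sector_density lam mu B : measurable B ->
  measurable_fun setT (sector_density lam mu B).
Proof.
move=> mB.
have ms1 : measurable_fun setT (fun z : R3 R * R3 R => slope z.1).
  exact: (measurableT_comp measurable_slope measurable_fst).
have s1 : measurable_fun setT (fun z : R3 R * R3 R => (slope z.1).1).
  exact: (measurableT_comp measurable_fst ms1).
have s2 : measurable_fun setT (fun z : R3 R * R3 R => (slope z.1).2).
  exact: (measurableT_comp measurable_snd ms1).
have p1 : measurable_fun setT (fun z : R3 R * R3 R => z.1.1).
  exact: (measurableT_comp (@measurable_proj1 R) measurable_fst).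
have p2 : measurable_fun setT (fun z : R3 R * R3 R => z.1.2.1).
  exact: (measurableT_comp (@measurable_proj2 R) measurable_fst).
have p3 : measurable_fun setT (fun z : R3 R * R3 R => z.1.2.2).
  exact: (measurableT_comp (@measurable_proj3 R) measurable_fst).
have q1 : measurable_fun setT (fun z : R3 R * R3 R => z.2.1).
  exact: (measurableT_comp (@measurable_proj1 R) measurable_snd).
have q2 : measurable_fun setT (fun z : R3 R * R3 R => z.2.2.1).
  exact: (measurableT_comp (@measurable_proj2 R) measurable_snd).
have q3 : measurable_fun setT (fun z : R3 R * R3 R => z.2.2.2).
  exact: (measurableT_comp (@measurable_proj3 R) measurable_snd).
have mt : measurable_fun setT sector_transversality.
  exact: (measurable_funD
    (measurable_funX 2 (measurable_funB (measurable_funM (measurable_funD p1 q1) s1) (measurable_funD p2 q2)))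
    (measurable_funX 2 (measurable_funB (measurable_funM (measurable_funD p1 q1) s2) (measurable_funD p3 q3)))).
have n1 : measurable_fun setT (fun z : R3 R * R3 R => `|z.1.1|) by exact: measurableT_comp.
have n2 : measurable_fun setT (fun z : R3 R * R3 R => `|z.2.1|) by exact: measurableT_comp.
apply: measurable_funM; last apply: measurable_funM.
- apply: (measurableT_comp (f := fun b : bool => b%:R : R)) => //.
  apply: measurable_and; first by apply: measurable_and; apply: measurable_and;
    do ?[exact: measurable_fun_ltr|exact: measurable_fun_ler].
  apply: measurable_or; first exact: measurable_cst.
  by apply: measurable_and; [exact: measurable_cst|exact: measurable_fun_ler].
- exact: (measurableT_comp (measurable_indic mB : measurable_fun setT (\1_B : R2 R -> R)) ms1).
- by apply: measurable_funX; exact: measurable_sector_weight.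
Qed.

(** In the coordinates (x, s), with s the slope, [integral_level_sets] bounds
    the integral over each line by 40 pi times the largest Jacobian 4 mu^2,
    and the slopes range over [B]. *)
Lemma sector_level_sets (lam mu : R) (B : set (R2 R)) (e tau : R) (p : R3 R) :
  0 < mu -> 0 < lam -> measurable B -> (leb2 B < +oo)%E -> 0 < e ->
  (\int[leb3]_q (sector_density lam mu B (q, p - q) *
     cauchy e (tau - (phase q + phase (p - q))))%:E <=
   (160 * pi * mu ^+ 2 * fine (leb2 B))%:E)%E.
Proof.
move=> mu0 lam0 mB Bfin e0.
pose f (q : R3 R) := sector_density lam mu B (q, p - q) *
  cauchy e (tau - (phase q + phase (p - q))).
have f0 q : (0 <= (f q)%:E)%E by rewrite lee_fin mulr_ge0 ?sector_density_ge0 ?cauchy_ge0.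
have mf : measurable_fun setT (fun q => (f q)%:E).
  apply/measurable_EFinP; apply: measurable_funM.
    apply: (measurableT_comp (measurable_sector_density lam mu mB) (g := fun q : R3 R => (q, p - q))).
    by apply/measurable_fun_pairP; split; [exact: measurable_id|exact: measurable_R3reflect].
  apply: (measurableT_comp (measurable_cauchy e)); apply: measurable_funB => //.
  apply: measurable_funD; first exact: measurable_phase.
  exact: (measurableT_comp (@measurable_phase R) (measurable_R3reflect p)).
rewrite (_ : (\int[leb3]_q _)%E = (\int[leb3]_q (f q)%:E)%E)// integral3_slope//; last first.
  move=> y; rewrite /f /sector_density /sector_region /= normr0 ltNge (ltW mu0) /=.
  by rewrite !mul0r.
have p0 : 0 <= 160 * pi * mu ^+ 2 := mulr_ge0 (mulr_ge0 (ler0n _ 160) (pi_ge0 R)) (sqr_ge0 mu).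
have key s : (\int[leb]_x ((x ^+ 2)%:E * (f (x, (x * s.1, x * s.2)))%:E) <=
    (160 * pi * mu ^+ 2)%:E * (\1_B s)%:E)%E.
  pose cond := (mu <= lam / 8) ||
    ((mu <= lam) && (64 * lam ^+ 4 <= transversality p.1 s.1 s.2 p.2.1 p.2.2)).
  pose reg x := (mu < `|x| <= 2 * mu) && (lam <= `|p.1 - x| < 2 * lam).
  pose G x := weight lam p.1 s.1 s.2 p.2.1 p.2.2 x ^+ 2 *
    cauchy e (tau + resonance p.1 s.1 s.2 p.2.1 p.2.2 x).
  have G0 x : 0 <= G x by rewrite mulr_ge0 ?sqr_ge0 ?cauchy_ge0.
  have E x : x ^+ 2 * f (x, (x * s.1, x * s.2)) =
      (cond%:R * \1_B s) * (x ^+ 2 * ((reg x)%:R * G x)).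
    rewrite /f /sector_density /sector_region /= -/(reg x).
    case: (boolP (reg x)) => [rx|nrx] /=; last by rewrite !(mul0r, mulr0).
    have x0 : x != 0 by rewrite -normr_gt0; case/andP: rx => /andP[h _] _; apply: lt_trans h.
    have y0 : p.1 - x != 0.
      by rewrite -normr_gt0; case/andP: rx => _ /andP[h _]; apply: lt_le_trans h.
    have sl : slope (x, (x * s.1, x * s.2)) = s.
      by case: (s) => a b; rewrite /slope /= ![x * _]mulrC !mulfK.
    rewrite sl /sector_transversality sl /= ![x + (_ - x)]addrC !subrK.
    rewrite ![x * _ + (_ - x * _)]addrC !subrK -/cond.
    have -> : sector_weight lam ((x, (x * s.1, x * s.2)), p - (x, (x * s.1, x * s.2))) =
        weight lam p.1 s.1 s.2 p.2.1 p.2.2 x.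
      rewrite /sector_weight /weight sl /norm2 /slope /transversality /=.
      by congr (_ + Num.sqrt _); field.
    have -> : tau - (phase (x, (x * s.1, x * s.2)) + phase (p - (x, (x * s.1, x * s.2)))) =
        tau + resonance p.1 s.1 s.2 p.2.1 p.2.2 x.
      rewrite /phase /resonance !norm2_sqr /=; field.
      by rewrite x0 y0.
    by rewrite /G; ring.
  under eq_integral do rewrite -EFinM E.
  have mreg : measurable_fun setT (fun x : R => reg x).
    have n1 : measurable_fun setT (fun x : R => `|x|) by exact: measurableT_comp.
    have n2 : measurable_fun setT (fun x : R => `|p.1 - x|).
      by apply: measurableT_comp => //; exact: measurable_funB.
    by apply: measurable_and; apply: measurable_and; do ?[exact: measurable_fun_ltr|exact: measurable_fun_ler].
  have mH : measurable_fun setT (fun x : R => ((reg x)%:R * G x)%:E).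
    apply/measurable_EFinP; apply: measurable_funM; last exact: measurable_weighted_cauchy.
    exact: (measurableT_comp (f := fun b : bool => b%:R : R)).
  have b0 : 0 <= \1_B s :> R by [].
  case: (boolP cond) => [hc|_]; last first.
    rewrite integral0_eq; last by move=> x _; rewrite !mul0r.
    by rewrite -EFinM lee_fin mulr_ge0.
  have h := integral_level_sets tau mu0 lam0 e0 hc.
  apply: (@le_trans _ _ (\int[leb]_x ((\1_B s * (4 * mu ^+ 2))%:E * ((reg x)%:R * G x)%:E))%E).
    apply: ge0_le_integral => //.
    - move=> x _; rewrite lee_fin mul1r; apply: mulr_ge0 => //.
      by apply: mulr_ge0; [exact: sqr_ge0|exact: mulr_ge0].
    - apply/measurable_EFinP; apply: measurable_funM => //; apply: measurable_funM.
        exact: measurable_funX.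
      exact/measurable_EFinP.
    - exact: measurable_funeM.
    - move=> x _; rewrite -EFinM lee_fin mul1r -(mulrA (\1_B s) (4 * _)); apply: ler_wpM2l => //.
      case: (boolP (reg x)) => [rx|_]; last by rewrite !(mul0r, mulr0).
      rewrite !mul1r; apply: ler_wpM2r => //; case/andP: rx => /andP[_ xu] _.
      rewrite -real_normK ?num_real// (_ : 4 * mu ^+ 2 = (2 * mu) ^+ 2); last by ring.
      by rewrite ler_sqr ?nnegrE ?mulr_ge0// ltW.
  have c0 : (0 <= (\1_B s * (4 * mu ^+ 2))%:E :> \bar R)%E by rewrite lee_fin mulr_ge0// mulr_ge0// sqr_ge0.
  have H0 x : [set: R] x -> (0 <= ((reg x)%:R * G x)%:E)%E by rewrite lee_fin mulr_ge0.
  rewrite ge0_integralZl//.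
  apply: (@le_trans _ _ ((\1_B s * (4 * mu ^+ 2))%:E * (40 * pi)%:E)%E).
    exact: lee_wpmul2l.
  by rewrite -!EFinM lee_fin le_eqVlt; apply/orP; left; apply/eqP; ring.
have mi : measurable_fun setT (fun s : R2 R => (\1_B s : R)%:E).
  by apply/measurable_EFinP; exact: measurable_indic.
have c0 : (0 <= (160 * pi * mu ^+ 2)%:E :> \bar R)%E by rewrite lee_fin.
have i0 s : [set: R2 R] s -> (0 <= (\1_B s : R)%:E)%E by rewrite lee_fin.
apply: (@le_trans _ _ (\int[leb2]_s ((160 * pi * mu ^+ 2)%:E * (\1_B s)%:E))%E).
  apply: ge0_le_integral => //.
  - by move=> s _; apply: integral_ge0 => x _; rewrite mule_ge0// lee_fin sqr_ge0.
  - pose H (z : R2 R * R) : \bar R := ((z.2 ^+ 2)%:E * (f (z.2, (z.2 * z.1.1, z.2 * z.1.2)))%:E)%E.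
    have mH : measurable_fun setT H.
      have m2 : measurable_fun setT (fun z : R2 R * R => z.2) by exact: measurable_snd.
      apply: emeasurable_funM; first by apply/measurable_EFinP; exact: measurable_funX.
      apply: (measurableT_comp mf (g := fun z : R2 R * R => (z.2, (z.2 * z.1.1, z.2 * z.1.2)))).
      apply/measurable_fun_pairP; split => //; apply/measurable_fun_pairP.
      have m1 : measurable_fun setT (fun z : R2 R * R => z.1) by exact: measurable_fst.
      split; apply: measurable_funM => //.
        exact: (measurableT_comp measurable_fst m1).
      exact: (measurableT_comp measurable_snd m1).
    apply: (@measurable_integral2 _ _ _ _ R leb _ mH).
    by move=> z; rewrite mule_ge0// lee_fin sqr_ge0.
  - exact: measurable_funeM.
rewrite ge0_integralZl//.
have -> : (\int[leb2]_s (\1_B s : R)%:E = leb2 B)%E by rewrite integral_indic// setIT.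
by rewrite [leRHS]EFinM fineK// ge0_fin_numE ?measure_ge0.
Qed.

End resonance.

(** * Products of free waves *)

Section measure_preserving.
Context d (T : measurableType d) (R : realType) (m : {measure set T -> \bar R}).
Variable th : T -> T.
Hypothesis mth : measurable_fun setT th.
Hypothesis hth : forall f : T -> \bar R, measurable_fun setT f -> (forall x, 0 <= f x)%E ->
  (\int[m]_x f (th x) = \int[m]_x f x)%E.

Lemma integral_transport (f : T -> \bar R) : measurable_fun setT f ->
  (\int[m]_x f (th x) = \int[m]_x f x)%E.
Proof.
move=> mf; rewrite integralE [RHS]integralE; congr (_ - _)%E.
  transitivity (\int[m]_x f^\+ (th x))%E; first by apply: eq_integral => x _; rewrite !funeposE.
  by apply: (hth (measurable_funepos mf)) => x; exact: funepos_ge0.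
transitivity (\int[m]_x f^\- (th x))%E; first by apply: eq_integral => x _; rewrite !funenegE.
by apply: (hth (measurable_funeneg mf)) => x; exact: funeneg_ge0.
Qed.

Lemma cintegrable_transport (G : T -> R[i]) : cmeasurable G ->
  cintegrable m setT (fun x => G (th x)) <-> cintegrable m setT G.
Proof.
move=> mG; have E : absint m (fun x => G (th x)) = absint m G.
  apply: (@integral_transport (fun x => (Normc.normc (G x))%:E)).
  exact/measurable_EFinP/measurable_normc.
split=> /cintegrableP[_ h]; apply/cintegrableP; split=> //; rewrite ?E// -?E//.
exact: cmeasurable_comp mG mth.
Qed.

Lemma cintegral_transport (G : T -> R[i]) : cmeasurable G ->
  cintegral m setT (fun x => G (th x)) = cintegral m setT G.
Proof.
move=> mG; have [Gi|nG] := pselect (cintegrable m setT G); last first.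
  by rewrite !cintegral_notint// => /(cintegrable_transport mG).
rewrite (cintegralE Gi) (cintegralE ((cintegrable_transport mG).2 Gi)) /Rintegral.
have [m1 m2] := mG.
rewrite (@integral_transport (fun x => (complex.Re (G x))%:E)); last exact/measurable_EFinP.
by rewrite (@integral_transport (fun x => (complex.Im (G x))%:E)); last exact/measurable_EFinP.
Qed.

End measure_preserving.

Section waves.
Variable R : realType.
Local Notation leb := (@lebesgue_measure R).
Local Notation leb2 := (@leb2 R).
Local Notation leb3 := (@leb3 R).
Local Notation leb4 := (@leb4 R).
Local Notation C := (R[i]).
Implicit Types (a b f g : R3 R -> C) (u v w : R4 R -> C).
Local Notation en := (energy leb3).
Local Notation eps := (fun n : nat => (n.+1%:R^-1 : R)).

Lemma cintegral3_shift (p : R3 R) f : cmeasurable f ->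
  cintegral leb3 setT (fun q : R3 R => f (q - p)) = cintegral leb3 setT f.
Proof.
move=> mf; apply: (cintegral_transport (th := fun q : R3 R => q - p)) => //.
  exact: measurable_R3D.
by move=> h mh h0; exact: (integral3_shift (- p) mh h0).
Qed.

Lemma cintegrable3_shift (p : R3 R) f : cintegrable leb3 setT f ->
  cintegrable leb3 setT (fun q : R3 R => f (q - p)).
Proof.
move=> fi; apply/(cintegrable_transport (th := fun q : R3 R => q - p)) => //.
- exact: measurable_R3D.
- by move=> h mh h0; exact: (integral3_shift (- p) mh h0).
- exact: cintegrable_meas fi.
Qed.

Lemma cintegral3_opp f : cmeasurable f ->
  cintegral leb3 setT (fun q : R3 R => f (- q)) = cintegral leb3 setT f.
Proof.
move=> mf; apply: (cintegral_transport (th := fun q : R3 R => - q)) => //.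
  exact: measurable_R3N.
move=> h mh h0; rewrite -(integral3_reflect 0 mh h0).
by apply: eq_integral => q _; rewrite sub0r.
Qed.

Lemma cintegrable3_opp f : cmeasurable f -> cintegrable leb3 setT f ->
  cintegrable leb3 setT (fun q : R3 R => f (- q)).
Proof.
move=> mf fi; apply/(cintegrable_transport (th := fun q : R3 R => - q)) => //.
  exact: measurable_R3N.
move=> h mh h0; rewrite -(integral3_reflect 0 mh h0).
by apply: eq_integral => q _; rewrite sub0r.
Qed.

Definition convolution f g (p : R3 R) : C :=
  cintegral leb3 setT (fun q : R3 R => f q * g (p - q)).

Lemma convolution_joint f g : cmeasurable f -> cmeasurable g ->
  cmeasurable (fun z : R3 R * R3 R => f z.2 * g (z.1 - z.2)).
Proof.
move=> mf mg; apply: cmeasurableM; first exact: (cmeasurable_comp mf measurable_snd).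
exact: (cmeasurable_comp mg (h := fun z : R3 R * R3 R => z.1 - z.2) (@measurable_R3B R)).
Qed.

Lemma cmeasurable_convolution f g : cmeasurable f -> cmeasurable g ->
  cmeasurable (convolution f g).
Proof. by move=> mf mg; exact: (cmeasurable_cintegral leb3 (convolution_joint mf mg)). Qed.

Lemma absint_convolution f g : cmeasurable f -> cmeasurable g ->
  (\int[leb3]_p absint leb3 (fun q => f q * g (p - q))%R = absint leb3 f * absint leb3 g)%E.
Proof.
move=> mf mg; rewrite (absint_swap leb3 leb3 (convolution_joint mf mg)) /=.
have mng : measurable_fun setT (fun p : R3 R => (Normc.normc (g p))%:E).
  exact/measurable_EFinP/measurable_normc.
have E (q : R3 R) : (absint leb3 (fun p => f q * g (p - q))%R =
    (Normc.normc (f q))%:E * absint leb3 g)%E.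
  rewrite /absint; under eq_integral do rewrite normcMr EFinM.
  rewrite ge0_integralZl//; last 3 first.
  - apply/measurable_EFinP/measurable_normc.
    exact: (cmeasurable_comp mg (measurable_R3D (- q))).
  - by move=> p _; rewrite lee_fin normc_ge0.
  - by rewrite lee_fin normc_ge0.
  congr (_ * _)%E; apply: (integral3_shift (- q) mng).
  by move=> y; rewrite lee_fin normc_ge0.
under eq_integral do rewrite E.
rewrite ge0_integralZr ?absint_ge0//.
  exact/measurable_EFinP/measurable_normc.
by move=> q _; rewrite lee_fin normc_ge0.
Qed.

Lemma cintegrable_convolution f g : cintegrable leb3 setT f -> cintegrable leb3 setT g ->
  cintegrable leb3 setT (convolution f g).
Proof.
move=> /cintegrableP[mf fi] /cintegrableP[mg gi].
have mc := cmeasurable_convolution mf mg.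
apply/cintegrableP; split => //.
apply: (@le_lt_trans _ _ (absint leb3 f * absint leb3 g)%E); last first.
  by rewrite lte_mul_pinfty ?absint_ge0// ge0_fin_numE ?absint_ge0.
rewrite -(absint_convolution mf mg); apply: ge0_le_integral; first exact: measurableT.
- by move=> p _; rewrite lee_fin normc_ge0.
- exact/measurable_EFinP/measurable_normc.
- exact: (measurable_absint leb3 (convolution_joint mf mg)).
- by move=> p _; exact: normc_cintegral.
Qed.

Lemma fint_convolution f g x : cintegrable leb3 setT f -> cintegrable leb3 setT g ->
  fint 1 f x * fint 1 g x = (c3 R)%:C * fint 1 (convolution f g) x.
Proof.
move=> fi gi; have /cintegrableP[mf af] := fi; have /cintegrableP[mg ag] := gi.
pose H (z : R3 R * R3 R) := (f z.2 * g (z.1 - z.2)) * expi (1 * dot3 z.1 x).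
have mH : cmeasurable H.
  apply: cmeasurableM; first exact: convolution_joint.
  apply: cmeasurable_expi; apply: measurable_funM => //.
  under eq_fun do rewrite dot3C.
  exact: (measurableT_comp (measurable_dot3 x) measurable_fst).
have HI : (\int[leb3]_p absint leb3 (fun q => H (p, q)) < +oo)%E.
  apply: (@le_lt_trans _ _ (absint leb3 f * absint leb3 g)%E); last first.
    by rewrite lte_mul_pinfty ?absint_ge0// ge0_fin_numE ?absint_ge0.
  rewrite -(absint_convolution mf mg) le_eqVlt; apply/orP; left; apply/eqP.
  by apply: eq_integral => p _; apply: eq_integral => q _; rewrite /H [in LHS]normcMr normc_expi mulr1.
have inner p : cintegrable leb3 setT (fun q => f q * g (p - q)) ->
    cintegral leb3 setT (fun q => H (p, q)) = convolution f g p * expi (1 * dot3 p x).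
  move=> ip; rewrite mulrC -cintegralZ//; apply: eq_cintegral => q.
  by rewrite /H /= mulrC.
rewrite {3}/fint.
have -> : cintegral leb3 setT (fun p => convolution f g p * expi (1 * dot3 p x)) =
    cintegral leb3 setT (fun p => cintegral leb3 setT (fun q => H (p, q))).
  apply: eq_cintegral => p; have [ip|nip] := pselect (cintegrable leb3 setT (fun q => f q * g (p - q))).
    by rewrite inner.
  rewrite /convolution !cintegral_notint ?mul0r// => /cintegrableP[_ h].
  apply: nip; apply/cintegrableP; split; first exact: (cmeasurable_pair1 p (convolution_joint mf mg)).
  apply: le_lt_trans h; rewrite le_eqVlt; apply/orP; left; apply/eqP.
  by apply: eq_integral => q _; rewrite /H [in RHS]normcMr normc_expi mulr1.
rewrite (cFubini mH HI).
have E q : cintegral leb3 setT (fun p => H (p, q)) =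
    f q * expi (1 * dot3 q x) * cintegral leb3 setT (fun r => g r * expi (1 * dot3 r x)).
  rewrite -(cintegral3_shift q (cintegrable_meas (cintegrable_fint 1 x gi))) -cintegralZ.
    apply: eq_cintegral => p; rewrite /H /= dot3Bl !mul1r.
    have -> : expi (dot3 p x) = expi (dot3 q x) * expi (dot3 p x - dot3 q x).
      by rewrite -expiD addrC subrK.
    have r (f1 g1 x1 y1 : C) : f1 * g1 * (x1 * y1) = f1 * x1 * (g1 * y1) by ring.
    exact: r.
  have h := cintegrable_fint 1 x gi.
  exact: cintegrable3_shift h.
under [in RHS]eq_cintegral do rewrite E mulrC.
rewrite cintegralZ; last exact: cintegrable_fint.
by rewrite /fint; ring.
Qed.

(** The free wave with data transform [a], given by an absolutely convergent
    integral. *)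
Definition wave a (z : R4 R) : C := fint 1 (fun k => evolved a (z.1, k)) z.2.

Lemma cintegrable_evolved a t : cintegrable leb3 setT a ->
  cintegrable leb3 setT (fun k => evolved a (t, k)).
Proof.
move=> ai; apply: (le_cintegrable _ ai).
  exact: (cmeasurable_pair1 t (cmeasurable_evolved (cintegrable_meas ai))).
by move=> k; rewrite normcMr normc_expi mul1r.
Qed.

Lemma cmeasurable_wave a : cmeasurable a -> cmeasurable (wave a).
Proof.
move=> ma; apply: cmeasurableM; first exact: cmeasurable_cst.
have m1 : measurable_fun setT (fun z : R4 R * R3 R => z.1) by exact: measurable_fst.
have m2 : measurable_fun setT (fun z : R4 R * R3 R => z.2) by exact: measurable_snd.
have h : cmeasurable (fun z : R4 R * R3 R => evolved a (z.1.1, z.2) * expi (1 * dot3 z.2 z.1.2)).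
  apply: cmeasurableM.
    apply: (cmeasurable_comp (cmeasurable_evolved ma) (h := fun z : R4 R * R3 R => (z.1.1, z.2))).
    by apply/measurable_fun_pairP; split => //; exact: (measurableT_comp measurable_fst m1).
  apply: cmeasurable_expi; apply: measurable_funM => //.
  apply: (measurableT_comp (@measurable_dot3_2 R) (g := fun z : R4 R * R3 R => (z.2, z.1.2))).
  by apply/measurable_fun_pairP; split => //; exact: (measurableT_comp measurable_snd m1).
exact: (cmeasurable_cintegral leb3 h).
Qed.

Lemma waveD a b z : cintegrable leb3 setT a -> cintegrable leb3 setT b ->
  wave (fun k => a k + b k) z = wave a z + wave b z.
Proof.
move=> ai bi; rewrite /wave /fint -mulrDr -cintegralD; last 2 first.
- by apply: cintegrable_fint; exact: cintegrable_evolved.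
- by apply: cintegrable_fint; exact: cintegrable_evolved.
by congr (_ * _); apply: eq_cintegral => k; rewrite /evolved mulrDr mulrDl.
Qed.

Lemma energy_wave_mul a b : cintegrable leb3 setT a -> cintegrable leb3 setT b ->
  (energy leb4 (fun z => wave a z * wave b z)%R <=
   (c3 R ^+ 2)%:E * energy leb4 (bilinear (fun=> 1%R) a b))%E.
Proof.
move=> ai bi; have [ma mb] := (cintegrable_meas ai, cintegrable_meas bi).
have m1 : measurable_fun setT (fun _ : R3 R * R3 R => 1 : R) by exact: measurable_cst.
have mT := cmeasurable_bilinear m1 ma mb.
have mW := cmeasurableM (cmeasurable_wave ma) (cmeasurable_wave mb).
have meas (F : R4 R -> C) : cmeasurable F -> measurable_fun setT (fun t => en (fun x => F (t, x))).
  move=> mF; apply: (@measurable_integral2 _ _ _ _ R leb3 (fun z => (sqn (F z))%:E)).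
    exact/measurable_EFinP/measurable_sqn.
  by move=> z; rewrite lee_fin sqn_ge0.
have h0 t : (0 <= en (fun x => bilinear (fun=> 1%R) a b (t, x)))%E by exact: energy_ge0.
rewrite (energy4E mW) (energy4E mT) -(ge0_integralZl _ measurableT (meas _ mT) (fun t _ => h0 t)); last by rewrite lee_fin sqr_ge0.
apply: ge0_le_integral; first exact: measurableT.
- by move=> t _; exact: energy_ge0.
- exact: meas mW.
- by apply: measurable_funeM; exact: meas mT.
move=> t _; have [ait bit] := (cintegrable_evolved t ai, cintegrable_evolved t bi).
have mc := cintegrable_convolution ait bit.
rewrite -sqnC.
have -> : (fun x => wave a (t, x) * wave b (t, x)) =
    (fun x => (c3 R)%:C * fint 1 (convolution (fun k => evolved a (t, k)) (fun k => evolved b (t, k))) x).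
  by apply/funext => x; rewrite -fint_convolution.
rewrite energyZ; last by apply: cmeasurable_fint; exact: cintegrable_meas mc.
apply: lee_wpmul2l; first by rewrite lee_fin sqn_ge0.
apply: le_trans (energy_fint (sqr11 R) mc) _.
rewrite le_eqVlt; apply/orP; left; apply/eqP; congr (energy _ _); apply/funext => p.
by apply: eq_cintegral => q /=; rewrite mul1r.
Qed.

Definition wave_constant (mu : R) : R := c3 R ^+ 2 * (2 * pi ^+ 2 * mu ^+ 2).

Lemma wave_constant_ge0 mu : 0 <= wave_constant mu.
Proof. by rewrite mulr_ge0 ?sqr_ge0// mulr_ge0 ?sqr_ge0// mulr_ge0 ?sqr_ge0. Qed.

Lemma same_sign_estimate (mu : R) a b : 0 < mu ->
  cintegrable leb3 setT a -> cintegrable leb3 setT b ->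
  (forall k, a k != 0 -> 0 < k.1 < mu) -> (forall k, b k != 0 -> 0 < k.1) ->
  (energy leb4 (fun z => wave a z * wave b z)%R <= (wave_constant mu)%:E * (en a * en b))%E.
Proof.
move=> mu0 ai bi ha hb; have [ma mb] := (cintegrable_meas ai, cintegrable_meas bi).
apply: le_trans (energy_wave_mul ai bi) _.
have -> : (wave_constant mu)%:E = ((c3 R ^+ 2)%:E * (2 * pi ^+ 2 * mu ^+ 2)%:E)%E by rewrite -EFinM.
rewrite -muleA; apply: lee_wpmul2l; first by rewrite lee_fin sqr_ge0.
pose rho (z : R3 R * R3 R) : R := ((0 < z.1.1 < mu) && (0 < z.2.1))%:R.
have p1 : measurable_fun setT (fun z : R3 R * R3 R => z.1.1).
  exact: (measurableT_comp (@measurable_proj1 R) measurable_fst).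
have q1 : measurable_fun setT (fun z : R3 R * R3 R => z.2.1).
  exact: (measurableT_comp (@measurable_proj1 R) measurable_snd).
apply: (bilinear_energy (rho := rho)) => //.
- apply: (measurableT_comp (f := fun b : bool => b%:R : R)) => //.
  by apply: measurable_and; [apply: measurable_and|]; exact: measurable_fun_ltr.
- move=> q r; rewrite mul1r sqnM /rho /=.
  have [->|/ha hq] := eqVneq (a q) 0; first by rewrite sqn0 !mul0r mulr0.
  have [->|/hb hr] := eqVneq (b r) 0; first by rewrite sqn0 !mulr0.
  by rewrite hq hr mul1r.
- by move=> e tau p e0; exact: same_sign_level_sets.
Qed.

Lemma conjcM' (z w : C) : ((z * w)^*)%C = (z^*)%C * (w^*)%C.
Proof. exact: rmorphM. Qed.

Definition refl a (k : R3 R) : C := ((a (- k))^*)%C.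

Lemma phaseN (k : R3 R) : phase (- k) = - phase k.
Proof. by rewrite /phase !norm2_sqr /= !sqrrN invrN mulrN opprB addrC exprNn; ring. Qed.

Lemma cintegrable_refl a : cintegrable leb3 setT a -> cintegrable leb3 setT (refl a).
Proof. by move=> ai; apply: cintegrableJ; exact: cintegrable3_opp (cintegrable_meas ai) ai. Qed.

Lemma energy_refl a : cmeasurable a -> en (refl a) = en a.
Proof. by move=> ma; rewrite energyJ energyNr. Qed.

(** Complex conjugation exchanges waves of positive and of negative frequency,
    since the phase is odd. *)
Lemma wave_refl a z : cintegrable leb3 setT a -> wave (refl a) z = ((wave a z)^*)%C.
Proof.
move=> ai; have ma := cintegrable_meas ai.
pose G (k : R3 R) := evolved (refl a) (z.1, k) * expi (1 * dot3 k z.2).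
have mG : cmeasurable G.
  apply: cintegrable_meas; apply: cintegrable_fint; apply: cintegrable_evolved.
  exact: cintegrable_refl.
rewrite /wave /fint conjcM' -cintegralJ; congr (_ * _).
  by apply: complex_ext; rewrite ?cReJ ?cImJ ?cImC ?oppr0.
rewrite -(cintegral3_opp mG); apply: eq_cintegral => k.
rewrite /G /evolved /refl /= opprK phaseN dot3Nl !mulrN !expiN.
by rewrite !conjcM'.
Qed.

Definition half (s : bool) a (k : R3 R) : C := (if s then (0 < k.1)%R else (k.1 < 0)%R)%:R%:C * a k.

Lemma cmeasurable_half s a : cmeasurable a -> cmeasurable (half s a).
Proof.
move=> ma; apply: cmeasurableM => //; apply: cmeasurable_real.
apply: (measurableT_comp (f := fun b : bool => b%:R : R)) => //.
by case: s; apply: measurable_fun_ltr => //; exact: measurable_proj1.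
Qed.

Lemma sqn_half s a k : sqn (half s a k) <= sqn (a k).
Proof. by rewrite sqnM sqnC ler_piMl ?sqn_ge0// expr_le1//; case: (if _ then _ else _). Qed.

Lemma cintegrable_half s a : cintegrable leb3 setT a -> cintegrable leb3 setT (half s a).
Proof.
move=> ai; apply: (le_cintegrable _ ai); first by apply: cmeasurable_half; exact: cintegrable_meas ai.
by move=> k; apply: normc_le_sqn; exact: sqn_half.
Qed.

Lemma half_split a k : (a k != 0 -> k.1 != 0) -> a k = half true a k + half false a k.
Proof.
rewrite /half -mulrDl; have [->|a0] := eqVneq (a k) 0; first by rewrite mulr0.
by move=> /(_ isT); case: ltgtP => //= _ _; rewrite ?addr0 ?add0r mul1r.
Qed.

Definition positive (s : bool) a : R3 R -> C := if s then half true a else refl (half false a).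

Lemma cintegrable_positive s a : cintegrable leb3 setT a -> cintegrable leb3 setT (positive s a).
Proof.
by case: s => ai; [exact: cintegrable_half|apply: cintegrable_refl; exact: cintegrable_half].
Qed.

Lemma energy_positive s a : cmeasurable a -> (en (positive s a) <= en a)%E.
Proof.
move=> ma; case: s; last rewrite /positive energy_refl.
- by apply: le_energy => //; [exact: cmeasurable_half|move=> k; exact: sqn_half].
- by apply: le_energy => //; [exact: cmeasurable_half|move=> k; exact: sqn_half].
- exact: cmeasurable_half.
Qed.

Lemma positive_support s a k : positive s a k != 0 ->
  0 < k.1 /\ (a k != 0 \/ a (- k) != 0).
Proof.
have cj (z : C) : (z^*)%C != 0 -> z != 0 by apply: contra_neq => ->; rewrite rmorph0.
case: s; rewrite /positive /refl /half /=; last move=> /cj; rewrite mulf_eq0 negb_or => /andP[].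
- case: (boolP (0 < k.1)) => k0 /=; last by rewrite eqxx.
  by move=> _ ak; split => //; left.
- rewrite oppr_lt0; case: (boolP (0 < k.1)) => k0 /=; last by rewrite eqxx.
  by move=> _ ak; split => //; right.
Qed.

Lemma sqn_wave_positive s a z : cintegrable leb3 setT a ->
  sqn (wave (positive s a) z) = sqn (wave (half s a) z).
Proof. by move=> ai; case: s => //; rewrite /positive wave_refl ?sqnJ//; exact: cintegrable_half. Qed.

(** Conjugating one or both factors leaves the modulus of the product
    unchanged and makes both frequencies positive. *)
Lemma half_estimate (mu : R) s s' a b : 0 < mu ->
  cintegrable leb3 setT a -> cintegrable leb3 setT b -> (forall k, a k != 0 -> `|k.1| < mu) ->
  (energy leb4 (fun z => wave (half s a) z * wave (half s' b) z)%R <=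
   (wave_constant mu)%:E * (en a * en b))%E.
Proof.
move=> mu0 ai bi ha; have [ma mb] := (cintegrable_meas ai, cintegrable_meas bi).
have -> : energy leb4 (fun z => wave (half s a) z * wave (half s' b) z) =
    energy leb4 (fun z => wave (positive s a) z * wave (positive s' b) z).
  have E z : sqn (wave (half s a) z * wave (half s' b) z) =
      sqn (wave (positive s a) z * wave (positive s' b) z).
    by rewrite 2!sqnM !sqn_wave_positive.
  by rewrite /energy; apply: eq_integral => z _; rewrite E.
apply: le_trans (same_sign_estimate mu0 (cintegrable_positive s ai) (cintegrable_positive s' bi) _ _) _.
- move=> k /positive_support[k0 [/ha|/ha]].
    by rewrite gtr0_norm// k0.
  by rewrite /= normrN gtr0_norm// k0.
- by move=> k /positive_support[].
- apply: lee_wpmul2l; first by rewrite lee_fin wave_constant_ge0.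
  by apply: lee_pmul; rewrite ?energy_ge0 ?energy_positive.
Qed.

(** The constant is 16 = 4 * 4, as splitting a wave into its two halves costs
    a factor 4 for each of the waves. *)
Lemma wave_estimate (mu : R) a b : 0 < mu ->
  cintegrable leb3 setT a -> cintegrable leb3 setT b ->
  (forall k, a k != 0 -> 0 < `|k.1| < mu) -> (forall k, b k != 0 -> k.1 != 0) ->
  (energy leb4 (fun z => wave a z * wave b z)%R <=
   (16 * wave_constant mu)%:E * (en a * en b))%E.
Proof.
move=> mu0 ai bi ha hb; have [ma mb] := (cintegrable_meas ai, cintegrable_meas bi).
have ha' k : a k != 0 -> `|k.1| < mu by move=> /ha /andP[].
have split f : cintegrable leb3 setT f -> (forall k, f k != 0 -> k.1 != 0) ->
    wave f = (fun z => wave (half true f) z + wave (half false f) z).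
  move=> fi hf; apply/funext => z; rewrite -waveD; do ?exact: cintegrable_half.
  by congr (wave _ z); apply/funext => k; exact: half_split (hf k).
have sa : wave a = (fun z => wave (half true a) z + wave (half false a) z).
  by apply: split => // k /ha; rewrite normr_gt0 => /andP[].
have mw s f : cintegrable leb3 setT f -> cmeasurable (wave (half s f)).
  by move=> fi; apply: cmeasurable_wave; apply: cmeasurable_half; exact: cintegrable_meas fi.
set K := wave_constant mu; set X := (en a * en b)%E.
have X0 : (0 <= X)%E by rewrite mule_ge0 ?energy_ge0.
have K0 := wave_constant_ge0 mu.
have dist (r : R) : 0 <= r -> ((4 * r)%:E * X = 2%:E * (r%:E * X) + 2%:E * (r%:E * X))%E.
  have -> : ((4 * r)%:E = 2%:E * r%:E + 2%:E * r%:E)%E.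
    by rewrite -!EFinM -EFinD; congr EFin; ring.
  by move=> r0; rewrite ge0_muleDl ?mule_ge0 ?lee_fin// -!muleA.
have h1 s : (energy leb4 (fun z => wave (half s a) z * wave b z)%R <= (4 * K)%:E * X)%E.
  have -> : (fun z => wave (half s a) z * wave b z) = (fun z =>
      wave (half s a) z * wave (half true b) z + wave (half s a) z * wave (half false b) z).
    by apply/funext => z; rewrite (split b)// mulrDr.
  apply: le_trans (energyD leb4 (cmeasurableM (mw _ _ ai) (mw _ _ bi)) (cmeasurableM (mw _ _ ai) (mw _ _ bi))) _.
  rewrite dist//.
  by apply: leeD; apply: lee_wpmul2l; rewrite ?lee_fin//; exact: half_estimate.
have -> : (fun z => wave a z * wave b z) =
    (fun z => wave (half true a) z * wave b z + wave (half false a) z * wave b z).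
  by apply/funext => z; rewrite sa mulrDl.
have mwb := cmeasurable_wave mb.
apply: le_trans (energyD leb4 (cmeasurableM (mw _ _ ai) mwb) (cmeasurableM (mw _ _ ai) mwb)) _.
have -> : 16 * K = 4 * (4 * K) by ring.
have K4 : 0 <= 4 * K by exact: (mulr_ge0 (ler0n _ 4) K0).
rewrite (dist _ K4).
by apply: leeD; apply: lee_wpmul2l; rewrite ?lee_fin.
Qed.

Lemma cvg_sqn (z : nat -> C) (l : C) : (fun n => sqn (z n - l)) @ \oo --> (0 : R) ->
  (fun n => sqn (z n)) @ \oo --> sqn l.
Proof.
move=> h; have part (p : C -> R) : (forall x y, p (x - y) = p x - p y) ->
    (forall x, p x ^+ 2 <= sqn x) -> (fun n => p (z n)) @ \oo --> p l.
  move=> pB p2; apply/cvgrPdist_le => e e0.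
  move/cvgrPdist_le: h => /(_ (e ^+ 2) (exprn_gt0 2 e0)); apply: filterS => n.
  rewrite sub0r normrN ger0_norm ?sqn_ge0// => hn.
  rewrite distrC -pB -(@ler_sqr R) ?nnegrE ?normr_ge0 ?(ltW e0)// real_normK ?num_real//.
  exact: le_trans hn.
rewrite /sqn expr2 [_ ^+ 2 in X in _ + X]expr2; under eq_fun do rewrite !expr2.
have h1 : (fun n => complex.Re (z n)) @ \oo --> complex.Re l.
  by apply: part => [x y|x]; [rewrite cReD cReN|rewrite lerDl sqr_ge0].
have h2 : (fun n => complex.Im (z n)) @ \oo --> complex.Im l.
  by apply: part => [x y|x]; [rewrite cImD cImN|rewrite lerDr sqr_ge0].
by apply: cvgD; exact: cvgM.
Qed.

Lemma regular_evolved e a t : regular e (fun k => evolved a (t, k)) =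
  (fun k => evolved (regular e a) (t, k)).
Proof. by apply/funext => k; rewrite /regular /evolved mulrCA. Qed.

(** The regularised waves converge almost everywhere in space-time, because
    their distance to the wave is uniformly small in time; the factor
    [decay 1] makes it square integrable. *)
Lemma wave_cvg_ae a u (N : nat -> nat) : cmeasurable u -> L2 leb3 a ->
  (forall t, is_fourier (fun x => u (t, x)) (fun k => evolved a (t, k))) ->
  (forall j, en (fun k => regular (eps (N j)) a k - a k)%R <= (8^-1 ^+ j / 4)%:E)%E ->
  \forall z \ae leb4, (fun j => sqn (wave (regular (eps (N j)) a) z)) @ \oo --> sqn (u z).
Proof.
move=> mu La hu hN; have ma := L2_cmeas La.
have md : cmeasurable (fun z : R4 R => (decay 1 z.1)%:C).
  by apply: cmeasurable_real; exact: (measurableT_comp (measurable_decay 1) measurable_fst).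
have mW j : cmeasurable (wave (regular (eps (N j)) a)).
  by apply: cmeasurable_wave; exact: cmeasurable_regular.
pose h j (z : R4 R) := (decay 1 z.1)%:C * wave (regular (eps (N j)) a) z.
pose f (z : R4 R) := (decay 1 z.1)%:C * u z.
have mh j : cmeasurable (h j) by exact: cmeasurableM.
have mf : cmeasurable f by exact: cmeasurableM.
have hE j : (energy leb4 (fun z => h j z - f z)%R <= (8^-1 ^+ j)%:E)%E.
  rewrite energy4E; last exact: cmeasurableB.
  have bt t : (en (fun x => h j (t, x) - f (t, x))%R <= (decay 1 t)%:E * (8^-1 ^+ j / 2)%:E)%E.
    have -> : (fun x => h j (t, x) - f (t, x)) =
        (fun x => (decay 1 t)%:C * (fint 1 (regular (eps (N j)) (fun k => evolved a (t, k))) x - u (t, x))).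
      by apply/funext => x; rewrite /h /f /= mulrBr /wave regular_evolved.
    have mx : cmeasurable (fun x => fint 1 (regular (eps (N j)) (fun k => evolved a (t, k))) x - u (t, x)).
      apply: cmeasurableB; last exact: cmeasurable_pair1.
      apply: cmeasurable_fint; apply: cmeasurable_regular.
      exact: (cmeasurable_pair1 t (cmeasurable_evolved ma)).
    rewrite energyZ// sqnC; apply: lee_pmul; rewrite ?energy_ge0 ?lee_fin ?sqr_ge0//.
      by rewrite expr2 ler_piMl ?decay_ge0// decay_le1.
    apply: le_trans (inversion_rate (N j) (hu t)) _.
    rewrite (_ : (8^-1 ^+ j / 2)%:E = (2%:E * (8^-1 ^+ j / 4)%:E)%E); last first.
      by rewrite -EFinM; congr EFin; field.
    apply: lee_wpmul2l; first by rewrite lee_fin.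
    apply: le_trans (hN j); rewrite le_eqVlt; apply/orP; left; apply/eqP.
    apply: eq_integral => k _; rewrite regular_evolved /regular /evolved /=.
    by rewrite -mulrBr sqnM sqn_expi mul1r.
  apply: (@le_trans _ _ (\int[leb]_t ((decay 1 t)%:E * (8^-1 ^+ j / 2)%:E))%E).
    apply: ge0_le_integral; first exact: measurableT.
    - by move=> t _; exact: energy_ge0.
    - apply: (@measurable_integral2 _ _ _ _ R leb3 (fun z => (sqn (h j z - f z))%:E)).
        by apply/measurable_EFinP/measurable_sqn; exact: cmeasurableB.
      by move=> z; rewrite lee_fin sqn_ge0.
    - by apply: emeasurable_funM => //; apply/measurable_EFinP; exact: measurable_decay.
    - by move=> t _; exact: bt.
  have p0 : 0 <= 8^-1 ^+ j / 2 :> R by rewrite divr_ge0 ?exprn_ge0.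
  rewrite ge0_integralZr//; last 2 first.
  - by apply/measurable_EFinP; exact: measurable_decay.
  - by move=> t _; rewrite lee_fin decay_ge0.
  by rewrite integral_decay// -EFinM lee_fin le_eqVlt; apply/orP; left; apply/eqP; field.
apply: (ae_imp (fast_cvg_ae mh mf hE)) => z hz; apply: cvg_sqn.
have d0 : 0 < decay 1 z.1 ^+ 2 by rewrite exprn_gt0// expR_gt0.
have -> : (fun j => sqn (wave (regular (eps (N j)) a) z - u z)) =
    (fun j => (decay 1 z.1 ^+ 2)^-1 * sqn (h j z - f z)).
  by apply/funext => j; rewrite /h /f -mulrBr sqnM sqnC mulKf ?gt_eqF.
rewrite -(mulr0 (decay 1 z.1 ^+ 2)^-1); apply: cvgM; [exact: cvg_cst|exact: hz].
Qed.


Lemma fast_regular a b : L2 leb3 a -> L2 leb3 b -> exists N : nat -> nat, forall j,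
  (en (fun k => regular (eps (N j)) a k - a k)%R <= (8^-1 ^+ j / 4)%:E)%E /\
  (en (fun k => regular (eps (N j)) b k - b k)%R <= (8^-1 ^+ j / 4)%:E)%E.
Proof.
move=> La Lb.
have /choice[N NP] : forall j, exists n,
    (en (fun k => regular (eps n) a k - a k)%R <= (8^-1 ^+ j / 4)%:E)%E /\
    (en (fun k => regular (eps n) b k - b k)%R <= (8^-1 ^+ j / 4)%:E)%E.
  move=> j; have e0 : 0 < 8^-1 ^+ j / 4 :> R by rewrite divr_gt0// exprn_gt0.
  have [N1 h1] := cvg_regular La e0; have [N2 h2] := cvg_regular Lb e0.
  by exists (maxn N1 N2); split; [apply: h1; exact: leq_maxl|apply: h2; exact: leq_maxr].
by exists N.
Qed.

(** Fatou's lemma along the regularised waves, to which [wave_estimate]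
    applies. *)
Lemma product_estimate (mu : R) u v a b : 0 < mu -> cmeasurable u -> cmeasurable v ->
  L2 leb3 a -> L2 leb3 b ->
  (forall k, a k != 0 -> 0 < `|k.1| < mu) -> (forall k, b k != 0 -> k.1 != 0) ->
  (forall t, is_fourier (fun x => u (t, x)) (fun k => evolved a (t, k))) ->
  (forall t, is_fourier (fun x => v (t, x)) (fun k => evolved b (t, k))) ->
  (energy leb4 (fun z => u z * v z)%R <= (16 * wave_constant mu)%:E * (en a * en b))%E.
Proof.
move=> mu0 mu' mv La Lb ha hb hu hv.
have [N hN] := fast_regular La Lb; have [ma mb] := (L2_cmeas La, L2_cmeas Lb).
have cu := wave_cvg_ae mu' La hu (fun j => (hN j).1).
have cv := wave_cvg_ae mv Lb hv (fun j => (hN j).2).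
have e0 n : 0 < eps n by rewrite invr_gt0.
have mW j f : cmeasurable f -> cmeasurable (wave (regular (eps (N j)) f)).
  by move=> mf; apply: cmeasurable_wave; exact: cmeasurable_regular.
have supp f (P : R3 R -> Prop) e : (forall k, f k != 0 -> P k) -> (forall k, regular e f k != 0 -> P k).
  by move=> hf k; rewrite /regular mulf_eq0 negb_or => /andP[_]; exact: hf.
rewrite /energy; apply: (fatou_cvg (f := fun j z =>
  sqn (wave (regular (eps (N j)) a) z * wave (regular (eps (N j)) b) z))).
- by move=> j; apply: measurable_sqn; apply: cmeasurableM; exact: mW.
- by apply: measurable_sqn; exact: cmeasurableM.
- by move=> j z; exact: sqn_ge0.
- by move=> z; exact: sqn_ge0.
- apply: (ae_imp (ae_conj cu cv)) => z [hu' hv']; rewrite sqnM; under eq_fun do rewrite sqnM.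
  exact: cvgM.
- move=> j; apply: le_trans (wave_estimate mu0 (cintegrable_regular (e0 _) La)
    (cintegrable_regular (e0 _) Lb) (supp _ _ _ ha) (supp _ _ _ hb)) _.
  apply: lee_wpmul2l; first by rewrite lee_fin mulr_ge0 ?wave_constant_ge0.
  apply: lee_pmul; rewrite ?energy_ge0//.
    by apply: le_energy => //; [exact: cmeasurable_regular|move=> k; exact: sqn_regular].
  by apply: le_energy => //; [exact: cmeasurable_regular|move=> k; exact: sqn_regular].
Qed.

Lemma is_fourier_ae f g g' : is_fourier f g -> cmeasurable g' ->
  (\forall k \ae leb3, g' k = g k) -> is_fourier f g'.
Proof.
move=> /is_fourierP[Lf Lg [h [hi hL h1 h2]]] mg' gg'.
have mg := L2_cmeas Lg.
have Lg' : L2 leb3 g'.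
  by apply/L2P; split => //; rewrite (ae_eq_energy mg' mg gg'); have /L2P[] := Lg.
split => //; exists h; first by move=> n; split; [exact: hi|exact: hL].
split; first exact/cvg_energyP.
under eq_fun do under eq_fun do rewrite fourier3E.
apply/cvg_energyP => e e0; have [N hN] := h2 e e0; exists N => n Nn.
apply: le_trans (hN n Nn); rewrite le_eqVlt; apply/orP; left; apply/eqP.
have mF : cmeasurable (fint (-1) (h n)) by apply: cmeasurable_fint; exact: cintegrable_meas (hi n).
apply: ae_eq_energy; [exact: cmeasurableB|exact: cmeasurableB|].
by apply: (ae_imp gg') => k ->.
Qed.

(** As transforms are unique almost everywhere, the multipliers of the evolution
    and of the projection can be composed. *)
Lemma evolution_fourier (A : set (R3 R)) (u0 : R3 R -> C) u w g a :
  is_evolution u0 u -> is_projection_at_all_times A u w ->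
  is_fourier u0 g -> cmeasurable a -> (\forall k \ae leb3, a k = (\1_A k : R)%:C * g k) ->
  forall t, is_fourier (fun x => w (t, x)) (fun k => evolved a (t, k)).
Proof.
move=> [_ hu] [_ hw] hg ma hag t.
have [fh [hh [F1 F2 E1]]] := hu t; have [fh' [hh' [F3 F4 E2]]] := hw t.
have U1 := is_fourier_uniq hg F1; have U2 := is_fourier_uniq F2 F3.
apply: (is_fourier_ae F4); first exact: (cmeasurable_pair1 t (cmeasurable_evolved ma)).
apply: (ae_imp (ae_conj (ae_conj E1 E2) (ae_conj (ae_conj U1 U2) hag))).
move=> k [[e1 e2] [[e3 e4] e5]]; rewrite /evolved e2 -e4 e1 e5 e3 symbolSE /=.
by rewrite mulrCA.
Qed.

Lemma initial_fourier (A : set (R3 R)) (u0 u0A g : R3 R -> C) : is_projection A u0 u0A ->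
  is_fourier u0 g -> exists2 a, is_fourier u0A a & \forall k \ae leb3, a k = (\1_A k : R)%:C * g k.
Proof.
move=> [fh [hh [F1 F2 E1]]] hg; exists hh => //.
by apply: (ae_imp (ae_conj E1 (is_fourier_uniq hg F1))) => k [-> ->].
Qed.

Lemma sqrt_product_le (K : R) (X A B : \bar R) : 0 <= K -> (0 <= X)%E -> (0 <= A)%E -> (0 <= B)%E ->
  (X <= (K ^+ 2)%:E * (A * B))%E ->
  (X `^ 2^-1 <= K%:E * (A `^ 2^-1) * (B `^ 2^-1))%E.
Proof.
move=> K0 X0 A0 B0 /(sqrte_le X0); rewrite !poweRM ?lee_fin ?sqr_ge0 ?mule_ge0//.
rewrite muleA; congr (_ <= _ * _ * _)%E.
by rewrite poweR_EFin powR12_sqrt ?sqr_ge0// sqrtr_sqr ger0_norm.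
Qed.

(** The constant is 16 [wave_constant mu], times a factor 4 for each of the
    two passages from transforms to data. *)
Lemma low_frequency_product (mu lam : R) (u0 v0 : R3 R -> C) u v ul vg :
  0 < mu -> 0 < lam -> L2 leb3 u0 -> L2 leb3 v0 ->
  is_evolution u0 u -> is_evolution v0 v ->
  is_projection_at_all_times (below mu) u ul ->
  is_projection_at_all_times (above lam) v vg ->
  (energy leb4 (fun p => ul p * vg p)%R <=
     (512 * c3 R ^+ 2 * pi ^+ 2 * mu ^+ 2)%:E * (en u0 * en v0))%E.
Proof.
move=> mu0 lam0 Lu Lv eu ev pu pv.
have [g [_ [hg _ _]]] := eu.2 0; have [h [_ [hh _ _]]] := ev.2 0.
have [_ Lg _] := hg; have [_ Lh _] := hh.
have mn : measurable_fun setT (fun k : R3 R => `|k.1|).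
  by apply: measurableT_comp => //; exact: measurable_proj1.
pose a (k : R3 R) : C := (0 < `|k.1| < mu)%R%:R%:C * g k.
pose b (k : R3 R) : C := (lam < `|k.1|)%R%:R%:C * h k.
have mr : measurable_fun setT (fun b : bool => b%:R : R) by [].
have ma : cmeasurable a.
  apply: cmeasurableM; last exact: L2_cmeas Lg.
  apply: cmeasurable_real; apply: (measurableT_comp mr).
  by apply: measurable_and; exact: measurable_fun_ltr.
have mb : cmeasurable b.
  apply: cmeasurableM; last exact: L2_cmeas Lh.
  by apply: cmeasurable_real; apply: (measurableT_comp mr); exact: measurable_fun_ltr.
have bool_le (c : bool) (z : C) : sqn (c%:R%:C * z) <= sqn z.
  by rewrite sqnM sqnC; case: c; rewrite ?expr0n ?expr1n ?mul0r ?mul1r ?sqn_ge0.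
have La : L2 leb3 a by apply: (le_L2 ma Lg) => k; exact: bool_le.
have Lb : L2 leb3 b by apply: (le_L2 mb Lh) => k; exact: bool_le.
have nz (c : bool) (z : C) : c%:R%:C * z != 0 -> c.
  by case: c => //; rewrite mul0r eqxx.
have ae_a : \forall k \ae leb3, a k = (\1_(below mu) k : R)%:C * g k.
  apply: (ae_imp (ae3_neq (0 : R) 0 0)) => k [k0 _ _].
  by rewrite /a normr_gt0 k0 /= indicE; congr (_%:R%:C * _); rewrite /below mem_setE.
have ae_b : \forall k \ae leb3, b k = (\1_(above lam) k : R)%:C * h k.
  apply: aeW => k.
  by rewrite /b indicE; congr (_%:R%:C * _); rewrite /above mem_setE.
have ha k : a k != 0 -> 0 < `|k.1| < mu by exact: nz.
have hb k : b k != 0 -> k.1 != 0.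
  by move=> /nz hk; rewrite -normr_gt0; exact: lt_trans hk.
apply: le_trans (product_estimate mu0 pu.1 pv.1 La Lb ha hb
  (evolution_fourier eu pu hg ma ae_a) (evolution_fourier ev pv hh mb ae_b)) _.
have e1 : (en a <= 4%:E * en u0)%E.
  apply: le_trans (is_fourier_energy hg); apply: le_energy ma (L2_cmeas Lg) _ => k; exact: bool_le.
have e2 : (en b <= 4%:E * en v0)%E.
  apply: le_trans (is_fourier_energy hh); apply: le_energy mb (L2_cmeas Lh) _ => k; exact: bool_le.
apply: (@le_trans _ _ ((16 * wave_constant mu)%:E * ((4%:E * en u0) * (4%:E * en v0)))%E).
  apply: lee_wpmul2l; first by rewrite lee_fin mulr_ge0 ?wave_constant_ge0.
  by apply: lee_pmul; rewrite ?energy_ge0.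
have -> : (512 * c3 R ^+ 2 * pi ^+ 2 * mu ^+ 2)%:E = ((16 * wave_constant mu)%:E * (4%:E * 4%:E))%E.
  by rewrite -!EFinM /wave_constant; congr EFin; ring.
have E (x y p q : \bar R) : (x * (y * p * (y * q)) = x * (y * y) * (p * q))%E.
  by rewrite -(muleA x) (muleACA y).
by rewrite E lexx.
Qed.

End waves.

(** * The weighted convolution *)

Section restriction.
Context d (T : measurableType d) (R : realType) (m : {measure set T -> \bar R}).

Lemma cintegral_mkcond (D : set T) (f : T -> R[i]) : measurable D ->
  cintegral m D f = cintegral m setT (fun x => (\1_D x : R)%:C * f x).
Proof.
move=> mD; have E (p : R[i] -> R) : (forall (r : R) z, p (r%:C * z) = r * p z) ->
    (fun x => (p ((\1_D x : R)%:C * f x))%:E) = (fun x => (p (f x))%:E) \_ D.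
  move=> pM; apply/funext => x; rewrite pM indicE /patch.
  by case: ifP => _; rewrite ?mul1r ?mul0r.
have ERe : (fun x => (complex.Re ((\1_D x : R)%:C * f x))%:E) = (fun x => (complex.Re (f x))%:E) \_ D.
  by apply: E => r z; rewrite cReM cReC cImC mul0r subr0.
have EIm : (fun x => (complex.Im ((\1_D x : R)%:C * f x))%:E) = (fun x => (complex.Im (f x))%:E) \_ D.
  by apply: E => r z; rewrite cImM cReC cImC mul0r addr0.
have P : cintegrable m setT (fun x => (\1_D x : R)%:C * f x) <-> cintegrable m D f.
  by rewrite /cintegrable ERe EIm; split=> -[h1 h2]; split; apply/(integrable_mkcond _ mD).
rewrite /cintegral; case: asboolP => h1; case: asboolP => h2.
- congr (_ +i* _); rewrite /Rintegral.
    by rewrite integral_mkcond -ERe.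
  by rewrite integral_mkcond -EIm.
- by case: h2; apply/P.
- by case: h1; apply/P.
- by [].
Qed.

Lemma measure_indic (D : set T) : measurable D -> m D = (\int[m]_x (\1_D x : R)%:E)%E.
Proof. by move=> mD; rewrite integral_indic// setIT. Qed.

End restriction.

Section weighted_convolution.
Variable R : realType.
Local Notation leb := (@lebesgue_measure R).
Local Notation leb2 := (@leb2 R).
Local Notation leb3 := (@leb3 R).
Local Notation leb4 := (@leb4 R).
Local Notation C := (R[i]).
Implicit Types (a b : R3 R -> C) (U V : R4 R -> C) (G B : set (R2 R)).
Local Notation en := (energy leb3).

Lemma ae_reflect (p : R3 R) (P : R3 R -> Prop) : (\forall k \ae leb3, P k) ->
  \forall q \ae leb3, P (p - q).
Proof.
move=> [A [mA A0 PA]]; have mp := measurable_R3reflect p.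
have mA' : measurable ((fun q : R3 R => p - q) @^-1` A).
  by rewrite -[X in measurable X]setTI; apply: mp.
exists ((fun q : R3 R => p - q) @^-1` A); split; [exact: mA'| |by move=> q hq; apply: PA].
rewrite (measure_indic leb3 mA') -A0 (measure_indic leb3 mA).
have mAE : measurable_fun setT (fun q : R3 R => (\1_A q : R)%:E).
  by apply/measurable_EFinP; exact: measurable_indic.
by rewrite -(integral3_reflect p mAE).
Qed.

Lemma weighted_convE (D : set (R3 R)) (lam : R) U V a b (t : R) (p : R3 R) : measurable D ->
  cmeasurable a -> cmeasurable b ->
  cmeasurable (fun k => U (t, k)) -> cmeasurable (fun k => V (t, k)) ->
  (\forall k \ae leb3, U (t, k) = evolved a (t, k)) ->
  (\forall k \ae leb3, V (t, k) = evolved b (t, k)) ->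
  weighted_conv D lam U V (t, p) =
  bilinear (sector_weight lam) (fun k => (\1_D k : R)%:C * a k) b (t, p).
Proof.
move=> mD ma mb mU mV hU hV; rewrite /weighted_conv cintegral_mkcond//=.
have mw : cmeasurable (fun q : R3 R => (sector_weight lam (q, p - q))%:C).
  apply: cmeasurable_real.
  apply: (measurableT_comp (measurable_sector_weight lam) (g := fun q : R3 R => (q, p - q))).
  by apply/measurable_fun_pairP; split; [exact: measurable_id|exact: measurable_R3reflect].
have mrefl (f : R3 R -> C) : cmeasurable f -> cmeasurable (fun q : R3 R => f (p - q)).
  by move=> mf; exact: (cmeasurable_comp mf (measurable_R3reflect p)).
have mI := cmeasurable_indic R mD.
have mev f : cmeasurable f -> cmeasurable (fun k => evolved f (t, k)).
  by move=> mf; exact: (cmeasurable_pair1 t (cmeasurable_evolved mf)).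
apply: ae_eq_cintegral.
- exact: (cmeasurableM mI (cmeasurableM (cmeasurableM mw mU) (mrefl _ mV))).
- exact: (cmeasurableM (cmeasurableM mw (mev _ (cmeasurableM mI ma))) (mrefl _ (mev _ mb))).
- apply: (ae_imp (ae_conj hU (ae_reflect p hV))) => q [-> ->].
  rewrite /evolved /sector_weight /=.
  have r (i w x a' y : C) : i * (w * (x * a') * y) = w * (x * (i * a')) * y by ring.
  exact: r.
Qed.

Lemma outer_borel G : exists B, [/\ measurable B, G `<=` B & leb2 B = vol2 G].
Proof.
have [voo|vfin] := eqVneq (vol2 G) +oo%E.
  exists setT; split => //; rewrite voo; apply/eqP; rewrite eq_le leey /=.
  by rewrite -voo; apply: ereal_inf_lbound; exists setT.
have vol0 : (0 <= vol2 G)%E by apply: le_ereal_inf_tmp => _ [B [mB _] <-]; exact: measure_ge0.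
have fv : vol2 G \is a fin_num by rewrite ge0_fin_numE// ltey.
have /choice[B hB] : forall n : nat, exists B, [/\ measurable B, G `<=` B &
    (leb2 B < vol2 G + (n.+1%:R^-1)%:E)%E].
  move=> n; have e0 : 0 < n.+1%:R^-1 :> R by rewrite invr_gt0.
  by have [_ [B [mB GB] <-] hlt] := lb_ereal_inf_adherent e0 fv; exists B.
have mI : measurable (\bigcap_n B n) by apply: bigcap_measurable => // n _; have [] := hB n.
have GI : G `<=` \bigcap_n B n by move=> x Gx n _; have [_ GB _] := hB n; exact: GB.
exists (\bigcap_n B n); split => //; apply/eqP; rewrite eq_le; apply/andP; split; last first.
  by apply: ereal_inf_lbound; exists (\bigcap_n B n).
apply/lee_addgt0Pr => e e0.
have [n hn] : exists n : nat, n.+1%:R^-1 < e.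
  exists (Num.bound e^-1); rewrite invf_plt ?posrE//.
  apply: le_lt_trans (ler_norm _) (lt_trans (archi_boundP (normr_ge0 _)) _).
  by rewrite /Num.bound normr_id ltr_nat.
have [mB _ lt] := hB n.
apply: le_trans (le_measure _ _ _ (bigcap_inf _)) (le_trans (ltW lt) _) => //; rewrite ?inE//.
by apply: leeD2l; rewrite lee_fin ltW.
Qed.

(** Along the line of slope [s = slope q] the quantity |xi s - eta| is
    constant, and at [r] it equals |r.1 s - r.2| >= (10 - 2) lam^2. *)
Lemma transversal_case (mu lam : R) (q r : R3 R) : 0 < mu -> 0 < lam -> mu <= lam ->
  mu < `|q.1| -> `|r.1| < 2 * lam -> disc lam (slope q) -> 10 * lam ^+ 2 <= norm2 r.2 ->
  64 * lam ^+ 4 <= sector_transversality (q, r).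
Proof.
move=> mu0 lam0 ml hq hr hs hn.
have q0 : q.1 != 0 by rewrite -normr_gt0; exact: lt_trans hq.
move: hs; rewrite /disc /=; set s := slope q => hs.
have sl1 : q.1 * s.1 = q.2.1 by rewrite /s /slope /= mulrC divfK.
have sl2 : q.1 * s.2 = q.2.2 by rewrite /s /slope /= mulrC divfK.
have -> : sector_transversality (q, r) = (q.2.1 + r.1 * s.1 - (q.2.1 + r.2.1)) ^+ 2 +
    (q.2.2 + r.1 * s.2 - (q.2.2 + r.2.2)) ^+ 2.
  by rewrite -{1}sl1 -{1}sl2 -!mulrDl.
clearbody s.
have s2 : s.1 ^+ 2 + s.2 ^+ 2 <= lam ^+ 2.
  by rewrite -norm2_sqr ler_sqr ?nnegrE ?sqrtr_ge0// ltW.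
have r2 : r.1 ^+ 2 <= 4 * lam ^+ 2.
  rewrite -real_normK ?num_real// (_ : 4 * lam ^+ 2 = (2 * lam) ^+ 2); last by ring.
  by rewrite ler_sqr ?nnegrE ?mulr_ge0// ltW.
have n2 : 100 * lam ^+ 4 <= r.2.1 ^+ 2 + r.2.2 ^+ 2.
  rewrite -norm2_sqr (_ : 100 * lam ^+ 4 = (10 * lam ^+ 2) ^+ 2); last by ring.
  by rewrite ler_sqr ?nnegrE ?sqrtr_ge0// mulr_ge0// sqr_ge0.
have x2 : (r.1 * s.1) ^+ 2 + (r.1 * s.2) ^+ 2 <= 4 * lam ^+ 4.
  rewrite !exprMn -mulrDr (_ : 4 * lam ^+ 4 = (4 * lam ^+ 2) * lam ^+ 2); last by ring.
  by apply: ler_pM; rewrite ?sqr_ge0// addr_ge0 ?sqr_ge0.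
have e1 : q.2.1 + r.1 * s.1 - (q.2.1 + r.2.1) = r.1 * s.1 - r.2.1 by ring.
have e2 : q.2.2 + r.1 * s.2 - (q.2.2 + r.2.2) = r.1 * s.2 - r.2.2 by ring.
rewrite e1 e2; move: (r.1 * s.1) (r.1 * s.2) x2 => X Y x2.
move: (r.2.1) (r.2.2) n2 => x y n2.
(* (X - x)^2 >= 4/5 x^2 - 4 X^2, which suffices because 4/5 * 100 - 4 * 4 = 64 *)
have := sqr_ge0 (x - 5 * X); have := sqr_ge0 (y - 5 * Y).
move: (lam ^+ 4) n2 x2 => L n2 x2 h1 h2.
lra.
Qed.

Definition sector_data (mu : R) B a (k : R3 R) : C :=
  ((mu < `|k.1| <= 2 * mu)%R%:R * \1_B (slope k))%:C * a k.

Definition dyadic_data (lam rad : R) b (k : R3 R) : C :=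
  ((lam <= `|k.1| < 2 * lam) && (rad <= norm2 k.2))%:R%:C * b k.

Lemma measurable_norm2 : measurable_fun setT (fun k : R3 R => norm2 k.2).
Proof.
apply: (measurableT_comp (f := @Num.sqrt R)).
  by apply: continuous_measurable_fun; exact: sqrt_continuous.
by apply: measurable_funD; apply: measurable_funX; [exact: measurable_proj2|exact: measurable_proj3].
Qed.

Lemma cmeasurable_sector_data mu B a : measurable B -> cmeasurable a ->
  cmeasurable (sector_data mu B a).
Proof.
move=> mB ma; apply: cmeasurableM => //; apply: cmeasurable_real; apply: measurable_funM.
  have mn : measurable_fun setT (fun k : R3 R => `|k.1|).
    by apply: measurableT_comp => //; exact: measurable_proj1.
  apply: (measurableT_comp (f := fun b : bool => b%:R : R)) => //.
  by apply: measurable_and; [exact: measurable_fun_ltr|exact: measurable_fun_ler].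
exact: (measurableT_comp (measurable_indic mB : measurable_fun setT (\1_B : R2 R -> R)) (@measurable_slope R)).
Qed.

Lemma cmeasurable_dyadic_data lam rad b : cmeasurable b -> cmeasurable (dyadic_data lam rad b).
Proof.
move=> mb; apply: cmeasurableM => //; apply: cmeasurable_real.
have mn : measurable_fun setT (fun k : R3 R => `|k.1|).
  by apply: measurableT_comp => //; exact: measurable_proj1.
apply: (measurableT_comp (f := fun b : bool => b%:R : R)) => //.
apply: measurable_and; last by apply: measurable_fun_ler => //; exact: measurable_norm2.
by apply: measurable_and; [exact: measurable_fun_ler|exact: measurable_fun_ltr].
Qed.

Lemma sector_data_neq0 mu B a k : sector_data mu B a k != 0 ->
  (mu < `|k.1| <= 2 * mu) /\ B (slope k).
Proof.
rewrite /sector_data indicE; case: (boolP (_ < _ <= _)) => hk /=; last by rewrite !mul0r eqxx.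
by case: (boolP (slope k \in B)) => [/set_mem Bk|_] /=; [split|rewrite mulr0 mul0r eqxx].
Qed.

Lemma dyadic_data_neq0 lam rad b k : dyadic_data lam rad b k != 0 ->
  (lam <= `|k.1| < 2 * lam) /\ rad <= norm2 k.2.
Proof.
by rewrite /dyadic_data; case: (boolP (_ && _)) => [/andP[]//|_] /=; rewrite mul0r eqxx.
Qed.

Definition sector_constant (mu : R) B : R := 160 * pi * mu ^+ 2 * fine (leb2 B).

Lemma sector_constant_ge0 mu B : measurable B -> 0 <= sector_constant mu B.
Proof. move=> mB; apply: mulr_ge0; last by rewrite fine_ge0 ?measure_ge0.
exact: (mulr_ge0 (mulr_ge0 (ler0n _ 160) (pi_ge0 R)) (sqr_ge0 mu)). Qed.

(** The support conditions place all pairs of interacting frequencies where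
    [weight_le] holds, hence [sector_level_sets] provides the hypothesis of
    [bilinear_energy]. *)
Lemma weighted_bilinear_energy (mu lam rad : R) B a b : 0 < mu -> 0 < lam -> measurable B ->
  (leb2 B < +oo)%E -> cmeasurable a -> cmeasurable b ->
  mu <= lam / 8 \/ [/\ mu <= lam, B `<=` disc lam & 10 * lam ^+ 2 <= rad] ->
  (forall k, a k != 0 -> (mu < `|k.1| <= 2 * mu) /\ B (slope k)) ->
  (forall k, b k != 0 -> (lam <= `|k.1| < 2 * lam) /\ rad <= norm2 k.2) ->
  (energy leb4 (bilinear (sector_weight lam) a b) <=
   (sector_constant mu B)%:E * (en a * en b))%E.
Proof.
move=> mu0 lam0 mB Bfin ma mb hc ha hb.
apply: (bilinear_energy (rho := sector_density lam mu B)) => //.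
- exact: measurable_sector_weight.
- exact: measurable_sector_density.
- by move=> z; exact: sector_density_ge0.
- move=> q r; rewrite !sqnM sqnC /sector_density /=.
  have [->|/ha[hq Bq]] := eqVneq (a q) 0; first by rewrite sqn0 !(mul0r, mulr0).
  have [->|/hb[hr nr]] := eqVneq (b r) 0; first by rewrite sqn0 !mulr0.
  have -> : sector_region lam mu (q, r).
    rewrite /sector_region /= hq hr /=; case: hc => [->//|[ml Bd rr]].
    apply/orP; right; rewrite ml /=; move: hq hr => /andP[hq _] /andP[_ hr].
    by apply: (transversal_case mu0 lam0 ml hq hr (Bd _ Bq)); exact: le_trans nr.
  by rewrite indicE mem_set//= !mul1r mulrA.
- by move=> e tau p e0; exact: sector_level_sets.
Qed.

(** With both waves restricted to bounded frequencies the weight is bounded at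
    each total frequency, and the integral converges absolutely. *)
Lemma cintegrable_truncated (mu lam n : R) a b (t : R) (p : R3 R) : 0 < mu -> 0 < lam ->
  L2 leb3 a -> L2 leb3 b ->
  (forall k, a k != 0 -> mu < `|k.1| /\ norm2 k.2 < n) ->
  (forall k, b k != 0 -> lam <= `|k.1|) ->
  cintegrable leb3 setT (fun q : R3 R =>
    (sector_weight lam (q, p - q))%:C * evolved a (t, q) * evolved b (t, p - q)).
Proof.
move=> mu0 lam0 La Lb ha hb; have [ma mb] := (L2_cmeas La, L2_cmeas Lb).
have n_ge0 (y : R2 R) : 0 <= norm2 y by exact: sqrtr_ge0.
pose M := lam + Num.sqrt (2 * (n ^+ 2 / mu ^+ 2) + 2 * ((2 * norm2 p.2 ^+ 2 + 2 * n ^+ 2) / lam ^+ 2)).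
have M0 : 0 <= M by rewrite addr_ge0 ?sqrtr_ge0// ltW.
have Lr : L2 leb3 (fun q : R3 R => b (p - q)).
  apply/L2P; split; first exact: (cmeasurable_comp mb (measurable_R3reflect p)).
  by rewrite energy_reflect//; have /L2P[] := Lb.
have iM := cintegrableZ (M%:C) (L2M_cintegrable La Lr).
apply: (le_cintegrable _ iM).
  apply: cmeasurableM; first apply: cmeasurableM.
  - apply: cmeasurable_real.
    apply: (measurableT_comp (measurable_sector_weight lam) (g := fun q : R3 R => (q, p - q))).
    by apply/measurable_fun_pairP; split; [exact: measurable_id|exact: measurable_R3reflect].
  - exact: (cmeasurable_pair1 t (cmeasurable_evolved ma)).
  - apply: (cmeasurable_comp (cmeasurable_pair1 t (cmeasurable_evolved mb)) (measurable_R3reflect p)).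
move=> q; rewrite /evolved !normcMr !normc_expi !mul1r !normcC mulrA.
have [->|/ha[hq nq]] := eqVneq (a q) 0; first by rewrite normc_0 !(mulr0, mul0r).
have [->|/hb hr] := eqVneq (b (p - q)) 0; first by rewrite normc_0 !mulr0.
apply: ler_wpM2r; first exact: normc_ge0.
apply: ler_wpM2r; first exact: normc_ge0.
rewrite !ger0_norm//; last by rewrite addr_ge0 ?sqrtr_ge0// ltW.
rewrite /sector_weight /M lerD2l /norm2 ler_wsqrtr//=.
have q2 : mu ^+ 2 <= q.1 ^+ 2 by rewrite -[leRHS]real_normK ?num_real// ler_sqr ?nnegrE// ltW.
have r2 : lam ^+ 2 <= (p.1 - q.1) ^+ 2.
  by rewrite -[leRHS]real_normK ?num_real// ler_sqr ?nnegrE// ltW.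
have mu2 : 0 < mu ^+ 2 by rewrite exprn_gt0.
have lam2 : 0 < lam ^+ 2 by rewrite exprn_gt0.
have q2p : 0 < q.1 ^+ 2 by exact: lt_le_trans q2.
have r2p : 0 < (p.1 - q.1) ^+ 2 by exact: lt_le_trans r2.
have qn : q.2.1 ^+ 2 + q.2.2 ^+ 2 <= n ^+ 2.
  by rewrite -norm2_sqr ler_sqr ?nnegrE ?n_ge0// ltW// (le_lt_trans (n_ge0 q.2)).
have s1 : (q.2.1 / q.1) ^+ 2 + (q.2.2 / q.1) ^+ 2 <= n ^+ 2 / mu ^+ 2.
  rewrite !expr_div_n -mulrDl; apply: ler_pM => //; rewrite ?addr_ge0 ?sqr_ge0 ?invr_ge0 ?sqr_ge0//.
  by rewrite lef_pV2.
have s2 : ((p.2.1 - q.2.1) / (p.1 - q.1)) ^+ 2 + ((p.2.2 - q.2.2) / (p.1 - q.1)) ^+ 2 <=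
    (2 * (Num.sqrt (p.2.1 ^+ 2 + p.2.2 ^+ 2)) ^+ 2 + 2 * n ^+ 2) / lam ^+ 2.
  rewrite !expr_div_n -mulrDl; apply: ler_pM => //; rewrite ?addr_ge0 ?sqr_ge0 ?invr_ge0 ?sqr_ge0//.
    rewrite sqr_sqrtr ?addr_ge0 ?sqr_ge0//.
    have := sqr_ge0 (p.2.1 + q.2.1); have := sqr_ge0 (p.2.2 + q.2.2).
    by move: (p.2.1) (p.2.2) (q.2.1) (q.2.2) qn => x y z w; clear; move=> *; lra.
  by rewrite lef_pV2.
move: s1 s2; set A1 := q.2.1 / q.1; set A2 := q.2.2 / q.1.
set B1 := (_ - _) / _; set B2 := (p.2.2 - _) / _ => s1 s2.
have := sqr_ge0 (A1 + B1); have := sqr_ge0 (A2 + B2).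
set E1 := n ^+ 2 / _ in s1 *; set E2 := (_ / lam ^+ 2) in s2 *.
by clear - s1 s2; move=> *; lra.
Qed.

Lemma bilinearB (w : R3 R * R3 R -> R) a a' b (t : R) (p : R3 R) :
  cintegrable leb3 setT (fun q : R3 R => (w (q, p - q))%:C * evolved a (t, q) * evolved b (t, p - q)) ->
  cintegrable leb3 setT (fun q : R3 R => (w (q, p - q))%:C * evolved a' (t, q) * evolved b (t, p - q)) ->
  bilinear w a b (t, p) - bilinear w a' b (t, p) = bilinear w (fun k => a k - a' k) b (t, p).
Proof.
move=> i1 i2; rewrite /bilinear -cintegralB//; apply: eq_cintegral => q /=.
have r (w' x a1 a2 y : C) : w' * (x * a1) * y - w' * (x * a2) * y = w' * (x * (a1 - a2)) * y by ring.
exact: r.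
Qed.

Lemma measurable_disc (r : R) : measurable (disc r).
Proof.
rewrite -[disc r]setTI; apply: (@measurable_fun_ltr _ _ _ setT (@norm2 R) (cst r)) => //.
apply: (measurableT_comp (f := @Num.sqrt R)).
  by apply: continuous_measurable_fun; exact: sqrt_continuous.
by apply: measurable_funD; apply: measurable_funX; [exact: measurable_fst|exact: measurable_snd].
Qed.

Definition truncation (n : nat) : set (R3 R) := [set q | norm2 q.2 < n%:R].

Lemma measurable_truncation n : measurable (truncation n).
Proof.
rewrite -[truncation n]setTI.
exact: (@measurable_fun_ltr _ _ _ setT _ (cst n%:R) measurable_norm2 (measurable_cst _) measurableT [set true]).
Qed.

Definition restrict (D : set (R3 R)) a (k : R3 R) : C := (\1_D k : R)%:C * a k.

Lemma cmeasurable_restrict D a : measurable D -> cmeasurable a -> cmeasurable (restrict D a).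
Proof. by move=> mD ma; apply: cmeasurableM => //; exact: cmeasurable_indic. Qed.

Lemma sqn_restrict D a k : sqn (restrict D a k) <= sqn (a k).
Proof.
rewrite /restrict sqnM sqnC indicE ler_piMl ?sqn_ge0//.
by case: (_ \in _); rewrite ?expr0n ?expr1n.
Qed.

Lemma restrict_neq0 D a k : restrict D a k != 0 -> D k /\ a k != 0.
Proof.
rewrite /restrict indicE; case: (boolP (k \in D)) => [/set_mem Dk|_]; last by rewrite mul0r eqxx.
by rewrite mul1r.
Qed.

Lemma cvg_truncation a : L2 leb3 a -> cvg_energy leb3 (fun n => restrict (truncation n) a) a.
Proof.
move=> La; have ma := L2_cmeas La.
have eqn n k : norm2 k.2 < n%:R -> restrict (truncation n) a k = a k.
  by move=> h; rewrite /restrict indicE mem_set// mul1r.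
apply: (cvg_energy_dominated _ ma La) => [n|n k|k].
- by apply: cmeasurable_restrict => //; exact: measurable_truncation.
- rewrite /restrict indicE; case: (_ \in _); rewrite ?mul1r ?mul0r ?subrr ?sqn0 ?sqn_ge0//.
  by rewrite sub0r sqnN.
- apply: cvg_near_cst; near=> n; rewrite eqn ?subrr ?sqn0//.
  near: n; exists (Num.bound (norm2 k.2)) => // n /= hn.
  apply: le_lt_trans (ler_norm _) (lt_le_trans (archi_boundP (normr_ge0 _)) _).
  by rewrite ler_nat; apply: leq_trans hn; rewrite /Num.bound normr_id.
Unshelve. all: by end_near. Qed.

Section estimate.
Variables (mu lam rad : R) (B : set (R2 R)) (a b : R3 R -> C).
Hypotheses (mu0 : 0 < mu) (lam0 : 0 < lam) (mB : measurable B) (Bfin : (leb2 B < +oo)%E).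
Hypotheses (La : L2 leb3 a) (Lb : L2 leb3 b).
Hypothesis hc : mu <= lam / 8 \/ [/\ mu <= lam, B `<=` disc lam & 10 * lam ^+ 2 <= rad].
Hypothesis ha : forall k, a k != 0 -> (mu < `|k.1| <= 2 * mu) /\ B (slope k).
Hypothesis hb : forall k, b k != 0 -> (lam <= `|k.1| < 2 * lam) /\ rad <= norm2 k.2.
Local Notation K := (sector_constant mu B).
Local Notation W := (fun n => bilinear (sector_weight lam) (restrict (truncation n) a) b).

Lemma truncated_difference n j :
  (energy leb4 (fun z => W n z - W j z)%R <=
   K%:E * (en (fun k => restrict (truncation n) a k - restrict (truncation j) a k)%R * en b))%E.
Proof.
have [ma mb] := (L2_cmeas La, L2_cmeas Lb).
have Lr i : L2 leb3 (restrict (truncation i) a).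
  apply: (le_L2 _ La); last by move=> k; exact: sqn_restrict.
  by apply: cmeasurable_restrict => //; exact: measurable_truncation.
have ci i t p := @cintegrable_truncated mu lam i%:R (restrict (truncation i) a) b t p mu0 lam0 (Lr i) Lb
  (fun k h => let: conj h1 h2 := restrict_neq0 h in conj (proj1 (andP (proj1 (ha h2)))) h1)
  (fun k h => proj1 (andP (proj1 (hb h)))).
have -> : (fun z => W n z - W j z) = bilinear (sector_weight lam)
    (fun k => restrict (truncation n) a k - restrict (truncation j) a k) b.
  by apply/funext => -[t p]; apply: bilinearB; exact: ci.
apply: weighted_bilinear_energy hc _ hb => //.
  by apply: cmeasurableB; apply: cmeasurable_restrict => //; exact: measurable_truncation.
move=> k hk; apply: ha; move: hk; apply: contra_neq => ak.
by rewrite /restrict ak !mulr0 subrr.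
Qed.

Lemma truncated_energy n : (energy leb4 (W n) <= K%:E * (en a * en b))%E.
Proof.
have [ma mb] := (L2_cmeas La, L2_cmeas Lb).
have mr : cmeasurable (restrict (truncation n) a).
  by apply: cmeasurable_restrict => //; exact: measurable_truncation.
apply: le_trans (weighted_bilinear_energy mu0 lam0 mB Bfin mr mb hc _ hb) _.
  by move=> k /restrict_neq0[_]; exact: ha.
apply: lee_wpmul2l; first by rewrite lee_fin sector_constant_ge0.
apply: lee_wpmul2r; first exact: energy_ge0.
by apply: le_energy => // k; exact: sqn_restrict.
Qed.

(** By bilinearity the difference of two truncations is controlled by the
    difference of the truncated data, which tends to 0. *)
Lemma truncated_limit : exists F, [/\ L2 leb4 F, cvg_energy leb4 W F &
  (energy leb4 F <= (2 * K)%:E * (en a * en b))%E].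
Proof.
have [ma mb] := (L2_cmeas La, L2_cmeas Lb).
have mr n : cmeasurable (restrict (truncation n) a).
  by apply: cmeasurable_restrict => //; exact: measurable_truncation.
have mW n : cmeasurable (W n).
  by apply: cmeasurable_bilinear => //; exact: measurable_sector_weight.
have K0 := sector_constant_ge0 mu mB.
have fa : en a \is a fin_num by rewrite ge0_fin_numE ?energy_ge0//; have /L2P[] := La.
have fb : en b \is a fin_num by rewrite ge0_fin_numE ?energy_ge0//; have /L2P[] := Lb.
have LW n : L2 leb4 (W n).
  apply/L2P; split => //; apply: le_lt_trans (truncated_energy n) _.
  by rewrite ltey_eq !fin_numM.
have CW e : 0 < e -> exists N, forall n j, (N <= n)%N -> (N <= j)%N ->
    (energy leb4 (fun z => W n z - W j z)%R <= e%:E)%E.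
  move=> e0; pose Q := K * fine (en b) + 1.
  have Q0 : 0 < Q by rewrite ltr_wpDl// mulr_ge0// fine_ge0 ?energy_ge0.
  have [N hN] := cvg_energy_cauchy mr ma (cvg_truncation La) (divr_gt0 e0 Q0).
  exists N => n j Nn Nj; apply: le_trans (truncated_difference n j) _.
  apply: (@le_trans _ _ (K%:E * ((e / Q)%:E * en b))%E).
    apply: lee_wpmul2l; first by rewrite lee_fin.
    by apply: lee_wpmul2r; [exact: energy_ge0|exact: hN].
  rewrite -(fineK fb) -!EFinM lee_fin mulrCA mulrAC ler_pdivrMr//.
  by rewrite ler_wpM2l ?(ltW e0)// lerDl.
have [F LF hF] := Riesz_Fischer LW CW; exists F; split => //.
apply/lee_addgt0Pr => e e0; have e2 : 0 < e / 2 by rewrite divr_gt0.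
have [N hN] := hF _ e2; have mF := LF.1.
have := energyD leb4 (cmeasurableB mF (mW N)) (mW N).
rewrite (_ : (fun z => F z - W N z + W N z) = F); last by apply/funext => z; rewrite subrK.
move/le_trans; apply; rewrite addeC; apply: leeD.
  rewrite EFinM -muleA; apply: lee_wpmul2l; [by rewrite lee_fin|exact: truncated_energy].
rewrite (_ : e%:E = (2%:E * (e / 2)%:E)%E); last by rewrite -EFinM; congr EFin; field.
by apply: lee_wpmul2l; [rewrite lee_fin|rewrite energyBC; exact: hN].
Qed.

End estimate.

(** The weighted convolution depends on the classes of [U] and [V] at each
    time alone, so both may be replaced by evolved data cut off to the
    prescribed supports, and [G] by a Borel set of the same measure. *)
Lemma weighted_conv_estimate (mu lam : R) G a b U V : 0 < mu -> 0 < lam ->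
  L2 leb3 a -> L2 leb3 b ->
  (forall t, cmeasurable (fun k => U (t, k)) /\ (\forall k \ae leb3, U (t, k) = evolved a (t, k))) ->
  (forall t, cmeasurable (fun k => V (t, k)) /\ (\forall k \ae leb3, V (t, k) = evolved b (t, k))) ->
  (\forall k \ae leb3, a k != 0 -> sector mu G k) ->
  (\forall k \ae leb3, b k != 0 -> dyadic lam k) ->
  mu <= lam / 8 \/ [/\ mu <= lam, G `<=` disc lam &
    \forall k \ae leb3, b k != 0 -> 10 * lam ^+ 2 <= norm2 k.2] ->
  (vol2 G < +oo)%E ->
  let K : R := 160 * pi * mu ^+ 2 * fine (vol2 G) in
  (energy leb4 (weighted_conv setT lam U V) <= K%:E * (en a * en b))%E /\
  exists2 F, is_weighted_conv lam U V F & (energy leb4 F <= (2 * K)%:E * (en a * en b))%E.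
Proof.
move=> mu0 lam0 La Lb hU hV sa sb hc Vfin K.
have [ma mb] := (L2_cmeas La, L2_cmeas Lb).
have [B [mB GB BE]] : exists B, [/\ measurable B, G `<=` B & leb2 B = vol2 G].
  exact: outer_borel.
have [B' [rad [mB' GB' BE' hc' hrad]]] : exists B' rad, [/\ measurable B', G `<=` B', leb2 B' = vol2 G,
    mu <= lam / 8 \/ [/\ mu <= lam, B' `<=` disc lam & 10 * lam ^+ 2 <= rad] &
    \forall k \ae leb3, b k != 0 -> rad <= norm2 k.2].
  case: hc => [hc|[ml Gd hb]].
    exists B, 0; split => //; first by left.
    by apply: aeW => k _; exact: sqrtr_ge0.
  have mD := measurable_disc lam.
  exists (B `&` disc lam), (10 * lam ^+ 2); split => //.
  - exact: measurableI.
  - by move=> x Gx; split; [exact: GB|exact: Gd].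
  - apply/eqP; rewrite eq_le; apply/andP; split.
      by rewrite -BE; apply: le_measure; rewrite ?inE//; exact: measurableI.
    apply: ereal_inf_lbound; exists (B `&` disc lam) => //; split; first exact: measurableI.
    by move=> x Gx; split; [exact: GB|exact: Gd].
  - by right; split => // x [].
have B'fin : (leb2 B' < +oo)%E by rewrite BE'.
pose a' := sector_data mu B' a; pose b' := dyadic_data lam rad b.
have ma' : cmeasurable a' by exact: cmeasurable_sector_data.
have mb' : cmeasurable b' by exact: cmeasurable_dyadic_data.
have aa' : \forall k \ae leb3, a k = a' k.
  apply: (ae_imp sa) => k hk; rewrite /a' /sector_data.
  have [->|/hk[h1 h2]] := eqVneq (a k) 0; first by rewrite mulr0.
  by rewrite h1 indicE mem_set ?mul1r//; exact: GB'.
have bb' : \forall k \ae leb3, b k = b' k.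
  apply: (ae_imp (ae_conj sb hrad)) => k [hk hr]; rewrite /b' /dyadic_data.
  have [->|nb] := eqVneq (b k) 0; first by rewrite mulr0.
  by have := hk nb; rewrite /dyadic /= => ->; rewrite (hr nb) mul1r.
have ea : en a' = en a by apply/esym/ae_eq_energy.
have eb : en b' = en b by apply/esym/ae_eq_energy.
have La' : L2 leb3 a' by apply/L2P; split => //; rewrite ea; have /L2P[] := La.
have Lb' : L2 leb3 b' by apply/L2P; split => //; rewrite eb; have /L2P[] := Lb.
have WE D z : measurable D -> weighted_conv D lam U V z = bilinear (sector_weight lam) (restrict D a') b' z.
  case: z => t p mD; apply: weighted_convE => //; do ?[exact: (hU t).1|exact: (hV t).1].
    by apply: (ae_imp (ae_conj (hU t).2 aa')) => k [-> ak]; rewrite /evolved ak.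
  by apply: (ae_imp (ae_conj (hV t).2 bb')) => k [-> bk]; rewrite /evolved bk.
have KE : K = sector_constant mu B' by rewrite /K -BE'.
have ha' k : a' k != 0 -> (mu < `|k.1| <= 2 * mu) /\ B' (slope k) by exact: sector_data_neq0.
have hb' k : b' k != 0 -> (lam <= `|k.1| < 2 * lam) /\ rad <= norm2 k.2 by exact: dyadic_data_neq0.
rewrite KE -ea -eb; split.
  have -> : weighted_conv setT lam U V = bilinear (sector_weight lam) a' b'.
    apply/funext => z; rewrite WE//; congr (bilinear _ _ _ z); apply/funext => k.
    by rewrite /restrict indicT mul1r.
  exact: weighted_bilinear_energy hc' ha' hb'.
have [F [LF hF eF]] := truncated_limit mu0 lam0 mB' B'fin La' Lb' hc' ha' hb'.
exists F => //; split => //.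
have -> : (fun n : nat => L2norm leb4 (fun p => weighted_conv [set q | norm2 q.2 < n%:R] lam U V p - F p)) =
    (fun n : nat => L2norm leb4 (fun p => bilinear (sector_weight lam) (restrict (truncation n) a') b' p - F p)).
  apply/funext => n; congr (L2norm _ _); apply/funext => z; rewrite WE//; exact: measurable_truncation.
exact/cvg_energyP.
Qed.

End weighted_convolution.

(** * Smooth bumps *)

Section smooth_closure.
Variables (R : realType) (V : normedModType R).
Implicit Types f g : V -> R.

Lemma is_derive_lim f (x v : V) (df : R) :
  (fun h : R => h^-1 *: (f (h *: v + x) - f x)) @ 0^' --> df -> is_derive x v f df.
Proof.
move=> h; have h' : (fun h0 : R => h0^-1 *: ((f \o shift x) (h0 *: v) - f x)) @ 0^' --> df by [].
by split; [apply/cvg_ex; exists df|exact: cvg_lim h'].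
Qed.

Lemma is_derive_line f (x v : V) (df : R) :
  is_derive (0 : R) 1 (fun h : R => f (h *: v + x)) df -> is_derive x v f df.
Proof.
move=> [/cvg_ex[l hl] E]; apply: is_derive_lim.
have {}E : l = df by rewrite -E; apply/esym; exact: cvg_lim hl.
rewrite -E (_ : (fun h : R => h^-1 *: (f (h *: v + x) - f x)) = (fun h : R =>
  h^-1 *: (((fun h0 : R => f (h0 *: v + x)) \o shift 0) (h *: (1 : R)) - f ((0 : R) *: v + x))))//.
by apply/funext => h /=; rewrite scale0r add0r addr0 [h *: (1 : R)]mulr1.
Qed.

Lemma Ck_continuous n f : Ck n f -> continuous f.
Proof. by case: n => [|n] []. Qed.

Lemma Ck_pred n f : Ck n.+1 f -> Ck n f.
Proof.
elim: n f => [|n IH] f [fc fd]; split => // v.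
by have [dv Dv] := fd v; split => //; exact: IH.
Qed.

Lemma Ck_cst n (c : R) : Ck n (fun _ : V => c).
Proof.
elim: n c => [|n IH] c; split; do ?[by move=> x; exact: cvg_cst] => //.
move=> v; split; first by move=> x; exact: derivable_cst.
have -> : (fun x : V => 'D_v (fun=> c) x) = (fun=> 0) by apply/funext => x; exact: derive_cst.
exact: IH.
Qed.

Lemma CkD n f g : Ck n f -> Ck n g -> Ck n (fun x => f x + g x).
Proof.
elim: n f g => [|n IH] f g [fc fd] [gc gd]; split => //.
- by move=> x; apply: cvgD; [exact: fc|exact: gc].
- by move=> x; apply: cvgD; [exact: fc|exact: gc].
move=> v; have [fv Df] := fd v; have [gv Dg] := gd v; split.
  by move=> x; exact: derivableD.
have -> : (fun x => 'D_v (fun y => f y + g y) x) = (fun x => 'D_v f x + 'D_v g x).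
  by apply/funext => x; exact: deriveD.
exact: IH.
Qed.

Lemma CkM n f g : Ck n f -> Ck n g -> Ck n (fun x => f x * g x).
Proof.
elim: n f g => [|n IH] f g Cf Cg.
  by case: Cf Cg => fc _ [gc _]; split => // x; apply: cvgM; [exact: fc|exact: gc].
have [[fc fd] [gc gd]] := (Cf, Cg).
split; first by move=> x; apply: cvgM; [exact: fc|exact: gc].
move=> v; have [fv Df] := fd v; have [gv Dg] := gd v; split.
  by move=> x; exact: derivableM.
have -> : (fun x => 'D_v (fun y => f y * g y) x) = (fun x => f x * 'D_v g x + g x * 'D_v f x).
  by apply/funext => x; exact: deriveM.
by apply: CkD; apply: IH => //; exact: Ck_pred.
Qed.

(** Functions of one linear coordinate, given by a family that is closed under
    differentiation. *)
Lemma Ck_coordinate (G : nat -> R -> R) (c : nat -> R) (p : V -> R) (s d : R) :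
  (forall k (x : R), is_derive x 1 (G k) (c k * G k.+1 x + G k.+2 x)) ->
  continuous p -> (forall (h : R) (v x : V), p (h *: v + x) = h * p v + p x) ->
  forall n k, Ck n (fun z => G k (s * p z + d)).
Proof.
move=> dG pc pl.
have cont k : continuous (fun z : V => G k (s * p z + d)).
  move=> z; have hG := isd_continuous (dG k (s * p z + d)).
  have hp : {for z, continuous (fun z => s * p z + d)}.
    by apply: cvgD; [apply: cvgM; [exact: cvg_cst|exact: pc]|exact: cvg_cst].
  exact: (continuous_comp hp hG).
have D k (x v : V) : is_derive x v (fun z => G k (s * p z + d))
    ((s * p v) * (c k * G k.+1 (s * p x + d) + G k.+2 (s * p x + d))).
  apply: is_derive_line.
  have -> : (fun h : R => G k (s * p (h *: v + x) + d)) =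
      (fun h : R => G k (h * (s * p v) + (s * p x + d))).
    by apply/funext => h; rewrite pl; congr (G k _); ring.
  have d1 := isdD (isdM (isd_id (0 : R)) (isd_cst (s * p v) 0)) (isd_cst (s * p x + d) 0).
  have d2 := @isd_comp R (G k) (fun h : R => h * (s * p v) + (s * p x + d)) 0 _ _ (dG k _) d1.
  apply: (is_derive_eq d2); rewrite !mul0r add0r addr0 mulr1 add0r.
  by rewrite mulrC.
elim=> [|n IH] k; first by split => //; exact: cont.
split; first exact: cont.
move=> v; split; first by move=> x; have [] := D k x v.
have -> : (fun x : V => 'D_v (fun z => G k (s * p z + d)) x) = (fun x : V =>
    (s * p v) * (c k * G k.+1 (s * p x + d) + G k.+2 (s * p x + d))).
  by apply/funext => x; have [] := D k x v.
by apply: CkM; [exact: Ck_cst|apply: CkD; [apply: CkM; [exact: Ck_cst|]|]; exact: IH].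
Qed.

End smooth_closure.

Section bumps.
Variable R : realType.

(** The functions x^-k exp(-1/x), extended by 0; their linear span is stable
    under differentiation. *)
Definition flat (k : nat) (x : R) : R := if 0 < x then x^-1 ^+ k * expR (- x^-1) else 0.

Lemma flat_bound k x : 0 < x -> flat k x <= k.+2`!%:R * x ^+ 2.
Proof.
move=> x0; rewrite /flat x0 expRN.
have h := @expR_ge1Dxn R x^-1 k.+1 (ltW (_ : 0 < x^-1)).
have {}h : x^-1 ^+ k.+2 / k.+2`!%:R <= expR x^-1.
  by apply: le_trans (h _); [rewrite lerDr|rewrite invr_gt0].
have f0 : 0 < k.+2`!%:R :> R by rewrite ltr0n fact_gt0.
have xk : 0 < x^-1 ^+ k.+2 by rewrite exprn_gt0// invr_gt0.
rewrite ler_pdivrMr ?expR_gt0//.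
apply: (@le_trans _ _ (k.+2`!%:R * x ^+ 2 * (x^-1 ^+ k.+2 / k.+2`!%:R))); last first.
  by rewrite ler_wpM2l// mulr_ge0 ?ltW// exprn_gt0.
rewrite le_eqVlt; apply/orP; left; apply/eqP.
rewrite (_ : x^-1 ^+ k.+2 = x^-1 ^+ k * x^-1 ^+ 2); last by rewrite -exprD addn2.
have := lt0r_neq0 f0; have := lt0r_neq0 x0.
move: (x^-1 ^+ k) => X; move: (k.+2`!%:R : R) => F x1 F1.
by field; rewrite x1 F1.
Qed.

Lemma flat_ge0 k x : 0 <= flat k x.
Proof.
by rewrite /flat; case: ifP => // x0; rewrite mulr_ge0 ?expR_ge0// exprn_ge0// invr_ge0 ltW.
Qed.

Lemma is_derive_flat (k : nat) (x : R) : is_derive x 1 (flat k) (- k%:R * flat k.+1 x + flat k.+2 x).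
Proof.
have [x0|x0|->] := ltgtP x 0.
- have f0 j : flat j x = 0 by rewrite /flat ltNge (ltW x0).
  rewrite !f0 mulr0 addr0.
  apply: (near_eq_is_derive (f := fun=> 0)).
  near=> y; rewrite /flat ltNge (_ : y <= 0)//=.
  by apply: ltW; near: y; exact: lt_nbhsl.
- have dV := @isdV R (fun y => y) x _ (lt0r_neq0 x0) (isd_id x).
  have dE := @isd_comp R (@expR R) (fun y => - y^-1) x _ _ (is_derive_expR _) (isdN dV).
  have dP := isdM (isdX k dV) dE.
  have {}dP : is_derive x 1 (fun y : R => y^-1 ^+ k * expR (- y^-1)) (- k%:R * flat k.+1 x + flat k.+2 x).
    apply: (is_derive_eq dP); rewrite /flat x0.
    have xn := lt0r_neq0 x0; move: (expR _) => E.
    case: k {dP} => [|k]; first by rewrite !mul0r oppr0 mul0r add0r expr0 !mul1r; field.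
    by rewrite /= !exprS; move: (x^-1 ^+ k) => X; move: (k.+1%:R : R) => K; field.
  apply: (near_eq_is_derive _ dP); near=> y; rewrite /flat (_ : 0 < y)//.
  by near: y; exact: lt_nbhsr.
- have -> : flat k.+1 0 = 0 by rewrite /flat ltxx.
  have -> : flat k.+2 0 = 0 by rewrite /flat ltxx.
  rewrite mulr0 addr0; apply: is_derive_lim.
  have f00 : flat k 0 = 0 by rewrite /flat ltxx.
  apply/cvgrPdist_le => e e0.
  have F0 : 0 < k.+2`!%:R :> R by rewrite ltr0n fact_gt0.
  near=> h; rewrite f00 subr0 addr0 sub0r normrN [h *: (1 : R)]mulr1.
  have hn : h != 0 by near: h; exact: nbhs_dnbhs_neq.
  rewrite normrM normfV ler_pdivrMl ?normr_gt0// ger0_norm ?flat_ge0//.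
  have he : `|h| <= e / k.+2`!%:R.
    near: h; apply: (@dnbhs0_le R) => //; exact: divr_gt0.
  have [h0|h0] := ltP 0 h; last by rewrite /flat ltNge h0 /= mulr_ge0// ltW.
  apply: le_trans (flat_bound k h0) _; rewrite gtr0_norm// expr2 mulrCA ler_pM2l//.
  by rewrite mulrC -ler_pdivlMr//; move: he; rewrite gtr0_norm.
Unshelve. all: by end_near. Qed.

Definition bump (n : nat) (a b x : R) : R :=
  flat 0 (n.+1%:R * (x - a)) * flat 0 (n.+1%:R * (b - x)).

Lemma flat0E x : flat 0 x = if 0 < x then expR (- x^-1) else 0.
Proof. by rewrite /flat expr0 mul1r. Qed.

Lemma flat0_le1 x : flat 0 x <= 1.
Proof.
by rewrite flat0E; case: ifP => // x0; rewrite -expR0 ler_expR oppr_le0 invr_ge0 ltW.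
Qed.

Lemma bump_ge0 n a b x : 0 <= bump n a b x. Proof. by rewrite mulr_ge0 ?flat_ge0. Qed.

Lemma bump_le1 n a b x : bump n a b x <= 1.
Proof. by rewrite -[1]mulr1 ler_pM ?flat_ge0 ?flat0_le1. Qed.

Lemma bump_support n a b x : bump n a b x != 0 -> a < x < b.
Proof.
rewrite /bump mulf_eq0 negb_or => /andP[]; rewrite !flat0E !pmulr_rgt0// !subr_gt0.
by case: (a < x); case: (x < b); rewrite ?eqxx.
Qed.

Lemma cvg_bump a b x : (fun n => bump n a b x) @ \oo --> (\1_(`]a, b[%classic) x : R).
Proof.
have one (y : R) : 0 < y -> (fun n : nat => flat 0 (n.+1%:R * y)) @ \oo --> (1 : R).
  move=> y0; have := @cvg_decay1 R y^-1; rewrite (_ : (fun n : nat => flat 0 (n.+1%:R * y)) = (fun n : nat => decay n.+1%:R^-1 y^-1))//.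
  apply/funext => n; rewrite flat0E pmulr_rgt0// y0 /decay ger0_norm ?invr_ge0 ?ltW//.
  by rewrite invfM.
rewrite indicE mem_setE /= in_itv /=; have [/andP[ax xb]|nx] := boolP (a < x < b).
  by rewrite -[1]mulr1; apply: cvgM; apply: one; rewrite subr_gt0.
have -> : (fun n => bump n a b x) = (fun=> 0); last exact: cvg_cst.
apply/funext => n; apply/eqP; apply: contraNT nx; exact: bump_support.
Qed.

Lemma Ck_bump (V : normedModType R) (p : V -> R) n a b : continuous p ->
  (forall (h : R) (v x : V), p (h *: v + x) = h * p v + p x) ->
  forall k, Ck k (fun z => bump n a b (p z)).
Proof.
move=> pc pl k; rewrite /bump; apply: CkM.
  have -> : (fun z => flat 0 (n.+1%:R * (p z - a))) = (fun z => flat 0 (n.+1%:R * p z + - (n.+1%:R * a))).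
    by apply/funext => z; rewrite mulrBr.
  exact: (@Ck_coordinate R V flat (fun k => - k%:R) p n.+1%:R (- (n.+1%:R * a)) is_derive_flat pc pl k 0).
have -> : (fun z => flat 0 (n.+1%:R * (b - p z))) = (fun z => flat 0 (- n.+1%:R * p z + n.+1%:R * b)).
  by apply/funext => z; congr (flat 0 _); ring.
exact: (@Ck_coordinate R V flat (fun k => - k%:R) p (- n.+1%:R) (n.+1%:R * b) is_derive_flat pc pl k 0).
Qed.

Lemma continuous_bump n a b : continuous (bump n a b).
Proof.
apply: (@Ck_continuous R R 0 (bump n a b)).
by apply: (@Ck_bump R (fun x => x)) => // x; exact: cvg_id.
Qed.

End bumps.

(** * The distributional Fourier transform of a wave *)

Section time_bumps.
Variable R : realType.
Local Notation leb := (@lebesgue_measure R).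
Local Notation C := (R[i]).
Implicit Types (g : R -> R) (lo hi a b s t : R).
Local Notation eps := (fun n : nat => (n.+1%:R^-1 : R)).

Lemma compact_support_integral g lo hi : continuous g ->
  (forall x, ~~ (lo <= x <= hi) -> g x = 0) ->
  leb.-integrable setT (EFin \o g) /\
  (\int[leb]_x (g x)%:E = \int[leb]_(x in `[lo, hi]) (g x)%:E)%E.
Proof.
move=> gc g0.
have gE : (EFin \o g) \_ `[lo, hi] = EFin \o g.
  apply/funext => x; rewrite /patch mem_setE /= in_itv /=.
  by case: ifPn => // /g0; rewrite /= => ->.
split; last by rewrite [RHS]integral_mkcond -/(EFin \o g) gE.
have mI : measurable (`[lo, hi]%classic : set (measurableTypeR R)) by exact: measurable_itv.
have i : leb.-integrable `[lo, hi] (EFin \o g).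
  apply: continuous_compact_integrable; first exact: segment_compact.
  exact: continuous_subspaceT.
by have := (integrable_mkcond (mu := leb) (EFin \o g) mI).1 i; rewrite gE.
Qed.

Definition time_fourier g t : C := cintegral leb setT (fun x => (g x)%:C * expi (- (t * x))).

Lemma cintegrable_time g lo hi t : continuous g ->
  (forall x, ~~ (lo <= x <= hi) -> g x = 0) ->
  cintegrable leb setT (fun x => (g x)%:C * expi (- (t * x))).
Proof.
move=> gc g0; have gi := (compact_support_integral gc g0).1.
have mg : measurable_fun setT g by exact: continuous_measurable_fun.
have gi' : cintegrable leb setT (fun x => (g x)%:C) by split; [exact: gi|exact: integrable0].
apply: (le_cintegrable _ gi'); last by move=> x; rewrite normcMr normc_expi mulr1.
apply: cmeasurableM; first exact: cmeasurable_real.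
by apply: cmeasurable_expi; apply: measurableT_comp => //; exact: measurable_funM.
Qed.

(** The integral of the derivative of [g x * expi (- (t * x))] vanishes. *)
Lemma time_fourier_derive g g' lo hi t : lo <= hi ->
  (forall x : R, is_derive x 1 g (g' x)) -> continuous g' ->
  (forall x, ~~ (lo < x < hi) -> g x = 0) -> (forall x, ~~ (lo <= x <= hi) -> g' x = 0) ->
  sqn (time_fourier g' t) = t ^+ 2 * sqn (time_fourier g t).
Proof.
move=> lh dg gc' g0 g0'.
have gc : continuous g by move=> x; exact: isd_continuous (dg x).
have g00 x : ~~ (lo <= x <= hi) -> g x = 0.
  by move=> h; apply: g0; apply: contra h => /andP[a b]; rewrite !ltW.
have i1 := cintegrable_time t gc' g0'; have i2 := cintegrable_time t gc g00.
have [z [Rz Iz]] : exists z : C, complex.Re z = 0 /\ complex.Im z = - t by exists (Complex 0 (- t)).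
have i3 := cintegrableZ z i2.
pose G x : C := (g' x)%:C * expi (- (t * x)) + z * ((g x)%:C * expi (- (t * x))).
have iG : cintegrable leb setT G := cintegrableD i1 i3.
have ct : continuous (fun x : R => - (t * x)).
  by move=> x; apply: cvgN; apply: cvgM; [exact: cvg_cst|exact: cvg_id].
have cc : continuous (fun x : R => cos (- (t * x))).
  by move=> x; apply: continuous_comp; [exact: ct|exact: continuous_cos].
have cs : continuous (fun x : R => sin (- (t * x))).
  by move=> x; apply: continuous_comp; [exact: ct|exact: continuous_sin].
have dt (x : R) := isdN (isdM (isd_cst t x) (isd_id x)).
have dcos (x : R) := @isd_comp R cos (fun y => - (t * y)) x _ _ (is_derive_cos _) (dt x).
have dsin (x : R) := @isd_comp R sin (fun y => - (t * y)) x _ _ (is_derive_sin _) (dt x).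
have zero (F f : R -> R) : (forall x : R, is_derive x 1 F (f x)) -> continuous f ->
    F lo = 0 -> F hi = 0 -> (forall x, ~~ (lo <= x <= hi) -> f x = 0) -> (\int[leb]_x f x)%R = 0.
  move=> dF fc Fl Fh f0; rewrite /Rintegral (compact_support_integral fc f0).2.
  by rewrite (FTC_is_derive lh (fun x _ => dF x) (fun x _ => fc x)) Fl Fh subrr.
have gl : g lo = 0 by apply: g0; rewrite ltxx.
have gh : g hi = 0 by apply: g0; rewrite ltxx andbF.
have Rh (r s : R) w : complex.Re (r%:C * w + z * (s%:C * w)) = r * complex.Re w + t * (s * complex.Im w).
  by rewrite cReD !cReM !cImM !cReC !cImC Rz Iz; ring.
have Ih (r s : R) w : complex.Im (r%:C * w + z * (s%:C * w)) = r * complex.Im w - t * (s * complex.Re w).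
  by rewrite cImD !cImM !cReM !cReC !cImC Rz Iz; ring.
have ReG x : complex.Re (G x) = g' x * cos (- (t * x)) + t * (g x * sin (- (t * x))) by exact: Rh.
have ImG x : complex.Im (G x) = g' x * sin (- (t * x)) - t * (g x * cos (- (t * x))) by exact: Ih.
have E0 : cintegral leb setT G = 0.
  rewrite (cintegralE iG); apply: complex_ext => /=.
  - apply: (zero (fun x => g x * cos (- (t * x)))); rewrite ?gl ?gh ?mul0r//.
    + move=> x; apply: (is_derive_eq (isdM (dg x) (dcos x))).
      by rewrite ReG mulr1 mulr0 addr0; ring.
    + rewrite (_ : (fun x => _) = (fun x => g' x * cos (- (t * x)) + t * (g x * sin (- (t * x))))).
        move=> x; apply: cvgD; apply: cvgM; [exact: gc'|exact: cc|exact: cvg_cst|].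
        by apply: cvgM; [exact: gc|exact: cs].
      by apply/funext => x; exact: ReG.
    + by move=> x hx; rewrite ReG g0'// g00// !mul0r mulr0 addr0.
  - apply: (zero (fun x => g x * sin (- (t * x)))); rewrite ?gl ?gh ?mul0r//.
    + move=> x; apply: (is_derive_eq (isdM (dg x) (dsin x))).
      by rewrite ImG mulr1 mulr0 addr0; ring.
    + rewrite (_ : (fun x => _) = (fun x => g' x * sin (- (t * x)) - t * (g x * cos (- (t * x))))).
        move=> x; apply: cvgB; apply: cvgM; [exact: gc'|exact: cs|exact: cvg_cst|].
        by apply: cvgM; [exact: gc|exact: cc].
      by apply/funext => x; exact: ImG.
    + by move=> x hx; rewrite ImG g0'// g00// !mul0r mulr0 subr0.
have : time_fourier g' t + z * time_fourier g t = 0.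
  by rewrite -E0 /G cintegralD// cintegralZ.
move/eqP; rewrite addr_eq0 => /eqP ->; rewrite sqnN sqnM; congr (_ * _).
by rewrite /sqn Rz Iz expr0n add0r sqrrN.
Qed.

Lemma bump_derivatives n a b : exists g1 g2 : R -> R,
  [/\ forall x : R, is_derive x 1 (bump n a b) (g1 x), forall x : R, is_derive x 1 g1 (g2 x),
      continuous g1 & continuous g2] /\
  [/\ forall x, ~~ (a <= x <= b) -> g1 x = 0 & forall x, ~~ (a <= x <= b) -> g2 x = 0].
Proof.
have [_ c2] := @Ck_bump R R (fun x => x) n a b (fun x => cvg_id) (fun h v x => erefl) 2.
have [d1 [c1 c2']] := c2 1; have [d2 [c3' _]] := c2' 1.
have out (g : R -> R) : (forall x, ~~ (a <= x <= b) -> g x = 0) ->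
    forall x, ~~ (a <= x <= b) -> 'D_1 g x = 0.
  move=> g0 x hx; rewrite -(derive_cst (0 : R) x (1 : R)); apply: near_eq_derive.
  move: hx; rewrite negb_and -!ltNge => /orP[xa|bx]; near=> y; apply: g0;
    rewrite negb_and -!ltNge; apply/orP; [left|right]; near: y.
  - exact: lt_nbhsl.
  - exact: lt_nbhsr.
have b0 x : ~~ (a <= x <= b) -> bump n a b x = 0.
  move=> hx; apply/eqP; apply: contraNT hx => /bump_support /andP[h1 h2].
  by rewrite !ltW.
exists (fun x => 'D_1 (bump n a b) x), (fun x => 'D_1 (fun y => 'D_1 (bump n a b) y) x).
split; first by split; [move=> x; exact: DeriveDef (d1 x) erefl|move=> x; exact: DeriveDef (d2 x) erefl| |].
exact: (conj (out _ b0) (out _ (out _ b0))).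
Unshelve. all: by end_near. Qed.

Lemma normc_time_fourier g lo hi : continuous g -> (forall x, ~~ (lo <= x <= hi) -> g x = 0) ->
  exists2 M : R, 0 <= M & forall t, sqn (time_fourier g t) <= M.
Proof.
move=> gc g0; have gi := (compact_support_integral gc g0).1.
have gi' : cintegrable leb setT (fun x => (g x)%:C) by split; [exact: gi|exact: integrable0].
have /cintegrableP[mg fin] := gi'.
have f0 := absint_ge0 leb (fun x => (g x)%:C).
exists (fine (absint leb (fun x => (g x)%:C)) ^+ 2); first exact: sqr_ge0.
move=> t; rewrite -normc2 ler_sqr ?nnegrE ?normc_ge0 ?fine_ge0//.
rewrite -lee_fin fineK ?ge0_fin_numE//; apply: le_trans (normc_cintegral _ _) _.
rewrite le_eqVlt; apply/orP; left; apply/eqP.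
by apply: eq_integral => x _; rewrite normcMr normc_expi mulr1.
Qed.

Lemma cmeasurable_time_fourier g : continuous g -> cmeasurable (time_fourier g).
Proof.
move=> gc; have mg : measurable_fun setT g by exact: continuous_measurable_fun.
have h : cmeasurable (fun z : R * R => (g z.2)%:C * expi (- (z.1 * z.2))).
  apply: cmeasurableM.
    by apply: cmeasurable_real; exact: (measurableT_comp mg measurable_snd).
  apply: cmeasurable_expi; apply: measurableT_comp => //; apply: measurable_funM.
    exact: measurable_fst.
  exact: measurable_snd.
exact: (cmeasurable_cintegral leb h).
Qed.

(** Two integrations by parts bound the transform by a multiple of
    1 / (1 + t^2). *)
Lemma cintegrable_time_fourier n a b : a <= b ->
  cintegrable leb setT (time_fourier (bump n a b)).
Proof.
move=> ab; have [g1 [g2 [[d1 d2 c1 c2] [z1 z2]]]] := bump_derivatives n a b.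
have c0 := @continuous_bump R n a b.
have b0 x : ~~ (a < x < b) -> bump n a b x = 0.
  by move=> hx; apply/eqP; apply: contraNT hx => /bump_support.
have b00 x : ~~ (a <= x <= b) -> bump n a b x = 0.
  by move=> h; apply: b0; apply: contra h => /andP[? ?]; rewrite !ltW.
have [M0 m0 hM0] := normc_time_fourier c0 b00; have [M2 m2 hM2] := normc_time_fourier c2 z2.
have ab2 : a - 1 <= b + 1 by lra.
have wide (x : R) : ~~ (a - 1 < x < b + 1) -> ~~ (a <= x <= b).
  by apply: contra => /andP[h1 h2]; apply/andP; split; lra.
have wide' (x : R) : ~~ (a - 1 <= x <= b + 1) -> ~~ (a <= x <= b).
  by apply: contra => /andP[h1 h2]; apply/andP; split; lra.
have E t : t ^+ 4 * sqn (time_fourier (bump n a b) t) <= M2.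
  apply: le_trans (hM2 t).
  rewrite (@time_fourier_derive g1 g2 (a - 1) (b + 1) t ab2 d2 c2 (fun x h => z1 x (wide x h))
    (fun x h => z2 x (wide' x h))).
  rewrite (@time_fourier_derive _ g1 (a - 1) (b + 1) t ab2 d1 c1 (fun x h => b00 x (wide x h))
    (fun x h => z1 x (wide' x h))).
  by rewrite mulrA -exprD.
have mA := cmeasurable_time_fourier c0.
apply/cintegrableP; split => //.
pose Q := Num.sqrt (2 * (M0 + M2)).
have bd t : Normc.normc (time_fourier (bump n a b) t) <= Q / 2 * cauchy 1 (0 - t).
  have p0 : 0 < 1 + t ^+ 2 :> R by rewrite ltr_wpDr// sqr_ge0.
  have -> : Q / 2 * cauchy 1 (0 - t) = Q / (1 + t ^+ 2).
    rewrite sub0r cauchyN /cauchy expr1n mulr1; field.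
    by rewrite gt_eqF.
  rewrite ler_pdivlMr// -(@ler_sqr R) ?nnegrE ?sqrtr_ge0 ?mulr_ge0 ?normc_ge0 ?(ltW p0)//.
  rewrite sqr_sqrtr ?mulr_ge0 ?addr_ge0// exprMn normc2.
  have := hM0 t; have := E t; have := sqn_ge0 (time_fourier (bump n a b) t).
  set S := sqn _ => S0 h4 h0.
  apply: (@le_trans _ _ (2 * (S + t ^+ 4 * S))); last by rewrite ler_wpM2l// lerD.
  have -> : 2 * (S + t ^+ 4 * S) = S * (2 * (1 + (t ^+ 2) ^+ 2)) by ring.
  by rewrite ler_wpM2l//; have := sqr_ge0 (1 - t ^+ 2); move: (t ^+ 2) => T; rewrite !expr2; lra.
have Q0 : 0 <= Q / 2 by rewrite divr_ge0 ?sqrtr_ge0.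
have mc : measurable_fun setT (fun x : R => (cauchy 1 (0 - x))%:E).
  apply/measurable_EFinP; apply: (measurableT_comp (measurable_cauchy 1)).
  exact: measurable_funB.
apply: (@le_lt_trans _ _ (\int[leb]_t ((Q / 2)%:E * (cauchy 1 (0 - t))%:E))%E).
  apply: ge0_le_integral => //.
  - by move=> t _; rewrite lee_fin normc_ge0.
  - exact/measurable_EFinP/measurable_normc.
  - exact: measurable_funeM.
  - by move=> t _; rewrite -EFinM lee_fin.
have c00 x : [set: R] x -> (0 <= (cauchy 1 (0 - x))%:E)%E by rewrite lee_fin cauchy_ge0.
rewrite ge0_integralZl//.
apply: (@le_lt_trans _ _ ((Q / 2)%:E * (2 * pi)%:E)%E).
  by apply: lee_wpmul2l; rewrite ?lee_fin//; exact: integral_cauchy_le.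
by rewrite -EFinM ltry.
Qed.

End time_bumps.

Section time_dual.
Variable R : realType.
Local Notation leb := (@lebesgue_measure R).
Local Notation C := (R[i]).
Implicit Types (g : R -> R) (lo hi a b s t : R).
Local Notation eps := (fun n : nat => (n.+1%:R^-1 : R)).

(** For a smooth bump [g] this is 2 pi [g], by Fourier inversion. *)
Definition time_dual g s : C := cintegral leb setT (fun t => time_fourier g t * expi (t * s)).

Lemma integrable_mul_cauchy e g s : 0 < e -> measurable_fun setT g ->
  leb.-integrable setT (EFin \o g) ->
  leb.-integrable setT (EFin \o (fun x => g x * cauchy e (x - s))).
Proof.
move=> e0 mg gi.
have mc : measurable_fun setT (fun x : R => cauchy e (x - s)).
  by apply: (measurableT_comp (measurable_cauchy e)); exact: measurable_funB.
have den (y : R) : 0 < e ^+ 2 + y ^+ 2 by exact: cauchy_den.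
have bd (y : R) : cauchy e y <= 2 * e / e ^+ 2.
  by rewrite ler_wpM2l ?mulr_ge0 ?(ltW e0)// lef_pV2 ?posrE ?exprn_gt0// lerDl sqr_ge0.
have K0 : 0 <= 2 * e / e ^+ 2 by rewrite divr_ge0 ?mulr_ge0 ?sqr_ge0 ?(ltW e0).
have := integrableZl measurableT (2 * e / e ^+ 2) gi; apply: le_integrable => //.
  by apply/measurable_EFinP; exact: measurable_funM.
move=> x _; rewrite /= lee_fin normrM [leRHS]normrM mulrC ler_wpM2r//.
by rewrite !ger0_norm ?cauchy_ge0.
Qed.

Lemma regularised_time_dual e g lo hi s : 0 < e -> continuous g ->
  (forall x, ~~ (lo <= x <= hi) -> g x = 0) ->
  cintegral leb setT (fun t => (decay e t)%:C * (time_fourier g t * expi (t * s))) =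
  (\int[leb]_x (g x * cauchy e (x - s)))%:C.
Proof.
move=> e0 gc g0; have gi := (compact_support_integral gc g0).1.
have mg : measurable_fun setT g by exact: continuous_measurable_fun.
have gi' : cintegrable leb setT (fun x => (g x)%:C) by split; [exact: gi|exact: integrable0].
pose f (z : measurableTypeR R * measurableTypeR R) : C := (decay e z.1)%:C * expi (z.1 * s) * ((g z.2)%:C * expi (- (z.1 * z.2))).
have fE t x : f (t, x) = (decay e t)%:C * expi (t * s) * ((g x)%:C * expi (- (t * x))) by [].
have di : cintegrable leb setT (fun t : R => (decay e t)%:C * expi (t * s)).
  by apply: cintegrable_decay => //; exact: measurable_funM.
have /cintegrableP[md fd] := di; have /cintegrableP[mgc fg] := gi'.
have mf : cmeasurable f.
  apply: cmeasurableM; first exact: (cmeasurable_comp md measurable_fst).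
  apply: cmeasurableM; first exact: (cmeasurable_comp mgc measurable_snd).
  by apply: cmeasurable_expi; apply: measurableT_comp => //; exact: measurable_funM.
have fi : (\int[leb]_t absint leb (fun x => f (t, x)) < +oo)%E.
  have -> : (\int[leb]_t absint leb (fun x => f (t, x)) =
      \int[leb]_t absint leb (fun x => ((decay e t)%:C * expi (t * s)) * (g x)%:C)%R)%E.
    apply: eq_integral => t _; apply: eq_integral => x _.
    by rewrite fE !normcMr !normc_expi !mulr1.
  by rewrite absint_tensor// lte_mul_pinfty ?absint_ge0// ge0_fin_numE// absint_ge0.
transitivity (cintegral leb setT (fun t => cintegral leb setT (fun x => f (t, x)))).
  apply: eq_cintegral => t; under [RHS]eq_cintegral do rewrite fE.
  rewrite cintegralZ; last exact: cintegrable_time gc g0.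
  by rewrite /time_fourier -mulrA [X in _ * X]mulrC.
rewrite (cFubini mf fi) -cintegral_real; last exact: integrable_mul_cauchy.
apply: eq_cintegral => x; rewrite rmorphM /= cauchyB -fourier_decay// -cintegralZ; last first.
  by apply: cintegrable_decay => //; exact: measurable_funM.
apply: eq_cintegral => t; rewrite fE.
have -> : (s - x) * t = t * s + - (t * x) by ring.
rewrite expiD.
have r (d c p q : C) : d * p * (c * q) = c * (d * (p * q)) by ring.
exact: r.
Qed.

Lemma cvg_Re_decay (f : R -> C) : cintegrable leb setT f ->
  (fun n => complex.Re (cintegral leb setT (fun t => (decay (eps n) t)%:C * f t))) @ \oo -->
  complex.Re (cintegral leb setT f).
Proof.
move=> fi; have mf := cintegrable_meas fi; have [fr _] := fi.
have md n : cmeasurable (fun t : measurableTypeR R => (decay (eps n) t)%:C).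
  by apply: cmeasurable_real; exact: measurable_decay.
have e0 n : 0 <= eps n by rewrite invr_ge0.
have ni n : cintegrable leb setT (fun t => (decay (eps n) t)%:C * f t).
  apply: (le_cintegrable (cmeasurableM (md n) mf) fi) => t; rewrite normcMr normcC ger0_norm ?decay_ge0//.
  by rewrite -[leRHS]mul1r ler_wpM2r ?normc_ge0 ?decay_le1.
rewrite (cintegralE fi) /=.
have [|||_ _ h] := @dominated_convergence _ _ R leb setT measurableT
  (fun n t => (complex.Re ((decay (eps n) t)%:C * f t))%:E) (fun t => (complex.Re (f t))%:E)
  (fun t => (Normc.normc (f t))%:E)
  (fun n => (measurable_EFinP _ _).2 (cmeasurableM (md n) mf).1) ((measurable_EFinP _ _).2 mf.1).
- apply: nearW => t _; apply: cvg_EFin; first exact: nearW.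
  have -> : fine \o (fun n => (complex.Re ((decay (eps n) t)%:C * f t))%:E) =
      (fun n => decay (eps n) t * complex.Re (f t)).
    by apply/funext => n /=; rewrite cReM cReC cImC mul0r subr0.
  by rewrite -[X in _ --> X]mul1r; apply: cvgMl; exact: cvg_decay1.
- apply/integrableP; split; first exact/measurable_EFinP/measurable_normc.
  have /cintegrableP[_] := fi; congr (_ < _)%E; apply: eq_integral => t _.
  by rewrite gee0_abs// lee_fin normc_ge0.
- apply: nearW => t n _; rewrite lee_fin; apply: le_trans (Re_le_normc _) _.
  rewrite normcMr normcC ger0_norm ?decay_ge0//.
  by rewrite -[leRHS]mul1r ler_wpM2r ?normc_ge0 ?decay_le1.
rewrite /Rintegral.
rewrite (_ : (fun n => _) = (fun n => fine (\int[leb]_t (complex.Re ((decay (eps n) t)%:C * f t))%:E)%E)); last first.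
  by apply/funext => n; rewrite cintegralE.
apply: fine_cvg; rewrite fineK//; exact: integrable_fin_num.
Qed.

(** Fourier inversion for a bump, in the weak form that is needed: after
    regularisation the dual is the average of the bump against a Cauchy kernel
    centred at [s]. *)
Lemma time_dual_gt0 n a b s : a < s < b -> 0 < complex.Re (time_dual (bump n a b) s).
Proof.
move=> /andP[as_ sb]; have ab : a <= b by rewrite ltW// (lt_trans as_).
have gc := @continuous_bump R n a b; set g := bump n a b in gc *.
have g0 x : ~~ (a <= x <= b) -> g x = 0.
  by move=> h; apply/eqP; apply: contraNT h => /bump_support /andP[h1 h2]; rewrite !ltW.
have ai : cintegrable leb setT (fun t => time_fourier g t * expi (t * s)).
  have ai := @cintegrable_time_fourier R n a b ab.
  apply: (le_cintegrable _ ai); last by move=> t; rewrite normcMr normc_expi mulr1.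
  apply: cmeasurableM; first exact: cintegrable_meas ai.
  by apply: cmeasurable_expi; exact: measurable_funM.
pose a' := (a + s) / 2; pose b' := (s + b) / 2.
pose c := flat 0 (n.+1%:R * (a' - a)) * flat 0 (n.+1%:R * (b - b')).
have [a1 a2 b1 b2] : [/\ a < a', a' < s, s < b' & b' < b] by rewrite /a' /b'; split; lra.
have f0 (x y : R) : x <= y -> flat 0 x <= flat 0 y.
  rewrite !flat0E => xy; case: ifPn => x0; last by case: ifPn => // _; exact: expR_ge0.
  rewrite (lt_le_trans x0 xy) ler_expR lerN2 lef_pV2// posrE//; exact: lt_le_trans xy.
have c0 : 0 < c.
  by rewrite mulr_gt0// flat0E pmulr_rgt0// subr_gt0 ?a1 ?b2 expR_gt0.
have gc' x : c * \1_(`]a', b']%classic) x <= g x.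
  rewrite indicE mem_setE /= in_itv /=; case: (boolP (a' < x <= b')) => [/andP[h1 h2]|_]; last first.
    by rewrite mulr0 bump_ge0.
  by rewrite mulr1; apply: ler_pM; rewrite ?flat_ge0//; apply: f0; rewrite ler_wpM2l//; lra.
pose kap := 2 * atan (b' - s) - 2 * atan (a' - s).
have kap0 : 0 < kap.
  by rewrite subr_gt0 ltr_pM2l// (lt_trans (_ : _ < atan 0))// ?lt_atan// ?atan0; lra.
suff lb k : c * kap <= complex.Re (cintegral leb setT (fun t => (decay (eps k) t)%:C * (time_fourier g t * expi (t * s)))).
  apply: (@lt_le_trans _ _ (c * kap)); first by rewrite mulr_gt0.
  by apply: (cvgr_to_ge (cvg_Re_decay ai)); exact: nearW.
have e0 : 0 < eps k by rewrite invr_gt0.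
rewrite (regularised_time_dual s e0 gc g0) cReC.
have mc : measurable_fun setT (fun x : R => cauchy (eps k) (x - s)).
  by apply: (measurableT_comp (measurable_cauchy _)); exact: measurable_funB.
have mI : measurable_fun setT (fun x : R => \1_(`]a', b']%classic) x : R) by exact: measurable_indic.
have mg : measurable_fun setT g by exact: continuous_measurable_fun.
have ii : leb.-integrable setT (EFin \o (fun x : R => \1_(`]a', b']%classic) x * cauchy (eps k) (x - s))).
  by apply: cintegrable_cauchy_itv => //; exists (a', b').
have ic : leb.-integrable setT (EFin \o (fun x : R => c * (\1_(`]a', b']%classic) x * cauchy (eps k) (x - s)))).
  exact: (integrableZl measurableT c ii).
have ig := integrable_mul_cauchy s e0 mg (compact_support_integral gc g0).1.
apply: (@le_trans _ _ (\int[leb]_x (c * (\1_(`]a', b']%classic) x * cauchy (eps k) (x - s))))%R); last first.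
  apply: le_Rintegral => // x _; rewrite mulrA ler_wpM2r ?cauchy_ge0//; exact: gc'.
rewrite RintegralZl// integral_cauchy_itv ?(ltW (lt_trans a2 b1))// ler_wpM2l ?(ltW c0)//.
have sc (y : R) : y / eps k = y * k.+1%:R by rewrite invrK.
rewrite !sc; apply: lerB; rewrite ler_pM2l// le_atan//.
  by rewrite ler_peMr ?ler1n// subr_ge0 ltW.
by rewrite ler_neMr ?ler1n// subr_le0 ltW.
Qed.

End time_dual.

(** * Test functions that are products of bumps *)

Section test_functions.
Variable R : realType.
Local Notation leb := (@lebesgue_measure R).
Local Notation leb2 := (@leb2 R).
Local Notation leb3 := (@leb3 R).
Local Notation leb4 := (@leb4 R).
Local Notation C := (R[i]).
Local Notation en := (energy leb3).
Local Notation c3 := (c3 R).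
Implicit Types (l h k : R3 R) (a b t : R) (n : nat).

Definition freq_bump n l h k : R :=
  bump n l.1 h.1 k.1 * (bump n l.2.1 h.2.1 k.2.1 * bump n l.2.2 h.2.2 k.2.2).

Definition test_bump a b n l h (z : R4 R) : C := (bump 0 a b z.1 * freq_bump n l h z.2)%:C.

Definition closed_box a b l h : set (R * (R * (R * R))) :=
  `[a, b] `*` (`[l.1, h.1] `*` (`[l.2.1, h.2.1] `*` `[l.2.2, h.2.2])).

Definition cell l h : R3 R -> R := box `]l.1, h.1] `]l.2.1, h.2.1] `]l.2.2, h.2.2].

Lemma tsupport_test_bump a b n l h : tsupport (test_bump a b n l h) `<=` closed_box a b l h /\
  compact (tsupport (test_bump a b n l h)).
Proof.
have cb : compact (closed_box a b l h).
  by do 3 (apply: compact_setX; first exact: segment_compact); exact: segment_compact.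
have clb : closed (closed_box a b l h) by apply: compact_closed cb; exact: norm_hausdorff.
have sub : tsupport (test_bump a b n l h) `<=` closed_box a b l h.
  rewrite [X in _ `<=` X](closure_id _).1//; apply: closure_subset => z /= z0.
  have : bump 0 a b z.1 * freq_bump n l h z.2 != 0 by apply: contra_neq z0 => e; rewrite /test_bump e.
  have nz (x y : R) : x * y != 0 -> x != 0 /\ y != 0 by rewrite mulf_eq0 negb_or => /andP.
  move=> /nz[/bump_support /andP[? ?] /nz[/bump_support /andP[? ?]]].
  move=> /nz[/bump_support /andP[? ?] /bump_support /andP[? ?]].
  by do ! split; rewrite /= in_itv /=; apply/andP; split; exact: ltW.
by split => //; apply: subclosed_compact cb sub; exact: closed_closure.
Qed.

Lemma test_function_test_bump a b n l h : test_function (test_bump a b n l h).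
Proof.
split; last exact: (tsupport_test_bump a b n l h).2.
move=> k; split; last exact: Ck_cst.
have c1 (V : normedModType R) : continuous (fun z : V => z) by move=> x; exact: cvg_id.
rewrite (_ : (fun x => _) = fun z : R * (R * (R * R)) => bump 0 a b z.1 * (bump n l.1 h.1 z.2.1 *
  (bump n l.2.1 h.2.1 z.2.2.1 * bump n l.2.2 h.2.2 z.2.2.2)))//.
have f1 (U W : normedModType R) (p : U * W -> W) : (fun z : U * W => z.2) = p -> continuous p.
  by move=> <- z; exact: cvg_snd.
apply: CkM; first by apply: Ck_bump => // z; exact: cvg_fst.
apply: CkM.
  apply: Ck_bump => // z.
  by apply: (@continuous_comp _ _ _ snd fst z); [exact: cvg_snd|exact: cvg_fst].
have c2 : continuous (fun z : R * (R * (R * R)) => z.2.2).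
  by move=> z; apply: (@continuous_comp _ _ _ snd snd z); exact: cvg_snd.
apply: CkM; apply: Ck_bump => // z.
  by apply: (@continuous_comp _ _ _ (fun z : R * (R * (R * R)) => z.2.2) fst z); [exact: c2|exact: cvg_fst].
by apply: (@continuous_comp _ _ _ (fun z : R * (R * (R * R)) => z.2.2) snd z); [exact: c2|exact: cvg_snd].
Qed.

Lemma freq_bump01 n l h k : 0 <= freq_bump n l h k <= 1.
Proof.
have m01 (x y : R) : 0 <= x <= 1 -> 0 <= y <= 1 -> 0 <= x * y <= 1.
  by move=> /andP[x0 x1] /andP[y0 y1]; rewrite mulr_ge0//= -[1]mulr1 ler_pM.
have b01 a b x : 0 <= bump n a b x <= 1 by rewrite bump_ge0 bump_le1.
exact: (m01 _ _ (b01 _ _ _) (m01 _ _ (b01 _ _ _) (b01 _ _ _))).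
Qed.

Lemma measurable_freq_bump n l h : measurable_fun setT (freq_bump n l h).
Proof.
have mb a b : measurable_fun setT (bump n a b).
  by apply: continuous_measurable_fun; exact: continuous_bump.
exact: measurable_tensor3 (mb _ _) (mb _ _) (mb _ _).
Qed.

Lemma freq_bump_cell n l h k : freq_bump n l h k <= cell l h k.
Proof.
have one a b x : bump n a b x <= \1_(`]a, b]%classic) x.
  rewrite indicE mem_setE /= in_itv /=; have [|nx] := boolP (a < x <= b); first by rewrite bump_le1.
  rewrite le_eqVlt; apply/orP; left; apply: contraNT nx => /bump_support /andP[-> xb].
  exact: ltW.
have b0 a b x : 0 <= bump n a b x := bump_ge0 n a b x.
have p0 := mulr_ge0 (b0 l.2.1 h.2.1 k.2.1) (b0 l.2.2 h.2.2 k.2.2).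
exact: (ler_pM (b0 _ _ _) p0 (one _ _ _) (ler_pM (b0 _ _ _) (b0 _ _ _) (one _ _ _) (one _ _ _))).
Qed.

Lemma L2_freq_bump n l h : L2 leb3 (fun k => (freq_bump n l h k)%:C) /\
  cintegrable leb3 setT (fun k => (freq_bump n l h k)%:C).
Proof.
apply: L2_real; [exact: measurable_freq_bump|exact: freq_bump01|].
have oc (a b : R) : ocitv `]a, b]%classic by exists (a, b).
apply: le_lt_trans (box_fin (oc l.1 h.1) (oc l.2.1 h.2.1) (oc l.2.2 h.2.2)).
apply: ge0_le_integral => //.
- by move=> k _; rewrite lee_fin; have /andP[] := freq_bump01 n l h k.
- by apply/measurable_EFinP; exact: measurable_freq_bump.
- by apply/measurable_EFinP; apply: measurable_box; exact: measurable_itv.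
- by move=> k _; rewrite lee_fin freq_bump_cell.
Qed.

Definition distr_constant : C := ((2 * pi) ^- 2)%:C * (c3^-1)%:C.

Lemma distr_constant_neq0 : distr_constant != 0.
Proof.
rewrite mulf_neq0// (inj_eq (@complexI R) _ 0).
  by rewrite invr_eq0 expf_neq0// gt_eqF// pi2_gt0.
by rewrite invr_eq0 gt_eqF// c3_gt0.
Qed.

Lemma fourier4_test_bump a b n l h (z : R4 R) : fourier4 (test_bump a b n l h) z =
  distr_constant * (time_fourier (bump 0 a b) z.1 *
    fint (-1) (fun k => (freq_bump n l h k)%:C) z.2).
Proof.
set be := fun k => _.
have it : cintegrable leb setT (fun s => (bump 0 a b s)%:C * expi (- (z.1 * s))).
  apply: (@cintegrable_time R (bump 0 a b) a b); first exact: continuous_bump.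
  move=> x hx; apply/eqP; apply: contraNT hx => /bump_support /andP[h1 h2]; by rewrite !ltW.
have [Lb ib] := L2_freq_bump n l h.
have ib' := cintegrable_fint (-1) z.2 ib.
have tens := @cintegral_tensor _ _ _ _ R leb leb3 _ _ it ib'.
rewrite /fourier4 /fint /distr_constant.
have -> : cintegral leb4 setT (fun x => expi (- (x.1 * z.1 + x.2.1 * z.2.1 + dot2 x.2.2 z.2.2)) *
    test_bump a b n l h x) =
  time_fourier (bump 0 a b) z.1 * cintegral leb3 setT (fun k => be k * expi (-1 * dot3 k z.2)).
  rewrite /time_fourier -tens; apply: eq_cintegral => x.
  rewrite /test_bump /be /dot3 rmorphM /= -addrA opprD expiD mulN1r (mulrC z.1 x.1).
  set e1 := expi _; set e2 := expi _.
  have r (p q g f : C) : p * q * (g * f) = g * p * (f * q) by ring.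
  exact: r.
have cc : (c3^-1)%:C * c3%:C = 1 :> C by rewrite -rmorphM /= mulVf// gt_eqF// c3_gt0.
set A := time_fourier _ _; set B := cintegral _ _ _; set p := (_ ^- 2)%:C; set c := (c3^-1)%:C in cc *.
transitivity (p * (A * B) * (c * c3%:C)); first by rewrite cc mulr1.
have r (p' c' d A' B' : C) : p' * (A' * B') * (c' * d) = p' * c' * (A' * (d * B')) by ring.
exact: r.
Qed.

(** The inversion integral with regularisation parameter 1 is controlled by
    Bessel's inequality, and its distance to [f] by [inversion_rate]. *)
Lemma is_fourier_energy_inv f g : is_fourier f g -> (en f <= 6%:E * en g)%E.
Proof.
move=> Ffg; have [/L2P[mf _] Lg _] := is_fourierP Ffg; have mg := L2_cmeas Lg.
have e0 : 0 < (1%:R : R)^-1 by rewrite invr1.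
have ir := cintegrable_regular e0 Lg; have mr := cintegrable_meas ir.
have mF := cmeasurable_fint 1 mr.
have rg : (en (regular (1%:R^-1) g) <= en g)%E.
  by apply: le_energy => // k; exact: sqn_regular.
have rd : (en (fun k => regular (1%:R^-1) g k - g k)%R <= en g)%E.
  apply: le_energy => //; first exact: cmeasurableB.
  move=> k; rewrite /regular -[X in _ - X]mul1r -mulrBl sqnM -[leRHS]mul1r ler_wpM2r ?sqn_ge0//.
  rewrite -(rmorphB (real_complex R)) sqnC -[leLHS]sqrrN opprB.
  have := decay3_le1 k (ltW e0); have := decay3_ge0 (1%:R^-1) k.
  by move: (decay3 _ _) => d d0 d1; rewrite expr_le1// ?subr_ge0// gerBl.
have := @inversion_rate R f g 0 Ffg.
set F := fint 1 _ => hF.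
have -> : en f = en (fun x => F x - (F x - f x))%R by apply: eq_integral => x _; rewrite subKr.
apply: le_trans (energyB leb3 mF (cmeasurableB mF mf)) _.
have -> : (6%:E * en g = 2%:E * en g + 2%:E * (2%:E * en g))%E.
  by rewrite muleA -EFinM -ge0_muleDl ?lee_fin// -EFinD; congr (_%:E * _)%E; ring.
apply: leeD; rewrite lee_wpmul2l ?lee_fin//.
  exact: le_trans (energy_fint (@sqr11 R) ir) rg.
by apply: le_trans hF _; rewrite lee_wpmul2l ?lee_fin.
Qed.

(** The transform of the test function is a product. Integrating first in space,
    by [is_fourier_swap], and then in time produces [time_dual] at the phase. *)
Lemma fourier_distr_test_bump (v : R4 R -> C) (g : R3 R -> C) a b n l h : a <= b ->
  cmeasurable v -> L2 leb3 g ->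
  (forall t, is_fourier (fun x => v (t, x)) (fun k => evolved g (t, k))) ->
  fourier_distr v (test_bump a b n l h) = distr_constant *
    cintegral leb3 setT (fun k => g k * (freq_bump n l h k)%:C * time_dual (bump 0 a b) (phase k)).
Proof.
move=> ab mv Lg vF; have le_sq (x : R) : 0 <= x -> x <= 1 + x ^+ 2.
  by move=> x0; have := sqr_ge0 (1 - x); lra.
set A := time_fourier (bump 0 a b).
have iA : cintegrable leb setT A by exact: cintegrable_time_fourier.
have /cintegrableP[mA fA] := iA.
have [Lb ib] := L2_freq_bump n l h; set be := fun k => (freq_bump n l h k)%:C in Lb ib *.
have Lp : L2 leb3 (fint (-1) be) by apply: L2_fint => //; exact: N1sqr.
set psi := fint (-1) be in Lp *; have /L2P[mpsi fpsi] := Lp; have /L2P[mg fg] := Lg.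
pose f (z : R4 R) := A z.1 * (v z * psi z.2).
have mf : cmeasurable f.
  apply: cmeasurableM; first exact: (cmeasurable_comp mA measurable_fst).
  by apply: cmeasurableM => //; exact: (cmeasurable_comp mpsi measurable_snd).
have mvt t : cmeasurable (fun x => v (t, x)) by exact: cmeasurable_pair1.
pose M := (1 + 6%:E * en g * en psi)%E.
have Mfin : (M < +oo)%E.
  rewrite lte_add_pinfty ?ltry// lte_mul_pinfty ?mule_ge0 ?energy_ge0//.
    by rewrite fin_numM// ge0_fin_numE ?energy_ge0.
have absv t : (absint leb3 (fun x => v (t, x) * psi x)%R <= M)%E.
  have h2 : (absint leb3 (fun x => v (t, x) * psi x)%R `^ 2 <= 6%:E * en g * en psi)%E.
    apply: le_trans (absintM leb3 (mvt t) mpsi) _; apply: lee_wpmul2r; first exact: energy_ge0.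
    apply: le_trans (is_fourier_energy_inv (vF t)) _; apply: lee_wpmul2l => //.
    by apply: le_energy; [apply: L2_cmeas; have [_ ? _] := is_fourierP (vF t)|exact: mg|move=> k; rewrite sqn_evolved].
  apply: le_trans (_ : _ <= 1 + absint leb3 (fun x => v (t, x) * psi x)%R `^ 2)%E _; last exact: leeD2l.
  have := absint_ge0 leb3 (fun x => v (t, x) * psi x); case: (absint _ _) => [x| |]//=.
    by rewrite lee_fin => x0; rewrite (powR_mulrn 2 x0) -EFinD lee_fin le_sq.
  by rewrite pnatr_eq0 /= addey.
have fi : (\int[leb]_t absint leb3 (fun x => f (t, x)) < +oo)%E.
  apply: (@le_lt_trans _ _ (\int[leb]_t (M * (Normc.normc (A t))%:E))%E).
    apply: ge0_le_integral; [by []|by move=> t _; exact: absint_ge0|exact: (measurable_absint leb3 mf)| | ].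
    - by apply: measurable_funeM; exact/measurable_EFinP/measurable_normc.
    - move=> t _; rewrite muleC.
      have -> : absint leb3 (fun x => f (t, x)) = ((Normc.normc (A t))%:E * absint leb3 (fun x => v (t, x) * psi x)%R)%E.
        rewrite /absint -ge0_integralZl ?lee_fin ?normc_ge0//.
        - by apply: eq_integral => x _; rewrite -EFinM -normcMr.
        - apply/measurable_EFinP/measurable_normc; exact: cmeasurableM.
        - by move=> x _; rewrite lee_fin normc_ge0.
      by rewrite lee_wpmul2l ?lee_fin ?normc_ge0.
  rewrite ge0_integralZl//.
  - rewrite lte_mul_pinfty ?absint_ge0 ?adde_ge0 ?mule_ge0 ?energy_ge0//.
    by rewrite ge0_fin_numE// ?adde_ge0 ?mule_ge0 ?energy_ge0.
  - exact/measurable_EFinP/measurable_normc.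
  - by move=> t _; rewrite lee_fin normc_ge0.
  - by rewrite adde_ge0 ?mule_ge0 ?energy_ge0.
have gbi : cintegrable leb3 setT (fun k => g k * be k) by exact: L2M_cintegrable.
pose F (z : R4 R) := A z.1 * (evolved g z * be z.2).
have mF : cmeasurable F.
  apply: cmeasurableM; first exact: (cmeasurable_comp mA measurable_fst).
  apply: cmeasurableM; first exact: cmeasurable_evolved.
  by have /cintegrableP[mb _] := ib; exact: (cmeasurable_comp mb measurable_snd).
have Fi : (\int[leb]_t absint leb3 (fun k => F (t, k)) < +oo)%E.
  have /cintegrableP[mgb fgb] := gbi.
  have -> : (\int[leb]_t absint leb3 (fun k => F (t, k)) =
      \int[leb]_t absint leb3 (fun k => A t * (g k * be k))%R)%E.
    apply: eq_integral => t _; apply: eq_integral => k _; congr EFin.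
    by rewrite /F /evolved !normcMr normc_expi mul1r.
  by rewrite absint_tensor// lte_mul_pinfty ?absint_ge0// ge0_fin_numE// absint_ge0.
have if4 : cintegrable leb4 setT f := @cintegrable_prod _ _ _ _ R leb leb3 f mf fi.
transitivity (distr_constant * cintegral leb4 setT f).
  rewrite -cintegralZ//; apply: eq_cintegral => z; rewrite fourier4_test_bump.
  by rewrite mulrCA; congr (_ * _); rewrite mulrCA.
congr (_ * _).
transitivity (cintegral leb setT (fun t => cintegral leb3 setT (fun x => f (t, x)))).
  exact: (@cintegral_prod _ _ _ _ R leb leb3 f mf fi).
transitivity (cintegral leb setT (fun t => cintegral leb3 setT (fun k => F (t, k)))).
  apply: eq_cintegral => t; have [Lv LG _] := is_fourierP (vF t).
  transitivity (A t * cintegral leb3 setT (fun x => v (t, x) * psi x)).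
    exact: (cintegralZ (A t) (L2M_cintegrable Lv Lp)).
  rewrite -(is_fourier_swap (vF t) ib Lb).
  by symmetry; exact: (cintegralZ (A t) (L2M_cintegrable LG Lb)).
rewrite (cFubini mF Fi); apply: eq_cintegral => k; rewrite /time_dual -cintegralZ; last first.
  apply: (le_cintegrable _ iA); last by move=> t; rewrite normcMr normc_expi mulr1.
  by apply: cmeasurableM => //; apply: cmeasurable_expi; exact: measurable_funM.
apply: eq_cintegral => t; rewrite /F /evolved -/A.
have r (x p q w : C) : x * (p * q * w) = q * w * (x * p) by ring.
exact: r.
Qed.

End test_functions.

(** * Frequencies away from the support of the distribution *)

Section vanishing.
Variable R : realType.
Local Notation leb := (@lebesgue_measure R).
Local Notation leb2 := (@leb2 R).
Local Notation leb3 := (@leb3 R).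
Local Notation leb4 := (@leb4 R).
Local Notation C := (R[i]).
Local Notation en := (energy leb3).
Implicit Types (l h k p : R3 R) (a b t : R) (n : nat).

Definition inside l k h : bool :=
  [&& l.1 < k.1 <= h.1, l.2.1 < k.2.1 <= h.2.1 & l.2.2 < k.2.2 <= h.2.2].

Lemma cellE l h k : cell l h k = (inside l k h)%:R.
Proof.
rewrite /cell /box !indicE !mem_setE /= !in_itv /= /inside.
by do 3 (case: (_ < _ <= _); rewrite ?mul0r ?mul1r//=).
Qed.

Lemma time_dual_bounded n a b : a <= b ->
  cmeasurable (time_dual (bump n a b)) /\
  exists2 M : R, 0 <= M & forall s, sqn (time_dual (bump n a b) s) <= M.
Proof.
move=> ab; have iA := @cintegrable_time_fourier R n a b ab.
have /cintegrableP[mA fA] := iA; set A := time_fourier _ in iA mA fA; split.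
  have m2 : cmeasurable (fun z : R * R => A z.2 * expi (z.2 * z.1)).
    apply: cmeasurableM; first exact: (cmeasurable_comp mA measurable_snd).
    apply: cmeasurable_expi; apply: measurable_funM; first exact: measurable_snd.
    exact: measurable_fst.
  exact: (cmeasurable_cintegral leb m2).
have f0 := absint_ge0 leb A.
exists (fine (absint leb A) ^+ 2); first exact: sqr_ge0.
move=> s; rewrite -normc2 ler_sqr ?nnegrE ?normc_ge0 ?fine_ge0//.
rewrite -lee_fin fineK ?ge0_fin_numE//; apply: le_trans (normc_cintegral _ _) _.
rewrite le_eqVlt; apply/orP; left; apply/eqP.
by apply: eq_integral => x _; rewrite normcMr normc_expi mulr1.
Qed.

Lemma cvg_energy_freq_bump l h :
  cvg_energy leb3 (fun n k => (freq_bump n l h k)%:C) (fun k => (cell l h k)%:C).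
Proof.
pose f k : R := \1_(`]l.1, h.1[%classic) k.1 *
  (\1_(`]l.2.1, h.2.1[%classic) k.2.1 * \1_(`]l.2.2, h.2.2[%classic) k.2.2).
have mf : cmeasurable (fun k => (f k)%:C).
  by apply: cmeasurable_real; apply: measurable_tensor3; exact: measurable_indic.
have mn n : cmeasurable (fun k => (freq_bump n l h k)%:C).
  by apply: cmeasurable_real; exact: measurable_freq_bump.
have Lc : L2 leb3 (fun k => (cell l h k)%:C) by apply: L2_box; [exists (l.1, h.1)|exists (l.2.1, h.2.1)|exists (l.2.2, h.2.2)].
have fc k : 0 <= f k <= cell l h k.
  rewrite /f !mulr_ge0//=.
  have le (a b x : R) : \1_(`]a, b[%classic) x <= \1_(`]a, b]%classic) x :> R.
    rewrite !indicE !mem_setE /= !in_itv /=; case: (a < x) => //=; case: ltP => // /ltW ->; exact: lexx.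
  exact: (ler_pM _ _ (le _ _ _) (ler_pM _ _ (le _ _ _) (le _ _ _))).
have bc n k : 0 <= freq_bump n l h k <= cell l h k.
  by rewrite freq_bump_cell; have /andP[-> _] := freq_bump01 n l h k.
have hg n k : sqn ((freq_bump n l h k)%:C - (f k)%:C) <= sqn (cell l h k)%:C.
  rewrite -(rmorphB (real_complex R)) !sqnC -real_normK ?num_real//.
  have := bc n k; have := fc k; move: (f k) (freq_bump n l h k) (cell l h k) => x y z /andP[x0 xz] /andP[y0 yz].
  by rewrite ler_sqr ?nnegrE ?(le_trans x0 xz)// ler_norml; apply/andP; split; lra.
have hc k : (fun n => sqn ((freq_bump n l h k)%:C - (f k)%:C)) @ \oo --> (0 : R).
  have -> : (fun n => sqn ((freq_bump n l h k)%:C - (f k)%:C)) =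
      (fun n => (freq_bump n l h k - f k) * (freq_bump n l h k - f k)).
    by apply/funext => n; rewrite -(rmorphB (real_complex R)) sqnC.
  have c0 : (fun n => freq_bump n l h k - f k) @ \oo --> (0 : R).
    rewrite -(subrr (f k)); apply: cvgB; last exact: cvg_cst.
    apply: cvgM; first exact: cvg_bump.
    by apply: cvgM; exact: cvg_bump.
  by rewrite -(mulr0 0); apply: cvgM.
move=> e e0; have [N HN] := cvg_energy_dominated mn mf Lc hg hc e0.
exists N => n Nn; apply: le_trans (HN n Nn).
rewrite le_eqVlt; apply/orP; left; apply/eqP; apply: ae_eq_energy.
- by apply: cmeasurableB => //; exact: L2_cmeas Lc.
- exact: cmeasurableB.
- apply: (ae_imp (ae3_neq h.1 h.2.1 h.2.2)) => k [k1 k2 k3].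
  suff -> : cell l h k = f k by [].
  rewrite /cell /box /f !indicE !mem_setE /= !in_itv /=.
  by rewrite !le_eqVlt (negPf k1) (negPf k2) (negPf k3).
Qed.

(** As the bumps sharpen the integrals become integrals over boxes, whence [g]
    times [time_dual] vanishes on the cell; by [time_dual_gt0] the second
    factor has no zero there. *)
Lemma cell_vanishing (g : R3 R -> C) a b l h : a < b -> L2 leb3 g ->
  (forall k, inside l k h -> a < phase k < b) ->
  (forall n l' h', [&& l.1 <= l'.1, l.2.1 <= l'.2.1 & l.2.2 <= l'.2.2] ->
    [&& h'.1 <= h.1, h'.2.1 <= h.2.1 & h'.2.2 <= h.2.2] ->
    cintegral leb3 setT (fun k => g k * (freq_bump n l' h' k)%:C *
      time_dual (bump 0 a b) (phase k)) = 0) ->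
  \forall k \ae leb3, inside l k h -> g k = 0.
Proof.
move=> ab Lg ph H; set m := time_dual (bump 0 a b).
have [mm [M M0 hM]] := time_dual_bounded 0 (ltW ab); have mg := L2_cmeas Lg.
pose G k : C := g k * m (phase k).
have mph : cmeasurable (fun k => m (phase k)) := cmeasurable_comp mm (@measurable_phase R).
have LG : L2 leb3 G.
  apply: (le_L2 (cmeasurableM mg mph) (L2Z (Num.sqrt M)%:C Lg)) => k.
  by rewrite !sqnM sqnC sqr_sqrtr// mulrC ler_wpM2r ?sqn_ge0//; exact: hM.
have oc (x y : R) : ocitv `]x, y]%classic by exists (x, y).
have Lc l' h' : L2 leb3 (fun k => (cell l' h' k)%:C) by exact: L2_box.
have mc l' h' : cmeasurable (fun k => (cell l' h' k)%:C) := L2_cmeas (Lc l' h').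
pose D k : C := (cell l h k)%:C * G k.
have LD : L2 leb3 D.
  apply: (le_L2 (cmeasurableM (mc l h) (L2_cmeas LG)) LG) => k.
  rewrite sqnM sqnC -[leRHS]mul1r ler_wpM2r ?sqn_ge0// expr_le1// ?box_le1// box_ge0//.
have D0 : \forall k \ae leb3, D k = 0.
  apply: (ae0_boxes LD) => ? ? ? [u] _ <- [v] _ <- [w] _ <-.
  pose l' : R3 R := (Num.max u.1 l.1, (Num.max v.1 l.2.1, Num.max w.1 l.2.2)).
  pose h' : R3 R := (Num.min u.2 h.1, (Num.min v.2 h.2.1, Num.min w.2 h.2.2)).
  have I1 (x y : R * R) : `]x.1, x.2]%classic `&` `]y.1, y.2]%classic =
      `]Num.max x.1 y.1, Num.min x.2 y.2]%classic.
    apply/seteqP; split => z /=; rewrite !in_itv /= gt_max le_min.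
      by move=> [/andP[-> ->] /andP[-> ->]].
    by move=> /andP[/andP[-> ->] /andP[-> ->]].
  transitivity (cintegral leb3 setT (fun k => (cell l' h' k)%:C * G k)).
    apply: eq_cintegral => k; rewrite mulrA -rmorphM /= boxM.
    rewrite (I1 u (l.1, h.1)) (I1 v (l.2.1, h.2.1)) (I1 w (l.2.2, h.2.2)).
    by [].
  apply: (cvg_energy_cintegral (fun n => (L2_freq_bump n l' h').1) (Lc l' h') LG
    (cvg_energy_freq_bump l' h')) => e e0.
  exists 0 => n _; rewrite (_ : cintegral _ _ _ = 0) ?subrr ?sqn0 ?(ltW e0)//.
  rewrite -(H n l' h'); first by apply: eq_cintegral => k; rewrite /G mulrCA mulrA.
    by rewrite /= !le_max !lexx !orbT.
  by rewrite /= !ge_min !lexx !orbT.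
apply: (ae_imp D0) => k Dk ins; move: Dk; rewrite /D /G cellE ins mul1r => /eqP.
rewrite mulf_eq0 => /orP[/eqP//|/eqP m0].
by have := time_dual_gt0 0 (ph k ins); rewrite -/m m0 ltxx.
Qed.

Lemma continuous_phase (p : R * (R * R)) : p.1 != 0 -> {for p, continuous (@phase R)}.
Proof.
move=> p0.
have -> : @phase R = (fun k : R * (R * R) => k.1 * (k.1 * k.1) - (k.2.1 * k.2.1 + k.2.2 * k.2.2) / k.1).
  by apply/funext => k; rewrite /phase norm2_sqr !exprS expr0 !mulr1.
have c1 : fst k @[k --> p] --> p.1 by exact: cvg_fst.
have c2 : k.2.1 @[k --> p] --> p.2.1.
  by apply: (@continuous_comp _ _ _ snd fst p); [exact: cvg_snd|exact: cvg_fst].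
have c3 : k.2.2 @[k --> p] --> p.2.2.
  by apply: (@continuous_comp _ _ _ snd snd p); exact: cvg_snd.
apply: cvgB; first by apply: cvgM => //; exact: cvgM.
apply: cvgM; last exact: cvgV.
by apply: cvgD; apply: cvgM.
Qed.

Definition cube_lo p (r : R) : R3 R := (p.1 - r, (p.2.1 - r, p.2.2 - r)).
Definition cube_hi p (r : R) : R3 R := (p.1 + r, (p.2.1 + r, p.2.2 + r)).

(** The Fourier transform of the wave lives on the characteristic surface, so
    that its support sees exactly the frequencies of the initial data. *)
Lemma frequency_vanishing (v : R4 R -> C) (g : R3 R -> C) p : cmeasurable v -> L2 leb3 g ->
  (forall t, is_fourier (fun x => v (t, x)) (fun k => evolved g (t, k))) ->
  p.1 != 0 -> ~ distr_support (fourier_distr v) (phase p, p) ->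
  exists2 r : R, 0 < r & \forall k \ae leb3, inside (cube_lo p r) k (cube_hi p r) -> g k = 0.
Proof.
have near (r s x y : R) : r < s -> y - r <= x <= y + r -> `|y - x| < s.
  by move=> rs /andP[h1 h2]; rewrite ltr_norml; apply/andP; split; lra.
have half_ball (e x y : R) : `|x - y| < e / 2 -> x - e / 2 < y < x + e / 2.
  by rewrite ltr_norml => /andP[h1 h2]; apply/andP; split; lra.
have half_lt (e : R) : 0 < e -> e / 2 < e by move=> e0; lra.
have half_itv (e x : R) : 0 < e / 2 -> x - e / 2 < x + e / 2 by move=> e0; lra.
move=> mv Lg vF p0 /contrapT [V [oV Vp] HV].
have /nbhs_ballP[e /= e0 eV] : nbhs ((phase p, p) : R * (R * (R * R))) V by exact: open_nbhs_nbhs.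
have e2 : 0 < e / 2 by rewrite divr_gt0.
have /cvgrPdist_lt /(_ _ e2) /nbhs_ballP [d /= d0 dP] := continuous_phase p0.
pose r := Num.min (e / 2) (d / 2).
have r0 : 0 < r by rewrite lt_min e2 divr_gt0.
have [re rd] : r < e /\ r < d.
  split; first by apply: (@le_lt_trans _ _ (e / 2)); [rewrite ge_min lexx|exact: half_lt].
  by apply: (@le_lt_trans _ _ (d / 2)); [rewrite ge_min lexx orbT|exact: half_lt].
exists r => //.
apply: (@cell_vanishing g (phase p - e / 2) (phase p + e / 2) (cube_lo p r) (cube_hi p r)) => //.
- exact: half_itv.
- move=> k /and3P[k1 k2 k3].
  have w (x y : R) : y - r < x <= y + r -> `|y - x| < d.
    by move=> /andP[h1 h2]; apply: (near r) => //; rewrite ltW.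
  have : `|phase p - phase k| < e / 2 by apply: dP; split; [|split]; exact: w.
  exact: half_ball.
- move=> n l' h' /and3P[/= l1 l2 l3] /and3P[/= h1 h2 h3].
  have ab : phase p - e / 2 <= phase p + e / 2 by exact: ltW (half_itv _ _ e2).
  have H : tsupport (test_bump (phase p - e / 2) (phase p + e / 2) n l' h') `<=` V.
    move=> z /(tsupport_test_bump _ _ _ _ _).1 /= [].
    rewrite /= !in_itv /= => z0 [z1 [z2 z3]]; apply: eV.
    have w (x y u o : R) : x - r <= u -> o <= x + r -> u <= y <= o -> `|x - y| < e.
      by move=> h4 h5 /andP[h6 h7]; apply: (near r) => //; rewrite (le_trans h4 h6) (le_trans h7 h5).
    split; last by split; [|split]; [apply: w z1|apply: w z2|apply: w z3].
    exact: (near _ _ _ _ (half_lt e e0) z0).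
  by move: (HV _ (test_function_test_bump _ _ _ _ _) H); rewrite (fourier_distr_test_bump n l' h' ab mv Lg vF) => /eqP;
    rewrite mulf_eq0 (negPf (distr_constant_neq0 R)) => /eqP.
Qed.

(** Lindelof's argument: every point of [A] lies in one of countably many
    rational boxes on which the property holds almost everywhere. *)
Lemma ae_of_local (P : R3 R -> Prop) (A : set (R3 R)) :
  (forall p, A p -> exists2 r : R, 0 < r & \forall k \ae leb3, inside (cube_lo p r) k (cube_hi p r) -> P k) ->
  \forall k \ae leb3, A k -> P k.
Proof.
move=> H.
pose Q := (((rat * rat) * (rat * rat)) * (rat * rat))%type.
pose lo (q : Q) : R3 R := (ratr q.1.1.1, (ratr q.1.2.1, ratr q.2.1)).
pose hi (q : Q) : R3 R := (ratr q.1.1.2, (ratr q.1.2.2, ratr q.2.2)).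
pose good q := \forall k \ae leb3, inside (lo q) k (hi q) -> P k.
have : \forall k \ae leb3, forall n, forall q : Q, unpickle n = Some q -> good q -> inside (lo q) k (hi q) -> P k.
  apply: ae_foralln => n; case E: (unpickle n) => [q|]; last exact: aeW.
  have [gq|ngq] := pselect (good q); last by apply: aeW => k q' [<-].
  by apply: (ae_imp gq) => k Pk q' [<-] _.
move=> cov; apply: (ae_imp cov) => k Hk Ak; have [r r0 hr] := H k Ak.
have rb (x : R) : exists u : rat * rat, [/\ x - r <= ratr u.1, ratr u.2 <= x + r, ratr u.1 < x & x <= ratr u.2].
  have h1 : x - r < x by lra.
  have h2 : x < x + r by lra.
  have [u1] := rat_in_itvoo h1; have [u2] := rat_in_itvoo h2.
  rewrite !in_itv /= => /andP[a1 a2] /andP[a3 a4]; exists (u1, u2).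
  by split => //=; exact: ltW.
have [[u1 u2] /= [a1 a2 a3 a4]] := rb k.1; have [[v1 v2] /= [b1 b2 b3 b4]] := rb k.2.1.
have [[w1 w2] /= [d1 d2 d3 d4]] := rb k.2.2.
apply: (Hk (pickle (((u1, u2), (v1, v2)), (w1, w2)))); first exact: pickleK.
  apply: (ae_imp hr) => y Py /and3P[/= /andP[y1 y2] /andP[y3 y4] /andP[y5 y6]]; apply: Py.
  by rewrite /inside /= (le_lt_trans a1 y1) (le_trans y2 a2) (le_lt_trans b1 y3) (le_trans y4 b2)
    (le_lt_trans d1 y5) (le_trans y6 d2).
by apply/and3P; split; apply/andP; split.
Qed.

(** A frequency [k] in the given cylinder with k.1 != 0 has its point
    (phase k, k) of the characteristic surface off the support. *)
Lemma frequency_support (v : R4 R -> C) (g : R3 R -> C) (r : R) : cmeasurable v -> L2 leb3 g ->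
  (forall t, is_fourier (fun x => v (t, x)) (fun k => evolved g (t, k))) ->
  distr_support (fourier_distr v) `&` [set p | disc r p.2.2] = set0 ->
  \forall k \ae leb3, g k != 0 -> r <= norm2 k.2.
Proof.
move=> mv Lg vF S0.
have := @ae_of_local (fun k => g k = 0) [set k | k.1 != 0 /\ disc r k.2] _.
move=> H; apply: (ae_imp (ae_conj (H _) (ae3_neq 0 0 0))).
  move=> p [p0 pr]; apply: (frequency_vanishing mv Lg vF p0) => sp.
  have : (distr_support (fourier_distr v) `&` [set p | disc r p.2.2]) (phase p, p) by split.
  by rewrite S0.
move=> k [Hk [k0 _ _]] gk; rewrite leNgt; apply: contraNN gk => kr; apply/eqP; exact: Hk.
Qed.

End vanishing.

(** * From transforms to initial data *)

Section wave_data.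
Variable R : realType.
Local Notation leb3 := (@leb3 R).
Local Notation leb4 := (@leb4 R).
Local Notation C := (R[i]).
Local Notation en := (energy leb3).
Implicit Types (G : set (R2 R)) (U V w : R4 R -> C).

Definition sharp_evolution U a := forall t : R,
  cmeasurable (fun k => U (t, k)) /\ (\forall k \ae leb3, U (t, k) = evolved a (t, k)).

(** Settles sets of infinite measure, for which the bound is the product of
    infinity and 0 as soon as one of the data vanishes. *)
Lemma weighted_conv_eq0 (lam : R) U V a b : cmeasurable a -> cmeasurable b ->
  sharp_evolution U a -> sharp_evolution V b -> en a = 0%E \/ en b = 0%E ->
  energy leb4 (weighted_conv setT lam U V) = 0%E.
Proof.
move=> ma mb hU hV ab0.
suff W0 z : weighted_conv setT lam U V z = 0.
  by rewrite /energy; under eq_integral do rewrite W0 sqn0; exact: integral0.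
have m0 : cmeasurable (fun _ : R3 R => 0 : C) by exact: cmeasurable_cst.
have ev0 W c t : sharp_evolution W c -> (\forall k \ae leb3, c k = 0) ->
    \forall k \ae leb3, W (t, k) = evolved (fun=> 0) (t, k).
  by move=> hW c0; apply: (ae_imp (ae_conj (hW t).2 c0)) => k [-> ck]; rewrite /evolved ck.
case: z => t p; case: ab0 => [a0|b0].
  rewrite (weighted_convE lam p (@measurableT _ (R3 R)) m0 mb (hU t).1 (hV t).1
    (ev0 U a t hU (energy_eq0_ae ma a0)) (hV t).2).
  by rewrite /bilinear -[RHS](@cintegral0 _ _ R leb3); apply: eq_cintegral => q; rewrite /evolved !(mulr0, mul0r).
rewrite (weighted_convE lam p (@measurableT _ (R3 R)) ma m0 (hU t).1 (hV t).1 (hU t).2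
    (ev0 V b t hV (energy_eq0_ae mb b0))).
by rewrite /bilinear -[RHS](@cintegral0 _ _ R leb3); apply: eq_cintegral => q; rewrite /evolved !(mulr0, mul0r).
Qed.

Lemma projected_evolution (A : set (R3 R)) (u0 u0A : R3 R -> C) u w W :
  is_evolution u0 u -> is_projection_at_all_times A u w -> is_spatial_fourier w W ->
  is_projection A u0 u0A -> exists a, [/\ L2 leb3 a, (en a <= 4%:E * en u0A)%E,
    (\forall k \ae leb3, a k != 0 -> A k), sharp_evolution W a &
    forall t, is_fourier (fun x => w (t, x)) (fun k => evolved a (t, k))].
Proof.
move=> eu pw FW pA; have [g [_ [hg _ _]]] := eu.2 0.
have [a Fa ag] := initial_fourier pA hg; have [_ La _] := is_fourierP Fa.
have Fw := evolution_fourier eu pw hg (L2_cmeas La) ag; exists a; split => //.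
- exact: is_fourier_energy Fa.
- apply: (ae_imp ag) => k ->; rewrite indicE.
  by have [Ak|/negP nAk] := boolP (k \in A); [move=> _; rewrite inE in Ak|rewrite mul0r eqxx].
- move=> t; split; first by apply: L2_cmeas; have [] := is_fourierP (FW t).
  exact: is_fourier_uniq (FW t) (Fw t).
Qed.

End wave_data.

Section constants.
Variable R : realType.

(** As it exceeds 1, its square dominates each of its summands. *)
Definition bilinear_constant : R := 1 + 512 * c3 R ^+ 2 * pi ^+ 2 + 5120 * pi.

Lemma bilinear_constantP : [/\ 0 < bilinear_constant,
  512 * c3 R ^+ 2 * pi ^+ 2 <= bilinear_constant ^+ 2 & 5120 * pi <= bilinear_constant ^+ 2].
Proof.
have x0 : 0 <= 512 * c3 R ^+ 2 * pi ^+ 2 := mulr_ge0 (mulr_ge0 (ler0n _ 512) (sqr_ge0 _)) (sqr_ge0 _).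
have y0 : 0 <= 5120 * pi :> R := mulr_ge0 (ler0n _ 5120) (pi_ge0 R).
rewrite /bilinear_constant; move: (512 * _ * _) (5120 * pi) x0 y0 => x y x0 y0.
have h : 1 + x + y <= (1 + x + y) ^+ 2 by rewrite expr2 ler_peMr; lra.
by split; [lra|apply: le_trans h; lra|apply: le_trans h; lra].
Qed.

(** The factor 2 * 160 comes from [weighted_conv_estimate] and 4 * 4 from the
    passage from transforms to data; the product is 5120. *)
Lemma area_bound (mu r : R) (X A B A' B' : \bar R) : 0 <= mu -> 0 <= r -> (0 <= X)%E ->
  (0 <= A)%E -> (0 <= B)%E -> (0 <= A')%E -> (0 <= B')%E -> (A' <= 4%:E * A)%E -> (B' <= 4%:E * B)%E ->
  (X <= (2 * (160 * pi * mu ^+ 2 * r))%:E * (A' * B'))%E ->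
  (X `^ 2^-1 <= (bilinear_constant * mu)%:E * r%:E `^ 2^-1 * A `^ 2^-1 * B `^ 2^-1)%E.
Proof.
have [c0 _ cp] := bilinear_constantP; move: bilinear_constant c0 cp => c c0 cp.
move=> mu0 r0 X0 A0 B0 A'0 B'0 hA hB hX.
have K0 : 0 <= 2 * (160 * pi * mu ^+ 2 * r) :> R.
  exact: mulr_ge0 (ler0n _ 2) (mulr_ge0 (mulr_ge0 (mulr_ge0 (ler0n _ 160) (pi_ge0 R)) (sqr_ge0 mu)) r0).
rewrite poweR_EFin powR12_sqrt// -EFinM.
apply: sqrt_product_le => //; first by rewrite !mulr_ge0 ?sqrtr_ge0// ltW.
apply: le_trans hX _.
apply: (@le_trans _ _ ((2 * (160 * pi * mu ^+ 2 * r))%:E * ((4%:E * A) * (4%:E * B)))%E).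
  by apply: lee_wpmul2l; rewrite ?lee_fin//; exact: lee_pmul.
have -> : ((2 * (160 * pi * mu ^+ 2 * r))%:E * ((4%:E * A) * (4%:E * B)) =
    (2 * (160 * pi * mu ^+ 2 * r) * (4 * 4))%:E * (A * B))%E.
  by rewrite (muleACA 4%:E A 4%:E B) [LHS]muleA -!EFinM.
apply: lee_wpmul2r; first exact: mule_ge0.
rewrite lee_fin !exprMn sqr_sqrtr//.
have -> : 2 * (160 * pi * mu ^+ 2 * r) * (4 * 4) = 5120 * pi * mu ^+ 2 * r by ring.
by rewrite ler_wpM2r// ler_wpM2r ?sqr_ge0.
Qed.

End constants.

Theorem theorem2p1 (R : realType) :
  exists2 c : R, 0 < c &
  forall (mu lambda : R) (u0 v0 : R3 R -> R[i]) (u v : R4 R -> R[i]),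
    0 < mu -> 0 < lambda ->
    L2 leb3 u0 -> L2 leb3 v0 ->
    is_evolution u0 u -> is_evolution v0 v ->
    (forall u_lt v_gt : R4 R -> R[i],
      is_projection_at_all_times (below mu) u u_lt ->
      is_projection_at_all_times (above lambda) v v_gt ->
      (L2norm leb4 (fun p => (u_lt p * v_gt p)%R)
         <= (c * mu)%:E * L2norm leb3 u0 * L2norm leb3 v0)%E)
    /\
    (forall (G : set (R2 R)) (uG v_l uG_hat v_l_hat : R4 R -> R[i])
        (u0G v0_l : R3 R -> R[i]),
      mu <= lambda ->
      lebesgue_measurable2 G ->
      is_projection_at_all_times (sector mu G) u uG ->
      is_projection_at_all_times (dyadic lambda) v v_l ->
      is_spatial_fourier uG uG_hat ->
      is_spatial_fourier v_l v_l_hat ->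
      is_projection (sector mu G) u0 u0G ->
      is_projection (dyadic lambda) v0 v0_l ->
      mu <= lambda / 8 \/
        [/\ lambda / 8 < mu <= lambda,
            G `<=` disc lambda &
            distr_support (fourier_distr v_l) `&`
              [set p | disc (10 * lambda ^+ 2) p.2.2] = set0] ->
      let bound := ((c * mu)%:E * (vol2 G) `^ 2^-1
                      * L2norm leb3 u0G * L2norm leb3 v0_l)%E in
      (L2norm leb4 (weighted_conv setT lambda uG_hat v_l_hat) <= bound)%E /\
      ((vol2 G < +oo)%E ->
        exists2 F : R4 R -> R[i],
          is_weighted_conv lambda uG_hat v_l_hat F &
          (L2norm leb4 F <= bound)%E)).
Proof.
pose en := energy (@leb3 R).
exists (bilinear_constant R); first by have [] := bilinear_constantP R.
have [c0 c1 _] := bilinear_constantP R; set c := bilinear_constant R in c0 c1 *.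
move=> mu lam u0 v0 u v mu0 lam0 Lu Lv eu ev; split.
  move=> ul vg pu pv; rewrite !L2normE.
  apply: sqrt_product_le; rewrite ?energy_ge0 ?mulr_ge0 ?(ltW c0) ?(ltW mu0)//.
  apply: le_trans (low_frequency_product mu0 lam0 Lu Lv eu ev pu pv) _.
  apply: lee_wpmul2r; first by rewrite mule_ge0 ?energy_ge0.
  by rewrite lee_fin exprMn ler_wpM2r ?sqr_ge0.
move=> G uG vl U V u0G v0l ml _ pu pv FU FV pu0 pv0 hc bound.
have [a [La ea sa hU _]] := projected_evolution eu pu FU pu0.
have [b [Lb eb sb hV Fv]] := projected_evolution ev pv FV pv0.
have [B [mB GB BV]] := outer_borel G.
have hc' : mu <= lam / 8 \/ [/\ mu <= lam, G `<=` disc lam &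
    \forall k \ae leb3, b k != 0 -> 10 * lam ^+ 2 <= norm2 k.2].
  case: hc => [hc|[_ Gd S0]]; [by left|right; split => //].
  exact: (frequency_support pv.1 Lb Fv S0).
have [Voo|Vfin] := eqVneq (vol2 G) +oo%E.
  split; last by rewrite Voo ltxx.
  (* [bound] is then infinite unless one of the two data vanishes *)
  have W0 := weighted_conv_eq0 lam (L2_cmeas La) (L2_cmeas Lb) hU hV.
  have sq0 : (0 `^ 2^-1 = 0 :> \bar R)%E by rewrite poweR0r.
  have p0 (x : \bar R) : (0 <= x `^ 2^-1)%E := poweR_ge0 x 2^-1.
  have cm0 : (0 < (c * mu)%:E)%E by rewrite lte_fin mulr_gt0.
  have four0 : (4%:E * 0 = 0 :> \bar R)%E by rewrite mule0.
  have b0 : (0 <= bound)%E by rewrite /bound Voo !L2normE !mule_ge0 ?(ltW cm0).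
  have vanish : en a = 0%E \/ en b = 0%E -> (L2norm leb4 (weighted_conv setT lam U V) <= bound)%E.
    by move=> ab0; rewrite L2normE W0 ?sq0.
  have [A0|A0] := eqVneq (en u0G) 0%E.
    by apply: vanish; left; apply/eqP; rewrite eq_le energy_ge0 andbT -four0 -A0 ea.
  have [B0|B0] := eqVneq (en v0l) 0%E.
    by apply: vanish; right; apply/eqP; rewrite eq_le energy_ge0 andbT -four0 -B0 eb.
  have gt0 f : energy leb3 f != 0%E -> (0 < L2norm leb3 f)%E.
    by move=> f0; rewrite L2normE poweR_gt0// lt_neqAle eq_sym f0 energy_ge0.
  rewrite /bound Voo poweRyr ?invr_eq0// gt0_muley// !gt0_mulye ?gt0//.
  exact: leey.
have V0 : (0 <= vol2 G)%E by rewrite -BV measure_ge0.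
have Vlt : (vol2 G < +oo)%E by rewrite ltey.
have r0 : 0 <= fine (vol2 G) by rewrite fine_ge0.
have VE : (fine (vol2 G))%:E = vol2 G by rewrite fineK// ge0_fin_numE.
have [W1 [F FW W2]] := weighted_conv_estimate mu0 lam0 La Lb hU hV sa sb hc' Vlt.
have est (X : R4 R -> R[i]) : (energy leb4 X <=
    (2 * (160 * pi * mu ^+ 2 * fine (vol2 G)))%:E * (en a * en b))%E -> (L2norm leb4 X <= bound)%E.
  move=> hX; rewrite /bound !L2normE -VE.
  by apply: (area_bound (ltW mu0) r0 _ _ _ _ _ ea eb hX); exact: energy_ge0.
split; last by move=> _; exists F => //; exact: est.
apply: est; apply: le_trans W1 _; apply: lee_wpmul2r; first by rewrite mule_ge0 ?energy_ge0.
rewrite lee_fin -[leLHS]mul1r ler_wpM2r ?ler1n//.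
exact: mulr_ge0 (mulr_ge0 (mulr_ge0 (ler0n _ 160) (pi_ge0 R)) (sqr_ge0 mu)) r0.
Qed.
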